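(* Assume the setting and hypotheses described in the context, and in addition $\phi\ge1$. Then $$|R_{\mu\nu}(z)-\delta_{\mu\nu}m_\phi(z)|\prec\Psi(z)$$ uniformly in $z\in\mathbf S$ and $\mu,\nu\in\{1,\dots,N\}$; $$|G_{ij}(z)-\delta_{ij}m_{\phi^{-1}}(z)|\prec\phi^{-1}\Psi(z)$$ uniformly in $z\in\mathbf S$ and $i,j\in\{1,\dots,M\}$; and $$\Big|\frac1N\operatorname{tr}R(z)-m_\phi(z)\Big|\prec\frac1{N\eta},\qquad \Big|\frac1M\operatorname{tr}G(z)-m_{\phi^{-1}}(z)\Big|\prec\frac1{M\eta}$$ uniformly in $z\in\mathbf S$.
   Context: Let $N\in\mathbb N$ and let $M=M_N$ satisfy $N^{1/C}\le M\le N^{C}$ for a fixed constant $C>0$. Let $X$ be an $M\times N$ random matrix whose entries $X_{i\mu}$ are independent complex random variables with $\mathbb E X_{i\mu}=0$, $\mathbb E|X_{i\mu}|^2=(NM)^{-1/2}$, and such that for every $p\in\mathbb N$ there is a constant $C_p$ with $\mathbb E|(NM)^{1/4}X_{i\mu}|^p\le C_p$ for all $N,i,\mu$. Set $\phi=M/N$, $K=\min\{M,N\}$ and $\gamma_\pm=\sqrt\phi+1/\sqrt\phi\pm2$. The Marchenko–Pastur law is $\varrho_\phi(\mathrm dx)=\frac{\sqrt\phi}{2\pi}\frac{\sqrt{[(x-\gamma_-)(\gamma_+-x)]_+}}{x}\,\mathrm dx+(1-\phi)_+\delta_0(\mathrm dx)$, $m_\phi(z)=\int\frac{\varrho_\phi(\mathrm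 dx)}{x-z}$, and $m_{\phi^{-1}}(z)=\phi^{-1}\big(m_\phi(z)+(1-\phi)/z\big)$ is the Stieltjes transform of $\varrho_{\phi^{-1}}$. For $z=E+\mathrm i\eta$, $\eta>0$, let $R(z)=(X^*X-z)^{-1}$ ($N\times N$), $G(z)=(XX^*-z)^{-1}$ ($M\times M$), $\kappa=\min\{|\gamma_+-E|,|\gamma_--E|\}$, and $\Psi(z)=\sqrt{\frac{\operatorname{Im}m_\phi(z)}{N\eta}}+\frac1{N\eta}$. Fix $\omega\in(0,1)$ and let $\mathbf S=\{z=E+\mathrm i\eta:\kappa\le\omega^{-1},\ K^{-1+\omega}\le\eta\le\omega^{-1},\ |z|\ge\omega\}$. Stochastic domination: for families of nonnegative random variables $\xi=(\xi^{(N)}(u))$, $\zeta=(\zeta^{(N)}(u))$, we write $\xi\prec\zeta$ (uniformly in $u$) if for every $\varepsilon>0$, $D>0$, $\sup_u\mathbb P[\xi^{(N)}(u)>N^\varepsilon\zeta^{(N)}(u)]\le N^{-D}$ for $N\ge N_0(\varepsilon,D)$, with $N_0$ depending only on the constants in the hypotheses. *)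

(* Defs.v *)
From HB Require Import structures.
From mathcomp Require Import all_boot all_order all_algebra.
From mathcomp Require Import all_classical all_reals all_analysis.
From mathcomp Require Import complex.
Set Implicit Arguments. Unset Strict Implicit. Unset Printing Implicit Defensive.
Import Order.TTheory GRing.Theory Num.Theory.
Import numFieldNormedType.Exports.
Local Open Scope classical_set_scope.
Local Open Scope ring_scope.

Section LocalLaw.
Variable R : realType.

Definition cmod (x : R[i]) : R :=
  Num.sqrt (complex.Re x ^+ 2 + complex.Im x ^+ 2).

Definition toC (x : R) : R[i] := Complex x 0.

Definition gamma_p (phi : R) : R := Num.sqrt phi + (Num.sqrt phi)^-1 + 2.
Definition gamma_m (phi : R) : R := Num.sqrt phi + (Num.sqrt phi)^-1 - 2.

(* density of the absolutely continuous part of the Marchenko-Pastur law *)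
Definition mp_density (phi x : R) : R :=
  Num.sqrt phi / (2 * pi) *
  Num.sqrt (Num.max 0 ((x - gamma_m phi) * (gamma_p phi - x))) / x.

(* m_phi(z) = int rho_phi(dx) / (x - z), with
   rho_phi(dx) = mp_density phi x dx + (1 - phi)_+ delta_0(dx);
   the complex integral is computed componentwise (real and imaginary parts). *)
Definition m_phi (phi : R) (z : R[i]) : R[i] :=
  let f := fun x : R => (toC x - z)^-1 in
  Complex
    (Rintegral lebesgue_measure `[gamma_m phi, gamma_p phi]
       (fun x => mp_density phi x * complex.Re (f x))
     + Num.max 0 (1 - phi) * complex.Re (f 0))
    (Rintegral lebesgue_measure `[gamma_m phi, gamma_p phi]
       (fun x => mp_density phi x * complex.Im (f x))
     + Num.max 0 (1 - phi) * complex.Im (f 0)).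

Definition m_phi_inv (phi : R) (z : R[i]) : R[i] :=
  toC phi^-1 * (m_phi phi z + toC (1 - phi) / z).

Definition Psi (N M : nat) (z : R[i]) : R :=
  let phi := M%:R / N%:R in
  let eta := complex.Im z in
  Num.sqrt (complex.Im (m_phi phi z) / (N%:R * eta)) + (N%:R * eta)^-1.

Definition in_S (omega : R) (N M : nat) (z : R[i]) : Prop :=
  let phi := M%:R / N%:R in
  let E := complex.Re z in
  let eta := complex.Im z in
  let kappa := Num.min `|gamma_p phi - E| `|gamma_m phi - E| in
  [/\ kappa <= omega^-1,
      (minn M N)%:R `^ (-1 + omega) <= eta,
      eta <= omega^-1 &
      omega <= cmod z].

Definition adjmx (m n : nat) (A : 'M[R[i]]_(m, n)) : 'M[R[i]]_(n, m) :=
  \matrix_(i < n, j < m) conjc (A j i).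

Definition resR (m n : nat) (A : 'M[R[i]]_(m, n)) (z : R[i]) : 'M[R[i]]_n :=
  invmx (adjmx A *m A - z%:M).
Definition resG (m n : nat) (A : 'M[R[i]]_(m, n)) (z : R[i]) : 'M[R[i]]_m :=
  invmx (A *m adjmx A - z%:M).

Definition kdelta (n : nat) (i j : 'I_n) : R[i] := if i == j then 1 else 0.

Definition mutually_independent {d} {T : measurableType d}
  (P : probability T R) (I : finType) (Y : I -> T -> (R * R)%type) : Prop :=
  forall (J : {set I}) (B : I -> set (R * R)%type),
    (forall i, measurable (B i)) ->
    P (\bigcap_(i in [set i | i \in J]) (Y i @^-1` B i)) =
    (\prod_(i in J) P (Y i @^-1` B i))%E.

Definition model_hyp (C : R) (Cp : nat -> R) (N M : nat)
  {d} {T : measurableType d} (P : probability T R)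
  (X : T -> 'M[R[i]]_(M, N)) : Prop :=
  [/\ N%:R `^ C^-1 <= M%:R /\ M%:R <= N%:R `^ C,
      (forall (i : 'I_M) (mu : 'I_N),
         measurable_fun setT (fun t => complex.Re (X t i mu)) /\
         measurable_fun setT (fun t => complex.Im (X t i mu))),
      mutually_independent P
        (fun (p : 'I_M * 'I_N) t =>
           (complex.Re (X t p.1 p.2), complex.Im (X t p.1 p.2))),
      (forall (i : 'I_M) (mu : 'I_N),
         (\int[P]_t (complex.Re (X t i mu))%:E = 0)%E /\
         (\int[P]_t (complex.Im (X t i mu))%:E = 0)%E /\
         (\int[P]_t (cmod (X t i mu) ^+ 2)%:E =
            ((N%:R * M%:R) `^ (- (2^-1)))%:E)%E) &
      (forall (p : nat) (i : 'I_M) (mu : 'I_N),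
         (\int[P]_t (((N%:R * M%:R) `^ (4^-1) * cmod (X t i mu)) ^+ p)%:E
            <= (Cp p)%:E)%E)].

End LocalLaw.

(* Main.v *)
Require Import Defs.
From HB Require Import structures.
From mathcomp Require Import all_boot all_order all_algebra.
From mathcomp Require Import all_classical all_reals all_analysis.
From mathcomp Require Import complex measurable_realfun.
From mathcomp Require Import ring lra.
Import Order.TTheory GRing.Theory Num.Theory.
Import numFieldNormedType.Exports.
Set Implicit Arguments. Unset Strict Implicit. Unset Printing Implicit Defensive.
Local Open Scope classical_set_scope.
Local Open Scope ring_scope.

(** Let [s = N^-1 tr R].  Removing one row at a time (Sherman-Morrison) turns the trace of the resolvent
identity into [P(s) = N^-1 sum_i u_i (q_i - g)], where [P(s) = a s^2 + b s + 1] is the quadratic polynomial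
whose root in the upper half plane is [m_phi], [q_i] is the quadratic form of row [i] in the resolvent of the
minor, [u_i = 1 / (1 + q_i)] and [g] is its partial average.  Large deviation bounds for [q_i - g], propagated
from [Im z] of order one down a fine grid of spectral parameters, bound [s] and keep [u_i] under control
without having to choose a root.

The optimal rate comes from the moments of [T = P(s)].  In [E |T|^2p = N^-1 sum_i E Re (u_i (q_i - g) f(T))] the
leading part of [u_i (q_i - g)] has mean zero given the other rows, so it vanishes against [f(P(s''))] with
[s''] close to [s] and independent of row [i]; what remains is quadratic in the fluctuations and is absorbed,
giving [|T| < gap / (N eta) + (N eta)^-2], with [gap] the distance of the two roots of [P].  Since [eta gap] is
monotone in [eta], a discrete continuity argument along the grid selects the root [m_phi].  The entries of the
resolvents then follow from Schur complement formulas and a linear large deviation bound. *)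

(** * Complex moduli *)

(** The ratio [phi] may grow like a power of [N], so all constants must be uniform in it. The rows
    removed are those of the [N] by [M] matrix [X^*]; then [u_i] is of order [sqrt phi] and
    [q_i - g] of order [1 / sqrt phi] times a small parameter, and only their product enters. The
    obstacle is the spectral edge: where the roots of [P] merge, a bound on [|P(s)|] costs a square
    root when turned into a bound on [s - m_phi]. The factor [gap] in the bound of [|T|] compensates
    this: either [gap] is below [1 / (N eta)] up to constants and both roots are acceptable, or
    dividing by [gap] loses nothing. Conditional expectations are never formed. Independence is used
    as invariance of the expectation of a nonnegative function under replacing a set of entries by
    an independent copy, and signed integrands are split into positive and negative parts. Factors
    [N^eps] become natural powers of [nu = N^(1/q)] with [q] large, so stochastic domination reads:
    for every natural [D] the exceptional probability is at most [Cn * nu^-D], with [Cn] uniform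
    over all instances. *)

Lemma le_of_sqr (F : realDomainType) (x y : F) : 0 <= y -> x ^+ 2 <= y ^+ 2 -> x <= y.
Proof.
move=> y0; have [x0|x0 _] := leP 0 x; first by rewrite ler_sqr.
exact: le_trans (ltW x0) y0.
Qed.

Section ComplexModulus.
Variable R : realType.
Implicit Types x y z : R[i].
Local Notation Re := complex.Re.
Local Notation Im := complex.Im.
Local Notation normc := ComplexField.Normc.normc.

Lemma cmodE x : cmod x = normc x.
Proof. by case: x. Qed.
Lemma cmod_ge0 x : 0 <= cmod x. Proof. exact: sqrtr_ge0. Qed.
Lemma cmod_sqr x : cmod x ^+ 2 = Re x ^+ 2 + Im x ^+ 2.
Proof. by rewrite sqr_sqrtr// addr_ge0 ?sqr_ge0. Qed.
Lemma cmod0 : cmod (0 : R[i]) = 0. Proof. by rewrite cmodE ComplexField.Normc.normc0. Qed.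
Lemma cmod1 : cmod (1 : R[i]) = 1. Proof. by rewrite cmodE ComplexField.Normc.normc1. Qed.
Lemma cmodM x y : cmod (x * y) = cmod x * cmod y.
Proof. by rewrite !cmodE ComplexField.Normc.normcM. Qed.
Lemma cmodV x : cmod x^-1 = (cmod x)^-1.
Proof. by rewrite !cmodE ComplexField.Normc.normcV. Qed.
Lemma cmodN x : cmod (- x) = cmod x.
Proof. by rewrite !cmodE normcN. Qed.
Lemma cmodB x y : cmod (x - y) = cmod (y - x).
Proof. by rewrite -cmodN opprB. Qed.
Lemma cmodD x y : cmod (x + y) <= cmod x + cmod y.
Proof. by rewrite !cmodE le_normcD. Qed.
Lemma cmod_eq0 x : (cmod x == 0) = (x == 0).
Proof.
apply/eqP/eqP=> [|->]; last exact: cmod0.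
by rewrite cmodE => /ComplexField.Normc.eq0_normc.
Qed.
Lemma cmod_gt0 x : (0 < cmod x) = (x != 0).
Proof. by rewrite lt_def cmod_ge0 andbT cmod_eq0. Qed.
Lemma cmodX x n : cmod (x ^+ n) = cmod x ^+ n.
Proof. by elim: n => [|n IH]; rewrite ?expr0 ?cmod1// !exprS cmodM IH. Qed.
Lemma cmodJ x : cmod (conjc x) = cmod x.
Proof. by case: x => a b; rewrite /cmod /= sqrrN. Qed.
Lemma cmod_real (a : R) : cmod a%:C%C = `|a|.
Proof. by rewrite /cmod /= expr0n /= addr0 sqrtr_sqr. Qed.
Lemma cmod_pos (a : R) : 0 <= a -> cmod a%:C%C = a.
Proof. by move=> ?; rewrite cmod_real ger0_norm. Qed.
Lemma cmod_nat n : cmod (n%:R : R[i]) = n%:R.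
Proof. by rewrite -(rmorph_nat (real_complex R)) cmod_real ger0_norm. Qed.
Lemma cmod_Re x : `|Re x| <= cmod x.
Proof. by rewrite -sqrtr_sqr ler_wsqrtr// lerDl sqr_ge0. Qed.
Lemma cmod_Im x : `|Im x| <= cmod x.
Proof. by rewrite -sqrtr_sqr ler_wsqrtr// lerDr sqr_ge0. Qed.
Lemma Re_le_cmod x : Re x <= cmod x.
Proof. exact: le_trans (ler_norm _) (cmod_Re x). Qed.
Lemma Im_le_cmod x : Im x <= cmod x.
Proof. exact: le_trans (ler_norm _) (cmod_Im x). Qed.
Lemma cmodB_ge x y : cmod x - cmod y <= cmod (x - y).
Proof. by rewrite lerBlDr -{1}[x](subrK y) cmodD. Qed.
Lemma cmodD_ge x y : cmod x - cmod y <= cmod (x + y).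
Proof. by rewrite -[y in x + y]opprK -(cmodN y) cmodB_ge. Qed.
Lemma cmod_sum (I : Type) (r : seq I) (p : pred I) (F : I -> R[i]) :
  cmod (\sum_(i <- r | p i) F i) <= \sum_(i <- r | p i) cmod (F i).
Proof.
elim/big_rec2: _ => [|i a b _ ab]; first by rewrite cmod0.
by apply: le_trans (cmodD _ _) _; rewrite lerD2l.
Qed.

Lemma cReD x y : Re (x + y) = Re x + Re y. Proof. by case: x; case: y. Qed.
Lemma cImD x y : Im (x + y) = Im x + Im y. Proof. by case: x; case: y. Qed.
Lemma cReN x : Re (- x) = - Re x. Proof. by case: x. Qed.
Lemma cImN x : Im (- x) = - Im x. Proof. by case: x. Qed.
Lemma cReB x y : Re (x - y) = Re x - Re y. Proof. by rewrite cReD cReN. Qed.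
Lemma cImB x y : Im (x - y) = Im x - Im y. Proof. by rewrite cImD cImN. Qed.
Lemma cReM x y : Re (x * y) = Re x * Re y - Im x * Im y. Proof. by case: x; case: y. Qed.
Lemma cImM x y : Im (x * y) = Re x * Im y + Im x * Re y. Proof. by case: x; case: y. Qed.
Lemma cReJ x : Re (conjc x) = Re x. Proof. by case: x. Qed.
Lemma cImJ x : Im (conjc x) = - Im x. Proof. by case: x. Qed.
Lemma cRe_real (a : R) : Re a%:C%C = a. Proof. by []. Qed.
Lemma cIm_real (a : R) : Im a%:C%C = 0. Proof. by []. Qed.
Lemma cReZ (a : R) x : Re (a%:C%C * x) = a * Re x.
Proof. by rewrite cReM /= mul0r subr0. Qed.
Lemma cImZ (a : R) x : Im (a%:C%C * x) = a * Im x.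
Proof. by rewrite cImM /= mul0r addr0. Qed.
Lemma cRe_sum (I : Type) (r : seq I) (p : pred I) (F : I -> R[i]) :
  Re (\sum_(i <- r | p i) F i) = \sum_(i <- r | p i) Re (F i).
Proof. by elim/big_rec2: _ => // i a b _ <-; rewrite cReD. Qed.
Lemma mulJ x : x * conjc x = (cmod x ^+ 2)%:C%C.
Proof. by rewrite cmod_sqr; case: x => a b; apply/eqP; rewrite eq_complex /=; apply/andP; split; apply/eqP; ring. Qed.
Lemma toCE (a : R) : toC a = a%:C%C. Proof. by []. Qed.
Lemma natC n : (n%:R : R[i]) = (n%:R : R)%:C%C.
Proof. by rewrite rmorph_nat. Qed.
Lemma cinvE x : x^-1 = (cmod x ^- 2)%:C%C * conjc x.
Proof.
have [->|x0] := eqVneq x 0; first by rewrite invr0 conjc0 mulr0.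
have h : (cmod x ^+ 2)%:C%C != 0 :> R[i].
  by rewrite -mulJ mulf_neq0// conjc_eq0.
apply: (mulfI x0); rewrite divff// mulrCA mulJ -rmorphM /= mulVf//.
by rewrite expf_neq0// cmod_eq0.
Qed.
Lemma cImV x : Im x^-1 = - Im x / cmod x ^+ 2.
Proof. by rewrite cinvE cImZ cImJ mulrC. Qed.
Lemma cReV x : Re x^-1 = Re x / cmod x ^+ 2.
Proof. by rewrite cinvE cReZ cReJ mulrC. Qed.
Lemma neq0_Im x : 0 < Im x -> x != 0.
Proof. by case: x => a b /= b0; rewrite eq_complex negb_and /= (gt_eqF b0) orbT. Qed.
Lemma ler_cmodV x (a : R) : 0 < a -> a <= cmod x -> cmod x^-1 <= a^-1.
Proof. by move=> a0 ax; rewrite cmodV lef_pV2// posrE (lt_le_trans a0). Qed.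

End ComplexModulus.

(** * Resolvents *)

Section HilbertSchmidt.
Variable R : realType.
Local Notation Re := (@complex.Re R).
Local Notation Im := (@complex.Im R).
Local Notation C := R[i].

Definition hs m n (A : 'M[C]_(m, n)) : R := \sum_i \sum_j cmod (A i j) ^+ 2.

Lemma adjmxM m n p (A : 'M[C]_(m, n)) (B : 'M[C]_(n, p)) :
  adjmx (A *m B) = adjmx B *m adjmx A.
Proof.
apply/matrixP=> i j; rewrite !mxE rmorph_sum/=.
by apply: eq_bigr => k _; rewrite !mxE rmorphM mulrC.
Qed.
Lemma adjmxK m n (A : 'M[C]_(m, n)) : adjmx (adjmx A) = A.
Proof. by apply/matrixP=> i j; rewrite !mxE conjcK. Qed.
Lemma adjmxD m n (A B : 'M[C]_(m, n)) : adjmx (A + B) = adjmx A + adjmx B.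
Proof. by apply/matrixP=> i j; rewrite !mxE rmorphD. Qed.
Lemma adjmxN m n (A : 'M[C]_(m, n)) : adjmx (- A) = - adjmx A.
Proof. by apply/matrixP=> i j; rewrite !mxE rmorphN. Qed.
Lemma adjmxB m n (A B : 'M[C]_(m, n)) : adjmx (A - B) = adjmx A - adjmx B.
Proof. by rewrite adjmxD adjmxN. Qed.
Lemma adjmx_scalar n (a : C) : adjmx (a%:M : 'M[C]_n) = (conjc a)%:M.
Proof. by apply/matrixP=> i j; rewrite !mxE eq_sym rmorphMn. Qed.
Lemma adjmx1 n : adjmx (1%:M : 'M[C]_n) = 1%:M.
Proof. by rewrite adjmx_scalar conjc1. Qed.
Lemma tr_adjmx n (A : 'M[C]_n) : \tr (adjmx A) = conjc (\tr A).
Proof. by rewrite /mxtrace rmorph_sum; apply: eq_bigr => i _; rewrite !mxE. Qed.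

Lemma hs_ge0 m n (A : 'M[C]_(m, n)) : 0 <= hs A.
Proof. by rewrite /hs !sumr_ge0// => i _; rewrite sumr_ge0// => j _; rewrite sqr_ge0. Qed.
Lemma hs_adj m n (A : 'M[C]_(m, n)) : hs (adjmx A) = hs A.
Proof.
rewrite /hs exchange_big; apply: eq_bigr => i _; apply: eq_bigr => j _.
by rewrite mxE cmodJ.
Qed.
Lemma trM_adj m n (A : 'M[C]_(m, n)) : \tr (A *m adjmx A) = (hs A)%:C%C.
Proof.
rewrite /mxtrace /hs rmorph_sum; apply: eq_bigr => i _.
by rewrite mxE rmorph_sum; apply: eq_bigr => j _; rewrite mxE mulJ.
Qed.
Lemma tr_adjM m n (A : 'M[C]_(m, n)) : \tr (adjmx A *m A) = (hs A)%:C%C.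
Proof. by rewrite mxtrace_mulC trM_adj. Qed.
Lemma hs_eq0 m n (A : 'M[C]_(m, n)) : hs A = 0 -> A = 0.
Proof.
move/eqP; rewrite psumr_eq0; last by move=> *; rewrite sumr_ge0// => *; rewrite sqr_ge0.
move=> /allP h; apply/matrixP=> i j; rewrite mxE.
have := h i; rewrite mem_index_enum => /(_ isT); rewrite psumr_eq0; last by move=> *; rewrite sqr_ge0.
move=> /allP /(_ j); rewrite mem_index_enum => /(_ isT) /=.
by rewrite sqrf_eq0 cmod_eq0 => /eqP.
Qed.
Lemma hs1 n : hs (1%:M : 'M[C]_n) = n%:R.
Proof.
rewrite -[RHS](cRe_real _) -(natC R n) -[n%:R]mxtrace1.
by rewrite -[1%:M in RHS]mulmx1 -[X in _ *m X](adjmx1 n) trM_adj.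
Qed.

Lemma cauchy_schwarz_sum (I : finType) (f g : I -> R) :
  (\sum_i f i * g i) ^+ 2 <= (\sum_i f i ^+ 2) * (\sum_i g i ^+ 2).
Proof.
set F := \sum_i f i ^+ 2; set G := \sum_i g i ^+ 2; set X := \sum_i _.
have F0 : 0 <= F by rewrite sumr_ge0// => *; rewrite sqr_ge0.
have [F00|F00] := eqVneq F 0.
  suff -> : X = 0 by rewrite F00 mul0r expr0n.
  move/eqP: F00; rewrite psumr_eq0; last by move=> *; rewrite sqr_ge0.
  move=> /allP h; apply: big1 => i _; have := h i; rewrite mem_index_enum => /(_ isT).
  by rewrite /= sqrf_eq0 => /eqP ->; rewrite mul0r.
have Fp : 0 < F by rewrite lt_def F00.
have : 0 <= \sum_i (F * g i - X * f i) ^+ 2 by rewrite sumr_ge0// => *; rewrite sqr_ge0.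
have -> : \sum_i (F * g i - X * f i) ^+ 2 = F * (F * G - X ^+ 2).
  transitivity (\sum_i (F ^+ 2 * g i ^+ 2 - (2 * F * X) * (f i * g i) + X ^+ 2 * f i ^+ 2)).
    by apply: eq_bigr => i _; ring.
  rewrite !big_split/= sumrN -!mulr_sumr -/F -/G -/X; ring.
by rewrite pmulr_rge0// subr_ge0.
Qed.

(** Cauchy-Schwarz for the Hilbert-Schmidt inner product. It replaces operator norms throughout: no
    spectral theorem is used below. *)
Lemma cmod_trM m n (A : 'M[C]_(m, n)) (B : 'M[C]_(n, m)) :
  cmod (\tr (A *m B)) ^+ 2 <= hs A * hs B.
Proof.
have -> : hs B = \sum_i \sum_j cmod (B j i) ^+ 2 by rewrite /hs exchange_big.
rewrite /hs !pair_big/=.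
apply: le_trans (cauchy_schwarz_sum _ _).
rewrite ler_sqr ?nnegrE ?cmod_ge0//; last first.
  by rewrite sumr_ge0// => *; rewrite mulr_ge0 ?cmod_ge0.
rewrite -(pair_big xpredT xpredT (fun i j => cmod (A i j) * cmod (B j i)))/=.
apply: le_trans (cmod_sum _ _ _) _; apply: ler_sum => i _.
rewrite mxE; apply: le_trans (cmod_sum _ _ _) _; apply: ler_sum => j _.
by rewrite cmodM.
Qed.

Lemma cmod_trM_le m n (A : 'M[C]_(m, n)) (B : 'M[C]_(n, m)) (h : R) :
  hs A <= h -> hs B <= h -> cmod (\tr (A *m B)) <= h.
Proof.
move=> hA hB; have h0 : 0 <= h by exact: le_trans (hs_ge0 A) hA.
rewrite -ler_sqr ?nnegrE ?cmod_ge0//; apply: le_trans (cmod_trM _ _) _.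
by rewrite expr2 ler_pM ?hs_ge0.
Qed.

Lemma tr11 (A : 'M[C]_1) : \tr A = A 0 0.
Proof. by rewrite /mxtrace big_ord1. Qed.

Lemma Im_subJ (x : C) : x - conjc x = (2 * Im x)%:C%C * 'i%C.
Proof. by case: x => a b; apply/eqP; rewrite eq_complex /=; apply/andP; split; apply/eqP; ring. Qed.

End HilbertSchmidt.

Section Resolvent.
Variable R : realType.
Local Notation Re := (@complex.Re R).
Local Notation Im := (@complex.Im R).
Local Notation C := R[i].
Variables (m n : nat) (A : 'M[C]_(m, n)) (z : C).
Hypothesis z0 : 0 < Im z.
Local Notation eta := (Im z).
Local Notation H := (adjmx A *m A).
Local Notation G := (resR A z).

Lemma adj_gram : adjmx H = H.
Proof. by rewrite adjmxM adjmxK. Qed.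

Lemma res_unit : H - z%:M \in unitmx.
Proof.
rewrite -row_free_unit -kermx_eq0; apply/eqP.
have := mulmx_ker (H - z%:M); move: (kermx _) => K K0.
have : \tr (K *m (H - z%:M) *m adjmx K) = 0 by rewrite K0 mul0mx mxtrace0.
rewrite mulmxBr mulmxBl mul_mx_scalar -scalemxAl raddfB /= mxtraceZ trM_adj.
have -> : K *m H *m adjmx K = (K *m adjmx A) *m adjmx (K *m adjmx A).
  by rewrite adjmxM adjmxK !mulmxA.
rewrite trM_adj => /(congr1 Im); rewrite cImB [z * _]mulrC cImZ /= sub0r => /eqP.
by rewrite oppr_eq0 mulf_eq0 (gt_eqF z0) orbF => /eqP/hs_eq0.
Qed.

Lemma resM : G *m (H - z%:M) = 1%:M.
Proof. exact: mulVmx res_unit. Qed.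
Lemma Mres : (H - z%:M) *m G = 1%:M.
Proof. exact: mulmxV res_unit. Qed.
Lemma gram_res : H *m G = 1%:M + z *: G.
Proof. by rewrite -Mres mulmxBl mul_scalar_mx subrK. Qed.

Lemma adjM_res : adjmx (H - z%:M) *m adjmx G = 1%:M.
Proof. by rewrite -adjmxM resM adjmx1. Qed.
Lemma adj_resM : adjmx G *m adjmx (H - z%:M) = 1%:M.
Proof. by rewrite -adjmxM Mres adjmx1. Qed.

Lemma adj_shiftB : adjmx (H - z%:M) - (H - z%:M) = (z - conjc z)%:M.
Proof. by rewrite adjmxB adj_gram adjmx_scalar opprB addrC addrA subrK raddfB. Qed.

(** The resolvent identity between [G] and its adjoint, [H] being Hermitian. [ward2] is the same
    with the factors exchanged; both orders are needed to control [V G] as well as [G V^*]. *)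
Lemma ward1 : G - adjmx G = (z - conjc z) *: (G *m adjmx G).
Proof.
have -> : (z - conjc z) *: (G *m adjmx G) = G *m (adjmx (H - z%:M) - (H - z%:M)) *m adjmx G.
  by rewrite adj_shiftB mul_mx_scalar -scalemxAl.
by rewrite mulmxBr mulmxBl -mulmxA adjM_res mulmx1 resM mul1mx.
Qed.
Lemma ward2 : G - adjmx G = (z - conjc z) *: (adjmx G *m G).
Proof.
have -> : (z - conjc z) *: (adjmx G *m G) = adjmx G *m (adjmx (H - z%:M) - (H - z%:M)) *m G.
  by rewrite adj_shiftB mul_mx_scalar -scalemxAl.
by rewrite mulmxBr mulmxBl adj_resM mul1mx -mulmxA Mres mulmx1.
Qed.

(** Ward identity tested on [V]. It is the source of every bound of a norm by an imaginary part
    divided by [eta]. *)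
Lemma Im_tr_res k (V : 'M[C]_(k, n)) : Im (\tr (V *m G *m adjmx V)) = eta * hs (V *m G).
Proof.
have : \tr (V *m (G - adjmx G) *m adjmx V) = (z - conjc z) * (hs (V *m G))%:C%C.
  by rewrite ward1 -scalemxAr -scalemxAl mxtraceZ -trM_adj adjmxM !mulmxA.
rewrite mulmxBr mulmxBl raddfB /=.
have -> : V *m adjmx G *m adjmx V = adjmx (V *m G *m adjmx V).
  by rewrite !adjmxM adjmxK mulmxA.
rewrite tr_adjmx !Im_subJ => /(congr1 Im).
rewrite [_ * 'i%C * _]mulrAC -rmorphM !cImZ /= !mulr1 -mulrA => /mulfI; apply.
by rewrite pnatr_eq0.
Qed.
Lemma Im_tr_res_col k (V : 'M[C]_(k, n)) :
  Im (\tr (V *m G *m adjmx V)) = eta * hs (G *m adjmx V).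
Proof.
have : \tr (V *m (G - adjmx G) *m adjmx V) = (z - conjc z) * (hs (G *m adjmx V))%:C%C.
  by rewrite ward2 -scalemxAr -scalemxAl mxtraceZ -tr_adjM adjmxM adjmxK !mulmxA.
rewrite mulmxBr mulmxBl raddfB /=.
have -> : V *m adjmx G *m adjmx V = adjmx (V *m G *m adjmx V).
  by rewrite !adjmxM adjmxK mulmxA.
rewrite tr_adjmx !Im_subJ => /(congr1 Im).
rewrite [_ * 'i%C * _]mulrAC -rmorphM !cImZ /= !mulr1 -mulrA => /mulfI; apply.
by rewrite pnatr_eq0.
Qed.
Lemma Im_trG : Im (\tr G) = eta * hs G.
Proof. by have := Im_tr_res 1%:M; rewrite mul1mx adjmx1 mulmx1. Qed.

(** The operator norm bound [1 / eta] in disguise: by the Ward identity and Cauchy-Schwarz,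
    [eta * hs (V G)] is at most [sqrt (hs (V G) * hs V)], and one factor cancels. *)
Lemma hs_resM k (V : 'M[C]_(k, n)) : hs (V *m G) <= hs V / eta ^+ 2.
Proof.
rewrite ler_pdivlMr ?exprn_gt0//.
have h1 : eta * hs (V *m G) <= cmod (\tr (V *m G *m adjmx V)).
  by rewrite -Im_tr_res Im_le_cmod.
have h2 := cmod_trM (V *m G) (adjmx V); rewrite hs_adj in h2.
have h3 : (eta * hs (V *m G)) ^+ 2 <= hs (V *m G) * hs V.
  apply: le_trans h2; rewrite ler_sqr ?nnegrE ?cmod_ge0// mulr_ge0 ?hs_ge0//; exact: ltW.
have := hs_ge0 (V *m G); rewrite le_eqVlt => /predU1P[<-|p]; first by rewrite mul0r hs_ge0.
by rewrite -(ler_pM2l p) (le_trans _ h3)// le_eqVlt; apply/orP; left; apply/eqP; ring.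
Qed.
Lemma hs_res : hs G <= n%:R / eta ^+ 2.
Proof. by have := hs_resM 1%:M; rewrite mul1mx hs1. Qed.
Lemma hs_res2 : hs (G *m G) <= hs G / eta ^+ 2.
Proof. exact: hs_resM. Qed.

(** Cauchy-Schwarz splits [V G G V^*] into [V G] and [G V^*], which have the same norm by the two
    Ward identities. *)
Lemma cmod_tr_res2 k (V : 'M[C]_(k, n)) :
  cmod (\tr (V *m G *m G *m adjmx V)) <= Im (\tr (V *m G *m adjmx V)) / eta.
Proof.
rewrite -mulmxA; apply: cmod_trM_le.
  by rewrite Im_tr_res mulrAC divff ?gt_eqF// mul1r.
by rewrite Im_tr_res_col mulrAC divff ?gt_eqF// mul1r.
Qed.
Lemma cmod_trG2 : cmod (\tr (G *m G)) <= hs G.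
Proof. exact: cmod_trM_le. Qed.

(** Positivity of the Gram matrix: with [y = G V^*], the product is [z * hs (A y) - |z|^2 * hs y],
    and only the first term has an imaginary part. This keeps [1 + q_] and [1 + gt] away from zero
    without any probability. *)
Lemma Im_z_tr_res k (V : 'M[C]_(k, n)) : 0 <= Im (z * \tr (V *m G *m adjmx V)).
Proof.
pose y := G *m adjmx V.
have -> : z * \tr (V *m G *m adjmx V) = (hs (A *m y))%:C%C * z - (cmod z ^+ 2 * hs y)%:C%C.
  have -> : V = adjmx y *m adjmx (H - z%:M).
    by rewrite adjmxM adjmxK -mulmxA adj_resM mulmx1.
  have -> : adjmx y *m adjmx (H - z%:M) *m G *m adjmx (adjmx y *m adjmx (H - z%:M)) =
            adjmx (A *m y) *m (A *m y) - conjc z *: (adjmx y *m y).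
    rewrite [adjmx (_ *m adjmx (H - _))]adjmxM !adjmxK -!mulmxA [G *m _]mulmxA resM mul1mx.
    rewrite adjmxB adj_gram adjmx_scalar mulmxBl mulmxBr mul_scalar_mx -scalemxAr.
    by rewrite adjmxM !mulmxA.
  rewrite raddfB /= mxtraceZ !tr_adjM mulrBr mulrA mulJ [z * _]mulrC.
  by rewrite [in RHS]rmorphM.
by rewrite cImB cImZ /= subr0 mulr_ge0 ?hs_ge0// ltW.
Qed.

Lemma cmod_trG : cmod (\tr G) <= n%:R / eta.
Proof.
have := cmod_trM G 1%:M; rewrite mulmx1 hs1 => h.
have h2 : cmod (\tr G) ^+ 2 <= (n%:R / eta) ^+ 2.
  apply: le_trans h _; rewrite expr_div_n mulrC expr2 -mulrA ler_wpM2l//.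
  exact: hs_res.
by rewrite -(@ler_pXn2r _ 2)// ?nnegrE ?cmod_ge0// divr_ge0// ltW.
Qed.

Lemma resG_E : z *: resG A z = A *m G *m adjmx A - 1%:M.
Proof.
have z00 : z != 0 by apply: neq0_Im.
have h : (A *m adjmx A - z%:M) *m (A *m G *m adjmx A - 1%:M) = z%:M.
  have e : adjmx A *m (A *m (G *m adjmx A)) = adjmx A + z *: (G *m adjmx A).
    by rewrite !mulmxA gram_res mulmxDl mul1mx -scalemxAl.
  rewrite mulmxBr mulmx1 mulmxBl mul_scalar_mx -!mulmxA e.
  by rewrite mulmxDr -scalemxAr addrK opprB addrC subrK.
have h1 : (A *m adjmx A - z%:M) *m (z^-1 *: (A *m G *m adjmx A - 1%:M)) = 1%:M.
  by rewrite -scalemxAr h scale_scalar_mx mulVf.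
have [u _] := mulmx1_unit h1.
have -> : resG A z = z^-1 *: (A *m G *m adjmx A - 1%:M).
  by rewrite -[RHS](mulKmx u) h1 mulmx1.
by rewrite scalerA divff// scale1r.
Qed.
(** The two Gram matrices share their nonzero eigenvalues; the remaining ones are zero and
    contribute [-1/z] each. *)
Lemma tr_resG : z * \tr (resG A z) = n%:R + z * \tr G - m%:R.
Proof.
rewrite -mxtraceZ resG_E raddfB /= mxtrace1 -mulmxA mxtrace_mulC -mulmxA mxtrace_mulC.
by rewrite gram_res raddfD /= mxtraceZ mxtrace1.
Qed.
End Resolvent.

(** * Removal of one row: rank one perturbation and Schur complements *)

Section RowRemoval.
Variable R : realType.
Local Notation Re := (@complex.Re R).
Local Notation Im := (@complex.Im R).
Local Notation C := R[i].

(** Written as the trace of a one by one matrix, so that the trace identities for resolvents apply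
    to it verbatim. *)
Definition qf n (r s : 'rV[C]_n) (B : 'M[C]_n) : C := \tr (r *m B *m adjmx s).

(** The row is set to zero instead of being deleted: the Gram matrix [A^* A] is that of the minor,
    and all matrices keep their type. *)
Definition rowz m n (i : 'I_m) (A : 'M[C]_(m, n)) : 'M[C]_(m, n) :=
  \matrix_(k, l) if k == i then 0 else A k l.

Lemma qfE n (r s : 'rV[C]_n) (B : 'M[C]_n) :
  qf r s B = \sum_k \sum_l B k l * (r 0 k * conjc (s 0 l)).
Proof.
rewrite /qf tr11 mxE exchange_big; apply: eq_bigr => l _.
rewrite mxE mulr_suml; apply: eq_bigr => k _; rewrite mxE; ring.
Qed.

(** Resolvent identity followed by Cauchy-Schwarz. This crude continuity suffices because the grid
    of spectral parameters is very fine. *)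
Lemma resR_Lip m n (A : 'M[C]_(m, n)) (z z' : C) : 0 < Im z -> 0 < Im z' ->
  cmod (\tr (resR A z) - \tr (resR A z')) <= cmod (z - z') * (n%:R / (Im z * Im z')).
Proof.
move=> z0 z0'.
have -> : \tr (resR A z) - \tr (resR A z') = (z - z') * \tr (resR A z *m resR A z').
  rewrite -raddfB /= -mxtraceZ; congr mxtrace.
  rewrite -{1}[resR A z]mulmx1 -(Mres A z0') mulmxA -{2}[resR A z']mul1mx -(resM A z0).
  rewrite -mulmxBl -mulmxBr opprB addrC addrA subrK -raddfB /=.
  by rewrite mul_mx_scalar -scalemxAl.
rewrite cmodM ler_wpM2l ?cmod_ge0//.
apply: le_of_sqr; first by rewrite divr_ge0// mulr_ge0// ltW.
apply: le_trans (cmod_trM _ _) _.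
have := ler_pM (hs_ge0 _) (hs_ge0 _) (hs_res A z0) (hs_res A z0').
move=> h; apply: le_trans h _; rewrite le_eqVlt; apply/orP; left; apply/eqP.
by field; rewrite !gt_eqF.
Qed.

Variables (m n : nat) (A : 'M[C]_(m, n)) (z : C) (i : 'I_m).
Hypothesis z0 : 0 < Im z.
Local Notation eta := (Im z).
Local Notation G := (resR A z).
Local Notation A' := (rowz i A).
Local Notation G' := (resR A' z).
Local Notation r := (row i A).
Definition q_ : C := qf r r G'.
(** By the Schur complement this is [- z] times the diagonal entry of [resG] (see [resG_ii]). *)
Definition u_ : C := (1 + q_)^-1.

Lemma gram_rowz : adjmx A *m A = adjmx A' *m A' + adjmx r *m r.
Proof.
apply/matrixP=> k l; rewrite !mxE (bigD1 i)//= addrC; congr (_ + _).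
  rewrite [RHS](bigD1 i)//= !mxE eqxx conjc0 mul0r add0r.
  by apply: eq_bigr => j ji; rewrite !mxE (negbTE ji).
by rewrite big_ord1 !mxE.
Qed.

Lemma Im_q : Im q_ = eta * hs (r *m G').
Proof. by rewrite /q_ /qf Im_tr_res. Qed.
Lemma Im_q_ge0 : 0 <= Im q_.
Proof. by rewrite Im_q mulr_ge0 ?hs_ge0// ltW. Qed.
Lemma Im_zq : eta <= Im (z * (1 + q_)).
Proof. by rewrite mulrDr mulr1 cImD lerDl /q_ /qf Im_z_tr_res. Qed.
Lemma q_neq0 : 1 + q_ != 0.
Proof.
apply/eqP=> e; have := Im_zq; rewrite e mulr0 /= leNgt z0 //.
Qed.

(** [A^* A] differs from the Gram matrix of the minor by the rank one term [r^* r]; the candidate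
    inverse is checked by multiplication. *)
Lemma sherman_morrison : G = G' - u_ *: (G' *m adjmx r *m r *m G').
Proof.
have h : (adjmx A *m A - z%:M) *m (G' - u_ *: (G' *m adjmx r *m r *m G')) = 1%:M.
  have -> : adjmx A *m A - z%:M = (adjmx A' *m A' - z%:M) + adjmx r *m r.
    by rewrite gram_rowz addrAC.
  rewrite mulmxDl !mulmxBr -!scalemxAr !mulmxA Mres// mul1mx.
  have -> : adjmx r *m r *m G' *m adjmx r *m r *m G' = q_ *: (adjmx r *m r *m G').
    rewrite -!mulmxA [r *m (G' *m (adjmx r *m _))]mulmxA.
    have -> : (r *m G') *m (adjmx r *m (r *m G')) = q_ *: (r *m G').
      by rewrite mulmxA [r *m G' *m adjmx r]mx11_scalar -tr11 mul_scalar_mx.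
    by rewrite -scalemxAr.
  rewrite scalerA -addrA -[RHS]addr0; congr (_ + _).
  rewrite -mulmxA -{2}[adjmx r *m (r *m G')]scale1r -scaleNr -!scalerBl -scalerDl.
  suff -> : - u_ + (1 - u_ * q_) = 0 by rewrite scale0r.
  rewrite /u_; field; exact: q_neq0.
by rewrite -[LHS]mulmx1 -h mulmxA resM// mul1mx.
Qed.

Lemma row_res : r *m G = u_ *: (r *m G').
Proof.
rewrite sherman_morrison mulmxBr -scalemxAr !mulmxA.
rewrite [r *m G' *m adjmx r]mx11_scalar -tr11 -/(qf r r G') -/q_ mul_scalar_mx -scalemxAl.
rewrite scalerA -{1}[r *m G']scale1r -scalerBl; congr (_ *: _).
by rewrite /u_; field; exact: q_neq0.
Qed.
Lemma qf_res : qf r r G = 1 - u_.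
Proof.
rewrite /qf row_res -scalemxAl mxtraceZ -/(qf r r G') -/q_ /u_.
by field; exact: q_neq0.
Qed.
Lemma qf_res_l (s : 'rV[C]_n) : qf r s G = u_ * qf r s G'.
Proof. by rewrite /qf row_res -scalemxAl mxtraceZ. Qed.
Lemma qf_res_s (s : 'rV[C]_n) : qf s s G = qf s s G' - u_ * (qf s r G' * qf r s G').
Proof.
rewrite /qf sherman_morrison mulmxBr mulmxBl raddfB /= -scalemxAr -scalemxAl mxtraceZ.
congr (_ - _ * _); rewrite !mulmxA {1}[s *m G' *m adjmx r]mx11_scalar -tr11.
by rewrite mul_scalar_mx -!scalemxAl mxtraceZ.
Qed.
Lemma tr_res : \tr G = \tr G' - u_ * qf r r (G' *m G').
Proof.
rewrite sherman_morrison raddfB /= mxtraceZ; congr (_ - _ * _).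
by rewrite -mulmxA mxtrace_mulC /qf !mulmxA.
Qed.
Lemma cmod_qf2 : cmod (qf r r (G' *m G')) <= Im q_ / eta.
Proof. by have := cmod_tr_res2 A' z0 r; rewrite /q_ /qf !mulmxA. Qed.
(** Smallness of the denominator is harmless: the numerator is at most [Im q_ / eta], and [Im q_] is
    at most [|1 + q_|]. So removing a row moves the trace by at most [1 / eta], whatever the row. *)
Lemma cmod_u_qf2 : cmod (u_ * qf r r (G' *m G')) <= eta^-1.
Proof.
rewrite cmodM /u_ cmodV mulrC ler_pdivrMr ?cmod_gt0 ?q_neq0//.
apply: le_trans cmod_qf2 _; rewrite mulrC ler_wpM2l//; first by rewrite invr_ge0 ltW.
by apply: (le_trans _ (Im_le_cmod _)); rewrite cImD add0r.
Qed.
Lemma tr_res_diff : cmod (\tr G - \tr G') <= eta^-1.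
Proof. by rewrite tr_res addrAC subrr add0r cmodN cmod_u_qf2. Qed.
Lemma cmod_u : cmod u_ <= cmod z / eta.
Proof.
rewrite /u_ cmodV -[_^-1]mul1r ler_pdivrMr ?cmod_gt0 ?q_neq0//.
rewrite mulrAC ler_pdivlMr// mul1r -cmodM.
exact: (le_trans Im_zq (Im_le_cmod _)).
Qed.
Lemma resG_ii : z * resG A z i i = - u_.
Proof.
have := congr1 (fun M : 'M[C]_m => M i i) (resG_E A z0); rewrite !mxE eqxx mulr1n => ->.
have -> : \sum_j (A *m G) i j * adjmx A j i = qf r r G.
  by rewrite /qf tr11 !mxE; apply: eq_bigr => j _; rewrite !mxE; congr (_ * _); apply: eq_bigr => k _; rewrite !mxE.
by rewrite qf_res; ring.
Qed.
(** Only row [i] is removed; row [j] stays inside [G']. Given the rows other than [i], the right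
    side is therefore linear in row [i] up to the factor [u_]. *)
Lemma resG_ij j : i != j -> z * resG A z i j = u_ * qf r (row j A) G'.
Proof.
move=> ij; have := congr1 (fun M : 'M[C]_m => M i j) (resG_E A z0); rewrite !mxE (negbTE ij) mulr0n subr0 => ->.
rewrite -qf_res_l /qf tr11 !mxE; apply: eq_bigr => k _; rewrite !mxE; congr (_ * _).
by apply: eq_bigr => l _; rewrite !mxE.
Qed.
End RowRemoval.

Section TraceSum.
Variable R : realType.
Local Notation Im := (@complex.Im R).
Local Notation C := R[i].
Variables (m n : nat) (A : 'M[C]_(m, n)) (z : C).
Hypothesis z0 : 0 < Im z.
Lemma trace_sum : n%:R + z * \tr (resR A z) = \sum_i (1 - u_ A z i).
Proof.
have := tr_resG A z0; rewrite /mxtrace mulr_sumr.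
under eq_bigr do rewrite resG_ii//.
move=> h; rewrite big_split /= h sumr_const card_ord; ring.
Qed.
End TraceSum.

(** * Measurability and resampling of random matrices *)

Section ComplexMeasurable.
Variable R : realType.
Local Notation Re := (@complex.Re R).
Local Notation Im := (@complex.Im R).
Local Notation C := R[i].
Context d (T : measurableType d).

Definition rmeas (f : T -> R) := measurable_fun setT f.
Definition cmeas (f : T -> C) := rmeas (fun t => Re (f t)) /\ rmeas (fun t => Im (f t)).
Definition mxmeas m n (A : T -> 'M[C]_(m, n)) := forall i j, cmeas (fun t => A t i j).

Lemma rmeas_cst (a : R) : rmeas (fun=> a). Proof. exact: measurable_cst. Qed.
Lemma rmeasD f g : rmeas f -> rmeas g -> rmeas (fun t => f t + g t).
Proof. exact: measurable_funD. Qed.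
Lemma rmeasN f : rmeas f -> rmeas (fun t => - f t).
Proof. exact: measurable_funN. Qed.
Lemma rmeasB f g : rmeas f -> rmeas g -> rmeas (fun t => f t - g t).
Proof. exact: measurable_funB. Qed.
Lemma rmeasM f g : rmeas f -> rmeas g -> rmeas (fun t => f t * g t).
Proof. exact: measurable_funM. Qed.
Lemma rmeasX f n : rmeas f -> rmeas (fun t => f t ^+ n).
Proof. exact: measurable_funX. Qed.
Lemma rmeas_sqrt f : rmeas f -> rmeas (fun t => Num.sqrt (f t)).
Proof.
move=> mf; apply: measurableT_comp mf.
exact: (continuous_measurable_fun (@sqrt_continuous R)).
Qed.
Lemma rmeasV f : rmeas f -> rmeas (fun t => (f t)^-1).
Proof.
(* Inversion is not continuous at [0]; writing [1 / f] as [f * (f^2)^-1] reduces it to a real power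
   of a nonnegative function, and both sides vanish where [f] does. *)
move=> mf; rewrite (_ : (fun t => _) = (fun t => f t * (f t ^+ 2) `^ (-1))).
  apply: rmeasM => //; apply: (measurableT_comp (measurable_powR (-1))).
  exact: rmeasX.
apply/funext => t; rewrite powR_inv1 ?sqr_ge0//.
have [->|f0] := eqVneq (f t) 0; first by rewrite invr0 mul0r.
by field.
Qed.
Lemma rmeas_sum (I : Type) (s : seq I) (f : I -> T -> R) :
  (forall i, rmeas (f i)) -> rmeas (fun t => \sum_(i <- s) f i t).
Proof. exact: measurable_sum. Qed.

Lemma cmeas_cst (a : C) : cmeas (fun=> a). Proof. by split; exact: rmeas_cst. Qed.
Lemma cmeasD f g : cmeas f -> cmeas g -> cmeas (fun t => f t + g t).
Proof.
move=> [f1 f2] [g1 g2]; split.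
  by under [X in rmeas X]eq_fun do rewrite cReD; exact: rmeasD.
by under [X in rmeas X]eq_fun do rewrite cImD; exact: rmeasD.
Qed.
Lemma cmeasN f : cmeas f -> cmeas (fun t => - f t).
Proof.
move=> [f1 f2]; split.
  by under [X in rmeas X]eq_fun do rewrite cReN; exact: rmeasN.
by under [X in rmeas X]eq_fun do rewrite cImN; exact: rmeasN.
Qed.
Lemma cmeasB f g : cmeas f -> cmeas g -> cmeas (fun t => f t - g t).
Proof. by move=> mf mg; apply: cmeasD => //; exact: cmeasN. Qed.
Lemma cmeasJ f : cmeas f -> cmeas (fun t => conjc (f t)).
Proof.
move=> [f1 f2]; split.
  by under [X in rmeas X]eq_fun do rewrite cReJ.
by under [X in rmeas X]eq_fun do rewrite cImJ; exact: rmeasN.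
Qed.
Lemma cmeasM f g : cmeas f -> cmeas g -> cmeas (fun t => f t * g t).
Proof.
move=> [f1 f2] [g1 g2]; split.
  by under [X in rmeas X]eq_fun do rewrite cReM; apply: rmeasB; exact: rmeasM.
by under [X in rmeas X]eq_fun do rewrite cImM; apply: rmeasD; exact: rmeasM.
Qed.
Lemma cmeasX f n : cmeas f -> cmeas (fun t => f t ^+ n).
Proof.
move=> mf; elim: n => [|n IH]; first exact: cmeas_cst.
by under [X in cmeas X]eq_fun do rewrite exprS; exact: cmeasM.
Qed.
Lemma cmeas_real f : rmeas f -> cmeas (fun t => (f t)%:C%C).
Proof. by move=> mf; split=> //; exact: rmeas_cst. Qed.
Lemma rmeas_cmod f : cmeas f -> rmeas (fun t => cmod (f t)).
Proof.
by move=> [f1 f2]; apply: rmeas_sqrt; apply: rmeasD; exact: rmeasX.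
Qed.
Lemma cmeasV f : cmeas f -> cmeas (fun t => (f t)^-1).
Proof.
move=> mf; under [X in cmeas X]eq_fun do rewrite cinvE.
apply: cmeasM; last exact: cmeasJ.
apply: cmeas_real; apply: rmeasV; apply: rmeasX; exact: rmeas_cmod.
Qed.
Lemma cmeas_sum (I : Type) (s : seq I) (p : pred I) (f : I -> T -> C) :
  (forall i, cmeas (f i)) -> cmeas (fun t => \sum_(i <- s | p i) f i t).
Proof.
move=> mf; elim: s => [|a s IH].
  by under [X in cmeas X]eq_fun do rewrite big_nil; exact: cmeas_cst.
case pa : (p a).
  by under [X in cmeas X]eq_fun do rewrite big_cons pa; exact: cmeasD.
by under [X in cmeas X]eq_fun do rewrite big_cons pa.
Qed.
Lemma cmeas_prod (I : Type) (s : seq I) (p : pred I) (f : I -> T -> C) :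
  (forall i, cmeas (f i)) -> cmeas (fun t => \prod_(i <- s | p i) f i t).
Proof.
move=> mf; elim: s => [|a s IH].
  by under [X in cmeas X]eq_fun do rewrite big_nil; exact: cmeas_cst.
case pa : (p a).
  by under [X in cmeas X]eq_fun do rewrite big_cons pa; exact: cmeasM.
by under [X in cmeas X]eq_fun do rewrite big_cons pa.
Qed.

Lemma mxmeas_cst m n (A : 'M[C]_(m, n)) : mxmeas (fun=> A).
Proof. by move=> i j; exact: cmeas_cst. Qed.
Lemma mxmeasM m n p (A : T -> 'M[C]_(m, n)) (B : T -> 'M[C]_(n, p)) :
  mxmeas A -> mxmeas B -> mxmeas (fun t => A t *m B t).
Proof.
move=> mA mB i j; under [X in cmeas X]eq_fun do rewrite mxE.
by apply: cmeas_sum => k; exact: cmeasM.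
Qed.
Lemma mxmeasB m n (A B : T -> 'M[C]_(m, n)) :
  mxmeas A -> mxmeas B -> mxmeas (fun t => A t - B t).
Proof.
by move=> mA mB i j; under [X in cmeas X]eq_fun do rewrite !mxE; exact: cmeasB.
Qed.
Lemma mxmeas_adj m n (A : T -> 'M[C]_(m, n)) :
  mxmeas A -> mxmeas (fun t => adjmx (A t)).
Proof. by move=> mA i j; under [X in cmeas X]eq_fun do rewrite !mxE; exact: cmeasJ. Qed.
Lemma mxmeas_row m n (A : T -> 'M[C]_(m, n)) i :
  mxmeas A -> mxmeas (fun t => row i (A t)).
Proof. by move=> mA k j; under [X in cmeas X]eq_fun do rewrite !mxE. Qed.
Lemma mxmeas_rowz m n (A : T -> 'M[C]_(m, n)) i :
  mxmeas A -> mxmeas (fun t => rowz i (A t)).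
Proof.
move=> mA k j; under [X in cmeas X]eq_fun do rewrite !mxE.
case: (k == i); [exact: cmeas_cst|exact: mA].
Qed.
Lemma cmeas_tr n (A : T -> 'M[C]_n) : mxmeas A -> cmeas (fun t => \tr (A t)).
Proof. by move=> mA; apply: cmeas_sum. Qed.
Lemma rmeas_hs m n (A : T -> 'M[C]_(m, n)) : mxmeas A -> rmeas (fun t => hs (A t)).
Proof.
move=> mA; apply: rmeas_sum => i; apply: rmeas_sum => j.
by apply: rmeasX; exact: rmeas_cmod.
Qed.
Lemma cmeas_det n (A : T -> 'M[C]_n) : mxmeas A -> cmeas (fun t => \det (A t)).
Proof.
move=> mA; apply: cmeas_sum => s; apply: cmeasM; first exact: cmeas_cst.
exact: cmeas_prod.
Qed.
(** Cramer's rule: the entries of the inverse are polynomials in the entries of [A] divided by the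
    determinant. *)
Lemma mxmeas_inv n (A : T -> 'M[C]_n) :
  mxmeas A -> (forall t, A t \in unitmx) -> mxmeas (fun t => invmx (A t)).
Proof.
move=> mA uA i j.
under [X in cmeas X]eq_fun do rewrite /invmx uA !mxE.
apply: cmeasM; first by apply: cmeasV; exact: cmeas_det.
apply: cmeasM; first exact: cmeas_cst.
apply: cmeas_det => k l.
by under [X in cmeas X]eq_fun do rewrite !mxE.
Qed.
Lemma mxmeas_resR m n (A : T -> 'M[C]_(m, n)) z : 0 < Im z ->
  mxmeas A -> mxmeas (fun t => resR (A t) z).
Proof.
move=> z0 mA; apply: mxmeas_inv => [|t]; last exact: res_unit.
apply: mxmeasB; last exact: mxmeas_cst.
exact: (mxmeasM (mxmeas_adj mA) mA).
Qed.
Lemma cmeas_qf n (r s : T -> 'rV[C]_n) (B : T -> 'M[C]_n) :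
  mxmeas r -> mxmeas s -> mxmeas B -> cmeas (fun t => qf (r t) (s t) (B t)).
Proof.
move=> mr ms mB; apply: cmeas_tr; apply: mxmeasM; last exact: mxmeas_adj.
exact: mxmeasM.
Qed.
End ComplexMeasurable.

HB.instance Definition _ (R : realType) := isPointed.Build R[i] 0.

Section MatrixSpace.
Variable R : realType.
Local Notation Re := (@complex.Re R).
Local Notation Im := (@complex.Im R).
Local Notation C := R[i].

Definition pr2 (x : C) : R * R := (Re x, Im x).
Definition box m n (f : 'I_m * 'I_n -> set (R * R)) : set 'M[C]_(m, n) :=
  [set A | forall k, f k (pr2 (A k.1 k.2))].
Definition boxes m n : set (set 'M[C]_(m, n)) :=
  [set S | exists2 f, (forall k, measurable (f k)) & S = box f].
End MatrixSpace.
(* Matrices with the product Borel structure, generated by the boxes of the entries. *)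
Notation mxS R m n := (g_sigma_algebraType (@boxes R m n)).

Section MatrixLaw.
Variable R : realType.
Local Notation Re := (@complex.Re R).
Local Notation Im := (@complex.Im R).
Local Notation C := R[i].

Lemma mxmeas_id m n : mxmeas (fun A : mxS R m n => (A : 'M[C]_(m, n))).
Proof.
move=> i j; have h (g : R * R -> R) : measurable_fun setT g ->
    measurable_fun setT (fun A : mxS R m n => g (pr2 (A i j))).
  move=> mg _ B mB; rewrite setTI.
  apply: sub_sigma_algebra.
  exists (fun k => if k == (i, j) then g @^-1` B else setT).
    move=> k; case: ifP => // _; rewrite -[_ @^-1` _]setTI; exact: mg.
  apply/seteqP; split=> [A /= gB k|A /(_ (i, j))]; last by rewrite /= eqxx.
  by case: ifP => // /eqP ->.
split; first exact: (h fst measurable_fst).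
exact: (h snd measurable_snd).
Qed.

Lemma mxmeas_measurable d (T : measurableType d) m n (A : T -> 'M[C]_(m, n)) :
  mxmeas A -> measurable_fun setT (A : T -> mxS R m n).
Proof.
move=> mA; apply: (@measurability _ _ T (mxS R m n) setT A (@boxes R m n)) => // _ [_ [f mf ->] <-].
rewrite setTI.
have -> : A @^-1` box f = \bigcap_(k in [set: 'I_m * 'I_n]) ((fun t => pr2 (A t k.1 k.2)) @^-1` f k).
  by apply/seteqP; split=> [t h k _|t h k]; [exact: h|exact: (h k I)].
apply: fin_bigcap_measurable; first exact: finite_finset.
move=> k _; rewrite -[_ @^-1` _]setTI.
have [m1 m2] := mA k.1 k.2.
exact: (measurable_fun_pair m1 m2).
Qed.

Lemma boxesI m n : setI_closed (@boxes R m n).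
Proof.
move=> _ _ [f mf ->] [g mg ->]; exists (fun k => f k `&` g k).
  by move=> k; apply: measurableI.
apply/seteqP; split=> A /=; first by move=> [h1 h2] k; split.
by move=> h; split=> k; case: (h k).
Qed.

Definition mix m n (J : {set 'I_m * 'I_n}) (A B : 'M[C]_(m, n)) : 'M[C]_(m, n) :=
  \matrix_(i, j) if (i, j) \in J then B i j else A i j.

(** Independence of the entries in integrated form, with the entries in [J] redrawn. It stands in
    for the conditional expectation given the entries outside [J], and restricting to nonnegative
    [Phi] avoids integrability conditions. *)
Definition resample d (T : measurableType d) (P : probability T R) m n
    (A : T -> 'M[C]_(m, n)) :=
  forall (J : {set 'I_m * 'I_n}) (Phi : mxS R m n -> \bar R),
    measurable_fun setT Phi -> (forall B, 0 <= Phi B)%E ->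
    (\int[P]_t Phi (A t) = \int[P]_t \int[P]_s Phi (mix J (A t) (A s)))%E.

Section Resample.
Context d (T : measurableType d) (P : probability T R).
Variables (m n : nat) (A : T -> 'M[C]_(m, n)).
Hypothesis mA : mxmeas A.
Hypothesis indA : mutually_independent P
  (fun (p : 'I_m * 'I_n) t => (Re (A t p.1 p.2), Im (A t p.1 p.2))).

Lemma mxmeas_mix J : mxmeas (fun p : T * T => mix J (A p.1) (A p.2)).
Proof.
have h (X : T * T -> T) i j : measurable_fun setT X -> cmeas (fun p => A (X p) i j).
  by move=> mX; have [h1 h2] := mA i j; split; [exact: (measurableT_comp h1)|exact: (measurableT_comp h2)].
move=> i j; under [X in cmeas X]eq_fun do rewrite mxE.
by case: ((i, j) \in J); [apply: (h snd); exact: measurable_snd|apply: (h fst); exact: measurable_fst].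
Qed.

Lemma measurable_pr2 k (B : set (R * R)) : measurable B ->
  measurable ((fun t => pr2 (A t k.1 k.2)) @^-1` B).
Proof.
move=> mB; have [m1 m2] := mA k.1 k.2; rewrite -[_ @^-1` _]setTI.
exact: (measurable_fun_pair m1 m2).
Qed.

Lemma indep_box (J : {set 'I_m * 'I_n}) f : (forall k, measurable (f k)) ->
  P (\bigcap_(k in [set k | k \in J]) ((fun t => pr2 (A t k.1 k.2)) @^-1` f k)) =
  (\prod_(k in J) P ((fun t => pr2 (A t k.1 k.2)) @^-1` f k))%E.
Proof. by move=> mf; have := indA J mf. Qed.

(** Uniqueness of measures on a pi-system: the law of [A] and the law of the mixed matrix agree on
    boxes. *)
Lemma resample_indep : resample P A.
Proof.
move=> J Phi mPhi Phi0.
have mAS := mxmeas_measurable mA.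
have mmix := mxmeas_measurable (mxmeas_mix J).
pose m1 := pushforward P (A : T -> mxS R m n).
pose m2 := pushforward (P \x P)%E (fun p : T * T => mix J (A p.1) (A p.2) : mxS R m n).
have mE S : measurable S -> m1 S = m2 S.
  apply: (measure_unique (T := mxS R m n) (@boxes R m n) (fun=> setT)) => //.
  - exact: boxesI.
  - by move=> _; exists (fun=> setT) => //; apply/seteqP; split.
  - by apply/seteqP; split=> // x _; exists 0%N.
  - move=> _ [f mf ->].
    change (P (A @^-1` box f) = (P \x P)%E ((fun p : T * T => mix J (A p.1) (A p.2)) @^-1` box f)).
    pose F k := (fun t => pr2 (A t k.1 k.2)) @^-1` f k.
    have mF k : measurable (F k) by exact: measurable_pr2.
    have capE (K : {set 'I_m * 'I_n}) : measurable (\bigcap_(k in [set k | k \in K]) F k).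
      by apply: fin_bigcap_measurable => // ; exact: finite_finset.
    have -> : A @^-1` box f = \bigcap_(k in [set k | k \in [set: 'I_m * 'I_n]%SET]) F k.
      by apply/seteqP; split=> [t h k _|t h k]; [exact: h|apply: (h k); rewrite /= inE].
    (* The mixture lies in a box exactly when the first copy satisfies the constraints outside [J]
       and the second those in [J]: a rectangle of the product space. *)
    have -> : (fun p : T * T => mix J (A p.1) (A p.2)) @^-1` box f =
        (\bigcap_(k in [set k | k \in ~: J]) F k) `*` (\bigcap_(k in [set k | k \in J]) F k).
      apply/seteqP; split=> [[t s] /= h|[t s] /= [h1 h2] [i j]].
        split=> -[i j] /=; last by move=> iJ; have := h (i, j); rewrite mxE iJ.
        by rewrite inE => iJ; have := h (i, j); rewrite mxE (negbTE iJ).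
      rewrite mxE; case: ifPn => iJ; first exact: (h2 (i, j)).
      by apply: (h1 (i, j)); rewrite /= inE.
    have hP (K : {set 'I_m * 'I_n}) :
      P (\bigcap_(k in [set k | k \in K]) F k) = (\prod_(k in K) P (F k))%E.
      exact: indep_box.
    transitivity (P (\bigcap_(k in [set k | k \in ~: J]) F k) *
                  P (\bigcap_(k in [set k | k \in J]) F k))%E; last first.
      by rewrite product_measure1E.
    rewrite (hP [set: _]%SET) (hP J) (hP (~: J)%SET).
    rewrite [RHS]muleC (bigID (mem J))/=; congr (_ * _)%E; first by apply: eq_bigl => k; rewrite inE.
    by apply: eq_bigl => k; rewrite !inE.
  - move=> _; change (P (A @^-1` setT) < +oo)%E.
    by rewrite preimage_setT probability_setT ltry.
have e1 : (\int[m1]_x Phi x = \int[P]_t Phi (A t))%E.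
  by rewrite ge0_integral_pushforward.
have e2 : (\int[m2]_x Phi x = \int[(P \x P)%E]_p Phi (mix J (A p.1) (A p.2)))%E.
  by rewrite ge0_integral_pushforward.
rewrite -e1 (eq_measure_integral m2); last by move=> S mS _; exact: mE.
rewrite e2 fubini_tonelli1//.
exact: (measurableT_comp mPhi mmix).
Qed.

End Resample.

End MatrixLaw.

(** * Large deviation bounds *)

Section Elementary.
Variable F : realFieldType.
Implicit Types a b l : F.

Lemma le_pow_mix a b p q : 0 <= a -> 0 <= b -> a ^+ p * b ^+ q <= a ^+ (p + q) + b ^+ (p + q).
Proof.
move=> a0 b0; have [ab|/ltW ba] := leP a b.
  apply: (@le_trans _ _ (b ^+ (p + q))); last by rewrite lerDr exprn_ge0.
  by rewrite exprD ler_wpM2r ?exprn_ge0// lerXn2r ?nnegrE.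
apply: (@le_trans _ _ (a ^+ (p + q))); last by rewrite lerDl exprn_ge0.
by rewrite exprD ler_wpM2l ?exprn_ge0// lerXn2r ?nnegrE.
Qed.

(** Meant for [a = |x|^2], [b = |y|^2], [l = Re (x^* y)], the base being [|x + y|^2]. The first
    order term is kept exactly, because it will have mean zero; everything else is at least
    quadratic in [y]. *)
Lemma pow_expand p : exists2 K : F, 0 <= K & forall a b l, 0 <= a -> 0 <= b -> l ^+ 2 <= a * b ->
  (a + 2 * l + b) ^+ p.+1 <=
  a ^+ p.+1 + 2 * p.+1%:R * a ^+ p * l + K * (a ^+ p * b + b ^+ p.+1).
Proof.
elim: p => [|p [K K0 IH]].
  exists 1 => // a b l a0 b0 h; rewrite !expr1 expr0; lra.
exists (1 + 6 * p.+1%:R + 6 * K).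
  by rewrite !addr_ge0 ?mulr_ge0// ler0n.
move=> a b l a0 b0 h; have {}IH := IH a b l a0 b0 h.
have hl : 2 * `|l| <= a + b.
  apply: le_of_sqr; first exact: addr_ge0.
  rewrite exprMn real_normK ?num_real// -subr_ge0.
  apply: (@le_trans _ _ ((a - b) ^+ 2 + 4 * (a * b - l ^+ 2))); last by rewrite le_eqVlt; apply/orP; left; apply/eqP; ring.
  by rewrite addr_ge0 ?sqr_ge0// mulr_ge0// subr_ge0.
have /andP[hl1 hl2] : - (a + b) <= 2 * l <= a + b.
  by rewrite -ler_norml normrM (ger0_norm (_ : 0 <= 2 :> F)).
have F0 : 0 <= a + 2 * l + b by lra.
rewrite exprSr; apply: le_trans (ler_wpM2r F0 IH) _.
have ap : 0 <= a ^+ p by exact: exprn_ge0.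
have bp : 0 <= b ^+ p by exact: exprn_ge0.
set k : F := p.+1%:R; have k0 : 0 <= k by exact: ler0n.
have m1 : a ^+ p * b ^+ 2 <= a ^+ p.+1 * b + b ^+ p.+2.
  have [ab|/ltW ba] := leP a b.
    apply: (@le_trans _ _ (b ^+ p.+2)); last by rewrite lerDr mulr_ge0// exprn_ge0.
    by rewrite -[p.+2]addn2 exprD ler_wpM2r ?sqr_ge0// lerXn2r ?nnegrE.
  apply: (@le_trans _ _ (a ^+ p.+1 * b)); last by rewrite lerDl exprn_ge0.
  have -> : a ^+ p.+1 * b = a ^+ p * (a * b) by rewrite exprS; ring.
  by rewrite ler_wpM2l// expr2 ler_wpM2r.
have m2 : a * b ^+ p.+1 <= a ^+ p.+1 * b + b ^+ p.+2.
  have [ab|/ltW ba] := leP a b.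
    apply: (@le_trans _ _ (b ^+ p.+2)); last by rewrite lerDr mulr_ge0// exprn_ge0.
    by rewrite [b ^+ p.+2]exprS ler_wpM2r ?exprn_ge0.
  apply: (@le_trans _ _ (a ^+ p.+1 * b)); last by rewrite lerDl exprn_ge0.
  have -> : a * b ^+ p.+1 = a * b * b ^+ p by rewrite exprS; ring.
  have -> : a ^+ p.+1 * b = a * b * a ^+ p by rewrite exprS; ring.
  by rewrite ler_wpM2l ?mulr_ge0// lerXn2r ?nnegrE.
have n1 : 4 * k * a ^+ p * l ^+ 2 <= 4 * k * (a ^+ p.+1 * b).
  rewrite -mulrA ler_wpM2l ?mulr_ge0//.
  have -> : a ^+ p.+1 * b = a ^+ p * (a * b) by rewrite exprS; ring.
  by rewrite ler_wpM2l.
have n2 : 2 * k * a ^+ p * l * b <= k * (a ^+ p.+1 * b + a ^+ p * b ^+ 2).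
  apply: (@le_trans _ _ (k * (a ^+ p * b * (a + b)))).
    rewrite (_ : 2 * k * a ^+ p * l * b = k * (a ^+ p * b * (2 * l))); last by ring.
    by rewrite ler_wpM2l// ler_wpM2l// mulr_ge0.
  by rewrite le_eqVlt; apply/orP; left; apply/eqP; rewrite exprSr; ring.
have n3 : K * (a ^+ p * b + b ^+ p.+1) * (a + 2 * l + b) <=
   K * (2 * (a ^+ p.+1 * b + a ^+ p * b ^+ 2 + a * b ^+ p.+1 + b ^+ p.+2)).
  rewrite -mulrA ler_wpM2l//.
  apply: (@le_trans _ _ ((a ^+ p * b + b ^+ p.+1) * (2 * (a + b)))).
    rewrite ler_wpM2l ?addr_ge0 ?mulr_ge0 ?exprn_ge0//; lra.
  by rewrite le_eqVlt; apply/orP; left; apply/eqP; rewrite !exprSr; ring.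
have n4 : K * (2 * (a ^+ p.+1 * b + a ^+ p * b ^+ 2 + a * b ^+ p.+1 + b ^+ p.+2)) <=
  K * (6 * (a ^+ p.+1 * b + b ^+ p.+2)).
  rewrite ler_wpM2l//; have : 0 <= a ^+ p.+1 * b by rewrite mulr_ge0 ?exprn_ge0.
  have : 0 <= b ^+ p.+2 by rewrite exprn_ge0.
  lra.
have n5 : k * (a ^+ p.+1 * b + a ^+ p * b ^+ 2) <= k * (2 * (a ^+ p.+1 * b) + b ^+ p.+2).
  by rewrite ler_wpM2l//; lra.
have b2 : 0 <= b ^+ p.+2 by rewrite exprn_ge0.
have kb : 0 <= k * b ^+ p.+2 by rewrite mulr_ge0.
have -> : (a ^+ p.+1 + 2 * k * a ^+ p * l + K * (a ^+ p * b + b ^+ p.+1)) * (a + 2 * l + b) =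
  a ^+ p.+2 + 2 * (1 + k) * a ^+ p.+1 * l + a ^+ p.+1 * b
   + 4 * k * a ^+ p * l ^+ 2 + 2 * k * a ^+ p * l * b
   + K * (a ^+ p * b + b ^+ p.+1) * (a + 2 * l + b).
  by rewrite !exprSr; ring.
have -> : (p.+2)%:R = 1 + k :> F by rewrite -natr1 addrC.
lra.
Qed.

End Elementary.

(** * Expectations of nonnegative functions and mean zero functions *)

Section Expectation.
Variable R : realType.
Context d (T : measurableType d) (P : probability T R).
Implicit Types f g : T -> R.

Definition Ex f : \bar R := (\int[P]_t (f t)%:E)%E.

Lemma rmeasE f : rmeas f -> measurable_fun setT (EFin \o f).
Proof. by move=> mf; apply/measurable_EFinP. Qed.
Lemma Ex_ge0 f : (forall t, 0 <= f t) -> (0 <= Ex f)%E.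
Proof. by move=> f0; apply: integral_ge0 => t _; rewrite lee_fin. Qed.
Lemma Ex_le f g : rmeas f -> rmeas g -> (forall t, 0 <= f t <= g t) -> (Ex f <= Ex g)%E.
Proof.
move=> mf mg h; apply: ge0_le_integral => //.
- by move=> t _; rewrite lee_fin; case/andP: (h t).
- exact: rmeasE.
- exact: rmeasE.
- by move=> t _; rewrite lee_fin; case/andP: (h t).
Qed.
Lemma ExD f g : rmeas f -> rmeas g -> (forall t, 0 <= f t) -> (forall t, 0 <= g t) ->
  Ex (fun t => f t + g t) = (Ex f + Ex g)%E.
Proof.
move=> mf mg f0 g0; rewrite /Ex -ge0_integralD//.
- by move=> t _; rewrite lee_fin.
- exact: rmeasE.
- by move=> t _; rewrite lee_fin.
- exact: rmeasE.
Qed.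
Lemma ExZ (a : R) f : rmeas f -> (forall t, 0 <= f t) -> 0 <= a ->
  Ex (fun t => a * f t) = (a%:E * Ex f)%E.
Proof.
move=> mf f0 a0; rewrite /Ex -ge0_integralZl//.
- exact: rmeasE.
- by move=> t _; rewrite lee_fin.
Qed.
Lemma Ex_cst (a : R) : Ex (fun=> a) = a%:E.
Proof.
transitivity (a%:E * P setT)%E; first exact: integral_cst.
by rewrite probability_setT mule1.
Qed.
Lemma Ex_sum (I : Type) (s : seq I) (f : I -> T -> R) :
  (forall i, rmeas (f i)) -> (forall i t, 0 <= f i t) ->
  Ex (fun t => \sum_(i <- s) f i t) = (\sum_(i <- s) Ex (f i))%E.
Proof.
move=> mf f0; rewrite /Ex -ge0_integral_sum//.
- by apply: eq_integral => t _; rewrite sumEFin.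
- by move=> i; exact: rmeasE.
- by move=> i t _; rewrite lee_fin.
Qed.

Lemma measurable_lt f g : rmeas f -> rmeas g -> measurable [set t | f t < g t].
Proof.
move=> mf mg; have := measurable_fun_ltr mf mg => h.
have := h measurableT [set true] I; rewrite setTI.
by congr measurable; apply/seteqP; split=> t /=.
Qed.

Lemma markov_Ex f (a : R) : rmeas f -> (forall t, 0 <= f t) -> 0 < a ->
  (P [set t | (a < f t)%R] <= (a^-1)%:E * Ex f)%E.
Proof.
move=> mf f0 a0.
have mS : measurable [set t | a < f t] by apply: measurable_lt => //; exact: rmeas_cst.
have -> : P [set t | a < f t] = Ex (\1_[set t | a < f t]).
  by rewrite /Ex integral_indic// setIT.
rewrite -ExZ ?invr_ge0 ?(ltW a0)//; apply: Ex_le.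
- exact: measurable_indic.
- by apply: rmeasM => //; exact: rmeas_cst.
move=> t; rewrite indicE; apply/andP; split=> //.
case: (boolP (t \in _)) => [|_] /=; last by rewrite mulr_ge0// invr_ge0 ltW.
by rewrite inE /= => h; rewrite mulrC ler_pdivlMr// mul1r ltW.
Qed.

(** Integrability is part of the notion, so that the positive and negative parts have finite and
    equal integrals, the form in which mean zero is used. *)
Definition zm f := P.-integrable setT (EFin \o f) /\ Ex f = 0%E.

Lemma zm_ext f g : (forall t, f t = g t) -> zm f -> zm g.
Proof. by move=> /funext ->. Qed.
Lemma zm0 : zm (fun=> 0).
Proof.
split; last by rewrite Ex_cst.
exact: integrable0.
Qed.
Lemma zmD f g : zm f -> zm g -> zm (fun t => f t + g t).
Proof.
move=> [If Ef] [Ig Eg]; split.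
  by rewrite (_ : _ \o _ = (EFin \o f) \+ (EFin \o g))%E//; exact: integrableD.
by rewrite /Ex; under eq_integral do rewrite EFinD; rewrite integralD// -/(Ex f) -/(Ex g) Ef Eg adde0.
Qed.
Lemma zmZ a f : zm f -> zm (fun t => a * f t).
Proof.
move=> [If Ef]; split.
  by rewrite (_ : _ \o _ = (fun x => a%:E * (EFin \o f) x))%E//; exact: integrableZl.
by rewrite /Ex; under eq_integral do rewrite EFinM; rewrite integralZl// -/(Ex f) Ef mule0.
Qed.
Lemma zm_sum (I : Type) (s : seq I) (p : pred I) (f : I -> T -> R) :
  (forall i, p i -> zm (f i)) -> zm (fun t => \sum_(i <- s | p i) f i t).
Proof.
move=> zf; elim: s => [|a s IH].
  by apply: zm_ext zm0 => t; rewrite big_nil.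
case pa : (p a).
  by apply: zm_ext (zmD (zf a pa) IH) => t; rewrite big_cons pa.
by apply: zm_ext IH => t; rewrite big_cons pa.
Qed.

Definition rpos (x : R) := Num.max x 0.
Definition rneg (x : R) := Num.max (- x) 0.
Lemma rposneg x : x = rpos x - rneg x.
Proof. by rewrite /rpos /rneg; case: (leP x 0); case: (leP (- x) 0) => *; lra. Qed.
Lemma rpos_ge0 x : 0 <= rpos x. Proof. by rewrite /rpos le_max lexx orbT. Qed.
Lemma rneg_ge0 x : 0 <= rneg x. Proof. by rewrite /rneg le_max lexx orbT. Qed.
Lemma rneg_le x : rneg x <= `|x|. Proof. by rewrite /rneg ge_max -normrN ler_norm normr_ge0. Qed.
Lemma rmeas_pos f : rmeas f -> rmeas (fun t => rpos (f t)).
Proof. by move=> mf; apply: measurable_maxr => //; exact: rmeas_cst. Qed.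
Lemma rmeas_neg f : rmeas f -> rmeas (fun t => rneg (f t)).
Proof. by move=> mf; apply: measurable_maxr; [exact: rmeasN|exact: rmeas_cst]. Qed.

(** Allows a mean zero term to be cancelled inside inequalities between nonnegative expectations:
    its negative part is added on one side and its positive part on the other. *)
Lemma zm_posneg f : zm f -> Ex (fun t => rpos (f t)) = Ex (fun t => rneg (f t)).
Proof.
move=> [If Ef].
have e1 : Ex (fun t => rpos (f t)) = (\int[P]_t (EFin \o f)^\+ t)%E.
  by apply: eq_integral => t _; rewrite funeposE /= -EFin_max.
have e2 : Ex (fun t => rneg (f t)) = (\int[P]_t (EFin \o f)^\- t)%E.
  by apply: eq_integral => t _; rewrite funenegE /= -EFin_max.
move: Ef; rewrite /Ex integralE -e1 -e2 => /eqP.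
rewrite sube_eq ?add0e; first by move=> /eqP.
- rewrite e1; apply: integrable_pos_fin_num => //.
- by rewrite e2 fin_num_adde_defr// integrable_neg_fin_num.
Qed.
Lemma zmP f : rmeas f -> (Ex (fun t => `|f t|%R) < +oo)%E ->
  Ex (fun t => rpos (f t)) = Ex (fun t => rneg (f t)) -> zm f.
Proof.
move=> mf fin e; have If : P.-integrable setT (EFin \o f).
  by apply/integrableP; split; first exact: rmeasE.
split=> //.
have e1 : Ex (fun t => rpos (f t)) = (\int[P]_t (EFin \o f)^\+ t)%E.
  by apply: eq_integral => t _; rewrite funeposE /= -EFin_max.
have e2 : Ex (fun t => rneg (f t)) = (\int[P]_t (EFin \o f)^\- t)%E.
  by apply: eq_integral => t _; rewrite funenegE /= -EFin_max.
rewrite /Ex integralE -e1 -e2 e subee// e2 integrable_neg_fin_num//.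
Qed.

End Expectation.
Notation "\E_[ P ]_ t f" := (Ex P (fun t => f%R))
  (at level 36, P at level 10, t name, f at level 8, format "\E_[ P ]_ t  f").

(** * Moments of martingales *)

Section Martingale.
Variable R : realType.
Local Notation Re := (@complex.Re R).
Local Notation Im := (@complex.Im R).
Local Notation C := R[i].

Lemma cmodD_pow p : exists2 K : R, 0 <= K & forall x y : C,
  cmod (x + y) ^+ (2 * p.+1) <= cmod x ^+ (2 * p.+1)
   + 2 * p.+1%:R * (cmod x ^+ (2 * p) * Re (conjc x * y))
   + K * (cmod x ^+ (2 * p) * cmod y ^+ 2 + cmod y ^+ (2 * p.+1)).
Proof.
have [K K0 h] := pow_expand R p; exists K => // x y.
have h1 : Re (conjc x * y) ^+ 2 <= cmod x ^+ 2 * cmod y ^+ 2.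
  by rewrite -exprMn -(cmodJ x) -cmodM cmod_sqr lerDl sqr_ge0.
have := h _ _ _ (sqr_ge0 (cmod x)) (sqr_ge0 (cmod y)) h1.
rewrite -!exprM mulrA; congr (_ <= _).
have -> : cmod x ^+ 2 + 2 * Re (conjc x * y) + cmod y ^+ 2 = cmod (x + y) ^+ 2.
  rewrite !cmod_sqr cReD cImD cReM cReJ cImJ; ring.
by rewrite -exprM.
Qed.


(* A discrete Gronwall argument: [E |S_j|^2p + 2 V^p] grows at each step at most by the
   factor [1 + K v_j / V]. *)
Lemma martingale_moment p : exists2 K : R, 0 <= K &
  forall d (T : measurableType d) (P : probability T R) (n : nat) (S dS : nat -> T -> C) (v : nat -> R) (V : R),
  0 < V -> (forall j, 0 <= v j) -> \sum_(j < n) v j <= V ->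
  (forall j, cmeas (S j)) -> (forall j, cmeas (dS j)) ->
  (forall t, S 0%N t = 0) ->
  (forall j t, (j < n)%N -> S j.+1 t = S j t + dS j t) ->
  (forall j t, (j < n)%N -> v j = 0 -> dS j t = 0) ->
  (forall j, (j < n)%N -> (\E_[P]_t (cmod (dS j t) ^+ (2 * p.+1)) <= (v j ^+ p.+1)%:E)%E) ->
  (forall j, (j < n)%N ->
     (\E_[P]_t (`|cmod (S j t) ^+ (2 * p) * Re (conjc (S j t) * dS j t)|%R) < +oo)%E ->
     zm P (fun t => cmod (S j t) ^+ (2 * p) * Re (conjc (S j t) * dS j t))) ->
  (\E_[P]_t (cmod (S n t) ^+ (2 * p.+1)) <= (K * V ^+ p.+1)%:E)%E.
Proof.
have [K K0 hK] := cmodD_pow p.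
exists (2 * expR K); first by rewrite mulr_ge0// expR_ge0.
move=> d T P n S dS v V V0 v0 sv mS mdS S0 Srec dS0 EdS zS.
pose s j := \sum_(i < j) v i.
suff H j : (j <= n)%N ->
    (\E_[P]_t (cmod (S j t) ^+ (2 * p.+1)) <= (2 * V ^+ p.+1 * (expR (K * s j / V) - 1))%:E)%E.
  apply: le_trans (H n (leqnn _)) _; rewrite lee_fin.
  rewrite [leRHS]mulrAC ler_wpM2l//; first by rewrite mulr_ge0// exprn_ge0// ltW.
  apply: (@le_trans _ _ (expR (K * s n / V))); first by rewrite lerBlDr lerDl.
  by rewrite ler_expR ler_pdivrMr// ler_wpM2l.
elim: j => [_|j IH jn].
  rewrite (_ : (fun t => _) = fun=> 0); last by apply/funext => t; rewrite S0 cmod0 expr0n.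
  by rewrite Ex_cst /s big_ord0 mulr0 mul0r expR0 subrr mulr0.
have {}IH := IH (ltnW jn).
pose a t := cmod (S j t); pose b t := cmod (dS j t).
pose g t := a t ^+ (2 * p) * Re (conjc (S j t) * dS j t).
have ma : rmeas a by exact: rmeas_cmod.
have mb : rmeas b by exact: rmeas_cmod.
have mg : rmeas g.
  apply: rmeasM; first exact: rmeasX.
  exact: (cmeasM (cmeasJ (mS j)) (mdS j)).1.
have a0 t : 0 <= a t by exact: cmod_ge0.
have b0 t : 0 <= b t by exact: cmod_ge0.
have g_le t : `|g t| <= a t ^+ (2 * p.+1) + b t ^+ (2 * p.+1).
  rewrite /g normrM ger0_norm ?exprn_ge0//.
  apply: (@le_trans _ _ (a t ^+ (2 * p) * (a t * b t))).
    by rewrite ler_wpM2l ?exprn_ge0// (le_trans (cmod_Re _))// cmodM cmodJ.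
  have := le_pow_mix (2 * p).+1 1 (a0 t) (b0 t).
  by rewrite mulnS add2n addn1 expr1 exprSr -mulrA.
have mM k : rmeas (fun t => a t ^+ k) by exact: rmeasX.
have mN k : rmeas (fun t => b t ^+ k) by exact: rmeasX.
set e := \E_[P]_t (a t ^+ (2 * p.+1)) in IH *.
set f := \E_[P]_t (b t ^+ (2 * p.+1)).
have f_le : (f <= (v j ^+ p.+1)%:E)%E by exact: EdS.
have e0 : (0 <= e)%E by apply: Ex_ge0 => t; rewrite exprn_ge0.
have f0 : (0 <= f)%E by apply: Ex_ge0 => t; rewrite exprn_ge0.
have gfin : (\E_[P]_t (`|g t|%R) < +oo)%E.
  apply: (@le_lt_trans _ _ (e + f)%E).
    rewrite -ExD//; try by move=> t; rewrite exprn_ge0.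
    apply: Ex_le; first exact: measurableT_comp.
      exact: rmeasD.
    by move=> t; rewrite normr_ge0 g_le.
  by apply: lte_add_pinfty; [exact: (le_lt_trans IH (ltry _))|exact: (le_lt_trans f_le (ltry _))].
have zg : zm P g by exact: zS.
have Eg := zm_posneg zg.
have negfin : (\E_[P]_t (rneg (g t)) < +oo)%E.
  apply: le_lt_trans gfin; apply: Ex_le; first exact: rmeas_neg.
    exact: measurableT_comp.
  by move=> t; rewrite rneg_ge0 rneg_le.
(* The relative size of this step; every increment of the moment below is a multiple of it. *)
pose c := v j / V.
have c0 : 0 <= c by rewrite divr_ge0// ltW.
have sj : s j.+1 = s j + v j by rewrite /s big_ord_recr.
have vV : v j <= V.
  apply: le_trans sv; rewrite (bigD1 (Ordinal jn))//= lerDl sumr_ge0// => i _; exact: v0.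
(* Weighted Young inequality: [|S|^2p |dS|^2] is split with [|dS|^2] divided by [c], so that after
   taking expectations the [|dS|] term becomes [c * V ^+ p.+1]. The negative part of the cross term
   is moved to the left to keep all integrands nonnegative. *)
have pt t : cmod (S j.+1 t) ^+ (2 * p.+1) + 2 * p.+1%:R * rneg (g t) <=
    (1 + K * c) * a t ^+ (2 * p.+1) + K * (1 + c * (v j)^-1 ^+ p.+1 * V ^+ p.+1) * b t ^+ (2 * p.+1)
    + 2 * p.+1%:R * rpos (g t).
  have := hK (S j t) (dS j t); rewrite -Srec// -/(a t) -/(b t) -/(g t) [X in 2 * _ * X]rposneg.
  have : a t ^+ (2 * p) * b t ^+ 2 <=
     c * a t ^+ (2 * p.+1) + c * (v j)^-1 ^+ p.+1 * V ^+ p.+1 * b t ^+ (2 * p.+1).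
    have [vj0|vj0] := eqVneq (v j) 0.
      have -> : b t = 0 by rewrite /b dS0// cmod0.
      by rewrite !expr0n muln_eq0 /= !mulr0 addr0 mulr_ge0// exprn_ge0.
    have vp : 0 < v j by rewrite lt_def vj0 v0.
    have y0 : 0 <= b t ^+ 2 / c by rewrite mulr_ge0 ?invr_ge0 ?sqr_ge0.
    have := le_pow_mix p 1 (sqr_ge0 (a t)) y0; rewrite addn1 expr1 -!exprM => h.
    have := ler_wpM2l c0 h.
    have -> : c * (a t ^+ (2 * p) * (b t ^+ 2 / c)) = a t ^+ (2 * p) * b t ^+ 2.
      by rewrite mulrCA (mulrC c) divfK// gt_eqF// divr_gt0.
    move=> /le_trans; apply; rewrite mulrDr lerD2l le_eqVlt; apply/orP; left; apply/eqP.
    rewrite expr_div_n -exprM /c -exprVn invf_div exprMn; ring.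
  move=> h1 h2; have := ler_wpM2l K0 h1; lra.
have E1 : (\E_[P]_t (cmod (S j.+1 t) ^+ (2 * p.+1)) + (2 * p.+1%:R)%:E * \E_[P]_t (rneg (g t)) <=
   (1 + K * c)%:E * e + (K * (1 + c * (v j)^-1 ^+ p.+1 * V ^+ p.+1))%:E * f
    + (2 * p.+1%:R)%:E * \E_[P]_t (rpos (g t)))%E.
  have k1 : 0 <= 1 + K * c by rewrite addr_ge0// mulr_ge0.
  have k2 : 0 <= K * (1 + c * (v j)^-1 ^+ p.+1 * V ^+ p.+1).
    by rewrite mulr_ge0// addr_ge0// !mulr_ge0 ?exprn_ge0 ?invr_ge0 ?(ltW V0).
  have k3 : 0 <= 2 * p.+1%:R :> R by rewrite mulr_ge0.
  have mS1 : rmeas (fun t => cmod (S j.+1 t) ^+ (2 * p.+1)) by apply: rmeasX; exact: rmeas_cmod.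
  have mp : rmeas (fun t => rpos (g t)) by exact: rmeas_pos.
  have mn : rmeas (fun t => rneg (g t)) by exact: rmeas_neg.
  have mZ k h : rmeas h -> rmeas (fun t : T => k * h t).
    by move=> mh; apply: rmeasM => //; exact: rmeas_cst.
  rewrite -!ExZ//; try by move=> t; rewrite ?exprn_ge0 ?rpos_ge0 ?rneg_ge0.
  rewrite -!ExD//; try (by apply: mZ); try (by move=> t; rewrite ?addr_ge0 ?mulr_ge0 ?exprn_ge0 ?rpos_ge0 ?rneg_ge0 ?cmod_ge0); last first.
  - by move=> t; rewrite mulr_ge0// exprn_ge0.
  - by move=> t; rewrite addr_ge0// mulr_ge0// exprn_ge0.
  - by apply: rmeasD; apply: mZ.
  apply: Ex_le.
  - by apply: rmeasD => //; exact: mZ.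
  - by apply: rmeasD; [apply: rmeasD|]; apply: mZ; rewrite /=.
  by move=> t; rewrite pt andbT addr_ge0 ?mulr_ge0 ?exprn_ge0 ?rneg_ge0 ?cmod_ge0.
move: E1; rewrite Eg leeD2rE; last first.
  by rewrite fin_numM// fin_numElt negfin andbT (lt_le_trans (ltNy0 : -oo < 0)%E)// Ex_ge0// => t; rewrite rneg_ge0.
move=> /le_trans; apply.
have Vp : 0 < V ^+ p.+1 by rewrite exprn_gt0.
have k1 : 0 <= 1 + K * c by rewrite addr_ge0// mulr_ge0.
have k2 : 0 <= K * (1 + c * (v j)^-1 ^+ p.+1 * V ^+ p.+1).
  by rewrite mulr_ge0// addr_ge0// !mulr_ge0 ?exprn_ge0 ?invr_ge0 ?(ltW V0).
apply: (@le_trans _ _ ((1 + K * c) * (2 * V ^+ p.+1 * (expR (K * s j / V) - 1)) +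
   K * (1 + c * (v j)^-1 ^+ p.+1 * V ^+ p.+1) * v j ^+ p.+1)%:E).
  by rewrite [leRHS]EFinD; apply: leeD; rewrite [leRHS]EFinM; apply: lee_wpmul2l; rewrite ?lee_fin.
rewrite lee_fin.
have h1 : K * (1 + c * (v j)^-1 ^+ p.+1 * V ^+ p.+1) * v j ^+ p.+1 <= K * (2 * c * V ^+ p.+1).
  rewrite -mulrA ler_wpM2l// mulrDl mul1r.
  have [vj0|vj0] := eqVneq (v j) 0; first by rewrite /c vj0 expr0n /= !(mul0r,mulr0) addr0.
  have -> : c * (v j)^-1 ^+ p.+1 * V ^+ p.+1 * v j ^+ p.+1 = c * V ^+ p.+1.
    by rewrite exprVn; field; rewrite expf_neq0.
  suff : v j ^+ p.+1 <= c * V ^+ p.+1 by lra.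
  by rewrite exprS [V ^+ _]exprS mulrA divfK ?gt_eqF// ler_wpM2l// lerXn2r ?nnegrE// ltW.
apply: (@le_trans _ _ (2 * V ^+ p.+1 * ((1 + K * c) * expR (K * s j / V) - 1))).
  move: h1; set Y := K * (1 + _) * _; lra.
rewrite ler_wpM2l//; first by rewrite mulr_ge0// ltW.
rewrite lerB// sj mulrDr mulrDl expRD mulrC ler_wpM2l ?expR_ge0//.
by rewrite -mulrA -/c expR_ge1Dx.
Qed.

End Martingale.

(** * Moments of linear and quadratic forms in a row *)

Section LargeDeviationMoments.
Variable R : realType.
Local Notation Re := (@complex.Re R).
Local Notation Im := (@complex.Im R).
Local Notation C := R[i].

(** If the mean over the entries in [J] vanishes for every frozen value of the others, so does the
    full mean; the resampling identity is applied to the positive and negative parts separately. *)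
Lemma zm_resample d (T : measurableType d) (P : probability T R) m n
    (A : T -> 'M[C]_(m, n)) (J : {set 'I_m * 'I_n}) (Phi : mxS R m n -> R) :
  mxmeas A -> resample P A -> rmeas Phi ->
  (forall B, zm P (fun s => Phi (mix J B (A s)))) ->
  (\E_[P]_t `|Phi (A t)| < +oo)%E -> zm P (fun t => Phi (A t)).
Proof.
move=> mA rA mPhi zPhi fin.
have mPA : rmeas (fun t => Phi (A t)) by exact: (measurableT_comp mPhi (mxmeas_measurable mA)).
apply: zmP => //; rewrite /Ex (rA J (fun B => (rpos (Phi B))%:E)).
- rewrite (rA J (fun B => (rneg (Phi B))%:E)).
  + by apply: eq_integral => t _; exact: zm_posneg.
  + by apply: rmeasE; exact: rmeas_neg.
  + by move=> B; rewrite lee_fin rneg_ge0.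
- by apply: rmeasE; exact: rmeas_pos.
- by move=> B; rewrite lee_fin rpos_ge0.
Qed.

Lemma zm_lin d (T : measurableType d) (P : probability T R) (x : T -> C) (w : C) (k : R) :
  zm P (fun s => Re (x s)) -> zm P (fun s => Im (x s)) -> zm P (fun s => k * Re (w * x s)).
Proof.
move=> h1 h2; apply: zmZ; apply: zm_ext (zmD (zmZ (Re w) h1) (zmZ (- Im w) h2)) => s.
by rewrite cReM mulNr.
Qed.

(** All that is later used about the entries: common variance [c] and moments of order [2p] bounded
    by [mu p * c^p]. The notion is invariant under taking adjoints. *)
Definition row_model d (T : measurableType d) (P : probability T R) m n
    (A : T -> 'M[C]_(m, n)) (c : R) (mu : nat -> R) :=
  [/\ mxmeas A, resample P A,
    forall i k, [/\ zm P (fun t => Re (A t i k)), zm P (fun t => Im (A t i k)) &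
                    zm P (fun t => cmod (A t i k) ^+ 2 - c)] &
    forall i k p, (\E_[P]_t (cmod (A t i k) ^+ (2 * p)) <= (mu p * c ^+ p)%:E)%E].

Lemma le_pow_1D (x : R) q : 0 <= x -> x <= (1 + x) ^+ q.+1.
Proof.
move=> x0; apply: (@le_trans _ _ (1 + x)); first by rewrite lerDr.
by rewrite exprS ler_peMr ?addr_ge0// exprn_ege1// lerDl.
Qed.

Lemma ord_sum_split n (F : 'I_n -> C) (j : nat) :
  \sum_(k < n | (k < j.+1)%N) F k = \sum_(k < n | (k < j)%N) F k + \sum_(k < n | k == j :> nat) F k.
Proof.
rewrite (bigID (fun k : 'I_n => (k < j)%N))/=; congr (_ + _); apply: eq_bigl => k.
  by case: (ltnP k j) => kj; rewrite ?andbT ?andbF// ltnS ltnW.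
by rewrite -leqNgt ltnS eqn_leq.
Qed.

(** The sum is revealed one entry at a time. Each increment [b_k A_ik] has mean zero given the
    earlier ones, so the martingale bound applies with [v_k] proportional to [c |b_k|^2]. *)
Lemma moment_linear (mu : nat -> R) p : exists2 K : R, 0 <= K &
  forall d (T : measurableType d) (P : probability T R) m n (A : T -> 'M[C]_(m, n)) c,
  0 < c -> row_model P A c mu ->
  forall (i : 'I_m) (b : 'I_n -> C),
  (\E_[P]_t (cmod (\sum_k b k * A t i k) ^+ (2 * p.+1)) <=
     (K * (c * \sum_k cmod (b k) ^+ 2) ^+ p.+1)%:E)%E.
Proof.
have [K0 K00 hK] := martingale_moment R p.
(* Chosen so that [kap ^+ p.+1] dominates [mu p.+1]; this avoids extracting a root. *)
pose kap := 1 + `|mu p.+1|; have kap0 : 0 < kap by rewrite ltr_pwDl.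
exists (K0 * kap ^+ p.+1); first by rewrite mulr_ge0// exprn_ge0// ltW.
move=> d T P m n A c c0 [mA rA hz hm] i b.
set W := \sum_k _ ^+ 2.
have W0 : 0 <= W by rewrite sumr_ge0// => k _; rewrite sqr_ge0.
have [W00|Wn0] := eqVneq W 0.
  have b0 k : b k = 0.
    move/eqP: W00; rewrite psumr_eq0; last by move=> *; rewrite sqr_ge0.
    by move=> /allP /(_ k); rewrite mem_index_enum => /(_ isT)/=; rewrite sqrf_eq0 cmod_eq0 => /eqP.
  rewrite (_ : (fun t => _) = fun=> 0).
    by rewrite Ex_cst lee_fin mulr_ge0 ?exprn_ge0 ?mulr_ge0 ?exprn_ge0 ?(ltW kap0) ?(ltW c0).
  by apply/funext => t; rewrite big1 ?cmod0 ?expr0n// => k _; rewrite b0 mul0r.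
have Wp : 0 < W by rewrite lt_def Wn0.
pose Sm j (B : mxS R m n) : C := \sum_(k < n | (k < j)%N) b k * B i k.
pose Dm j (B : mxS R m n) : C := \sum_(k < n | k == j :> nat) b k * B i k.
pose v j : R := \sum_(k < n | k == j :> nat) kap * c * cmod (b k) ^+ 2.
have mSm j : cmeas (Sm j).
  apply: cmeas_sum => k; apply: cmeasM; first exact: cmeas_cst.
  exact: mxmeas_id.
have mDm j : cmeas (Dm j).
  apply: cmeas_sum => k; apply: cmeasM; first exact: cmeas_cst.
  exact: mxmeas_id.
have mAS := mxmeas_measurable mA.
have compA (f : mxS R m n -> C) : cmeas f -> cmeas (fun t => f (A t)).
  by move=> [f1 f2]; split; [exact: (measurableT_comp f1 mAS)|exact: (measurableT_comp f2 mAS)].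
have DmE j (jn : (j < n)%N) B : Dm j B = b (Ordinal jn) * B i (Ordinal jn).
  by rewrite /Dm (big_pred1 (Ordinal jn)).
have vE j (jn : (j < n)%N) : v j = kap * c * cmod (b (Ordinal jn)) ^+ 2.
  by rewrite /v (big_pred1 (Ordinal jn)).
have kc0 : 0 < kap * c by rewrite mulr_gt0.
rewrite (_ : (fun t => cmod _ ^+ _) = (fun t => cmod (Sm n (A t)) ^+ (2 * p.+1))); last first.
  by apply/funext => t; rewrite /Sm; congr (cmod _ ^+ _); apply: eq_bigl => k; rewrite ltn_ord.
rewrite -mulrA -exprMn.
apply: (hK _ _ P n (fun j t => Sm j (A t)) (fun j t => Dm j (A t)) v (kap * (c * W))).
- by rewrite mulr_gt0// mulr_gt0.
- by move=> j; rewrite sumr_ge0// => k _; rewrite mulr_ge0 ?sqr_ge0// ltW.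
- rewrite mulrA /W mulr_sumr le_eqVlt; apply/orP; left; apply/eqP.
  by apply: eq_bigr => k _; rewrite (vE k (ltn_ord k)); congr (_ * cmod (b _) ^+ 2); apply: val_inj.
- by move=> j; exact: compA.
- by move=> j; exact: compA.
- by move=> t; rewrite /Sm big_pred0.
- by move=> j t _; rewrite /Sm ord_sum_split.
- move=> j t jn /eqP; rewrite vE mulf_eq0 (gt_eqF kc0) /= sqrf_eq0 cmod_eq0 => /eqP b0.
  by rewrite DmE b0 mul0r.
- move=> j jn; set o := Ordinal jn.
  rewrite (_ : (fun t => _) = (fun t => cmod (b o) ^+ (2 * p.+1) * cmod (A t i o) ^+ (2 * p.+1))); last first.
    by apply/funext => t; rewrite DmE cmodM exprMn.
  rewrite ExZ ?exprn_ge0 ?cmod_ge0//; last 2 first.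
  + by apply: rmeasX; apply: rmeas_cmod; exact: mA.
  + by move=> t; rewrite exprn_ge0 ?cmod_ge0.
  apply: (@le_trans _ _ ((cmod (b o) ^+ (2 * p.+1))%:E * (mu p.+1 * c ^+ p.+1)%:E)%E).
    by apply: lee_wpmul2l; rewrite ?lee_fin ?exprn_ge0 ?cmod_ge0.
  rewrite -EFinM lee_fin (vE _ jn) exprMn -exprM exprMn mulrC ler_wpM2r ?exprn_ge0 ?cmod_ge0//.
  rewrite ler_wpM2r ?exprn_ge0 ?(ltW c0)//.
  by apply: le_trans (ler_norm _) _; exact: le_pow_1D.
- move=> j jn fin; set o := Ordinal jn.
  apply: (@zm_resample _ _ P _ _ A [set (i, o)]%SET (fun B => cmod (Sm j B) ^+ (2 * p) * Re (conjc (Sm j B) * Dm j B))) => //.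
    apply: rmeasM; first by apply: rmeasX; exact: rmeas_cmod.
    exact: (cmeasM (cmeasJ (mSm j)) (mDm j)).1.
  move=> B; have [h1 h2 _] := hz i o.
  apply: zm_ext (zm_lin (conjc (Sm j B) * b o) (cmod (Sm j B) ^+ (2 * p)) h1 h2) => s.
  have -> : Sm j (mix [set (i, o)]%SET B (A s)) = Sm j B.
    apply: eq_bigr => k kj; congr (_ * _); rewrite !mxE inE.
    by case: eqP => // -[ko]; move: kj; rewrite ko ltnn.
  by rewrite (DmE j jn) -/o !mxE inE eqxx mulrA.
Qed.



Lemma conjcM (x y : C) : conjc (x * y) = conjc x * conjc y.
Proof. exact: rmorphM. Qed.

Lemma pow_sum3 (x y w : R) q : 0 <= x -> 0 <= y -> 0 <= w ->
  (x + y + w) ^+ q <= 3 ^+ q * (x ^+ q + y ^+ q + w ^+ q).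
Proof.
move=> x0 y0 w0; pose M := Num.max x (Num.max y w).
have [xM yM wM] : [/\ x <= M, y <= M & w <= M] by rewrite !le_max !lexx !orbT.
have M0 : 0 <= M by exact: le_trans xM.
apply: (@le_trans _ _ ((3 * M) ^+ q)).
  by rewrite lerXn2r ?nnegrE ?addr_ge0 ?mulr_ge0//; lra.
rewrite exprMn ler_wpM2l ?exprn_ge0//.
have := exprn_ge0 q x0; have := exprn_ge0 q y0; have := exprn_ge0 q w0 => h1 h2 h3.
by rewrite /M /Num.max; case: ifP => _; [case: ifP => _|]; lra.
Qed.

Lemma pow_sum2 (x y : R) q : 0 <= x -> 0 <= y ->
  (x + y) ^+ q <= 2 ^+ q * (x ^+ q + y ^+ q).
Proof.
move=> x0 y0; pose M := Num.max x y.
have [xM yM] : x <= M /\ y <= M by rewrite !le_max !lexx !orbT.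
have M0 : 0 <= M by exact: le_trans xM.
apply: (@le_trans _ _ ((2 * M) ^+ q)).
  by rewrite lerXn2r ?nnegrE ?addr_ge0 ?mulr_ge0//; lra.
rewrite exprMn ler_wpM2l ?exprn_ge0//.
have := exprn_ge0 q x0; have := exprn_ge0 q y0 => h1 h2.
by rewrite /M /Num.max; case: ifP => _; lra.
Qed.

Lemma superadd3 (x y w : R) q : 0 <= x -> 0 <= y -> 0 <= w ->
  x ^+ q.+1 + y ^+ q.+1 + w ^+ q.+1 <= (x + y + w) ^+ q.+1.
Proof.
move=> x0 y0 w0; elim: q => [|q IH]; first by rewrite !expr1.
have s0 : 0 <= x + y + w by rewrite !addr_ge0.
rewrite [leRHS]exprS; apply: le_trans (ler_wpM2l s0 IH).
have hx := exprn_ge0 q.+1 x0; have hy := exprn_ge0 q.+1 y0; have hw := exprn_ge0 q.+1 w0.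
rewrite !mulrDl !mulrDr -!exprS.
have := mulr_ge0 x0 hy; have := mulr_ge0 x0 hw; have := mulr_ge0 y0 hx; have := mulr_ge0 y0 hw.
have := mulr_ge0 w0 hx; have := mulr_ge0 w0 hy; lra.
Qed.

(** A quadratic form is revealed along leading principal submatrices. The increment at [o] is [A_io]
    against linear forms in the earlier entries, plus the centred diagonal term; the linear forms
    are controlled by [moment_linear]. *)
Lemma moment_quadratic (mu : nat -> R) p : exists2 K : R, 0 <= K &
  forall d (T : measurableType d) (P : probability T R) m n (A : T -> 'M[C]_(m, n)) c,
  0 < c -> row_model P A c mu ->
  forall (i : 'I_m) (M : 'M[C]_n),
  (\E_[P]_t (cmod (qf (row i (A t)) (row i (A t)) M - c%:C%C * \tr M) ^+ (2 * p.+1)) <=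
     (K * (c ^+ 2 * hs M) ^+ p.+1)%:E)%E.
Proof.
have [K0 K00 hK] := martingale_moment R p.
have [K1 K10 hK1] := moment_linear mu p.
pose kap0 := 3 ^+ (2 * p.+1) * (`|mu p.+1| * K1 + 2 ^+ (2 * p.+1) * (`|mu (2 * p.+1)%N| + 1)).
have kap00 : 0 <= kap0.
  by rewrite !(mulr_ge0,addr_ge0)// ?exprn_ge0.
pose kap := 1 + kap0; have kapp : 0 < kap by rewrite ltr_pwDl.
exists (K0 * (2 * kap) ^+ p.+1); first by rewrite mulr_ge0// exprn_ge0// mulr_ge0// ltW.
move=> d T P m n A c c0 rm i M; have [mA rA hz hm] := rm.
have W0 := hs_ge0 M.
have [W00|Wn0] := eqVneq (hs M) 0.
  rewrite (hs_eq0 W00) (_ : (fun t => _) = fun=> 0).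
    rewrite Ex_cst lee_fin mulr_ge0//; first by rewrite mulr_ge0// exprn_ge0// mulr_ge0// ltW.
    by rewrite exprn_ge0// mulr_ge0 ?sqr_ge0 ?hs_ge0.
  by apply/funext => t; rewrite /qf mulmx0 mul0mx !mxtrace0 mulr0 subrr cmod0 expr0n.
have Wp : 0 < hs M by rewrite lt_def Wn0.
(* The coefficients are conjugated so that [Lr], like [Ll], is linear in the entries of the row, as
   [moment_linear] requires; the conjugate of [Lr] is what occurs in the increment. *)
pose Lr (o : 'I_n) (B : 'M[C]_(m, n)) : C := \sum_(l < n) (if (l < o)%N then conjc (M o l) else 0) * B i l.
pose Ll (o : 'I_n) (B : 'M[C]_(m, n)) : C := \sum_(k < n) (if (k < o)%N then M k o else 0) * B i k.
pose br (o : 'I_n) (B : 'M[C]_(m, n)) : C := B i o * conjc (Lr o B) + conjc (B i o) * Ll o B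
   + M o o * (cmod (B i o) ^+ 2 - c)%:C%C.
pose Sm j (B : mxS R m n) : C :=
  \sum_(k < n | (k < j)%N) \sum_(l < n | (l < j)%N) M k l * (B i k * conjc (B i l))
  - c%:C%C * \sum_(k < n | (k < j)%N) M k k.
pose Dm j (B : mxS R m n) : C := \sum_(o < n | o == j :> nat) br o B.
pose a1 (o : 'I_n) : R := \sum_(l < n | (l < o)%N) cmod (M o l) ^+ 2.
pose a2 (o : 'I_n) : R := \sum_(k < n | (k < o)%N) cmod (M k o) ^+ 2.
pose a3 (o : 'I_n) : R := cmod (M o o) ^+ 2.
pose v j : R := \sum_(o < n | o == j :> nat) kap * c ^+ 2 * (a1 o + a2 o + a3 o).
have a10 o : 0 <= a1 o by rewrite sumr_ge0// => *; rewrite sqr_ge0.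
have a20 o : 0 <= a2 o by rewrite sumr_ge0// => *; rewrite sqr_ge0.
have a30 o : 0 <= a3 o by rewrite sqr_ge0.
have mid k l : cmeas (fun B : mxS R m n => B k l) by exact: mxmeas_id.
have mL (f : 'I_n -> C) : cmeas (fun B : mxS R m n => \sum_l f l * B i l).
  by apply: cmeas_sum => k; apply: cmeasM => //; exact: cmeas_cst.
have mSm j : cmeas (Sm j).
  apply: cmeasB; last exact: cmeas_cst.
  apply: cmeas_sum => k; apply: cmeas_sum => l; apply: cmeasM; first exact: cmeas_cst.
  by apply: cmeasM => //; exact: cmeasJ.
have mbr o : cmeas (br o : mxS R m n -> C).
  apply: cmeasD; last first.
    apply: cmeasM; first exact: cmeas_cst.
    apply: cmeas_real; apply: rmeasB; last exact: rmeas_cst.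
    by apply: rmeasX; exact: rmeas_cmod.
  apply: cmeasD; apply: cmeasM => //; last exact: mL.
    by apply: cmeasJ; exact: mL.
  exact: cmeasJ.
have mDm j : cmeas (Dm j) by apply: cmeas_sum.
have mAS := mxmeas_measurable mA.
have compA (f : mxS R m n -> C) : cmeas f -> cmeas (fun t => f (A t)).
  by move=> [f1 f2]; split; [exact: (measurableT_comp f1 mAS)|exact: (measurableT_comp f2 mAS)].
have DmE j (jn : (j < n)%N) B : Dm j B = br (Ordinal jn) B.
  by rewrite /Dm (big_pred1 (Ordinal jn)).
have vE j (jn : (j < n)%N) : v j = kap * c ^+ 2 * (a1 (Ordinal jn) + a2 (Ordinal jn) + a3 (Ordinal jn)).
  by rewrite /v (big_pred1 (Ordinal jn)).
have kc0 : 0 < kap * c ^+ 2 by rewrite mulr_gt0// exprn_gt0.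
have SmE t : qf (row i (A t)) (row i (A t)) M - c%:C%C * \tr M = Sm n (A t).
  rewrite qfE /Sm /mxtrace; congr (_ - _ * _).
    apply: eq_big => [k|k _]; first by rewrite ltn_ord.
    by apply: eq_big => [l|l _]; [rewrite ltn_ord|rewrite !mxE].
  by apply: eq_bigl => k; rewrite ltn_ord.
under [X in Ex _ X]eq_fun do rewrite SmE.
rewrite -mulrA -exprMn.
have Sstep j B : Sm j.+1 B = Sm j B + Dm j B.
  have [jn|nj] := ltnP j n; last first.
    have -> : Dm j B = 0.
      rewrite /Dm big_pred0// => o.
      by apply/negbTE; rewrite neq_ltn (leq_trans (ltn_ord o) nj).
    rewrite addr0 /Sm.
    have e : (fun k : 'I_n => (k < j.+1)%N) =1 (fun k : 'I_n => (k < j)%N).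
      by move=> k; rewrite (leq_trans (ltn_ord k) nj) ltnS (ltnW (leq_trans (ltn_ord k) nj)).
    congr (_ - _ * _); last exact: eq_bigl.
    by rewrite (eq_bigl _ _ e); apply: eq_bigr => k _; exact: eq_bigl.
  set o := Ordinal jn.
  rewrite (DmE j jn) -/o /Sm !ord_sum_split.
  rewrite [X in _ + X - _](big_pred1 o)// [X in _ * (_ + X)](big_pred1 o)//.
  rewrite ord_sum_split [X in _ + (_ + X) - _](big_pred1 o)//.
  under eq_bigr => k _ do rewrite ord_sum_split [X in _ + X](big_pred1 o)//.
  rewrite big_split/= /br.
  have -> : B i o * conjc (Lr o B) = \sum_(l < n | (l < j)%N) M o l * (B i o * conjc (B i l)).
    rewrite /Lr rmorph_sum mulr_sumr [RHS]big_mkcond; apply: eq_bigr => l _ /=.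
    case: ifP => _; last by rewrite mul0r conjc0 mulr0.
    by rewrite conjcM conjcK; ring.
  have -> : conjc (B i o) * Ll o B = \sum_(l < n | (l < j)%N) M l o * (B i l * conjc (B i o)).
    rewrite /Ll mulr_sumr [RHS]big_mkcond; apply: eq_bigr => l _ /=.
    by case: ifP => _; [ring|rewrite mul0r mulr0].
  by rewrite mulJ rmorphB; ring.
(* The factor 2 in front of [kap] comes from bounding the part of row [o] and the part of column [o]
   of [M] by the full row and the full column. *)
apply: (hK _ _ P n (fun j t => Sm j (A t)) (fun j t => Dm j (A t)) v (2 * kap * (c ^+ 2 * hs M))).
- by rewrite !mulr_gt0// exprn_gt0.
- by move=> j; rewrite sumr_ge0// => o _; rewrite mulr_ge0 ?addr_ge0// ltW.
- have -> : \sum_(j < n) v j = kap * c ^+ 2 * \sum_(j < n) (a1 j + a2 j + a3 j).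
    rewrite mulr_sumr; apply: eq_bigr => j _; rewrite (vE j (ltn_ord j)).
    by congr (_ * (a1 _ + a2 _ + a3 _)); apply: val_inj.
  rewrite (_ : 2 * _ * _ = kap * c ^+ 2 * (2 * hs M)); last by ring.
  rewrite ler_wpM2l ?(ltW kc0)//.
  have -> : 2 * hs M = \sum_j (\sum_l cmod (M j l) ^+ 2 + \sum_k cmod (M k j) ^+ 2).
    by rewrite big_split/= [X in _ = _ + X]exchange_big /= -/(hs M); ring.
  apply: ler_sum => o _.
  have h1 : a1 o + a3 o <= \sum_l cmod (M o l) ^+ 2.
    rewrite [leRHS](bigID (fun l : 'I_n => (l < o)%N))/= lerD2l.
    by rewrite (bigD1 o) ?ltnn//= lerDl sumr_ge0// => *; rewrite sqr_ge0.
  have h2 : a2 o <= \sum_k cmod (M k o) ^+ 2.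
    by rewrite [leRHS](bigID (fun l : 'I_n => (l < o)%N))/= lerDl sumr_ge0// => *; rewrite sqr_ge0.
  by move: h1 h2; lra.
- by move=> j; exact: compA.
- by move=> j; exact: compA.
- by move=> t; rewrite /Sm !big_pred0// mulr0 subr0.
- by move=> j t _; exact: Sstep.
- move=> j t jn /eqP; rewrite vE mulf_eq0 (gt_eqF kc0) /=.
  set o := Ordinal jn; rewrite !paddr_eq0 ?addr_ge0// => /andP[/andP[/eqP e1 /eqP e2] /eqP e3].
  rewrite DmE -/o /br.
  have -> : M o o = 0 by apply/eqP; rewrite -cmod_eq0 -sqrf_eq0; exact/eqP.
  have e1' (l : 'I_n) : (l < o)%N -> M o l = 0.
    move=> lo; move/eqP: e1; rewrite psumr_eq0; last by move=> *; rewrite sqr_ge0.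
    by move=> /allP /(_ l); rewrite mem_index_enum lo => /(_ isT)/=; rewrite sqrf_eq0 cmod_eq0 => /eqP.
  have e2' (l : 'I_n) : (l < o)%N -> M l o = 0.
    move=> lo; move/eqP: e2; rewrite psumr_eq0; last by move=> *; rewrite sqr_ge0.
    by move=> /allP /(_ l); rewrite mem_index_enum lo => /(_ isT)/=; rewrite sqrf_eq0 cmod_eq0 => /eqP.
  rewrite /Lr /Ll !big1 ?conjc0 ?mulr0 ?mul0r ?addr0// => l _; case: ifP => // h.
  + by rewrite e2' ?mul0r.
  + by rewrite mul0r.
  + by rewrite e1' ?conjc0 ?mul0r.
  + by rewrite mul0r.
- move=> j jn; rewrite vE; set o := Ordinal jn.
  under [X in Ex _ X]eq_fun do rewrite DmE -/o.
  set q := p.+1.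
  have mx : cmeas (fun t => A t i o) by exact: mA.
  have mLr : cmeas (fun t => Lr o (A t)) by apply: compA; exact: mL.
  have mLl : cmeas (fun t => Ll o (A t)) by apply: compA; exact: mL.
  (* The coefficients vanish from [o] on, so the linear form does not contain [A_io]; redrawing that
     single entry makes the two factors independent. *)
  have EL (f : 'I_n -> C) (B0 : R) : (forall l : 'I_n, (o <= l)%N -> f l = 0) -> \sum_l cmod (f l) ^+ 2 = B0 ->
     (\E_[P]_t ((cmod (A t i o) * cmod (\sum_l f l * A t i l)) ^+ (2 * q)) <=
        (`|mu q| * K1 * (c ^+ 2 * B0) ^+ q)%:E)%E.
    move=> f0 fB; have := hK1 _ _ P _ _ A c c0 rm i f; rewrite fB => h.
    rewrite /Ex (rA [set (i, o)]%SET (fun B => ((cmod (B i o) * cmod (\sum_l f l * B i l)) ^+ (2 * q))%:E)).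
    + have B00 : 0 <= B0 by rewrite -fB sumr_ge0// => *; rewrite sqr_ge0.
      apply: (@le_trans _ _ (\E_[P]_t ((`|mu q| * c ^+ q) * cmod (\sum_l f l * A t i l) ^+ (2 * q)))%E).
        apply: ge0_le_integral => //.
        * by move=> t _; apply: integral_ge0 => s _; rewrite lee_fin exprn_ge0 ?mulr_ge0 ?cmod_ge0.
        * apply: (@measurable_fun_fubini_tonelli_F _ _ T T R P (fun z => ((cmod (mix [set (i, o)]%SET (A z.1) (A z.2) i o) * cmod (\sum_l f l * (mix [set (i, o)]%SET (A z.1) (A z.2)) i l)) ^+ (2 * q))%:E)); last first.
            by move=> z; rewrite lee_fin exprn_ge0 ?mulr_ge0 ?cmod_ge0.
          have mm := mxmeas_mix mA [set (i, o)]%SET.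
          apply: rmeasE; apply: rmeasX; apply: rmeasM; apply: rmeas_cmod; first exact: mm.
          by apply: cmeas_sum => l; apply: cmeasM; [exact: cmeas_cst|exact: mm].
        * apply: rmeasE; apply: rmeasM; first exact: rmeas_cst.
          by apply: rmeasX; apply: rmeas_cmod; exact: (compA _ (mL f)).
        move=> t _.
        rewrite (_ : (fun s => _) = (fun s => (cmod (\sum_l f l * A t i l) ^+ (2 * q) * cmod (A s i o) ^+ (2 * q))%:E)); last first.
          apply/funext => s; congr (_%:E); rewrite exprMn mulrC; congr (cmod _ ^+ _ * cmod _ ^+ _).
            apply: eq_bigr => l _; rewrite !mxE inE; case: eqP => // -[lo].
            by rewrite f0 ?lo ?leqnn// !mul0r.
          by rewrite !mxE inE eqxx.
        rewrite -/(Ex P _) ExZ ?exprn_ge0 ?cmod_ge0//; last 2 first.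
          by apply: rmeasX; exact: rmeas_cmod.
          by move=> s; rewrite exprn_ge0 ?cmod_ge0.
        apply: (@le_trans _ _ ((cmod (\sum_l f l * A t i l) ^+ (2 * q))%:E * (mu q * c ^+ q)%:E)%E).
          by apply: lee_wpmul2l; rewrite ?lee_fin ?exprn_ge0 ?cmod_ge0.
        rewrite -EFinM lee_fin mulrC ler_wpM2r ?exprn_ge0 ?cmod_ge0//.
        by rewrite ler_wpM2r ?exprn_ge0 ?(ltW c0)// ler_norm.
      rewrite ExZ ?mulr_ge0 ?exprn_ge0 ?(ltW c0)//; last 2 first.
      * by apply: rmeasX; apply: rmeas_cmod; exact: (compA _ (mL f)).
      * by move=> t; rewrite exprn_ge0 ?cmod_ge0.
      apply: (@le_trans _ _ ((`|mu q| * c ^+ q)%:E * (K1 * (c * B0) ^+ q)%:E)%E).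
        by apply: lee_wpmul2l => //; rewrite lee_fin mulr_ge0 ?exprn_ge0 ?(ltW c0).
      rewrite -EFinM lee_fin le_eqVlt; apply/orP; left; apply/eqP.
      by rewrite (_ : c ^+ 2 * B0 = c * (c * B0)); [rewrite [in RHS]exprMn; ring|ring].
    + apply: rmeasE; apply: rmeasX; apply: rmeasM; apply: rmeas_cmod => //; exact: mL.
    + by move=> B; rewrite lee_fin exprn_ge0 ?mulr_ge0 ?cmod_ge0.
  have sq2 : \sum_(l < n) cmod (if (l < o)%N then M l o else 0) ^+ 2 = a2 o.
    by rewrite /a2 [RHS]big_mkcond; apply: eq_bigr => l _; case: ifP => // _; rewrite cmod0 expr0n.
  have sq1 : \sum_(l < n) cmod (if (l < o)%N then conjc (M o l) else 0) ^+ 2 = a1 o.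
    by rewrite /a1 [RHS]big_mkcond; apply: eq_bigr => l _; case: ifP => _; rewrite ?cmodJ// cmod0 expr0n.
  have E1 := EL (fun l : 'I_n => if (l < o)%N then conjc (M o l) else 0) (a1 o) _ sq1.
  have {}E1 := E1 (fun l h => ifN _ _ (etrans (esym (leqNgt o l)) h)).
  have E2 := EL (fun l : 'I_n => if (l < o)%N then M l o else 0) (a2 o) _ sq2.
  have {}E2 := E2 (fun l h => ifN _ _ (etrans (esym (leqNgt o l)) h)).
  have E3 : (\E_[P]_t ((cmod (M o o) * (cmod (A t i o) ^+ 2 + c)) ^+ (2 * q)) <=
      (2 ^+ (2 * q) * (`|mu (2 * q)%N| + 1) * (c ^+ 2 * a3 o) ^+ q)%:E)%E.
    apply: (@le_trans _ _ (\E_[P]_t (cmod (M o o) ^+ (2 * q) * 2 ^+ (2 * q) * (cmod (A t i o) ^+ (2 * (2 * q)) + c ^+ (2 * q))))%E).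
      apply: Ex_le.
      - apply: rmeasX; apply: rmeasM; first exact: rmeas_cst.
        by apply: rmeasD; [apply: rmeasX; exact: rmeas_cmod|exact: rmeas_cst].
      - apply: rmeasM; first exact: rmeas_cst.
        by apply: rmeasD; [apply: rmeasX; exact: rmeas_cmod|exact: rmeas_cst].
      move=> t; rewrite exprn_ge0 ?mulr_ge0 ?addr_ge0 ?exprn_ge0 ?cmod_ge0 ?(ltW c0)//=.
      rewrite exprMn -mulrA ler_wpM2l ?exprn_ge0 ?cmod_ge0//.
      by rewrite [cmod (A t i o) ^+ (2 * (2 * q))]exprM; apply: pow_sum2; [exact: sqr_ge0|exact: ltW].
    have mp : rmeas (fun t => cmod (A t i o) ^+ (2 * (2 * q))) by apply: rmeasX; exact: rmeas_cmod.
    rewrite ExZ ?mulr_ge0 ?exprn_ge0 ?cmod_ge0//; last 2 first.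
    - by apply: rmeasD => //; exact: rmeas_cst.
    - by move=> t; rewrite addr_ge0 ?exprn_ge0 ?cmod_ge0 ?(ltW c0).
    rewrite ExD//; last 3 first.
    - exact: rmeas_cst.
    - by move=> t; rewrite exprn_ge0 ?cmod_ge0.
    - by move=> t; rewrite exprn_ge0 ?(ltW c0).
    rewrite Ex_cst.
    apply: (@le_trans _ _ ((cmod (M o o) ^+ (2 * q) * 2 ^+ (2 * q))%:E *
        ((`|mu (2 * q)%N| * c ^+ (2 * q))%:E + (c ^+ (2 * q))%:E))%E).
      apply: lee_wpmul2l; first by rewrite lee_fin mulr_ge0 ?exprn_ge0 ?cmod_ge0.
      apply: leeD => //; apply: le_trans (hm _ _ _) _; rewrite lee_fin.
      by rewrite ler_wpM2r ?exprn_ge0 ?(ltW c0)// ler_norm.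
    rewrite -EFinD -EFinM lee_fin le_eqVlt; apply/orP; left; apply/eqP.
    by rewrite /a3 [(c ^+ 2 * _) ^+ q]exprMn -!exprM; ring.
  have mb t : cmod (br o (A t)) ^+ (2 * q) <= 3 ^+ (2 * q) * (
     (cmod (A t i o) * cmod (Lr o (A t))) ^+ (2 * q) + (cmod (A t i o) * cmod (Ll o (A t))) ^+ (2 * q)
     + (cmod (M o o) * (cmod (A t i o) ^+ 2 + c)) ^+ (2 * q)).
    apply: le_trans (pow_sum3 _ _ _ _); rewrite ?mulr_ge0 ?addr_ge0 ?sqr_ge0 ?cmod_ge0 ?(ltW c0)//.
    rewrite lerXn2r ?nnegrE ?cmod_ge0 ?addr_ge0 ?mulr_ge0 ?addr_ge0 ?sqr_ge0 ?cmod_ge0 ?(ltW c0)//.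
    apply: le_trans (cmodD _ _) _; apply: lerD.
      apply: le_trans (cmodD _ _) _; rewrite !cmodM !cmodJ//.
    rewrite cmodM cmod_real ler_wpM2l ?cmod_ge0//.
    by apply: le_trans (ler_normB _ _) _; rewrite !ger0_norm ?sqr_ge0 ?(ltW c0).
  have m1 : rmeas (fun t => (cmod (A t i o) * cmod (Lr o (A t))) ^+ (2 * q)).
    by apply: rmeasX; apply: rmeasM; exact: rmeas_cmod.
  have m2 : rmeas (fun t => (cmod (A t i o) * cmod (Ll o (A t))) ^+ (2 * q)).
    by apply: rmeasX; apply: rmeasM; exact: rmeas_cmod.
  have m3 : rmeas (fun t => (cmod (M o o) * (cmod (A t i o) ^+ 2 + c)) ^+ (2 * q)).
    apply: rmeasX; apply: rmeasM; first exact: rmeas_cst.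
    by apply: rmeasD; [apply: rmeasX; exact: rmeas_cmod|exact: rmeas_cst].
  apply: (@le_trans _ _ ((3 ^+ (2 * q))%:E * ((`|mu q| * K1 * (c ^+ 2 * a1 o) ^+ q)%:E
      + (`|mu q| * K1 * (c ^+ 2 * a2 o) ^+ q)%:E + (2 ^+ (2 * q) * (`|mu (2 * q)%N| + 1) * (c ^+ 2 * a3 o) ^+ q)%:E))%E).
    apply: (@le_trans _ _ (\E_[P]_t (3 ^+ (2 * q) * (
     (cmod (A t i o) * cmod (Lr o (A t))) ^+ (2 * q) + (cmod (A t i o) * cmod (Ll o (A t))) ^+ (2 * q)
     + (cmod (M o o) * (cmod (A t i o) ^+ 2 + c)) ^+ (2 * q))))%E).
      apply: Ex_le.
      - by apply: rmeasX; apply: rmeas_cmod; apply: compA; exact: mbr.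
      - by apply: rmeasM; [exact: rmeas_cst|apply: rmeasD => //; exact: rmeasD].
      by move=> t; rewrite mb exprn_ge0 ?cmod_ge0.
    have p1 t : 0 <= (cmod (A t i o) * cmod (Lr o (A t))) ^+ (2 * q) by rewrite exprn_ge0 ?mulr_ge0 ?cmod_ge0.
    have p2 t : 0 <= (cmod (A t i o) * cmod (Ll o (A t))) ^+ (2 * q) by rewrite exprn_ge0 ?mulr_ge0 ?cmod_ge0.
    have p3 t : 0 <= (cmod (M o o) * (cmod (A t i o) ^+ 2 + c)) ^+ (2 * q).
      by rewrite exprn_ge0 ?mulr_ge0 ?addr_ge0 ?sqr_ge0 ?cmod_ge0 ?(ltW c0).
    rewrite ExZ ?exprn_ge0//; last 2 first.
    - by apply: rmeasD => //; exact: rmeasD.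
    - by move=> t; rewrite !addr_ge0.
    apply: lee_wpmul2l; first by rewrite lee_fin exprn_ge0.
    rewrite !ExD//; last 2 first.
    - by apply: rmeasD.
    - by move=> t; rewrite addr_ge0.
    by apply: leeD => //; apply: leeD.
  rewrite -!EFinD -EFinM lee_fin.
  rewrite -[kap * c ^+ 2 * _]mulrA [leRHS]exprMn.
  set x1 := c ^+ 2 * a1 o; set x2 := c ^+ 2 * a2 o; set x3 := c ^+ 2 * a3 o.
  have x10 : 0 <= x1 by rewrite mulr_ge0 ?sqr_ge0.
  have x20 : 0 <= x2 by rewrite mulr_ge0 ?sqr_ge0.
  have x30 : 0 <= x3 by rewrite mulr_ge0 ?sqr_ge0.
  rewrite (_ : c ^+ 2 * (a1 o + a2 o + a3 o) = x1 + x2 + x3); last by rewrite /x1 /x2 /x3; ring.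
  apply: (@le_trans _ _ (kap0 * (x1 ^+ q + x2 ^+ q + x3 ^+ q))).
    rewrite /kap0 -/q -[leRHS]mulrA ler_wpM2l ?exprn_ge0//.
    have := exprn_ge0 q x10; have := exprn_ge0 q x20; have := exprn_ge0 q x30.
    have : 0 <= `|mu q| * K1 by rewrite mulr_ge0.
    have : 0 <= 2 ^+ (2 * q) * (`|mu (2 * q)%N| + 1) by rewrite mulr_ge0 ?exprn_ge0// addr_ge0.
    move: (`|mu q| * K1) (2 ^+ (2 * q) * _) (x1 ^+ q) (x2 ^+ q) (x3 ^+ q) => u1 u2 y1 y2 y3 h1 h2 h3 h4 h5.
    rewrite -subr_ge0; have -> : (u1 + u2) * (y1 + y2 + y3) - (u1 * y1 + u1 * y2 + u2 * y3) = u2 * y1 + u2 * y2 + u1 * y3 by ring.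
    by rewrite !addr_ge0 ?mulr_ge0.
  apply: ler_pM => //.
  + by rewrite !addr_ge0 ?exprn_ge0.
  + exact: le_pow_1D.
  + exact: superadd3.
- move=> j jn fin; set o := Ordinal jn.
  apply: (@zm_resample _ _ P _ _ A [set (i, o)]%SET (fun B => cmod (Sm j B) ^+ (2 * p) * Re (conjc (Sm j B) * Dm j B))) => //.
    apply: rmeasM; first by apply: rmeasX; exact: rmeas_cmod.
    exact: (cmeasM (cmeasJ (mSm j)) (mDm j)).1.
  move=> B; have [h1 h2 h3] := hz i o.
  have hJ : zm P (fun s => Im (conjc (A s i o))).
    by apply: zm_ext (zmZ (-1) h2) => s; rewrite cImJ mulN1r.
  have hJ' : zm P (fun s => Re (conjc (A s i o))) by apply: zm_ext h1 => s; rewrite cReJ.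
  set k := cmod (Sm j B) ^+ (2 * p); set S0 := conjc (Sm j B).
  apply: zm_ext (zmD (zmD (zm_lin (S0 * conjc (Lr o B)) k h1 h2) (zm_lin (S0 * Ll o B) k hJ' hJ))
     (zmZ (k * Re (S0 * M o o)) h3)) => s.
  have mixE (l : 'I_n) : (l < o)%N -> mix [set (i, o)]%SET B (A s) i l = B i l.
    by move=> lo; rewrite !mxE inE; case: eqP => // -[e]; move: lo; rewrite e ltnn.
  have -> : Sm j (mix [set (i, o)]%SET B (A s)) = Sm j B.
    rewrite /Sm; congr (_ - _); apply: eq_bigr => a aj; apply: eq_bigr => b bj.
    by rewrite !mixE.
  rewrite (DmE j jn) -/o -/k -/S0 /br.
  have -> : mix [set (i, o)]%SET B (A s) i o = A s i o by rewrite !mxE inE eqxx.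
  have -> : Lr o (mix [set (i, o)]%SET B (A s)) = Lr o B.
    by apply: eq_bigr => l _; case: ifP => lo; rewrite ?mul0r// mixE.
  have -> : Ll o (mix [set (i, o)]%SET B (A s)) = Ll o B.
    by apply: eq_bigr => l _; case: ifP => lo; rewrite ?mul0r// mixE.
  move: (A s i o) (Lr o B) (Ll o B) => x y w.
  have -> : S0 * (x * conjc y + conjc x * w + M o o * (cmod x ^+ 2 - c)%:C%C) =
      S0 * conjc y * x + S0 * w * conjc x + (cmod x ^+ 2 - c)%:C%C * (S0 * M o o) by ring.
  by rewrite !cReD cReZ; ring.
Qed.

End LargeDeviationMoments.

(** * Tail bounds with random coefficients independent of the row *)

Section LargeDeviations.
Variable R : realType.
Local Notation Re := (@complex.Re R).
Local Notation Im := (@complex.Im R).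
Local Notation C := R[i].

Definition row_set m n (i : 'I_m) : {set 'I_m * 'I_n} := [set k | k.1 == i]%SET.

Lemma rowz_mix m n (i : 'I_m) (A B : 'M[C]_(m, n)) : rowz i (mix (row_set n i) A B) = rowz i A.
Proof. by apply/matrixP=> k l; rewrite !mxE; case: ifP => // ki; rewrite inE /= ki. Qed.
Lemma row_mix m n (i : 'I_m) (A B : 'M[C]_(m, n)) : row i (mix (row_set n i) A B) = row i B.
Proof. by apply/matrixP=> k l; rewrite !mxE inE /= eqxx. Qed.

Lemma resample_le d (T : measurableType d) (P : probability T R) m n
    (A : T -> 'M[C]_(m, n)) (J : {set 'I_m * 'I_n}) (Phi Psi : mxS R m n -> R) :
  mxmeas A -> resample P A -> rmeas Phi -> rmeas Psi -> (forall B, 0 <= Phi B) ->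
  (forall B, (\E_[P]_s (Phi (mix J B (A s))) <= (Psi B)%:E)%E) ->
  (\E_[P]_t (Phi (A t)) <= \E_[P]_t (Psi (A t)))%E.
Proof.
move=> mA rA mPhi mPsi Phi0 h.
rewrite /Ex (rA J (fun B => (Phi B)%:E)); [|exact: rmeasE|by move=> B; rewrite lee_fin].
apply: ge0_le_integral => //.
- by move=> t _; apply: integral_ge0 => s _; rewrite lee_fin.
- apply: (@measurable_fun_fubini_tonelli_F _ _ T T R P (fun z => (Phi (mix J (A z.1) (A z.2)))%:E)); last first.
    by move=> z; rewrite lee_fin.
  apply: rmeasE; exact: (measurableT_comp mPhi (mxmeas_measurable (mxmeas_mix mA J))).
- by apply: rmeasE; exact: (measurableT_comp mPsi (mxmeas_measurable mA)).
- by move=> t _; exact: h.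
Qed.

Lemma Ex_indic d (T : measurableType d) (P : probability T R) (S : set T) :
  measurable S -> \E_[P]_t (\1_S t) = P S.
Proof. by move=> mS; rewrite /Ex integral_indic// setIT. Qed.

Lemma resample_tail d (T : measurableType d) (P : probability T R) m n
    (A : T -> 'M[C]_(m, n)) (J : {set 'I_m * 'I_n}) (f g : mxS R m n -> R) (a : R) :
  mxmeas A -> resample P A -> rmeas f -> rmeas g ->
  (forall B, (P [set s | (g (mix J B (A s)) < f (mix J B (A s)))%R] <= a%:E)%E) ->
  (P [set t | (g (A t) < f (A t))%R] <= a%:E)%E.
Proof.
move=> mA rA mf mg h.
have mS : measurable [set B : mxS R m n | (g B < f B)%R] by exact: measurable_lt.
have mAS := mxmeas_measurable mA.
have e : P [set t | (g (A t) < f (A t))%R] = \E_[P]_t (\1_[set B : mxS R m n | (g B < f B)%R] (A t)).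
  rewrite -Ex_indic; last first.
    by apply: measurable_lt; [exact: (measurableT_comp mg mAS)|exact: (measurableT_comp mf mAS)].
  by [].
rewrite e -(Ex_cst P a); apply: (@resample_le _ _ P _ _ A J _ (fun=> a)) => //.
- exact: measurable_indic.
- exact: rmeas_cst.
move=> B; apply: le_trans (h B).
have mmB : mxmeas (fun s => mix J B (A s)).
  move=> k l; under [X in cmeas X]eq_fun do rewrite mxE.
  by case: ((k, l) \in J); [exact: mA|exact: cmeas_cst].
have mm := mxmeas_measurable mmB.
rewrite -Ex_indic// .
by apply: measurable_lt; [exact: (measurableT_comp mg mm)|exact: (measurableT_comp mf mm)].
Qed.

Lemma ld_tail_aux d (T : measurableType d) (P : probability T R) (f : T -> R) (K V L : R) q :
  rmeas f -> (forall t, 0 <= f t) -> 0 < L -> 0 < V -> 0 <= K ->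
  (\E_[P]_t (f t ^+ (2 * q)) <= (K * V ^+ q)%:E)%E ->
  (P [set t | (L * Num.sqrt V < f t)%R] <= (K / L ^+ (2 * q))%:E)%E.
Proof.
move=> mf f0 L0 V0 K0 h.
have [q0|q0] := posnP q.
  have K1 : 1 <= K.
    by move: h; rewrite q0 muln0 expr0 mulr1; under [X in Ex _ X]eq_fun do rewrite expr0; rewrite Ex_cst lee_fin.
  rewrite q0 muln0 expr0 divr1; apply: (@le_trans _ _ 1%E); last by rewrite lee_fin.
  by apply: probability_le1; apply: measurable_lt => //; exact: rmeas_cst.
have LV : 0 < L * Num.sqrt V by rewrite mulr_gt0 ?sqrtr_gt0.
have e : [set t | (L * Num.sqrt V < f t)%R] = [set t | ((L * Num.sqrt V) ^+ (2 * q) < f t ^+ (2 * q))%R].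
  by apply/seteqP; split=> t /=; rewrite ltr_pXn2r// ?nnegrE ?(ltW LV)// muln_gt0.
rewrite e; apply: (le_trans (@markov_Ex _ _ _ _ _ _ _ _ _)).
- exact: rmeasX.
- by move=> t; rewrite exprn_ge0.
- by rewrite exprn_gt0.
apply: (@le_trans _ _ ((((L * Num.sqrt V) ^+ (2 * q))^-1)%:E * (K * V ^+ q)%:E)%E).
  by apply: lee_wpmul2l => //; rewrite lee_fin invr_ge0 exprn_ge0// ltW.
rewrite -EFinM lee_fin exprMn [Num.sqrt V ^+ _]exprM sqr_sqrtr ?(ltW V0)//.
rewrite le_eqVlt; apply/orP; left; apply/eqP; field.
by rewrite !expf_neq0 ?gt_eqF.
Qed.

(** The coefficient matrix is evaluated at the matrix with row [i] cleared, so it is frozen when row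
    [i] is redrawn, and the moment bound with deterministic coefficients applies. The threshold may
    thus be random. *)
Lemma ld_quadratic_tail (mu : nat -> R) p : exists2 K : R, 0 <= K &
  forall d (T : measurableType d) (P : probability T R) m n (A : T -> 'M[C]_(m, n)) c,
  0 < c -> row_model P A c mu ->
  forall (i : 'I_m) (Bm : mxS R m n -> 'M[C]_n) (L : R), 0 < L -> mxmeas Bm ->
  (P [set t | (L * (c * Num.sqrt (hs (Bm (rowz i (A t))))) <
     cmod (qf (row i (A t)) (row i (A t)) (Bm (rowz i (A t))) - c%:C%C * \tr (Bm (rowz i (A t)))))%R]
   <= (K / L ^+ (2 * p.+1))%:E)%E.
Proof.
have [K K0 hK] := moment_quadratic mu p; exists K => // d T P m n A c c0 rm i Bm L L0 mB.
have [mA rA _ _] := rm.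
have mrz : mxmeas (fun B : mxS R m n => rowz i (B : 'M[C]_(m, n))).
  exact: (mxmeas_rowz i (@mxmeas_id R m n)).
have mBz : mxmeas (fun B : mxS R m n => Bm (rowz i (B : 'M[C]_(m, n)))).
  move=> k l; have [h1 h2] := mB k l; have mm := mxmeas_measurable mrz.
  by split; [exact: (measurableT_comp h1 mm)|exact: (measurableT_comp h2 mm)].
have mq : cmeas (fun B : mxS R m n => qf (row i (B : 'M[C]_(m, n))) (row i (B : 'M[C]_(m, n))) (Bm (rowz i B))
     - c%:C%C * \tr (Bm (rowz i B))).
  apply: cmeasB; first by apply: cmeas_qf => //; exact: (mxmeas_row i (@mxmeas_id R m n)).
  by apply: cmeasM; [exact: cmeas_cst|exact: cmeas_tr].
apply: (@resample_tail _ _ P _ _ A (row_set n i)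
  (fun B => cmod (qf (row i (B : 'M[C]_(m, n))) (row i (B : 'M[C]_(m, n))) (Bm (rowz i B)) - c%:C%C * \tr (Bm (rowz i B))))
  (fun B => L * (c * Num.sqrt (hs (Bm (rowz i B)))))) => //.
- exact: rmeas_cmod.
- apply: rmeasM; first exact: rmeas_cst.
  apply: rmeasM; first exact: rmeas_cst.
  by apply: rmeas_sqrt; exact: rmeas_hs.
move=> B.
rewrite (_ : [set s | _] = [set s | (L * (c * Num.sqrt (hs (Bm (rowz i B)))) <
   cmod (qf (row i (A s)) (row i (A s)) (Bm (rowz i B)) - c%:C%C * \tr (Bm (rowz i B))))%R]); last first.
  by apply/seteqP; split=> s /=; rewrite rowz_mix row_mix.
move: (Bm (rowz i B)) => M.
have := hs_ge0 M; rewrite le_eqVlt => /predU1P[M0|Mp].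
  rewrite (_ : [set s | _] = set0) ?measure0 ?lee_fin ?divr_ge0 ?exprn_ge0 ?(ltW L0)//.
  apply/seteqP; split=> // s /=.
  by rewrite (hs_eq0 (esym M0)) /qf mulmx0 mul0mx !mxtrace0 mulr0 subrr cmod0 ltNge mulr_ge0 ?mulr_ge0 ?sqrtr_ge0 ?ltW.
have -> : c * Num.sqrt (hs M) = Num.sqrt (c ^+ 2 * hs M).
  by rewrite sqrtrM ?sqr_ge0// sqrtr_sqr ger0_norm// ltW.
apply: ld_tail_aux => //; last exact: hK.
- apply: rmeas_cmod; apply: cmeasB; last exact: cmeas_cst.
  by apply: cmeas_qf; [exact: mxmeas_row|exact: mxmeas_row|exact: mxmeas_cst].
- by move=> t; exact: cmod_ge0.
- by rewrite mulr_gt0// exprn_gt0.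
Qed.

Lemma ld_quadratic_moment (mu : nat -> R) p : exists2 K : R, 0 <= K &
  forall d (T : measurableType d) (P : probability T R) m n (A : T -> 'M[C]_(m, n)) c,
  0 < c -> row_model P A c mu ->
  forall (i : 'I_m) (Bm : mxS R m n -> 'M[C]_n) (W : R), mxmeas Bm -> (forall B, hs (Bm B) <= W) ->
  (\E_[P]_t (cmod (qf (row i (A t)) (row i (A t)) (Bm (rowz i (A t)))
      - c%:C%C * \tr (Bm (rowz i (A t)))) ^+ (2 * p.+1))
   <= (K * (c ^+ 2 * W) ^+ p.+1)%:E)%E.
Proof.
have [K K0 hK] := moment_quadratic mu p; exists K => // d T P m n A c c0 rm i Bm W mB hW.
have [mA rA _ _] := rm.
have mrz : mxmeas (fun B : mxS R m n => rowz i (B : 'M[C]_(m, n))).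
  exact: (mxmeas_rowz i (@mxmeas_id R m n)).
have mBz : mxmeas (fun B : mxS R m n => Bm (rowz i (B : 'M[C]_(m, n)))).
  move=> k l; have [h1 h2] := mB k l; have mm := mxmeas_measurable mrz.
  by split; [exact: (measurableT_comp h1 mm)|exact: (measurableT_comp h2 mm)].
have mq : cmeas (fun B : mxS R m n => qf (row i (B : 'M[C]_(m, n))) (row i (B : 'M[C]_(m, n))) (Bm (rowz i B))
     - c%:C%C * \tr (Bm (rowz i B))).
  apply: cmeasB; first by apply: cmeas_qf => //; exact: (mxmeas_row i (@mxmeas_id R m n)).
  by apply: cmeasM; [exact: cmeas_cst|exact: cmeas_tr].
rewrite -(Ex_cst P).
apply: (@resample_le _ _ P _ _ A (row_set n i)
  (fun B => cmod (qf (row i (B : 'M[C]_(m, n))) (row i (B : 'M[C]_(m, n))) (Bm (rowz i B)) - c%:C%C * \tr (Bm (rowz i B))) ^+ (2 * p.+1))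
  (fun=> K * (c ^+ 2 * W) ^+ p.+1)) => //.
- by apply: rmeasX; exact: rmeas_cmod.
- exact: rmeas_cst.
- by move=> B; rewrite exprn_ge0 ?cmod_ge0.
move=> B; under [X in Ex _ X]eq_fun do rewrite rowz_mix row_mix.
apply: le_trans (hK _ _ P _ _ A c c0 rm i (Bm (rowz i B))) _; rewrite lee_fin ler_wpM2l//.
have h0 := hs_ge0 (Bm (rowz i B)).
have W0 : 0 <= W by exact: le_trans h0 (hW _).
apply: lerXn2r; first by rewrite nnegrE mulr_ge0 ?sqr_ge0.
  by rewrite nnegrE mulr_ge0 ?sqr_ge0.
by rewrite ler_wpM2l ?sqr_ge0.
Qed.

Lemma ld_linear_tail (mu : nat -> R) p : exists2 K : R, 0 <= K &
  forall d (T : measurableType d) (P : probability T R) m n (A : T -> 'M[C]_(m, n)) c,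
  0 < c -> row_model P A c mu ->
  forall (i : 'I_m) (b : mxS R m n -> 'cV[C]_n) (L : R), 0 < L -> mxmeas b ->
  (P [set t | (L * Num.sqrt (c * hs (b (rowz i (A t)))) <
     cmod (\tr (row i (A t) *m b (rowz i (A t)))))%R]
   <= (K / L ^+ (2 * p.+1))%:E)%E.
Proof.
have [K K0 hK] := moment_linear mu p; exists K => // d T P m n A c c0 rm i b L L0 mB.
have [mA rA _ _] := rm.
have mrz : mxmeas (fun B : mxS R m n => rowz i (B : 'M[C]_(m, n))).
  exact: (mxmeas_rowz i (@mxmeas_id R m n)).
have mBz : mxmeas (fun B : mxS R m n => b (rowz i (B : 'M[C]_(m, n)))).
  move=> k l; have [h1 h2] := mB k l; have mm := mxmeas_measurable mrz.
  by split; [exact: (measurableT_comp h1 mm)|exact: (measurableT_comp h2 mm)].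
apply: (@resample_tail _ _ P _ _ A (row_set n i)
  (fun B => cmod (\tr (row i (B : 'M[C]_(m, n)) *m b (rowz i B))))
  (fun B => L * Num.sqrt (c * hs (b (rowz i B))))) => //.
- apply: rmeas_cmod; apply: cmeas_tr; apply: mxmeasM => //.
  exact: (mxmeas_row i (@mxmeas_id R m n)).
- apply: rmeasM; first exact: rmeas_cst.
  by apply: rmeas_sqrt; apply: rmeasM; [exact: rmeas_cst|exact: rmeas_hs].
move=> B.
rewrite (_ : [set s | _] = [set s | (L * Num.sqrt (c * hs (b (rowz i B))) <
   cmod (\tr (row i (A s) *m b (rowz i B))))%R]); last first.
  by apply/seteqP; split=> s /=; rewrite rowz_mix row_mix.
move: (b (rowz i B)) => v.
have := hs_ge0 v; rewrite le_eqVlt => /predU1P[v0|vp].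
  rewrite (_ : [set s | _] = set0) ?measure0 ?lee_fin ?divr_ge0 ?exprn_ge0 ?(ltW L0)//.
  apply/seteqP; split=> // s /=.
  by rewrite (hs_eq0 (esym v0)) mulmx0 mxtrace0 cmod0 ltNge mulr_ge0 ?sqrtr_ge0 ?ltW.
apply: ld_tail_aux => //; last first.
- have e t : cmod (\tr (row i (A t) *m v)) = cmod (\sum_k v k 0 * A t i k).
    congr cmod; rewrite tr11 mxE; apply: eq_bigr => k _; rewrite !mxE mulrC//.
  under [X in Ex _ X]eq_fun do rewrite e.
  have -> : hs v = \sum_k cmod (v k 0) ^+ 2 by apply: eq_bigr => k _; rewrite big_ord1.
  exact: (hK _ _ P _ _ A c c0 rm i (fun k => v k 0)).
- by rewrite mulr_gt0.
- by move=> t; exact: cmod_ge0.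
- apply: rmeas_cmod; apply: cmeas_tr; apply: mxmeasM; [exact: mxmeas_row|exact: mxmeas_cst].
Qed.

Lemma Ex_cross_fin d (T : measurableType d) (P : probability T R) m n (A : T -> 'M[C]_(m, n)) c mu :
  row_model P A c mu -> forall i k l (w : C),
  (\E_[P]_t (`|Re (w * (A t i k * conjc (A t i l)))|) < +oo)%E.
Proof.
move=> [mA rA hz hm] i k l w.
have m2 k0 : rmeas (fun t => cmod (A t i k0) ^+ (2 * 1)) by apply: rmeasX; apply: rmeas_cmod; exact: mA.
apply: (@le_lt_trans _ _ (\E_[P]_t (cmod w * (cmod (A t i k) ^+ (2 * 1) + cmod (A t i l) ^+ (2 * 1))))%E).
  apply: Ex_le.
  - have mR := (cmeasM (cmeas_cst _ w) (cmeasM (mA i k) (cmeasJ (mA i l)))).1.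
    exact: (measurableT_comp _ mR).
  - by apply: rmeasM; [exact: rmeas_cst|exact: rmeasD].
  move=> t; rewrite normr_ge0 (le_trans (cmod_Re _))// !cmodM cmodJ ler_wpM2l ?cmod_ge0//.
  by have := le_pow_mix 1 1 (cmod_ge0 (A t i k)) (cmod_ge0 (A t i l)); rewrite !expr1.
rewrite ExZ ?cmod_ge0//; last 2 first.
- exact: rmeasD.
- by move=> t; rewrite addr_ge0 ?sqr_ge0.
rewrite ExD//; try by move=> t; rewrite sqr_ge0.
apply: (@le_lt_trans _ _ ((cmod w)%:E * ((mu 1%N * c ^+ 1)%:E + (mu 1%N * c ^+ 1)%:E))%E).
  by apply: lee_wpmul2l; [rewrite lee_fin cmod_ge0|apply: leeD; exact: hm].
by rewrite -EFinD -EFinM ltry.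
Qed.

(** Expanded entrywise: an off-diagonal product has mean zero by redrawing one of its two entries, a
    diagonal one by the choice of [c] as variance. *)
Lemma zm_quadratic d (T : measurableType d) (P : probability T R) m n (A : T -> 'M[C]_(m, n)) c mu :
  row_model P A c mu -> forall (i : 'I_m) (M : 'M[C]_n) (w : C),
  zm P (fun t => Re (w * (qf (row i (A t)) (row i (A t)) M - c%:C%C * \tr M))).
Proof.
move=> rm i M w; have [mA rA hz hm] := rm.
have h k l : zm P (fun t => Re (w * (M k l * (A t i k * conjc (A t i l) - (if k == l then c else 0)%:C%C)))).
  case: eqP => [->|/eqP kl].
    have [_ _ h3] := hz i l.
    apply: zm_ext (zmZ (Re (w * M l l)) h3) => t.
    by rewrite mulJ -rmorphB /= mulrA [in RHS]mulrC cReZ mulrC.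
  under [X in zm P X]eq_fun do rewrite subr0 mulrA.
  apply: (@zm_resample _ _ _ P _ _ A [set (i, k)]%SET (fun B => Re (w * M k l * (B i k * conjc (B i l))))) => //.
  - have mid := @mxmeas_id R m n.
    exact: (cmeasM (cmeas_cst _ (w * M k l)) (cmeasM (mid i k) (cmeasJ (mid i l)))).1.
  - move=> B; have [h1 h2 _] := hz i k.
    apply: zm_ext (zm_lin (w * M k l * conjc (B i l)) 1 h1 h2) => s.
    rewrite mul1r !mxE !inE eqxx /=.
    have -> : ((i, l) == (i, k)) = false by apply/negbTE/eqP => -[e]; rewrite e eqxx in kl.
    by congr Re; ring.
  - exact: (Ex_cross_fin rm).
apply: zm_ext (zm_sum (p := xpredT) (index_enum _) (fun k _ => zm_sum (p := xpredT) (index_enum _) (fun l _ => h k l))) => t.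
under eq_bigr do rewrite -cRe_sum -mulr_sumr.
rewrite -cRe_sum -mulr_sumr; congr (Re (w * _)).
rewrite qfE /mxtrace mulr_sumr -sumrB; apply: eq_bigr => k _.
transitivity (\sum_l (M k l * (row i (A t) 0 k * conjc (row i (A t) 0 l)) - (if l == k then c%:C%C * M k k else 0))).
  apply: eq_bigr => l _; rewrite mulrBr !mxE eq_sym; congr (_ - _).
  by case: eqP => [->|_]; [rewrite mulrC|rewrite rmorph0 mulr0].
by rewrite sumrB; congr (_ - _); rewrite -big_mkcond/= big_pred1_eq.
Qed.

(** The cancellation behind the fluctuation averaging: the weight [F] may depend on all the other
    rows, but not on row [i]. *)
Lemma zm_quadratic_row d (T : measurableType d) (P : probability T R) m n (A : T -> 'M[C]_(m, n)) c mu :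
  row_model P A c mu -> forall (i : 'I_m) (Bm : mxS R m n -> 'M[C]_n) (F : mxS R m n -> C),
  mxmeas Bm -> cmeas F ->
  (\E_[P]_t (`|Re (F (rowz i (A t)) * (qf (row i (A t)) (row i (A t)) (Bm (rowz i (A t)))
      - c%:C%C * \tr (Bm (rowz i (A t)))))|) < +oo)%E ->
  zm P (fun t => Re (F (rowz i (A t)) * (qf (row i (A t)) (row i (A t)) (Bm (rowz i (A t)))
      - c%:C%C * \tr (Bm (rowz i (A t)))))).
Proof.
move=> rm i Bm F mB mF fin; have [mA rA hz hm] := rm.
have mrz : mxmeas (fun B : mxS R m n => rowz i (B : 'M[C]_(m, n))).
  exact: (mxmeas_rowz i (@mxmeas_id R m n)).
have mm := mxmeas_measurable mrz.
have mBz : mxmeas (fun B : mxS R m n => Bm (rowz i (B : 'M[C]_(m, n)))).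
  move=> k l; have [h1 h2] := mB k l.
  by split; [exact: (measurableT_comp h1 mm)|exact: (measurableT_comp h2 mm)].
have mFz : cmeas (fun B : mxS R m n => F (rowz i (B : 'M[C]_(m, n)))).
  by have [h1 h2] := mF; split; [exact: (measurableT_comp h1 mm)|exact: (measurableT_comp h2 mm)].
apply: (@zm_resample _ _ _ P _ _ A (row_set n i)
  (fun B => Re (F (rowz i B) * (qf (row i (B : 'M[C]_(m, n))) (row i (B : 'M[C]_(m, n))) (Bm (rowz i B)) - c%:C%C * \tr (Bm (rowz i B)))))) => //.
  apply: (cmeasM mFz _).1; apply: cmeasB.
    by apply: cmeas_qf => //; exact: (mxmeas_row i (@mxmeas_id R m n)).
  by apply: cmeasM; [exact: cmeas_cst|exact: cmeas_tr].
move=> B; under [X in zm P X]eq_fun do rewrite rowz_mix row_mix.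
exact: (zm_quadratic rm).
Qed.

End LargeDeviations.

(** * Closed form of the Stieltjes transform *)

Section TrigIntegrals.
Variable R : realType.
Local Notation Re := (@complex.Re R).
Local Notation Im := (@complex.Im R).
Local Notation C := R[i].
Local Notation mu := (@lebesgue_measure R).

Lemma continuous_itv_integrable (f : R -> R) a b : continuous f ->
  mu.-integrable `[a, b] (EFin \o f).
Proof.
move=> cf; apply: continuous_compact_integrable; first exact: segment_compact.
exact: continuous_subspaceT.
Qed.

Lemma is_derive_continuous (F f : R -> R) :
  (forall x : R, is_derive x 1 F (f x)) -> continuous F.
Proof.
by move=> dF x; apply: differentiable_continuous; apply/derivable1_diffP; have [] := dF x.
Qed.

Lemma Rintegral_FTC2 (f F : R -> R) a b : a < b -> continuous f ->
  (forall x : R, is_derive x 1 F (f x)) -> Rintegral mu `[a, b] f = F b - F a.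
Proof.
move=> ab cf dF.
have cF : continuous F by exact: is_derive_continuous dF.
rewrite /Rintegral (@continuous_FTC2 _ f F)//.
- exact: continuous_subspaceT.
- split=> [x _||]; first by have [] := dF x.
  + exact: cvg_at_right_filter (cF a).
  + exact: cvg_at_left_filter (cF b).
- by move=> x _; rewrite derive1E; have [_ ->] := dF x.
Qed.

(** Substitution [x = c + 2 cos t]. For [c = sqrt phi + 1 / sqrt phi] the interval is the support of
    the Marchenko-Pastur law, and the square root in its density becomes [2 sin t]. *)
Lemma Rintegral_subst_cos (c : R) (G : R -> R) : continuous G ->
  Rintegral mu `[c - 2, c + 2] G =
  Rintegral mu `[0, pi] (fun t => G (c + 2 * cos t) * (2 * sin t)).
Proof.
move=> cG; pose F t := c + 2 * cos t : R.
have dF (x : R) : is_derive x 1 F (- (2 * sin x)).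
  by apply: is_derive_eq; rewrite /GRing.scale /=; ring.
have F'E : derive1 F = (fun x => - (2 * sin x)).
  by apply/funext => x; rewrite derive1E; have [_ ->] := dF x.
have cF : continuous F by exact: is_derive_continuous dF.
have cF' : continuous (fun x : R => - (2 * sin x)).
  move=> x; apply: cvgN; apply: cvgM; [exact: cvg_cst|exact: continuous_sin].
have F0 : F 0 = c + 2 by rewrite /F cos0 mulr1.
have Fpi : F pi = c - 2 by rewrite /F cospi mulrN1.
rewrite -F0 -Fpi /Rintegral (@integration_by_substitution_decreasing _ F G 0 pi) ?pi_ge0//.
- by congr fine; apply: eq_integral => t _; rewrite F'E /= opprK.
- by move=> x y x0 y0 xy; rewrite /F ltrD2l ltr_pM2l// ltr_cos.
- by move=> x _; rewrite F'E; exact: cF'.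
- rewrite F'E; apply/cvg_ex; exists (- (2 * sin 0)); exact: cvg_at_right_filter (cF' 0).
- rewrite F'E; apply/cvg_ex; exists (- (2 * sin pi)); exact: cvg_at_left_filter (cF' pi).
- split=> [x _||]; first by have [] := dF x.
  + exact: cvg_at_right_filter (cF 0).
  + exact: cvg_at_left_filter (cF pi).
- exact: continuous_subspaceT.
Qed.

Lemma is_derive_sinM (k : R) (x : R) : is_derive x 1 (fun x => sin (k * x)) (k * cos (k * x)).
Proof.
have h : is_derive x 1 (fun x : R => k * x) k.
  by apply: is_derive_eq; rewrite /GRing.scale /=; ring.
have := @is_derive1_comp _ sin (fun x : R => k * x) x _ _ _ h.
by move=> /(_ (cos (k * x)) (is_derive_sin _)); rewrite mulrC.
Qed.

(** Orthogonality of sines: only the first term of the series in [poisson_integral] survives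
    integration. *)
Lemma Rintegral_sin_sin k :
  Rintegral mu `[0, pi] (fun t : R => sin (k.+1%:R * t) * sin t) = if k is 0%N then pi / 2 else 0.
Proof.
have cf : continuous (fun t : R => sin (k.+1%:R * t) * sin t).
  move=> x; apply: cvgM; last exact: continuous_sin.
  exact: (is_derive_continuous (is_derive_sinM k.+1%:R)).
have sinpiN n : sin (n%:R * pi) = 0 :> R.
  elim: n => [|n IH]; first by rewrite mul0r sin0.
  by rewrite -natr1 mulrDl mul1r sinDpi IH oppr0.
case: k cf => [|k] cf.
  pose F t : R := t / 2 - sin (2 * t) / 4.
  have dF (x : R) : is_derive x 1 F (sin (1%:R * x) * sin x).
    have h := is_derive_sinM 2 x.
    apply: is_derive_eq; rewrite /GRing.scale /= mul1r.
    have -> : cos (2 * x) = 1 - 2 * sin x ^+ 2.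
      by rewrite mulr_natl cos_mulr2n cos2sin2; ring.
    by field.
  by rewrite (Rintegral_FTC2 (pi_gt0 R) cf dF) /F mulr0 sin0 (sinpiN 2%N) !mul0r !subr0.
pose F t : R := sin (k.+1%:R * t) / (2 * k.+1%:R) - sin (k.+3%:R * t) / (2 * k.+3%:R).
have dF (x : R) : is_derive x 1 F (sin (k.+2%:R * x) * sin x).
  have h1 := is_derive_sinM k.+1%:R x; have h2 := is_derive_sinM k.+3%:R x.
  apply: is_derive_eq; rewrite /GRing.scale /=.
  have e1 : k.+1%:R * x = k.+2%:R * x - x by rewrite -[k.+2]addn1 natrD; ring.
  have e2 : k.+3%:R * x = k.+2%:R * x + x by rewrite -[k.+3]addn1 natrD; ring.
  rewrite e1 e2 cosB cosD.
  have n1 : k.+1%:R != 0 :> R by rewrite pnatr_eq0.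
  have n3 : k.+3%:R != 0 :> R by rewrite pnatr_eq0.
  move: (k.+1%:R : R) (k.+3%:R : R) n1 n3 => a b a0 b0.
  by field; rewrite a0 b0.
by rewrite (Rintegral_FTC2 (pi_gt0 R) cf dF) /F !mulr0 sin0 !sinpiN !mul0r !subrr.
Qed.

End TrigIntegrals.

(** * Stieltjes transform of the semicircle law *)

Section PoissonIntegral.
Variable R : realType.
Local Notation Re := (@complex.Re R).
Local Notation Im := (@complex.Im R).
Local Notation C := R[i].
Local Notation mu := (@lebesgue_measure R).

Lemma continuous_Re_inv (g : R -> R) (c s : C) : continuous g ->
  (forall x, (g x)%:C%C + s != 0) -> continuous (fun x => Re (c * ((g x)%:C%C + s)^-1)).
Proof.
move=> cg g0.
have e : (fun x => Re (c * ((g x)%:C%C + s)^-1)) =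
  (fun x => (Re c * (g x + Re s) + Im c * Im s) * ((g x + Re s) ^+ 2 + Im s ^+ 2)^-1).
  apply/funext => x; rewrite cReM cReV cImV cmod_sqr cReD cImD /= add0r; ring.
rewrite e => x.
have n0 : (g x + Re s) ^+ 2 + Im s ^+ 2 != 0.
  have := g0 x; rewrite -cmod_gt0 => /(exprn_gt0 2).
  by rewrite cmod_sqr cReD cImD /= add0r => /lt0r_neq0.
have c1 : {for x, continuous (fun x => g x + Re s)}.
  by apply: cvgD; [exact: cg|exact: cvg_cst].
apply: cvgM.
  by apply: cvgD; [apply: cvgM; [exact: cvg_cst|exact: c1]|exact: cvg_cst].
apply: cvgV => //; apply: cvgD; last exact: cvg_cst.
by rewrite expr2; apply: cvgM; exact: c1.
Qed.

(** Truncated generating function of the Chebyshev polynomials of the second kind, multiplied by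
    [sin t], with its exact remainder. *)
Lemma chebyshev_sum (S : C) (t : R) n :
  (1 + (2 * cos t)%:C%C * S + S ^+ 2) * (\sum_(k < n) (- S) ^+ k * (sin (k.+1%:R * t))%:C%C) =
  (sin t)%:C%C - (- S) ^+ n * ((sin (n.+1%:R * t))%:C%C + S * (sin (n%:R * t))%:C%C).
Proof.
elim: n => [|n IH].
  by rewrite big_ord0 mulr0 expr0 !mul1r mul0r sin0 mulr0 addr0 subrr.
rewrite big_ord_recr /= mulrDr IH.
have h : (2 * cos t)%:C%C * (sin (n.+1%:R * t))%:C%C = (sin (n.+2%:R * t))%:C%C + (sin (n%:R * t))%:C%C :> C.
  rewrite -rmorphM -rmorphD; congr (_%:C%C).
  have -> : n.+2%:R * t = n.+1%:R * t + t by rewrite -[n.+2]addn1 natrD; ring.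
  have -> : n%:R * t = n.+1%:R * t - t by rewrite -[n.+1]addn1 natrD; ring.
  by rewrite sinD sinB; ring.
rewrite [(- S) ^+ n.+1]exprS.
transitivity ((sin t)%:C%C + (- S) ^+ n * (S * ((2 * cos t)%:C%C * (sin (n.+1%:R * t))%:C%C) + S ^+ 2 * (sin (n.+1%:R * t))%:C%C - S * (sin (n%:R * t))%:C%C)); first by ring.
by rewrite h; ring.
Qed.

Lemma cmod_poisson_ge (S : C) (t : R) : cmod S < 1 ->
  (1 - cmod S) ^+ 2 <= cmod (1 + (2 * cos t)%:C%C * S + S ^+ 2).
Proof.
move=> S1; pose e : C := Complex (cos t) (sin t).
have e1 : cmod e = 1 by rewrite /cmod /= cos2Dsin2 sqrtr1.
have eJ : e * conjc e = 1 by rewrite mulJ e1 expr1n.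
have e2 : e + conjc e = (2 * cos t)%:C%C.
  by apply/eqP; rewrite eq_complex /= subrr; apply/andP; split; apply/eqP; ring.
have -> : 1 + (2 * cos t)%:C%C * S + S ^+ 2 = (1 + S * e) * (1 + S * conjc e).
  transitivity (1 + (e + conjc e) * S + S ^+ 2 * (e * conjc e)); last by ring.
  by rewrite eJ e2 mulr1.
rewrite cmodM expr2; apply: ler_pM; rewrite ?subr_ge0 ?(ltW S1)//.
  by apply: le_trans (cmodD_ge _ _); rewrite cmod1 cmodM e1 mulr1.
by apply: le_trans (cmodD_ge _ _); rewrite cmod1 cmodM cmodJ e1 mulr1.
Qed.

Lemma geometric_eq0 (x K r : R) : 0 <= r < 1 -> (forall n, `|x| <= K * r ^+ n.+1) -> x = 0.
Proof.
move=> /andP[r0 r1] h; apply/eqP; rewrite -normr_le0.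
have cv : K * (r * r ^+ n) @[n --> \oo] --> K * (r * 0).
  apply: cvgM; first exact: cvg_cst.
  apply: cvgM; first exact: cvg_cst.
  by apply: cvg_expr; rewrite ger0_norm.
rewrite !mulr0 in cv.
rewrite -(cvg_lim _ cv)//; apply: limr_ge; first by apply/cvg_ex; exists 0.
by apply: nearW => n; rewrite -exprS; exact: h.
Qed.

(** The integrand is expanded in powers of [- S] by [chebyshev_sum]; all partial sums have the same
    integral, and the uniform error decays geometrically. The free factor [c] serves to extract real
    and imaginary parts with one statement. *)
Lemma poisson_integral (S c : C) : S != 0 -> cmod S < 1 ->
  Rintegral mu `[0, pi] (fun t => Re (c * ((2 * cos t)%:C%C + (S + S^-1))^-1) * (4 * sin t ^+ 2)) =
  2 * pi * Re (c * S).
Proof.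
move=> S0 S1.
pose D t : C := 1 + (2 * cos t)%:C%C * S + S ^+ 2.
have r1 : 0 < 1 - cmod S by rewrite subr_gt0.
have Dge t : (1 - cmod S) ^+ 2 <= cmod (D t) by exact: cmod_poisson_ge.
have D0 t : D t != 0 by rewrite -cmod_gt0 (lt_le_trans _ (Dge t))// exprn_gt0.
have den t : (2 * cos t)%:C%C + (S + S^-1) = D t / S by rewrite /D; field.
have den0 t : (2 * cos t)%:C%C + (S + S^-1) != 0.
  by rewrite den mulf_neq0// invr_eq0.
pose f t := Re (c * ((2 * cos t)%:C%C + (S + S^-1))^-1) * (4 * sin t ^+ 2).
change (Rintegral mu `[0, pi] f = 2 * pi * Re (c * S)).
pose b k : R := Re (4 * c * S * (- S) ^+ k).
pose g k (t : R) : R := sin (k.+1%:R * t) * sin t.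
pose h n (t : R) : R := \sum_(k < n) b k * g k t.
have cg k : continuous (g k).
  move=> x; apply: cvgM; last exact: continuous_sin.
  exact: (is_derive_continuous (is_derive_sinM k.+1%:R)).
have ch n : continuous (h n).
  elim: n => [|n IH].
    by rewrite (_ : h 0%N = fun=> 0); [exact: cst_continuous|apply/funext => t; rewrite /h big_ord0].
  rewrite (_ : h n.+1 = fun t => h n t + b n * g n t); last by apply/funext => t; rewrite /h big_ord_recr.
  by move=> x; apply: cvgD; [exact: IH|apply: cvgM; [exact: cvg_cst|exact: cg]].
have cf : continuous f.
  move=> x; apply: cvgM.
    apply: (@continuous_Re_inv (fun t => 2 * cos t) c (S + S^-1)) => //.
    by move=> y; apply: cvgM; [exact: cvg_cst|exact: continuous_cos].
  apply: cvgM; first exact: cvg_cst.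
  by rewrite expr2; apply: cvgM; exact: continuous_sin.
have If := continuous_itv_integrable 0 pi cf.
have Ih n := continuous_itv_integrable 0 pi (ch n).
have Inth n : Rintegral mu `[0, pi] (h n.+1) = 2 * pi * Re (c * S).
  have Ig k : Rintegral mu `[0, pi] (fun t => b k * g k t) = b k * (if k is 0%N then pi / 2 else 0).
    rewrite RintegralZl//; last exact: continuous_itv_integrable.
    by rewrite Rintegral_sin_sin.
  have H m : Rintegral mu `[0, pi] (h m) = \sum_(k < m) b k * (if val k is 0%N then pi / 2 else 0).
    elim: m => [|m IH].
      rewrite big_ord0 /Rintegral (eq_integral (fun=> 0%E)) ?integral0// => t _.
      by rewrite /h big_ord0.
    rewrite big_ord_recr /= -IH -Ig -RintegralD//.
    - by apply: eq_Rintegral => t _; rewrite /h big_ord_recr.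
    - exact: Ih.
    - have cbg : continuous (fun t => b m * g m t).
        by move=> x; apply: cvgM; [exact: cvg_cst|exact: cg].
      exact: (continuous_itv_integrable _ _ cbg).
  rewrite H big_ord_recl /= big1 ?addr0; last by move=> k _; rewrite mulr0.
  rewrite /b expr0 mulr1 -mulrA -[4](rmorph_nat (real_complex R)) cReZ.
  by field.
pose K := 8 * cmod c / (1 - cmod S) ^+ 2.
have fh n t : `|f t - h n t| <= K * cmod S ^+ n.
  have -> : f t - h n t = Re (4 * c * S * (sin t)%:C%C * ((- S) ^+ n * ((sin (n.+1%:R * t))%:C%C + S * (sin (n%:R * t))%:C%C) / D t)).
    have hE : h n t = Re (4 * c * S * (sin t)%:C%C * (\sum_(k < n) (- S) ^+ k * (sin (k.+1%:R * t))%:C%C)).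
      rewrite /h mulr_sumr cRe_sum; apply: eq_bigr => k _; rewrite /b /g mulrC -cReZ; congr Re.
      by rewrite rmorphM; ring.
    have fE : f t = Re (4 * c * S * (sin t)%:C%C * ((sin t)%:C%C / D t)).
      rewrite /f mulrC -cReZ den; congr Re.
      have -> : (4 * sin t ^+ 2)%:C%C = 4 * (sin t)%:C%C * (sin t)%:C%C :> C.
        by rewrite expr2 !rmorphM /= rmorph_nat mulrA.
      by field; rewrite S0 D0.
    rewrite hE fE -cReB; congr Re; rewrite -mulrBr; congr (_ * _).
    apply: (mulfI (D0 t)); rewrite mulrBr /D chebyshev_sum -/(D t); field; exact: D0.
  apply: le_trans (cmod_Re _) _; rewrite !cmodM cmodV !cmodX cmodN.
  rewrite -[4](rmorph_nat (real_complex R)) !cmod_real ger0_norm//.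
  have s1 : cmod ((sin (n.+1%:R * t))%:C%C + S * (sin (n%:R * t))%:C%C) <= 2.
    apply: le_trans (cmodD _ _) _; rewrite cmodM !cmod_real.
    have := sin_max (n.+1%:R * t); have := sin_max (n%:R * t) => h1 h2.
    have : cmod S * `|sin (n%:R * t)| <= 1 * 1 by apply: ler_pM; rewrite ?cmod_ge0// ltW.
    lra.
  have s2 := sin_max t.
  rewrite /K.
  have Dinv : (cmod (D t))^-1 <= ((1 - cmod S) ^+ 2)^-1.
    by rewrite lef_pV2// posrE ?exprn_gt0// (lt_le_trans _ (Dge t))// exprn_gt0.
  have Sn : 0 <= cmod S ^+ n by rewrite exprn_ge0 ?cmod_ge0.
  apply: (@le_trans _ _ ((4 * cmod c * 1 * 1) * (cmod S ^+ n * 2 * ((1 - cmod S) ^+ 2)^-1))).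
    apply: ler_pM; rewrite ?mulr_ge0 ?cmod_ge0 ?invr_ge0 ?exprn_ge0 ?cmod_ge0//.
      apply: ler_pM; rewrite ?mulr_ge0 ?cmod_ge0//.
      by apply: ler_wpM2l; [rewrite mulr_ge0 ?cmod_ge0|exact: ltW].
    apply: ler_pM; rewrite ?mulr_ge0 ?cmod_ge0 ?invr_ge0 ?exprn_ge0 ?cmod_ge0//.
    by rewrite ler_wpM2l.
  by rewrite le_eqVlt; apply/orP; left; apply/eqP; ring.
apply/eqP; rewrite -subr_eq0; apply/eqP.
apply: (@geometric_eq0 _ (K * pi) (cmod S)); first by rewrite cmod_ge0.
move=> n; rewrite -(Inth n) -(RintegralB _ If (Ih n.+1))//.
have Ifh : mu.-integrable `[0, pi] (EFin \o (fun t => f t - h n.+1 t)).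
  have cfh : continuous (fun t => f t - h n.+1 t).
    by move=> x; apply: cvgB; [exact: cf|exact: ch].
  exact: (continuous_itv_integrable _ _ cfh).
apply: le_trans (le_normr_Rintegral _ Ifh) _ => //.
apply: (@le_trans _ _ (Rintegral mu `[0, pi] (fun=> K * cmod S ^+ n.+1))).
  apply: le_Rintegral => //.
  - have cfh : continuous (fun t => `|f t - h n.+1 t|).
      by move=> x; apply: cvg_norm; apply: cvgB; [exact: cf|exact: ch].
    exact: (continuous_itv_integrable _ _ cfh).
  - exact: (continuous_itv_integrable _ _ (@cst_continuous _ _ (K * cmod S ^+ n.+1))).
have mE : fine (@lebesgue_measure R `[0, pi]%classic) = pi.
  by rewrite lebesgue_measure_itv /= lte_fin pi_gt0 /= subr0.
rewrite Rintegral_cst// [X in _ * X](_ : _ = pi)//.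
by rewrite le_eqVlt; apply/orP; left; apply/eqP; ring.
Qed.

End PoissonIntegral.

(** * The Marchenko-Pastur law in the disc parametrization *)

Section MarchenkoPastur.
Variable R : realType.
Local Notation Re := (@complex.Re R).
Local Notation Im := (@complex.Im R).
Local Notation C := R[i].
Local Notation mu := (@lebesgue_measure R).

Lemma Im_joukowski (S : C) : S != 0 -> Im (S + S^-1) = Im S * (1 - cmod S ^- 2).
Proof. by move=> S0; rewrite cImD cImV; ring. Qed.

(** The two solutions of [S + 1/S = - zeta] are inverse to each other. Modulus one would make
    [S + 1/S] real, so exactly one lies inside the unit disc, and there the sign of [Im S] is
    forced. *)
Lemma joukowski (zeta : C) : 0 < Im zeta ->
  exists S : C, [/\ S != 0, cmod S < 1, 0 < Im S & S + S^-1 = - zeta].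
Proof.
move=> h0; pose d := sqrtc (zeta ^+ 2 - 4); have d2 : d ^+ 2 = zeta ^+ 2 - 4 by rewrite sqr_sqrtc.
pose S1 := (- zeta + d) / 2; pose S2 := (- zeta - d) / 2.
have two0 : (2 : C) != 0 by rewrite pnatr_eq0.
have p12 : S1 * S2 = 1.
  transitivity ((zeta ^+ 2 - d ^+ 2) / 4); first by rewrite /S1 /S2; field.
  by rewrite d2; field.
have s12 : S1 + S2 = - zeta by rewrite /S1 /S2; field.
have n1 : S1 != 0 by apply/eqP => e; move/eqP: p12; rewrite e mul0r eq_sym oner_eq0.
have n2 : S2 != 0 by apply/eqP => e; move/eqP: p12; rewrite e mulr0 eq_sym oner_eq0.
have e1 : S1 + S1^-1 = - zeta by rewrite -s12 -[S1^-1]mul1r -p12; field.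
have e2 : S2 + S2^-1 = - zeta by rewrite -s12 -[S2^-1]mul1r -p12; field.
have key (S : C) : S != 0 -> S + S^-1 = - zeta -> cmod S < 1 -> 0 < Im S.
  move=> S0 eS S1'; have := Im_joukowski S0; rewrite eS cImN => h.
  have cp : 0 < cmod S by rewrite cmod_gt0.
  have : 1 < cmod S ^- 2.
    by rewrite invf_gt1 ?exprn_gt0// expr_lt1 ?ltW.
  move=> h2; have : Im S * (1 - cmod S ^- 2) < 0 by rewrite -h; lra.
  by rewrite nmulr_llt0//; lra.
have c1 : cmod S1 != 1.
  apply/eqP => e; have := Im_joukowski n1; rewrite e1 e expr1n invr1 subrr mulr0 cImN; lra.
have cc : cmod S1 * cmod S2 = 1 by rewrite -cmodM p12 cmod1.
move: c1; rewrite neq_lt => /orP[lt1|gt1].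
  by exists S1; split=> //; exact: key.
have lt2 : cmod S2 < 1.
  rewrite -[cmod S2]mul1r; apply: (@lt_le_trans _ _ (cmod S1 * cmod S2)); last by rewrite cc.
  by rewrite ltr_pM2r// cmod_gt0.
by exists S2; split=> //; exact: key.
Qed.

Variable phi : R.
Hypothesis phi1 : 1 <= phi.
Local Notation s0 := ((Num.sqrt phi)^-1).
Local Notation g0 := (Num.sqrt phi + (Num.sqrt phi)^-1).

Let phi0 : 0 < phi. Proof. exact: lt_le_trans phi1. Qed.
Let sp0 : 0 < Num.sqrt phi. Proof. by rewrite sqrtr_gt0. Qed.
Let sp1 : 1 <= Num.sqrt phi. Proof. by rewrite -sqrtr1 ler_wsqrtr. Qed.
Let s0p : 0 < s0. Proof. by rewrite invr_gt0. Qed.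
Let s01 : s0 <= 1. Proof. by rewrite invf_le1. Qed.
Let ss : Num.sqrt phi * s0 = 1. Proof. by rewrite divff// gt_eqF. Qed.

Lemma g0_ge2 : 2 <= g0.
Proof.
rewrite -subr_ge0; have -> : g0 - 2 = s0 * (Num.sqrt phi - 1) ^+ 2.
  by field; rewrite gt_eqF.
by rewrite mulr_ge0 ?sqr_ge0// ltW.
Qed.

Definition mp_w (x : R) : R := Num.sqrt (Num.max 0 ((x - gamma_m phi) * (gamma_p phi - x))).

Lemma mp_w_ge0 x : 0 <= mp_w x. Proof. exact: sqrtr_ge0. Qed.

Lemma continuous_mp_w : continuous mp_w.
Proof.
move=> x; apply: continuous_comp; last exact: sqrt_continuous.
apply: continuous_max; first exact: cst_continuous.
by apply: cvgM; apply: cvgB; (try exact: cvg_cst); exact: cvg_id.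
Qed.

Lemma mp_w_cos t : 0 <= t <= pi -> mp_w (g0 + 2 * cos t) = 2 * sin t.
Proof.
move=> ht; rewrite /mp_w /gamma_m /gamma_p.
have -> : (g0 + 2 * cos t - (g0 - 2)) * (g0 + 2 - (g0 + 2 * cos t)) = (2 * sin t) ^+ 2.
  by rewrite exprMn sin2cos2; ring.
by rewrite max_r ?sqr_ge0// sqrtr_sqr ger0_norm// mulr_ge0// sin_ge0_pi.
Qed.

Lemma Rintegral_mp (S k : C) (g : R -> R) : S != 0 -> cmod S < 1 -> continuous g ->
  (forall t, g (g0 + 2 * cos t) = Re (k * ((2 * cos t)%:C%C + (S + S^-1))^-1)) ->
  Rintegral mu `[gamma_m phi, gamma_p phi] (fun x => g x * mp_w x) = 2 * pi * Re (k * S).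
Proof.
move=> S0 S1 cg gE.
have cG : continuous (fun x => g x * mp_w x).
  by move=> x; apply: cvgM; [exact: cg|exact: continuous_mp_w].
rewrite /gamma_m /gamma_p Rintegral_subst_cos// -(poisson_integral k S0 S1).
apply: eq_Rintegral => t; rewrite inE /= in_itv /= => ht.
by rewrite gE mp_w_cos//; ring.
Qed.

(** [S] is the disc coordinate of the spectral parameter [- dl]. The last bound is continuity at
    [dl = 0] in quantitative form; the square cannot be dropped, since for [phi = 1] the difference
    is of order [sqrt dl]. *)
Lemma real_joukowski (dl : R) : 0 < dl -> exists S : R,
  [/\ 0 < S, S < 1, S + S^-1 = g0 + dl & (s0 - S) ^+ 2 <= dl].
Proof.
move=> d0; pose b := g0 + dl; have b2 : 2 < b by rewrite /b; have := g0_ge2; lra.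
pose r := Num.sqrt (b ^+ 2 - 4).
have bb : 0 < b ^+ 2 - 4.
  have -> : b ^+ 2 - 4 = (b - 2) * (b + 2) by ring.
  by rewrite mulr_gt0//; lra.
have r2 : r ^+ 2 = b ^+ 2 - 4 by rewrite sqr_sqrtr// ltW.
have r0 : 0 < r by rewrite sqrtr_gt0.
have rb : r < b.
  rewrite ltNge; apply/negP => h.
  have : b ^+ 2 <= r ^+ 2 by rewrite lerXn2r ?nnegrE// ltW// (lt_trans _ b2).
  rewrite r2; lra.
have S0 : 0 < (b - r) / 2 by rewrite divr_gt0// subr_gt0.
have Sinv : ((b - r) / 2)^-1 = (b + r) / 2.
  apply: (mulfI (lt0r_neq0 S0)); rewrite divff ?gt_eqF//.
  transitivity ((b ^+ 2 - r ^+ 2) / 4); last by field.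
  by rewrite r2; field.
exists ((b - r) / 2); set S := (b - r) / 2; have eS : S + S^-1 = b by rewrite /S Sinv; field.
have S1 : S < 1.
  rewrite ltNge; apply/negP => S1.
  have : S^-1 <= 1 by rewrite invf_le1.
  by rewrite /S Sinv; move: S1; rewrite /S; lra.
split=> //.
have e : (s0 - S) * (1 - S * s0) = dl * (S * s0).
  have h : S + S^-1 = Num.sqrt phi + s0 + dl by rewrite eS.
  have -> : dl = S + S^-1 - Num.sqrt phi - s0 by rewrite h; ring.
  by field; rewrite !gt_eqF.
have Ss : S * s0 <= 1 by rewrite mulr_ile1// ltW.
have Ss0 : 0 < S * s0 by rewrite mulr_gt0.
(* Both factors on the left of [e] must be positive, which places [S] below [s0]. *)
have sS : S <= s0.
  rewrite -subr_ge0; have : S * s0 < 1 by rewrite -[X in _ < X]mulr1 ltr_leM || (apply: (@lt_le_trans _ _ s0) => //; rewrite gtr_pMl).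
  move=> h; rewrite -(@pmulr_lge0 _ (1 - S * s0)) ?subr_gt0// e.
  by rewrite mulr_ge0 ?ltW.
have h1 : s0 - S <= 1 - S * s0.
  rewrite -subr_ge0; have -> : 1 - S * s0 - (s0 - S) = (1 - s0) * (1 + S) by ring.
  by rewrite mulr_ge0// ?subr_ge0// addr_ge0// ltW.
rewrite expr2; apply: (@le_trans _ _ ((s0 - S) * (1 - S * s0))).
  by rewrite ler_wpM2l// subr_ge0.
by rewrite e ger_pMr.
Qed.

(** The Stieltjes integral at the spectral parameter [0], which for [phi = 1] is an edge where the
    integrand is singular. It is reached by monotone convergence from parameters [- dl n]. *)
Lemma integral_mp_inv : (\int[mu]_(x in `[gamma_m phi, gamma_p phi]) (mp_w x / x)%:E)%E = (2 * pi * s0)%:E.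
Proof.
pose dl n : R := n.+1%:R^-1.
have dl0 n : 0 < dl n by rewrite invr_gt0.
(* The absolute value only makes the regularized integrand continuous on the whole line; on the
   support [x] is nonnegative. *)
pose fn n (x : R) : \bar R := (mp_w x / (`|x| + dl n))%:E.
have gm0 : 0 <= gamma_m phi by rewrite /gamma_m subr_ge0 g0_ge2.
have cden n : continuous (fun x : R => (`|x| + dl n)^-1).
  move=> x; apply: cvgV; first by rewrite gt_eqF// ltr_wpDl.
  by apply: cvgD; [apply: cvg_norm; exact: cvg_id|exact: cvg_cst].
have cfn n : continuous (fun x => mp_w x / (`|x| + dl n)).
  by move=> x; apply: cvgM; [exact: continuous_mp_w|exact: cden].
have xpos x : `[gamma_m phi, gamma_p phi]%classic x -> 0 <= x.
  by rewrite /= in_itv /= => /andP[h _]; exact: le_trans h.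
have cv : (\int[mu]_(x in `[gamma_m phi, gamma_p phi]) fn n x)%E @[n --> \oo] -->
   (\int[mu]_(x in `[gamma_m phi, gamma_p phi]) (mp_w x / x)%:E)%E.
  have -> : (\int[mu]_(x in `[gamma_m phi, gamma_p phi]) (mp_w x / x)%:E =
             \int[mu]_(x in `[gamma_m phi, gamma_p phi]) limn (fun n => fn n x))%E; last first.
    apply: cvg_monotone_convergence => //.
    - move=> n; apply/measurable_EFinP; apply: measurable_funTS.
      exact: continuous_measurable_fun.
    - by move=> n x _; rewrite lee_fin divr_ge0 ?mp_w_ge0// addr_ge0// ltW.
    - move=> x hx m n mn; rewrite lee_fin ler_wpM2l ?mp_w_ge0//.
      rewrite lef_pV2 ?posrE ?ltr_wpDl// lerD2l /dl lef_pV2 ?posrE// ler_nat//.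
  apply: eq_integral => x; rewrite inE => hx; apply/esym/cvg_lim => //.
  have x0 := xpos x hx.
  have [xe|xn] := eqVneq x 0.
    have w0 : mp_w x = 0.
      move: hx; rewrite /= in_itv /= xe => /andP[h _].
      have e : gamma_m phi = 0 by apply/eqP; rewrite eq_le h gm0.
      by rewrite /mp_w e subrr mul0r max_l// sqrtr0.
    rewrite /fn w0 mul0r (_ : (fun n => _) = fun=> 0%E); first exact: cvg_cst.
    by apply/funext => n; rewrite mul0r.
  apply: cvg_EFin; first by apply: nearW.
  rewrite (_ : _ \o _ = (fun n => mp_w x * (`|x| + dl n)^-1))//.
  apply: cvgM; first exact: cvg_cst.
  apply: cvgV => //; rewrite -[X in _ --> X](ger0_norm x0) -[X in _ --> X]addr0.
  apply: cvgD; first exact: cvg_cst.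
  exact: cvg_harmonic.
have In n : exists2 S : R, (\int[mu]_(x in `[gamma_m phi, gamma_p phi]) fn n x)%E = (2 * pi * S)%:E & (s0 - S) ^+ 2 <= dl n.
  have [S [Sp S1 eS hS]] := real_joukowski (dl0 n).
  exists S => //.
  have SC : (S%:C%C : C) != 0 by rewrite -cmod_gt0 cmod_pos ?ltW.
  have := @Rintegral_mp S%:C%C 1 (fun x => (`|x| + dl n)^-1) SC.
  rewrite cmod_pos ?(ltW Sp)// mul1r cRe_real => /(_ S1 (cden n)) h.
  rewrite -h; last first.
    move=> t; rewrite mul1r.
    have <- : ((2 * cos t + (S + S^-1))^-1)%:C%C = ((2 * cos t)%:C%C + (S%:C%C + S%:C%C^-1))^-1 :> C.
      by rewrite fmorphV !rmorphD fmorphV.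
    rewrite /= eS ger0_norm.
      by congr (_^-1); ring.
    have := g0_ge2; have := cos_geN1 t; lra.
  rewrite /Rintegral fineK.
    by apply: eq_integral => x _; rewrite mulrC.
  apply: integrable_fin_num => //.
  have cG : continuous (fun x => (`|x| + dl n)^-1 * mp_w x).
    by move=> x; apply: cvgM; [exact: cden|exact: continuous_mp_w].
  exact: (continuous_itv_integrable _ _ cG).
pose Sn n := projT1 (cid2 (In n)).
have SnE n : (\int[mu]_(x in `[gamma_m phi, gamma_p phi]) fn n x)%E = (2 * pi * Sn n)%:E.
  by rewrite /Sn; case: cid2.
have Sncv n : (s0 - Sn n) ^+ 2 <= dl n by rewrite /Sn; case: cid2.
have cS : Sn n @[n --> \oo] --> s0.
  apply/cvgrPdist_le => e e0.
  have : \forall n \near \oo, dl n <= e ^+ 2.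
    have /cvgrPdist_le := @cvg_harmonic R => /(_ (e ^+ 2)); rewrite exprn_gt0// => /(_ isT).
    apply: filterS => n; rewrite sub0r normrN ger0_norm//; exact/ltW/dl0.
  apply: filterS => n hn; apply: le_of_sqr; first exact: ltW.
  by rewrite real_normK ?num_real// (le_trans (Sncv n)).
have cv2 : (\int[mu]_(x in `[gamma_m phi, gamma_p phi]) fn n x)%E @[n --> \oo] --> (2 * pi * s0)%:E.
  under eq_cvg do rewrite SnE.
  apply: cvg_EFin; first by apply: nearW.
  by apply: cvgM; [exact: cvg_cst|exact: cS].
exact: (cvg_unique _ cv cv2).
Qed.

(** Partial fractions: [1 / (x (x - z))] is [(1 / (x - z) - 1 / x) / z], so the integral is a
    semicircle transform minus [integral_mp_inv]. *)
Lemma Rintegral_mp_density (z S k : C) : 0 < Im z -> S != 0 -> cmod S < 1 ->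
  S + S^-1 = g0%:C%C - z ->
  Rintegral mu `[gamma_m phi, gamma_p phi]
    (fun x => mp_density phi x * Re (k * (x%:C%C - z)^-1)) =
  Num.sqrt phi * Re (k * (S - s0%:C%C) / z).
Proof.
move=> z0 S0 S1 eS.
have zn : z != 0 by exact: neq0_Im.
have xz (x : R) : x%:C%C + - z != 0.
  by rewrite -oppr_eq0 opprB neq0_Im// cImB /= subr0.
have gm0 : 0 <= gamma_m phi by rewrite /gamma_m subr_ge0 g0_ge2.
pose f1 x : R := Re (k / z * (x%:C%C + - z)^-1) * mp_w x.
pose f2 x : R := mp_w x / x.
have ci : continuous (fun x : R => x) by move=> x; exact: cvg_id.
have cg : continuous (fun x : R => Re (k / z * (x%:C%C + - z)^-1)).
  exact: (continuous_Re_inv (c := k / z) ci xz).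
have I1 : mu.-integrable `[gamma_m phi, gamma_p phi] (EFin \o f1).
  have cG : continuous f1 by move=> x; apply: cvgM; [exact: cg|exact: continuous_mp_w].
  exact: (continuous_itv_integrable _ _ cG).
have mf2 : measurable_fun `[gamma_m phi, gamma_p phi]%classic f2.
  have -> : f2 = (fun x : R => mp_w x * (x * (x ^+ 2) `^ (-1))).
    apply/funext => t; rewrite /f2 powR_inv1 ?sqr_ge0//; congr (_ * _).
    by have [->|f0] := eqVneq t 0; [rewrite invr0 mul0r|field].
  apply: measurable_funTS; apply: measurable_funM.
    exact: (continuous_measurable_fun continuous_mp_w).
  apply: measurable_funM => //; apply: (measurableT_comp (measurable_powR (-1))).
  exact: measurable_funX.
have I2 : mu.-integrable `[gamma_m phi, gamma_p phi] (EFin \o f2).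
  apply/integrableP; split; first exact/measurable_EFinP.
  suff -> : (\int[mu]_(x in `[gamma_m phi, gamma_p phi]) `|(EFin \o f2) x| =
     \int[mu]_(x in `[gamma_m phi, gamma_p phi]) (mp_w x / x)%:E)%E by rewrite integral_mp_inv ltry.
  apply: eq_integral => x; rewrite inE /= in_itv /= => /andP[h _].
  by rewrite ger0_norm// divr_ge0 ?mp_w_ge0// (le_trans gm0).
have E1 : Rintegral mu `[gamma_m phi, gamma_p phi] f1 = 2 * pi * Re (k / z * S).
  apply: (Rintegral_mp S0 S1 cg) => t; rewrite eS; congr (Re (_ * _^-1)).
  by rewrite !rmorphD /=; ring.
have E2 : Rintegral mu `[gamma_m phi, gamma_p phi] f2 = 2 * pi * s0.
  by rewrite /Rintegral integral_mp_inv.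
have I2' : mu.-integrable `[gamma_m phi, gamma_p phi] (EFin \o (fun x => Re (k / z) * f2 x)).
  by rewrite (_ : _ \o _ = (fun x => (Re (k / z))%:E * (EFin \o f2) x)%E)//; exact: integrableZl.
transitivity (Rintegral mu `[gamma_m phi, gamma_p phi]
    (fun x => Num.sqrt phi / (2 * pi) * (f1 x - Re (k / z) * f2 x))).
  apply: eq_Rintegral => x; rewrite inE /= in_itv /= => /andP[h _].
  have x0 : 0 <= x by exact: le_trans h.
  rewrite /mp_density -/(mp_w x).
  suff h2 : mp_w x * (x^-1 * Re (k * (x%:C%C - z)^-1)) = f1 x - Re (k / z) * f2 x.
    by rewrite -h2; ring.
  (* The point [0] belongs to the support only when [phi = 1]; there the square root vanishes, in
     agreement with the convention [1 / 0 = 0]. *)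
  rewrite /f1 /f2; have [xe|xn] := eqVneq x 0.
    have e : gamma_m phi = 0 by apply/eqP; rewrite eq_le gm0 -xe h.
    have -> : mp_w x = 0 by rewrite /mp_w e xe subrr mul0r max_l// sqrtr0.
    by rewrite !mul0r !mulr0 subrr.
  have -> : mp_w x * (x^-1 * Re (k * (x%:C%C - z)^-1)) = mp_w x * Re (x^-1%:C%C * (k * (x%:C%C - z)^-1)).
    by rewrite cReZ.
  have -> : x^-1%:C%C * (k * (x%:C%C - z)^-1) = k / z * (x%:C%C + - z)^-1 - x^-1%:C%C * (k / z).
    have xC : x%:C%C != 0 :> C by rewrite -cmod_gt0 cmod_pos// lt_def xn.
    have xzn : x%:C%C - z != 0 := xz x.
    by rewrite fmorphV; field; rewrite ?zn ?xzn ?xC.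
  by rewrite cReB cReZ; ring.
rewrite RintegralZl//; last first.
  rewrite (_ : _ \o _ = (EFin \o f1) \- (EFin \o (fun x => Re (k / z) * f2 x)%R))%E//.
  exact: integrableB.
rewrite RintegralB// RintegralZl// E1 E2.
have gen (y : C) : k * (S - y) / z = k / z * S - y * (k / z) by field.
rewrite gen.
rewrite cReB cReZ; have pin : (pi : R) != 0 by rewrite gt_eqF ?pi_gt0.
by move: s0 (Re _) (Re _) pin; move: (@pi R) => pp y A B pin; field.
Qed.

(** Every property of [m_phi] used later is read off from this parametrization by the upper half
    disc. The atom at [0] is absent because [phi] is at least 1. *)
Lemma m_phi_E (z : C) : 0 < Im z -> exists S : C,
  [/\ S != 0, cmod S < 1, 0 < Im S, z = g0%:C%C - (S + S^-1) &
      m_phi phi z = S / (1 - s0%:C%C * S)].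
Proof.
move=> z0; have h0 : 0 < Im (z - g0%:C%C) by rewrite cImB /= subr0.
have [S [S0 S1 ImS eS]] := joukowski h0; exists S; rewrite opprB in eS.
split=> //; first by rewrite eS opprB addrC subrK.
have zn : z != 0 by exact: neq0_Im.
have mE : m_phi phi z = (Num.sqrt phi)%:C%C * ((S - s0%:C%C) / z).
  rewrite /m_phi max_l ?subr_le0// !mul0r !addr0.
  apply/eqP; rewrite eq_complex; apply/andP; split; apply/eqP.
    rewrite cReZ [LHS]/=; have := Rintegral_mp_density 1 z0 S0 S1 eS; rewrite mul1r => <-.
    by apply: eq_Rintegral => x _; rewrite mul1r.
  rewrite cImZ [LHS]/=; have := Rintegral_mp_density (- 'i%C) z0 S0 S1 eS.
  (* The weight [- i] turns the statement about real parts into one about imaginary parts. *)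
  have reI (w : C) : Re (- 'i%C * w) = Im w by case: w => a b /=; ring.
  rewrite -mulrA reI => <-.
  by apply: eq_Rintegral => x _; rewrite reI.
rewrite mE; have s00 : (Num.sqrt phi)%:C%C != 0 :> C by rewrite -cmod_gt0 cmod_pos// ltW.
have ssC : (Num.sqrt phi)%:C%C * s0%:C%C = 1 :> C by rewrite -rmorphM ss.
have zE : z * S = (s0%:C%C - S) * (S - (Num.sqrt phi)%:C%C).
  have -> : z = g0%:C%C - (S + S^-1) by rewrite eS opprB addrC subrK.
  rewrite rmorphD /=; move: ssC s00; move: (Num.sqrt phi)%:C%C s0%:C%C => a b ab _.
  transitivity (a * S + b * S - S ^+ 2 - a * b); last by ring.
  by rewrite ab; field.
have d0 : 1 - s0%:C%C * S != 0.
  rewrite -cmod_gt0; apply: (@lt_le_trans _ _ (1 - s0 * cmod S)).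
    by rewrite subr_gt0 -[X in _ < X]mulr1; apply: (@le_lt_trans _ _ (1 * cmod S)); rewrite ?mul1r ?mulr1// ler_piMl// cmod_ge0.
  by have := cmodB_ge 1 (s0%:C%C * S); rewrite cmod1 cmodM cmod_pos ?(ltW s0p).
have e2 : 1 - s0%:C%C * S = s0%:C%C * ((Num.sqrt phi)%:C%C - S).
  by rewrite mulrBr [s0%:C%C * (Num.sqrt phi)%:C%C]mulrC ssC.
apply: (mulIf d0); rewrite divfK// -[LHS]mulrA; apply: (mulIf zn).
rewrite [S * z]mulrC zE e2.
move: ssC; move: (Num.sqrt phi)%:C%C s0%:C%C => a b ab.
transitivity (a * b * ((S - b) * (a - S))); first by field.
by rewrite ab; ring.
Qed.

End MarchenkoPastur.

(** * The two roots of the self-consistent equation *)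

Section MPFacts.
Variable R : realType.
Local Notation Re := (@complex.Re R).
Local Notation Im := (@complex.Im R).
Local Notation C := R[i].

Definition mp_a (phi : R) (z : C) : C := z / (Num.sqrt phi)%:C%C.
Definition mp_b (phi : R) (z : C) : C := z - (Num.sqrt phi)%:C%C + (Num.sqrt phi)^-1%:C%C.
Definition mp_poly (phi : R) (z s : C) : C := mp_a phi z * s ^+ 2 + mp_b phi z * s + 1.
(* The second root of [mp_poly]: the product of the roots is [1 / mp_a]. *)
Definition m_phi2 (phi : R) (z : C) : C := (mp_a phi z * m_phi phi z)^-1.
Definition mp_gap (phi : R) (z : C) : R := cmod (m_phi phi z - m_phi2 phi z).

Section Fixed.
Variables (phi : R) (phi1 : 1 <= phi).
Local Notation sp := (Num.sqrt phi).
Local Notation m := (m_phi phi).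
Local Notation m2 := (m_phi2 phi).
Local Notation g0 := (sp + sp^-1).

Lemma sp_ge1 : 1 <= sp. Proof. by rewrite -sqrtr1 ler_wsqrtr. Qed.
Lemma sp_gt0 : 0 < sp. Proof. exact: lt_le_trans ltr01 sp_ge1. Qed.
Lemma spC_neq0 : sp%:C%C != 0 :> C.
Proof. by rewrite -cmod_gt0 cmod_pos ?sp_gt0// ltW ?sp_gt0. Qed.
Lemma spV_le1 : sp^-1 <= 1. Proof. by rewrite invf_le1 ?sp_ge1 ?sp_gt0. Qed.
Lemma spVC : sp^-1%:C%C = (sp%:C%C)^-1 :> C. Proof. by rewrite fmorphV. Qed.

Lemma cmod_1B_S (S : C) : cmod S < 1 ->
  1 - sp^-1%:C%C * S != 0 /\ cmod (1 - sp^-1%:C%C * S) <= 2.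
Proof.
move=> S1; have h : cmod (sp^-1%:C%C * S) < 1.
  rewrite cmodM cmod_pos ?invr_ge0 ?(ltW sp_gt0)//; apply: le_lt_trans S1.
  by rewrite ler_piMl ?cmod_ge0// spV_le1.
split.
  rewrite -cmod_gt0; apply: lt_le_trans (cmodB_ge _ _); by rewrite cmod1 subr_gt0.
by apply: le_trans (cmodD _ _) _; rewrite cmod1 cmodN; move: h; lra.
Qed.

Lemma neq0_subM (F : fieldType) (y t : F) : y != 0 -> 1 - y^-1 * t != 0 -> y - t != 0.
Proof.
move=> y0; have -> : 1 - y^-1 * t = (y - t) / y by field.
by rewrite mulf_eq0 negb_or => /andP[].
Qed.

Lemma Im_joukowskiE (S : C) (z : C) : S != 0 -> z = g0%:C%C - (S + S^-1) ->
  Im z * cmod S ^+ 2 = Im S * (1 - cmod S ^+ 2).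
Proof.
move=> S0 ->; rewrite cImB cIm_real sub0r Im_joukowski//; field.
by rewrite cmod_eq0.
Qed.

(** In the disc coordinate, [z m = sqrt phi * S - 1], [1 + m / sqrt phi = 1 / (1 - S / sqrt phi)]
    and [m2 = 1 / (S - 1 / sqrt phi)]; all claims follow from [|S| < 1] and [Im S > 0]. The last one
    also uses [Im z * |S|^2 = Im S * (1 - |S|^2)]. *)
Lemma mp_facts (z : C) : 0 < Im z ->
  [/\ m z != 0, mp_a phi z * m z ^+ 2 + mp_b phi z * m z + 1 = 0, 0 < Im (m z), Im (m2 z) <= 0 &
  [/\ 0 <= Im (z * m z) <= 4 * sp * Im (m z), 2^-1 <= cmod (1 + sp^-1%:C%C * m z) &
    Im z <= 4 * (cmod (z - g0%:C%C) + 1) ^+ 2 * Im (m z)]].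
Proof.
move=> z0; have [S [S0 S1 ImS zE mE]] := m_phi_E phi1 z0.
have [d0 d2] := cmod_1B_S S1.
have zn : z != 0 by exact: neq0_Im.
have dp : 0 < cmod (1 - sp^-1%:C%C * S) by rewrite cmod_gt0.
have mn : m z != 0 by rewrite mE mulf_neq0// invr_eq0.
have zmE : z * m z = sp%:C%C * S - 1.
  rewrite mE zE rmorphD /= spVC; move: d0; rewrite spVC; move: (sp%:C%C) spC_neq0 => y y0 d0.
  by have ys := neq0_subM y0 d0; field; rewrite ?S0 ?y0 ?ys.
have ImmE : Im (m z) = Im S / cmod (1 - sp^-1%:C%C * S) ^+ 2.
  rewrite mE cImM cImV cReV cReB cImB cReZ cImZ /= cmod_sqr cReB cImB cReZ cImZ /=.
  by ring.
have Imm : 0 < Im (m z) by rewrite ImmE divr_gt0// exprn_gt0.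
have ImSm : Im S <= 4 * Im (m z).
  rewrite ImmE mulrA ler_pdivlMr ?exprn_gt0// mulrC ler_wpM2r ?(ltW ImS)//.
  have -> : 4 = 2 ^+ 2 :> R by ring.
  by rewrite lerXn2r ?nnegrE ?cmod_ge0.
split=> //.
- apply: (mulIf zn); rewrite mul0r.
  have -> : (mp_a phi z * m z ^+ 2 + mp_b phi z * m z + 1) * z =
     (z * m z) * (z * m z) / sp%:C%C + mp_b phi z * (z * m z) + z by rewrite /mp_a; ring.
  rewrite zmE /mp_b zE rmorphD /= spVC; move: (sp%:C%C) spC_neq0 => y y0.
  by field; rewrite S0 y0.
- have -> : m2 z = (S - sp^-1%:C%C)^-1.
    rewrite /m_phi2 /mp_a; congr (_^-1); rewrite mulrAC zmE mulrBl mul1r spVC; field; exact: spC_neq0.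
  rewrite cImV cImB /= subr0 mulNr oppr_le0 divr_ge0 ?sqr_ge0//; exact: ltW.
split.
- have -> : Im (z * m z) = sp * Im S by rewrite zmE cImB cImZ [X in _ - X](_ : _ = 0)// subr0.
  have s0 := sp_gt0.
  rewrite mulr_ge0 ?(ltW s0) ?(ltW ImS)// andTb.
  rewrite [leRHS](_ : _ = sp * (4 * Im (m z))); last by ring.
  by rewrite ler_wpM2l// ltW.
- have -> : 1 + sp^-1%:C%C * m z = (1 - sp^-1%:C%C * S)^-1.
    by rewrite mE; move: d0; move: (sp^-1%:C%C) => y d0; field.
  by rewrite cmodV lef_pV2// posrE.
- have h := Im_joukowskiE S0 zE.
  have S2 : cmod S ^+ 2 < 1 by rewrite expr_lt1 ?cmod_ge0.
  have h1 : Im z * cmod S ^+ 2 <= Im S.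
    by rewrite h ler_piMr ?(ltW ImS)// gerBl sqr_ge0.
  have Sp : 0 < cmod S by rewrite cmod_gt0.
  (* A lower bound on [|S|]: since [|z - g0| = |S + 1/S|], the inverse of [|S|] is at most
     [|z - g0| + |S|]. *)
  have h2 : 1 <= cmod S * (cmod (z - g0%:C%C) + 1).
    have -> : z - g0%:C%C = - (S + S^-1) by rewrite zE addrAC subrr add0r.
    rewrite cmodN; have h0 : 1 <= cmod S * (cmod (S + S^-1) + cmod S).
      rewrite -(@cmod1 R) -(divff S0) cmodM ler_wpM2l ?cmod_ge0//.
      have := cmodB_ge S^-1 (- S); rewrite opprK cmodN addrC [S + _]addrC; lra.
    by apply: le_trans h0 _; rewrite ler_wpM2l ?cmod_ge0// lerD2l ltW.
  have h3 : 1 <= cmod S ^+ 2 * (cmod (z - g0%:C%C) + 1) ^+ 2 by rewrite -exprMn exprn_ege1.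
  apply: (@le_trans _ _ (Im z * cmod S ^+ 2 * (cmod (z - g0%:C%C) + 1) ^+ 2)).
    by rewrite -mulrA ler_peMr// ltW.
  apply: (@le_trans _ _ (Im S * (cmod (z - g0%:C%C) + 1) ^+ 2)); first by rewrite ler_wpM2r ?sqr_ge0.
  by rewrite mulrAC; rewrite ler_wpM2r ?sqr_ge0.
Qed.

Lemma mp_factor (z s : C) : 0 < Im z ->
  mp_poly phi z s = mp_a phi z * (s - m z) * (s - m2 z).
Proof.
move=> z0; have [mn e _ _ _] := mp_facts z0.
have an : mp_a phi z != 0 by rewrite mulf_neq0 ?invr_eq0 ?spC_neq0// neq0_Im.
rewrite /mp_poly /m_phi2.
have -> : mp_b phi z = - mp_a phi z * m z - (m z)^-1.
  apply: (mulIf mn); rewrite mulrBl mulVf//; apply/eqP; rewrite -subr_eq0; apply/eqP.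
  by rewrite -e; ring.
by field; rewrite ?mn ?an.
Qed.

Lemma mp_roots (z : C) : 0 < Im z ->
  mp_a phi z * m z * m2 z = 1 /\ mp_a phi z * (m z - m2 z) = mp_a phi z * m z * 2 + mp_b phi z.
Proof.
move=> z0; have [mn e _ _ _] := mp_facts z0.
have an : mp_a phi z != 0 by rewrite mulf_neq0 ?invr_eq0 ?spC_neq0// neq0_Im.
have h : mp_a phi z * m z * m2 z = 1 by rewrite /m_phi2 divff// mulf_neq0.
split=> //; apply: (mulIf mn); apply/eqP; rewrite -subr_eq0; apply/eqP.
transitivity (- (mp_a phi z * m z ^+ 2 + mp_b phi z * m z + mp_a phi z * m z * m2 z)); first by ring.
by rewrite h e oppr0.
Qed.

(** The discriminant of the quadratic polynomial factors as [(z - gamma_p)(z - gamma_m)]. *)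
Lemma mp_gap_sqr (z : C) : 0 < Im z ->
  (cmod (mp_a phi z) * mp_gap phi z) ^+ 2 =
  cmod (z - (gamma_p phi)%:C%C) * cmod (z - (gamma_m phi)%:C%C).
Proof.
move=> z0; have [mn e _ _ _] := mp_facts z0; have [_ h] := mp_roots z0.
rewrite /mp_gap -cmodM h -cmodX -cmodM; congr cmod.
transitivity (4 * mp_a phi z * (mp_a phi z * m z ^+ 2 + mp_b phi z * m z + 1) + (mp_b phi z ^+ 2 - 4 * mp_a phi z)).
  by ring.
have gpE : (gamma_p phi)%:C%C = sp%:C%C + sp^-1%:C%C + 2 :> C.
  by rewrite (natC R 2) -!rmorphD.
have gmE : (gamma_m phi)%:C%C = sp%:C%C + sp^-1%:C%C - 2 :> C.
  by rewrite (natC R 2) -rmorphD -rmorphB.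
rewrite e mulr0 add0r gpE gmE /mp_a /mp_b spVC.
by move: (sp%:C%C) spC_neq0 => y y0; field.
Qed.

(** The roots lie on opposite sides of the real axis. *)
Lemma mp_gap_ge_Im (z : C) : 0 < Im z -> Im (m z) <= mp_gap phi z.
Proof.
move=> z0; have [_ _ h1 h2 _] := mp_facts z0.
apply: le_trans (Im_le_cmod _); rewrite cImB; lra.
Qed.

(** From [m (a m + b) = -1], where [Im (a m + b)] is at least [Im z] because [Im (z m)] is
    nonnegative. *)
Lemma cmod_m_le (z : C) : 0 < Im z -> cmod (m z) <= (Im z)^-1.
Proof.
move=> z0; have [mn e _ _ [/andP[h _] _ _]] := mp_facts z0.
have e1 : m z * (mp_a phi z * m z + mp_b phi z) = -1.
  by apply/eqP; rewrite -subr_eq0 opprK; apply/eqP; rewrite -e; ring.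
have e2 : Im z <= cmod (mp_a phi z * m z + mp_b phi z).
  apply: le_trans (Im_le_cmod _).
  have -> : mp_a phi z * m z = sp^-1%:C%C * (z * m z) by rewrite /mp_a spVC; ring.
  rewrite /mp_b !(cImD,cImB,cImZ) /= subr0 addr0 lerDr mulr_ge0// invr_ge0 ltW ?sp_gt0//.
have h3 : cmod (m z) * cmod (mp_a phi z * m z + mp_b phi z) = 1 by rewrite -cmodM e1 cmodN cmod1.
rewrite -[_^-1]mul1r ler_pdivlMr// -h3 ler_wpM2l ?cmod_ge0//.
Qed.

(** Subtracting the two parametrizations gives [(S - S')(1 - S S') = (z - z') S S'], and [1 - |S|]
    is bounded below in terms of [Im z]. *)
Lemma S_Lip (S S' : C) (z z' : C) : 0 < Im z -> S != 0 -> S' != 0 -> cmod S < 1 -> cmod S' < 1 -> 0 < Im S ->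
  z = g0%:C%C - (S + S^-1) -> z' = g0%:C%C - (S' + S'^-1) ->
  cmod (S - S') * Num.min 2^-1 (Im z / 4) <= cmod (z - z').
Proof.
move=> z0 S0 S0' S1 S1' ImS zE zE'.
have Sp : 0 < cmod S by rewrite cmod_gt0.
have Sp' : 0 < cmod S' by rewrite cmod_gt0.
have h := Im_joukowskiE S0 zE.
have h1 : Num.min 2^-1 (Im z / 4) <= 1 - cmod S.
  have [le|gt] := leP (cmod S) 2^-1; first by rewrite ge_min; apply/orP; left; lra.
  rewrite ge_min; apply/orP; right.
  have ImSS : Im S <= cmod S := Im_le_cmod S.
  have S2 : 0 <= 1 - cmod S ^+ 2 by rewrite subr_ge0 expr_le1 ?cmod_ge0// ltW.
  have : Im z * cmod S ^+ 2 <= cmod S * (1 - cmod S ^+ 2) by rewrite h ler_wpM2r.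
  rewrite expr2 mulrA mulrC ler_pM2l// => h3.
  have : Im z * 2^-1 <= Im z * cmod S by rewrite ler_wpM2l// ltW.
  have : 1 - cmod S * cmod S = (1 - cmod S) * (1 + cmod S) by ring.
  have : (1 - cmod S) * (1 + cmod S) <= (1 - cmod S) * 2 by rewrite ler_wpM2l; lra.
  lra.
have e : (S - S') * (1 - S * S') = (z - z') * (S * S') by rewrite zE zE'; move: g0%:C%C => y; field; rewrite ?S0 ?S0'.
have SS1 : cmod S * cmod S' <= cmod S by rewrite ler_piMr ?cmod_ge0// ltW.
have h2 : cmod (S - S') * (1 - cmod S) <= cmod (z - z').
  apply: (@le_trans _ _ (cmod (S - S') * cmod (1 - S * S'))).
    rewrite ler_wpM2l ?cmod_ge0//; apply: le_trans (cmodB_ge _ _).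
    by rewrite cmod1 cmodM lerB.
  rewrite -cmodM e !cmodM ler_piMr ?cmod_ge0//; lra.
by apply: le_trans h2; rewrite ler_wpM2l ?cmod_ge0.
Qed.

(** Obtained from [m = (sqrt phi * S - 1) / z] and [S_Lip]. Only a polynomial dependence on
    [1 / Im z] matters, since the grid is finer than any such loss. *)
Lemma m_Lip (z z' : C) : 0 < Im z -> 0 < Im z' -> Im z' <= Im z -> 
  cmod (m z - m z') * (Num.min 2^-1 (Im z / 4) * Im z' ^+ 2) <= 3 * sp * (1 + Im z) * cmod (z - z').
Proof.
move=> z0 z0' zz.
have [S [S0 S1 ImS zE mE]] := m_phi_E phi1 z0.
have [S' [S0' S1' ImS' zE' mE']] := m_phi_E phi1 z0'.
have [d0 _] := cmod_1B_S S1; have [d0' _] := cmod_1B_S S1'.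
have zn : z != 0 by exact: neq0_Im.
have zn' : z' != 0 by exact: neq0_Im.
have lip := S_Lip z0 S0 S0' S1 S1' ImS zE zE'.
have mz (y T : C) : y != 0 -> T != 0 -> 1 - sp^-1%:C%C * T != 0 -> y = g0%:C%C - (T + T^-1) ->
    T / (1 - sp^-1%:C%C * T) = (sp%:C%C * T - 1) / y.
  move=> y0 T0 dT yE; apply: (mulIf y0); rewrite divfK//.
  rewrite {1}yE rmorphD /= spVC; move: dT; rewrite spVC; move: (sp%:C%C) spC_neq0 => x x0 dT.
  by have ys := neq0_subM x0 dT; field; rewrite ?T0 ?x0 ?ys.
have e : m z - m z' = (sp%:C%C * (S - S')) / z + (sp%:C%C * S' - 1) * (z' - z) / (z * z').
  by rewrite mE mE' (mz z) // (mz z')//; field; rewrite zn zn'.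
set mn := Num.min _ _ in lip *.
have mn0 : 0 < mn by rewrite lt_min; apply/andP; split; rewrite ?divr_gt0.
have mn1 : mn <= 2^-1 by rewrite ge_min lexx.
have zi : cmod z^-1 <= (Im z)^-1 by apply: ler_cmodV => //; exact: Im_le_cmod.
have zi' : cmod z'^-1 <= (Im z')^-1 by apply: ler_cmodV => //; exact: Im_le_cmod.
have s1 := sp_ge1; have s0 := sp_gt0.
have b1 : cmod (sp%:C%C * S' - 1) <= 2 * sp.
  apply: le_trans (cmodD _ _) _; rewrite cmodN cmod1 cmodM cmod_pos ?(ltW s0)//.
  have : sp * cmod S' <= sp * 1 by rewrite ler_wpM2l ?(ltW s0)// ltW.
  lra.
set D := cmod (z - z'); have D0 : 0 <= D by exact: cmod_ge0.
have step : cmod (m z - m z') <= sp * (D / mn) * (Im z')^-1 + 2 * sp * D * ((Im z')^-1 * (Im z')^-1).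
  rewrite e; apply: le_trans (cmodD _ _) _; apply: lerD.
    rewrite !cmodM cmod_pos ?(ltW s0)//; apply: ler_pM; rewrite ?mulr_ge0 ?cmod_ge0 ?(ltW s0)//.
      by rewrite ler_wpM2l ?(ltW s0)// ler_pdivlMr.
    by apply: le_trans zi _; rewrite lef_pV2 ?posrE.
  rewrite !cmodM invfM cmodM -(cmodB z z'); apply: ler_pM; rewrite ?mulr_ge0 ?cmod_ge0//.
    by apply: ler_pM; rewrite ?cmod_ge0.
  apply: ler_pM; rewrite ?cmod_ge0//.
  by apply: le_trans zi _; rewrite lef_pV2 ?posrE.
have mz0 : 0 <= mn * Im z' ^+ 2 by rewrite mulr_ge0 ?sqr_ge0// ltW.
apply: le_trans (ler_wpM2r mz0 step) _.
have -> : (sp * (D / mn) * (Im z')^-1 + 2 * sp * D * ((Im z')^-1 * (Im z')^-1)) * (mn * Im z' ^+ 2) =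
  sp * D * (Im z' + 2 * mn) by field; rewrite !gt_eqF.
rewrite [leRHS](_ : _ = sp * D * (3 * (1 + Im z))); last by ring.
rewrite ler_wpM2l ?mulr_ge0 ?(ltW s0)//; lra.
Qed.

(** Write [eta * gap] as [(eta / |z|) * (|z| * gap)]. The first factor increases with [eta], and the
    second, by [mp_gap_sqr], is [sqrt phi] times the square root of the distances to the two real
    edges. *)
Lemma mp_gap_mono (E e1 e2 : R) : 0 < e1 -> e1 <= e2 ->
  e1 * mp_gap phi (Complex E e1) <= e2 * mp_gap phi (Complex E e2).
Proof.
move=> p1 le12; have p2 : 0 < e2 by exact: lt_le_trans le12.
pose z1 := Complex E e1; pose z2 := Complex E e2.
have h1 := @mp_gap_sqr z1 p1; have h2 := @mp_gap_sqr z2 p2.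
have mono (x : R) : cmod (z1 - x%:C%C) <= cmod (z2 - x%:C%C).
  by rewrite /cmod ler_wsqrtr//= lerD2l subr0 subr0 lerXn2r ?nnegrE ?(ltW p1) ?(ltW p2).
have g0' (z : C) : 0 <= mp_gap phi z by exact: cmod_ge0.
have az (z : C) : cmod (mp_a phi z) = cmod z / sp.
  by rewrite /mp_a cmodM cmodV cmod_pos// ltW ?sp_gt0.
have s0 := sp_gt0.
have z1p : 0 < cmod z1 by rewrite cmod_gt0 neq0_Im.
have z2p : 0 < cmod z2 by rewrite cmod_gt0 neq0_Im.
have k1 : cmod (mp_a phi z1) * mp_gap phi z1 <= cmod (mp_a phi z2) * mp_gap phi z2.
  apply: le_of_sqr; first by rewrite mulr_ge0 ?cmod_ge0.
  by rewrite h1 h2 ler_pM ?cmod_ge0.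
have k2 : e1 * cmod z2 <= e2 * cmod z1.
  apply: le_of_sqr; first by rewrite mulr_ge0 ?cmod_ge0// ltW.
  rewrite !exprMn !cmod_sqr /= !mulrDr [e2 ^+ 2 * e1 ^+ 2]mulrC lerD2r ler_wpM2r ?sqr_ge0//.
  by rewrite lerXn2r ?nnegrE ?(ltW p1) ?(ltW p2).
move: k1; rewrite !az -!mulrA ![sp^-1 * _]mulrC !mulrA ler_pM2r ?invr_gt0// => k1.
rewrite -(ler_pM2l z1p) -/z1 -/z2.
apply: (@le_trans _ _ (e1 * (cmod z2 * mp_gap phi z2))).
  by rewrite mulrCA ler_wpM2l// ltW.
rewrite mulrA [leRHS]mulrA; apply: ler_wpM2r => //.
by rewrite [leRHS]mulrC.
Qed.

(** The limiting form of [resG_ii] for the other Gram matrix, with [1 + m / sqrt phi] in place of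
    [1 + q_]. *)
Lemma m_phi_invE (z : C) : 0 < Im z -> z * (1 + sp^-1%:C%C * m z) * m_phi_inv phi z = -1.
Proof.
move=> z0; have [mn e _ _ _] := mp_facts z0.
have zn : z != 0 by exact: neq0_Im.
have p0 : phi%:C%C = sp%:C%C ^+ 2 :> C by rewrite -rmorphXn /= sqr_sqrtr// (le_trans _ phi1).
have -> : m_phi_inv phi z = (phi%:C%C)^-1 * (m z + (1 - phi%:C%C) / z).
  by rewrite /m_phi_inv !toCE fmorphV rmorphB.
rewrite p0 spVC.
move: e; rewrite /mp_a /mp_b spVC; move: (sp%:C%C) spC_neq0 => y y0 e.
transitivity (y^-1 ^+ 2 * (z / y * m z ^+ 2 + (z - y + y^-1) * m z + 1) - 1); last by rewrite e mulr0 sub0r.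
by field; rewrite zn y0.
Qed.

End Fixed.
End MPFacts.

(** * Self-consistent equation *)

Section SelfConsistent.
Variable R : realType.
Local Notation Re := (@complex.Re R).
Local Notation Im := (@complex.Im R).
Local Notation C := R[i].
Variables N M : nat.
Hypothesis N0 : (0 < N)%N.
Hypothesis NM : (N <= M)%N.
Variable z : C.
Hypothesis z0 : 0 < Im z.

Definition mp_ratio : R := M%:R / N%:R.
Local Notation phi := mp_ratio.
Local Notation sp := (Num.sqrt phi).
(** Equals [(N M)^(-1/2)], the variance of the entries; this form displays the powers of
    [sqrt phi]. *)
Definition entry_var : R := (sp * N%:R)^-1.
Local Notation c := entry_var.
Local Notation eta := (Im z).

(** Here [A] plays the part of [X^*], so [resG A z] is the resolvent of [X^* X]. Below, [gt]
    evaluated at the matrix with row [i] cleared is the partial average of [q_] over that row, and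
    [Yt] is the corresponding average of [z (1 + q_)]. *)
Definition st (A : 'M[C]_(N, M)) : C := (N%:R)^-1 * \tr (resG A z).
Definition gt (A : 'M[C]_(N, M)) : C := c%:C%C * \tr (resR A z).
Definition Yt (A : 'M[C]_(N, M)) : C := z * (1 + gt A).
Definition eps_ (A : 'M[C]_(N, M)) i : C := q_ A z i - gt (rowz i A).
(** The partial average over row [i] of [k2_]; likewise [up_] is [u_] with [q_] replaced by its
    partial average. *)
Definition t2_ (A : 'M[C]_(N, M)) i : C := c%:C%C * \tr (resR (rowz i A) z *m resR (rowz i A) z).
Definition k2_ (A : 'M[C]_(N, M)) i : C := qf (row i A) (row i A) (resR (rowz i A) z *m resR (rowz i A) z).
Definition up_ (A : 'M[C]_(N, M)) i : C := (1 + gt (rowz i A))^-1.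
(** The part of [u_ (q_ - gt)] that has mean zero given the other rows; [rho_] is the remainder in
    [decomp]. *)
Definition zeta_ (A : 'M[C]_(N, M)) i : C := up_ A i * eps_ A i.
Definition rho_ (A : 'M[C]_(N, M)) i : C :=
  c%:C%C * u_ A z i ^+ 2 * k2_ A i - u_ A z i * up_ A i * eps_ A i ^+ 2.
(* A second order approximation of [st A] that does not depend on row [i]. *)
Definition spp_ (A : 'M[C]_(N, M)) i : C := st (rowz i A) - (N%:R)^-1 * (up_ A i * t2_ A i).

Lemma Nr0 : 0 < N%:R :> R. Proof. by rewrite ltr0n. Qed.
Lemma NC0 : N%:R != 0 :> C. Proof. by rewrite pnatr_eq0 -lt0n. Qed.
Lemma phi_ge1 : 1 <= phi. Proof. by rewrite /mp_ratio ler_pdivlMr ?Nr0// mul1r ler_nat. Qed.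
Lemma phi_gt0 : 0 < phi. Proof. exact: lt_le_trans phi_ge1. Qed.
Lemma spsp : sp * sp = phi. Proof. by rewrite -expr2 sqr_sqrtr// ltW ?phi_gt0. Qed.
Lemma phiN : phi * N%:R = M%:R. Proof. by rewrite /mp_ratio divfK// gt_eqF ?Nr0. Qed.
Lemma sp1 : 1 <= sp. Proof. exact: (sp_ge1 phi_ge1). Qed.
Lemma sp0 : 0 < sp. Proof. exact: lt_le_trans sp1. Qed.
Lemma c0 : 0 < c. Proof. by rewrite invr_gt0 mulr_gt0 ?Nr0 ?sp0. Qed.
Lemma zn0 : z != 0. Proof. exact: neq0_Im. Qed.

Lemma resG_resR m n (A : 'M[C]_(m, n)) (x : C) : resG A x = resR (adjmx A) x.
Proof. by rewrite /resG /resR adjmxK. Qed.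

Lemma stE A : st A = (N%:R)^-1 * (\tr (resR A z) + (M%:R - N%:R) / z).
Proof.
rewrite /st; congr (_ * _); apply: (mulfI zn0); rewrite tr_resG//.
by field; exact: zn0.
Qed.

Lemma spC2 : (sp%:C%C) ^+ 2 * N%:R = M%:R :> C.
Proof. by rewrite (natC R N) (natC R M) -rmorphXn -rmorphM /= expr2 spsp phiN. Qed.
Lemma cC : c%:C%C = (sp%:C%C * N%:R)^-1 :> C.
Proof. by rewrite (natC R N) -rmorphM -fmorphV. Qed.

(** The traces of the two resolvents differ by the [M - N] extra zero eigenvalues, so [gt] is an
    affine function of [st]. This is what closes the equation. *)
Lemma gtE A : gt A = (sp%:C%C)^-1 * st A - (sp%:C%C - (sp%:C%C)^-1) / z.
Proof.
have y0 := spC_neq0 phi_ge1.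
rewrite stE /gt cC -spC2; move: (sp%:C%C) y0 => y y0; field.
by rewrite zn0 y0 NC0.
Qed.
Lemma YtE A : Yt A = mp_b phi z + mp_a phi z * st A.
Proof.
have y0 := spC_neq0 phi_ge1.
rewrite /Yt gtE /mp_b /mp_a spVC; move: (sp%:C%C) y0 => y y0; field.
by rewrite zn0 y0.
Qed.
Lemma polyE A : mp_poly phi z (st A) = 1 + st A * Yt A.
Proof. by rewrite YtE /mp_poly; ring. Qed.

Lemma self_consistent A :
  N%:R * mp_poly phi z (st A) = \sum_i u_ A z i * (q_ A z i - gt A).
Proof.
rewrite polyE; have h := trace_sum A z0.
have e1 : N%:R * st A * z = M%:R + z * \tr (resR A z) - N%:R.
  by rewrite stE mulrA divff ?NC0// mul1r; field; exact: zn0.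
have -> : N%:R * (1 + st A * Yt A) = N%:R + (N%:R * st A * z) * (1 + gt A).
  by rewrite /Yt; ring.
rewrite e1 h.
(* Since [u (1 + q) = 1], each summand becomes affine in [u] with coefficients independent of [i],
   and [trace_sum] evaluates the sum. *)
have -> : \sum_i u_ A z i * (q_ A z i - gt A) = \sum_i ((1 - u_ A z i) * (1 + gt A) - gt A).
  apply: eq_bigr => i _; rewrite /u_; field; exact: q_neq0.
rewrite [RHS]sumrB -big_distrl /= sumr_const card_ord -[gt A *+ N]mulr_natl; ring.
Qed.

Lemma Im_st_ge0 A : 0 <= Im (st A).
Proof.
rewrite /st (natC R N) -fmorphV cImZ mulr_ge0 ?invr_ge0// resG_resR Im_trG//.
by rewrite mulr_ge0 ?hs_ge0// ltW.
Qed.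
Lemma Im_gtE A : Im (gt A) = c * (eta * hs (resR A z)).
Proof. by rewrite /gt cImZ Im_trG. Qed.
Lemma cmod_st_le A : cmod (st A) <= eta^-1.
Proof.
rewrite /st (natC R N) -fmorphV cmodM cmod_pos ?invr_ge0// resG_resR.
rewrite mulrC ler_pdivrMr ?Nr0//; apply: le_trans (cmod_trG _ z0) _.
by rewrite mulrC.
Qed.
Lemma Im_Yt A : eta <= Im (Yt A).
Proof.
rewrite /Yt mulrDr mulr1 cImD lerDl /gt mulrCA cImZ mulr_ge0 ?(ltW c0)//.
by have := Im_z_tr_res A z0 1%:M; rewrite mul1mx adjmx1 mulmx1.
Qed.
Lemma Yt_neq0 A : Yt A != 0.
Proof. by apply: neq0_Im; apply: lt_le_trans (Im_Yt A). Qed.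
Lemma gt_neq0 A : 1 + gt A != 0.
Proof. by have := Yt_neq0 A; rewrite mulf_eq0 negb_or => /andP[]. Qed.

Lemma gt_rowz A i : cmod (gt A - gt (rowz i A)) <= c / eta.
Proof.
rewrite /gt -mulrBr cmodM cmod_pos ?(ltW c0)// ler_wpM2l ?(ltW c0)//.
exact: tr_res_diff.
Qed.
Lemma gt_rowzE A i : gt A = gt (rowz i A) - c%:C%C * (u_ A z i * k2_ A i).
Proof. by rewrite /gt (tr_res A i z0) -mulrBr. Qed.
Lemma st_rowzE A i : st A = st (rowz i A) - (N%:R)^-1 * (u_ A z i * k2_ A i).
Proof. by rewrite !stE (tr_res A i z0) /k2_; ring. Qed.
Lemma uB A i : u_ A z i - up_ A i = - (u_ A z i * up_ A i * eps_ A i).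
Proof.
rewrite /u_ /up_ /eps_; have h1 := q_neq0 A i z0; have h2 := gt_neq0 (rowz i A).
by field; rewrite h1 h2.
Qed.
(** Two corrections make up [rho_]: passing from the average of the full matrix to that of the
    minor, and replacing [u_] by [up_]. The second costs another factor [eps_], hence the square. *)
Lemma decomp A i : u_ A z i * (q_ A z i - gt A) = zeta_ A i + rho_ A i.
Proof.
have -> : q_ A z i - gt A = eps_ A i + c%:C%C * (u_ A z i * k2_ A i).
  by rewrite (gt_rowzE A i) /eps_; ring.
rewrite /zeta_ /rho_; have := uB A i; move: (u_ _ _ _) (up_ _ _) (eps_ _ _) (k2_ _ _) => u v e k h.
have h' : v = u + u * v * e by rewrite -[RHS]opprK opprD -h; ring.
have -> : v * e = u * e + u * v * e ^+ 2 by rewrite {1}h'; ring.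
ring.
Qed.
(** Only the fluctuations [k2_ - t2_] and [eps_] remain. So [spp_] is closer to [st] than the trace
    of the minor, which differs from it by a term of order [1 / (N eta)]. *)
Lemma spp_diff A i : st A - spp_ A i =
  - ((N%:R)^-1 * (u_ A z i * (k2_ A i - t2_ A i) - u_ A z i * up_ A i * eps_ A i * t2_ A i)).
Proof.
rewrite (st_rowzE A i) /spp_ -[X in _ - X * t2_ A i]opprK -uB; ring.
Qed.
Lemma poly_diff (a b : C) : mp_poly phi z a - mp_poly phi z b =
  (a - b) * (2 * mp_a phi z * a + mp_b phi z - mp_a phi z * (a - b)).
Proof. by rewrite /mp_poly; ring. Qed.

Lemma Im_gt_le A : Im (gt A) <= sp^-1 * (Im (st A) + phi * eta / cmod z ^+ 2).
Proof.
rewrite gtE -spVC -rmorphB cImB !cImZ cImV mulrDr mulNr mulrN opprK lerD2l mulrA -mulrA.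
rewrite [leRHS](_ : _ = sp * (eta / cmod z ^+ 2)); last first.
  have h := esym spsp; have y0 := sp0; have cz : 0 < cmod z by rewrite cmod_gt0 zn0.
  move: h y0; move: sp => y h y0; rewrite h; move: (cmod z) cz => x x0; field.
  by rewrite !gt_eqF.
by rewrite ler_wpM2r ?divr_ge0 ?sqr_ge0 ?(ltW z0)// gerBl invr_ge0 ltW ?sp0.
Qed.

(** * Bounds for one row, given the large deviation estimates *)

Section RowBounds.
Variables (K K1 L : R) (A : 'M[C]_(N, M)) (i : 'I_N).
Hypothesis K_ge1 : 1 <= K.
Hypothesis K1_ge1 : 1 <= K1.
Hypothesis L_ge1 : 1 <= L.
Hypothesis zK : cmod z <= K * sp.
Hypothesis Kz : sp <= K * cmod z.
Hypothesis etaK : eta <= K.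
Hypothesis sK : cmod (st A) <= K1.
Hypothesis YK : K1^-1 <= cmod (Yt A).
Hypothesis ld1 : cmod (eps_ A i) <= L * (c * Num.sqrt (hs (resR (rowz i A) z))).
Hypothesis ld2 : cmod (k2_ A i - t2_ A i) <=
  L * (c * Num.sqrt (hs (resR (rowz i A) z *m resR (rowz i A) z))).
Definition K3 := K1 + K ^+ 3 + 1.
Hypothesis small : 16 * K1 ^+ 2 * K ^+ 2 * K3 * L ^+ 2 <= N%:R * eta.

Local Notation Ne := (N%:R * eta).
(** An upper bound for [sqrt phi] times [Im (gt (rowz i A))]: the trace itself, the zero
    eigenvalues, and the cost of clearing a row. *)
Definition Gam : R := Im (st A) + K ^+ 2 * eta + Ne^-1.
(** A random counterpart of the control parameter, with [Im (st A)] in place of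
    [Im (m_phi phi z)]. *)
Definition Psi1 : R := Num.sqrt (Gam / Ne).
(** [sqrt phi * kk] will bound [u_] and [up_]; the factor 2 leaves room for clearing the row and for
    the fluctuation [eps_]. *)
Definition kk : R := 2 * K1 * K.

Lemma Ne0 : 0 < Ne. Proof. by rewrite mulr_gt0 ?Nr0. Qed.
Lemma K0 : 0 < K. Proof. exact: lt_le_trans K_ge1. Qed.
Lemma K10 : 0 < K1. Proof. exact: lt_le_trans K1_ge1. Qed.
Lemma L0 : 0 < L. Proof. exact: lt_le_trans L_ge1. Qed.
Lemma K3_ge1 : 1 <= K3.
Proof. by rewrite /K3 lerDr addr_ge0 ?exprn_ge0// ltW ?K0 ?K10. Qed.
Lemma kk0 : 0 < kk. Proof. by rewrite !mulr_gt0 ?K0 ?K10. Qed.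
Lemma kk2 : 0 < 2 * kk. Proof. by rewrite pmulr_rgt0 ?kk0. Qed.
Lemma Ne1 : 1 <= Ne.
Proof.
apply: le_trans small.
by rewrite !mulr_ege1 ?exprn_ege1 ?K3_ge1// (ler_nat _ 1 16).
Qed.
Lemma Gam_ge : Ne^-1 <= Gam.
Proof. by rewrite /Gam lerDr addr_ge0 ?Im_st_ge0// mulr_ge0 ?sqr_ge0// ltW. Qed.
Lemma Gam0 : 0 < Gam. Proof. by apply: lt_le_trans Gam_ge; rewrite invr_gt0 Ne0. Qed.
Lemma Gam_le : Gam <= K3.
Proof.
rewrite /Gam /K3; apply: lerD; last by rewrite invf_le1 ?Ne1 ?Ne0.
apply: lerD; first exact: le_trans (Im_le_cmod _) sK.
by rewrite [leRHS]exprSr ler_wpM2l ?sqr_ge0.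
Qed.
Lemma Psi1_sqr : Psi1 ^+ 2 = Gam / Ne.
Proof. by rewrite sqr_sqrtr// divr_ge0 ?ltW ?Gam0 ?Ne0. Qed.
Lemma Psi1_ge0 : 0 <= Psi1. Proof. exact: sqrtr_ge0. Qed.
Lemma Psi1_leGam : Psi1 <= Gam.
Proof.
apply: le_of_sqr; first exact: ltW Gam0.
by rewrite Psi1_sqr expr2 ler_wpM2l ?(ltW Gam0)// Gam_ge.
Qed.
(** The square of [2 * kk] is [16 * K1^2 * K^2], which is where the constant of the hypothesis
    [small] comes from. *)
Lemma LPsi1_le : L * Psi1 <= (2 * kk)^-1.
Proof.
apply: le_of_sqr; first by rewrite invr_ge0 mulr_ge0// ltW ?kk0.
rewrite exprMn Psi1_sqr exprVn mulrA ler_pdivrMr ?Ne0//.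
rewrite ler_pdivlMl ?exprn_gt0 ?kk2//; apply: le_trans small.
rewrite [leRHS](_ : _ = (2 * kk) ^+ 2 * (L ^+ 2 * K3)); last by rewrite /kk; ring.
by rewrite ler_wpM2l ?sqr_ge0// ler_wpM2l ?sqr_ge0// Gam_le.
Qed.
Lemma Ne_inv_le : Ne^-1 <= (2 * kk)^-1.
Proof.
rewrite lef_pV2 ?posrE ?Ne0 ?kk2//; apply: le_trans small.
have h : 2 * kk = 4 * (K1 * K) by rewrite /kk; ring.
rewrite h [leRHS](_ : _ = 16 * (K1 * K) * ((K1 * K) * (K3 * L ^+ 2))); last by ring.
have KK : 0 <= K1 * K by rewrite mulr_ge0 ?ltW ?K0 ?K10.
have : 1 <= (K1 * K) * (K3 * L ^+ 2) by rewrite !mulr_ege1 ?exprn_ege1 ?K3_ge1.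
move: (K1 * K * (K3 * _)) => x x1.
have : 16 * (K1 * K) * 1 <= 16 * (K1 * K) * x by apply: ler_wpM2l => //; apply: mulr_ge0.
lra.
Qed.

Lemma c_eta : c / eta = sp^-1 * Ne^-1.
Proof. by rewrite /entry_var !invfM; ring. Qed.

Lemma Im_gt_rowz : Im (gt (rowz i A)) <= sp^-1 * Gam.
Proof.
have h1 : Im (gt (rowz i A)) <= Im (gt A) + c / eta.
  rewrite -lerBlDl -cImB; apply: le_trans (Im_le_cmod _) _.
  by rewrite cmodB gt_rowz.
apply: le_trans h1 _; rewrite c_eta.
apply: (@le_trans _ _ (sp^-1 * (Im (st A) + phi * eta / cmod z ^+ 2) + sp^-1 * Ne^-1)).
  by rewrite lerD2r Im_gt_le.
rewrite -mulrDr ler_wpM2l ?invr_ge0 ?(ltW sp0)// /Gam lerD2r lerD2l.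
rewrite mulrAC ler_wpM2r ?(ltW z0)// ler_pdivrMr ?exprn_gt0 ?cmod_gt0 ?zn0//.
rewrite -exprMn; apply: (@le_trans _ _ (sp ^+ 2)); first by rewrite expr2 spsp.
by rewrite lerXn2r ?nnegrE ?(ltW sp0)// mulr_ge0 ?cmod_ge0 ?(ltW K0).
Qed.

Lemma chs_le : c * hs (resR (rowz i A) z) <= sp^-1 * Gam / eta.
Proof.
rewrite ler_pdivlMr//; apply: le_trans Im_gt_rowz.
by rewrite Im_gtE; rewrite le_eqVlt; apply/orP; left; apply/eqP; ring.
Qed.
Lemma csqrt_le : c * Num.sqrt (hs (resR (rowz i A) z)) <= sp^-1 * Psi1.
Proof.
have s0 : 0 <= sp^-1 by rewrite invr_ge0 ltW ?sp0.
apply: le_of_sqr; first by rewrite mulr_ge0// Psi1_ge0.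
rewrite !exprMn sqr_sqrtr ?hs_ge0// Psi1_sqr expr2 -mulrA.
apply: le_trans (ler_wpM2l (ltW c0) chs_le) _.
rewrite le_eqVlt; apply/orP; left; apply/eqP; rewrite /entry_var; field.
by rewrite !gt_eqF ?sp0 ?Nr0.
Qed.
Lemma eps_le : cmod (eps_ A i) <= sp^-1 * (L * Psi1).
Proof.
apply: le_trans ld1 _; rewrite [leRHS]mulrCA ler_wpM2l ?(ltW L0)//; exact: csqrt_le.
Qed.
Lemma eps2_le : cmod (k2_ A i - t2_ A i) <= sp^-1 * (L * Psi1) / eta.
Proof.
apply: le_trans ld2 _; rewrite [leRHS](_ : _ = L * (sp^-1 * Psi1 / eta)); last by ring.
rewrite ler_wpM2l ?(ltW L0)//.
apply: (@le_trans _ _ (c * Num.sqrt (hs (resR (rowz i A) z)) / eta)); last first.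
  by rewrite ler_wpM2r ?invr_ge0 ?(ltW z0)// csqrt_le.
rewrite -mulrA ler_wpM2l ?(ltW c0)//.
apply: le_of_sqr; first by rewrite divr_ge0 ?sqrtr_ge0// ltW.
by rewrite expr_div_n !sqr_sqrtr ?hs_ge0// hs_res2.
Qed.
Lemma t2_le : cmod (t2_ A i) <= sp^-1 * Gam / eta.
Proof.
rewrite /t2_ cmodM cmod_pos ?(ltW c0)//; apply: le_trans chs_le.
by rewrite ler_wpM2l ?(ltW c0)// cmod_trG2.
Qed.
Lemma gt_ge : 2 * (sp * kk)^-1 <= cmod (1 + gt A).
Proof.
have e : cmod (Yt A) = cmod z * cmod (1 + gt A) by rewrite /Yt cmodM.
have zp : 0 < cmod z by rewrite cmod_gt0 zn0.
rewrite -(ler_pM2l zp) -e; apply: le_trans YK.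
apply: (@le_trans _ _ (K * sp * (2 * (sp * kk)^-1))).
  by rewrite ler_wpM2r// mulr_ge0// invr_ge0 mulr_ge0 ?ltW ?sp0 ?kk0.
rewrite le_eqVlt; apply/orP; left; apply/eqP; rewrite /kk; field.
by rewrite !gt_eqF ?sp0 ?K0 ?K10.
Qed.
Lemma spkk : 0 < (sp * kk)^-1. Proof. by rewrite invr_gt0 pmulr_rgt0 ?sp0 ?kk0. Qed.
Lemma small1 (x : R) : x <= (2 * kk)^-1 -> sp^-1 * x <= (sp * kk)^-1 / 2.
Proof.
move=> h; apply: (@le_trans _ _ (sp^-1 * (2 * kk)^-1)).
  by rewrite ler_wpM2l// invr_ge0 ltW ?sp0.
by rewrite !invfM le_eqVlt; apply/orP; left; apply/eqP; ring.
Qed.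
Lemma gt_rowz_ge : (sp * kk)^-1 <= cmod (1 + gt (rowz i A)).
Proof.
have h := gt_ge; have h1 := gt_rowz A i; have h2 := small1 Ne_inv_le; have h3 := spkk.
rewrite c_eta in h1.
have := cmodB_ge (1 + gt A) (gt A - gt (rowz i A)).
have -> : 1 + gt A - (gt A - gt (rowz i A)) = 1 + gt (rowz i A) by ring.
lra.
Qed.
(** The lower bound for [1 + gt A] is twice the one claimed; clearing the row and passing from the
    average to [q_] each lose at most a quarter of it. *)
Lemma q_ge : (sp * kk)^-1 <= cmod (1 + q_ A z i).
Proof.
have h := gt_ge; have h1 := gt_rowz A i; have h2 := small1 Ne_inv_le; have h3 := spkk.
have h4 := eps_le; have h5 := small1 LPsi1_le.
rewrite c_eta in h1.
have := cmodB_ge (1 + gt A) (gt A - gt (rowz i A) - eps_ A i).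
have -> : 1 + gt A - (gt A - gt (rowz i A) - eps_ A i) = 1 + q_ A z i by rewrite /eps_; ring.
have := cmodD (gt A - gt (rowz i A)) (- eps_ A i); rewrite cmodN.
lra.
Qed.
Lemma u_le : cmod (u_ A z i) <= sp * kk.
Proof.
rewrite -[sp * kk]invrK /u_; apply: ler_cmodV; [exact: spkk|exact: q_ge].
Qed.
Lemma up_le : cmod (up_ A i) <= sp * kk.
Proof.
rewrite -[sp * kk]invrK /up_; apply: ler_cmodV; [exact: spkk|exact: gt_rowz_ge].
Qed.
Lemma spV0 : 0 <= sp^-1. Proof. by rewrite invr_ge0 ltW ?sp0. Qed.
Lemma spkk0 : 0 <= sp * kk. Proof. by rewrite mulr_ge0 ?ltW ?sp0 ?kk0. Qed.
Lemma zeta_le : cmod (zeta_ A i) <= kk * (L * Psi1).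
Proof.
rewrite cmodM; apply: le_trans (ler_pM _ _ up_le eps_le) _; rewrite ?cmod_ge0//.
by rewrite le_eqVlt; apply/orP; left; apply/eqP; field; rewrite gt_eqF ?sp0.
Qed.
Lemma qg_le : cmod (u_ A z i * (q_ A z i - gt A)) <= kk * (L * Psi1 + Ne^-1).
Proof.
have e : q_ A z i - gt A = eps_ A i - (gt A - gt (rowz i A)) by rewrite /eps_; ring.
have h : cmod (q_ A z i - gt A) <= sp^-1 * (L * Psi1 + Ne^-1).
  rewrite e; apply: le_trans (cmodD _ _) _; rewrite cmodN mulrDr -c_eta.
  by apply: lerD; [exact: eps_le|exact: gt_rowz].
rewrite cmodM; apply: le_trans (ler_pM _ _ u_le h) _; rewrite ?cmod_ge0//.
by rewrite le_eqVlt; apply/orP; left; apply/eqP; field; rewrite !gt_eqF ?sp0 ?Nr0.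
Qed.
Lemma Im_q_le : Im (q_ A z i) <= sp^-1 * (2 * L * Gam).
Proof.
have -> : q_ A z i = gt (rowz i A) + eps_ A i by rewrite /eps_; ring.
rewrite cImD; apply: (@le_trans _ _ (sp^-1 * Gam + sp^-1 * (L * Psi1))).
  by apply: lerD; [exact: Im_gt_rowz|exact: le_trans (Im_le_cmod _) eps_le].
rewrite -mulrDr ler_wpM2l ?spV0//.
have h : L * Psi1 <= L * Gam by rewrite ler_wpM2l ?(ltW L0)// Psi1_leGam.
have : 1 * Gam <= L * Gam by rewrite ler_wpM2r// ltW ?Gam0.
lra.
Qed.
(** Both terms of [rho_] are of order [Psi1^2 = Gam / (N eta)], and the powers of [sqrt phi]
    cancel. *)
Lemma rho_le : cmod (rho_ A i) <= 3 * kk ^+ 2 * L ^+ 2 * (Gam / Ne).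
Proof.
rewrite /rho_; apply: le_trans (cmodD _ _) _; rewrite cmodN (cmodM (_ * _)) (cmodM c%:C%C).
rewrite (cmodM (_ * _)) (cmodM (u_ _ _ _) (up_ _ _)) !cmodX cmod_pos ?(ltW c0)//.
have k2 : cmod (k2_ A i) <= sp^-1 * (2 * L * Gam) / eta.
  by apply: le_trans (cmod_qf2 A i z0) _; rewrite ler_wpM2r ?invr_ge0 ?(ltW z0)// Im_q_le.
have uu : cmod (u_ A z i) ^+ 2 <= (sp * kk) ^+ 2.
  by rewrite lerXn2r ?nnegrE ?cmod_ge0 ?spkk0 ?u_le.
have b1 : c * cmod (u_ A z i) ^+ 2 * cmod (k2_ A i) <= c * (sp * kk) ^+ 2 * (sp^-1 * (2 * L * Gam) / eta).
  apply: ler_pM; rewrite ?mulr_ge0 ?sqr_ge0 ?cmod_ge0 ?(ltW c0)//.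
  by rewrite ler_wpM2l ?(ltW c0).
have b2 : cmod (u_ A z i) * cmod (up_ A i) * cmod (eps_ A i) ^+ 2 <= (sp * kk) * (sp * kk) * (sp^-1 * (L * Psi1)) ^+ 2.
  apply: ler_pM; rewrite ?mulr_ge0 ?sqr_ge0 ?cmod_ge0//.
    by apply: ler_pM; rewrite ?cmod_ge0 ?u_le ?up_le.
  by rewrite lerXn2r ?nnegrE ?cmod_ge0 ?mulr_ge0 ?spV0 ?Psi1_ge0 ?(ltW L0)// eps_le.
have e1 : c * (sp * kk) ^+ 2 * (sp^-1 * (2 * L * Gam) / eta) = 2 * kk ^+ 2 * L * (Gam / Ne).
  by rewrite /entry_var; field; rewrite !gt_eqF ?sp0 ?Nr0.
have e2 : (sp * kk) * (sp * kk) * (sp^-1 * (L * Psi1)) ^+ 2 = kk ^+ 2 * L ^+ 2 * (Gam / Ne).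
  by rewrite -Psi1_sqr; field; rewrite gt_eqF ?sp0.
rewrite e1 in b1; rewrite e2 in b2.
have G0 : 0 <= kk ^+ 2 * (Gam / Ne) by rewrite mulr_ge0 ?sqr_ge0 ?divr_ge0 ?ltW ?Gam0 ?Ne0.
have : L * (kk ^+ 2 * (Gam / Ne)) <= L ^+ 2 * (kk ^+ 2 * (Gam / Ne)).
  by rewrite ler_wpM2r// expr2 ler_peMl// ltW ?L0.
move: b1 b2; move: (Gam / Ne) => x; lra.
Qed.
Lemma spp_le : cmod (st A - spp_ A i) <= L * Psi1 / Ne * (kk + kk ^+ 2 * K3).
Proof.
rewrite spp_diff cmodN cmodM (natC R N) -fmorphV cmod_pos ?invr_ge0//.
have b1 : cmod (u_ A z i * (k2_ A i - t2_ A i)) <= (sp * kk) * (sp^-1 * (L * Psi1) / eta).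
  by rewrite cmodM; apply: ler_pM; rewrite ?cmod_ge0 ?u_le ?eps2_le.
have b2 : cmod (u_ A z i * up_ A i * eps_ A i * t2_ A i) <=
   (sp * kk) * (sp * kk) * (sp^-1 * (L * Psi1)) * (sp^-1 * K3 / eta).
  rewrite (cmodM _ (t2_ _ _)) (cmodM _ (eps_ _ _)) (cmodM (u_ _ _ _)); apply: ler_pM; rewrite ?mulr_ge0 ?cmod_ge0//.
    apply: ler_pM; rewrite ?mulr_ge0 ?cmod_ge0 ?eps_le//.
    by apply: ler_pM; rewrite ?cmod_ge0 ?u_le ?up_le.
  apply: le_trans t2_le _; rewrite ler_wpM2r ?invr_ge0 ?(ltW z0)//.
  by rewrite ler_wpM2l ?spV0// Gam_le.
have := cmodD (u_ A z i * (k2_ A i - t2_ A i)) (- (u_ A z i * up_ A i * eps_ A i * t2_ A i)).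
rewrite cmodN => h1.
apply: (@le_trans _ _ (N%:R^-1 * ((sp * kk) * (sp^-1 * (L * Psi1) / eta) + (sp * kk) * (sp * kk) * (sp^-1 * (L * Psi1)) * (sp^-1 * K3 / eta)))).
  rewrite ler_wpM2l ?invr_ge0//; lra.
rewrite le_eqVlt; apply/orP; left; apply/eqP; field.
by rewrite !gt_eqF ?sp0 ?Nr0.
Qed.

Hypothesis Im_zK : eta <= K * Im (m_phi phi z).
Local Notation B := (mp_gap phi z).
Local Notation T := (mp_poly phi z (st A)).
Local Notation a := (mp_a phi z).
(** Will dominate [Gam]. The square root reflects that [|T|] only controls the product of the
    distances of [st] to the two roots. *)
Definition QQ : R := B + Num.sqrt (cmod T) + Ne^-1.
Definition C1 : R := 2 + K + K ^+ 3.
Definition k1 : R := kk + kk ^+ 2 * K3.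
Definition C2 : R := K * (3 + 2 * K) + K * k1 * C1.
Definition Crow : R := 3 * kk ^+ 2 * C1 + k1 * C2 * K3 + kk * k1 * C2 * C1 + 1.

Lemma cmod_aE : cmod a = cmod z / sp.
Proof. by rewrite /mp_a cmodM cmodV cmod_pos ?(ltW sp0). Qed.
Lemma cmod_a_le : cmod a <= K.
Proof. by rewrite cmod_aE ler_pdivrMr ?sp0. Qed.
Lemma cmod_a_ge : 1 <= K * cmod a.
Proof. by rewrite cmod_aE mulrA ler_pdivlMr ?sp0// mul1r. Qed.
Lemma B_ge0 : 0 <= B. Proof. exact: cmod_ge0. Qed.
Lemma X_ge0 : 0 <= Ne^-1. Proof. by rewrite invr_ge0 ltW ?Ne0. Qed.
Lemma root_prod_le : cmod (st A - m_phi phi z) * cmod (st A - m_phi2 phi z) <= K * cmod T.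
Proof.
rewrite (mp_factor phi_ge1 _ z0) (cmodM _ (_ - m_phi2 _ _)) (cmodM a) -!mulrA mulrA.
by rewrite ler_peMl ?mulr_ge0 ?cmod_ge0 ?cmod_a_ge.
Qed.
(** Otherwise the distance to the second root would exceed [K * sqrt |T|], and the product of both
    distances would be larger than [root_prod_le] allows. *)
Lemma root_dist_le : cmod (st A - m_phi phi z) <= B + K * Num.sqrt (cmod T).
Proof.
have := root_prod_le; have sE : K * cmod T = K * Num.sqrt (cmod T) ^+ 2 by rewrite sqr_sqrtr ?cmod_ge0.
have := cmodD (st A - m_phi2 phi z) (m_phi2 phi z - m_phi phi z).
have -> : st A - m_phi2 phi z + (m_phi2 phi z - m_phi phi z) = st A - m_phi phi z by ring.
rewrite [cmod (m_phi2 _ _ - _)]cmodB -/B sE; have := B_ge0; have := sqrtr_ge0 (cmod T).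
have := cmod_ge0 (st A - m_phi2 phi z); move: (cmod _) (cmod _) (Num.sqrt _) B => x y r b y0 r0 b0 xy h.
rewrite leNgt; apply/negP => xb.
have yr : K * r < y by lra.
have Kr : 0 <= K * r by rewrite mulr_ge0 ?(ltW K0).
have : K * r * (K * r) <= y * (K * r) by rewrite ler_wpM2r// ltW.
have : y * (K * r) < y * x by rewrite ltr_pM2l; lra.
have : K * r ^+ 2 <= K * r * (K * r).
  by rewrite [leRHS](_ : _ = K * (K * r ^+ 2)) ?ler_peMl// ?mulr_ge0 ?sqr_ge0 ?(ltW K0)//; ring.
lra.
Qed.
Lemma C1_ge : 2 <= C1.
Proof. by rewrite /C1 -addrA lerDl addr_ge0 ?exprn_ge0 ?(ltW K0). Qed.
(** [Im (st A)] is at most [Im m_phi] plus the distance to that root, and [Im m_phi] is at most the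
    gap; [Im z] is comparable to it or smaller. *)
Lemma Gam_Q : Gam <= C1 * QQ.
Proof.
have h1 : Im (st A) <= Im (m_phi phi z) + (B + K * Num.sqrt (cmod T)).
  rewrite -lerBlDl -cImB; apply: le_trans (Im_le_cmod _) _; exact: root_dist_le.
have h2 : Im (m_phi phi z) <= B := mp_gap_ge_Im phi_ge1 z0.
have h3 : K ^+ 2 * eta <= K ^+ 3 * B.
  apply: (@le_trans _ _ (K ^+ 2 * (K * B))); last by rewrite mulrA -exprSr.
  rewrite ler_wpM2l ?sqr_ge0//; apply: le_trans Im_zK _.
  by rewrite ler_wpM2l ?(ltW K0).
have := X_ge0; have := B_ge0; have := sqrtr_ge0 (cmod T); move: h1 h2 h3; rewrite /Gam /C1 /QQ.
have : 0 <= K ^+ 3 by rewrite exprn_ge0 ?(ltW K0).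
have := K0; move: (Im (st A)) (Im (m_phi phi z)) (K ^+ 2 * eta) B (Num.sqrt _) (Ne^-1) (K ^+ 3).
move=> x y w b r X k3 k0 k30 h1 h2 h3 r0 b0 X0.
have := mulr_ge0 (ltW k0) b0; have := mulr_ge0 (ltW k0) X0.
have := mulr_ge0 k30 r0; have := mulr_ge0 k30 X0; lra.
Qed.
Lemma Q_ge0 : 0 <= QQ. Proof. by rewrite !addr_ge0 ?B_ge0 ?X_ge0 ?sqrtr_ge0. Qed.
Lemma k1_ge0 : 0 <= k1.
Proof.
rewrite /k1; apply: addr_ge0; first exact: ltW kk0.
by apply: mulr_ge0; [exact: sqr_ge0|exact: le_trans K3_ge1].
Qed.
Lemma C2_ge0 : 0 <= C2.
Proof.
have h := ltW K0; have h1 : 0 <= C1 := le_trans (ler0n _ 2) C1_ge.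
by apply: addr_ge0; apply: mulr_ge0 => //; [rewrite addr_ge0// mulr_ge0|apply: mulr_ge0 => //; exact: k1_ge0].
Qed.
Lemma LPsiX : L * Psi1 / Ne * k1 <= L * k1 * C1 * QQ.
Proof.
rewrite -mulrA; apply: (@le_trans _ _ (L * Psi1 * (1 * k1))).
  rewrite ler_wpM2l ?mulr_ge0 ?(ltW L0) ?Psi1_ge0// ler_wpM2r ?k1_ge0//.
  by rewrite invf_le1 ?Ne1 ?Ne0.
rewrite mul1r [leRHS](_ : _ = L * (C1 * QQ) * k1); last by ring.
rewrite ler_wpM2r ?k1_ge0// ler_wpM2l ?(ltW L0)//; exact: le_trans Psi1_leGam Gam_Q.
Qed.
(** The derivative of the polynomial at [st] is [a] times [2 (st - m_phi) + (m_phi - m_phi2)], hence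
    of the order of the gap. This is how the gap enters the final rate. *)
Lemma der_le : cmod (2 * a * st A + mp_b phi z - a * (st A - spp_ A i)) <= C2 * L * QQ.
Proof.
have [_ e] := mp_roots phi_ge1 z0.
have -> : 2 * a * st A + mp_b phi z - a * (st A - spp_ A i) =
   a * (2 * (st A - m_phi phi z) + (m_phi phi z - m_phi2 phi z) - (st A - spp_ A i)).
  rewrite [RHS]mulrBr [X in _ = X - _]mulrDr e; ring.
rewrite cmodM; apply: (@le_trans _ _ (K * (2 * (B + K * Num.sqrt (cmod T)) + B + L * k1 * C1 * QQ))).
  apply: ler_pM; rewrite ?cmod_ge0 ?cmod_a_le//.
  apply: le_trans (cmodD _ _) _; rewrite cmodN; apply: lerD; last exact: le_trans spp_le LPsiX.
  apply: le_trans (cmodD _ _) _; rewrite lerD2r cmodM cmod_nat ler_wpM2l//; exact: root_dist_le.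
have b1 : 2 * (B + K * Num.sqrt (cmod T)) + B <= (3 + 2 * K) * L * QQ.
  apply: (@le_trans _ _ ((3 + 2 * K) * QQ)); last first.
    by rewrite ler_wpM2r ?Q_ge0// ler_peMr// addr_ge0// mulr_ge0// ltW ?K0.
  have := X_ge0; have := B_ge0; have := sqrtr_ge0 (cmod T); rewrite /QQ.
  have := K0; move: B (Num.sqrt _) (Ne^-1) => b r X k0 r0 b0 X0.
  have := mulr_ge0 (ltW k0) b0; have := mulr_ge0 (ltW k0) X0; lra.
rewrite [leRHS](_ : _ = K * ((3 + 2 * K) * L * QQ + L * k1 * C1 * QQ)); last by rewrite /C2; ring.
by rewrite ler_wpM2l ?(ltW K0)// lerD2r.
Qed.
Definition dd : C := T - mp_poly phi z (spp_ A i).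
Lemma dd_le : cmod dd <= L * Psi1 / Ne * k1 * (C2 * L * QQ).
Proof. by rewrite /dd poly_diff cmodM; apply: ler_pM; rewrite ?cmod_ge0 ?der_le// spp_le. Qed.
Lemma Crow_parts : [/\ 3 * kk ^+ 2 * C1 <= Crow, k1 * C2 * K3 <= Crow, kk * k1 * C2 * C1 <= Crow & 1 <= Crow].
Proof.
have := sqr_ge0 kk; have := K3_ge1; have c1 := C1_ge; have := C2_ge0; have := k1_ge0; have := kk0.
move=> p1 p2 p3 p4 p5.
have q1 : 0 <= kk ^+ 2 * C1 by apply: mulr_ge0 => //; lra.
have q2 : 0 <= k1 * C2 * K3 by apply: mulr_ge0; [apply: mulr_ge0|lra].
have q3 : 0 <= kk * k1 * C2 * C1 by apply: mulr_ge0; [apply: mulr_ge0 => //; apply: mulr_ge0; lra|lra].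
rewrite /Crow; split; lra.
Qed.
Definition WW : R := Crow * (L ^+ 2 * (QQ / Ne)).
(** One size [WW] serves all three errors. In the product the factors [Psi1] combine to
    [Gam / (N eta)], and [Gam_Q] turns this into a second factor [QQ / (N eta)]. *)
Lemma row_W : [/\ cmod (rho_ A i) <= WW, cmod dd <= WW & cmod (zeta_ A i) * cmod dd <= WW ^+ 2].
Proof.
have [c1 c2 c3 c4] := Crow_parts; have q0 := Q_ge0; have x0 := X_ge0; have l0 := ltW L0.
have cc : 0 <= Crow by apply: le_trans c4.
have QX : 0 <= QQ / Ne by rewrite mulr_ge0.
have LQX : 0 <= L ^+ 2 * (QQ / Ne) by rewrite mulr_ge0 ?sqr_ge0.
split.
- apply: le_trans rho_le _; rewrite /WW.
  apply: (@le_trans _ _ (3 * kk ^+ 2 * L ^+ 2 * (C1 * QQ / Ne))).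
    apply: ler_wpM2l; last by apply: ler_wpM2r => //; exact: Gam_Q.
    by apply: mulr_ge0; [apply: mulr_ge0 => //|]; exact: sqr_ge0.
  by rewrite [leLHS](_ : _ = 3 * kk ^+ 2 * C1 * (L ^+ 2 * (QQ / Ne))) ?ler_wpM2r//; ring.
- apply: le_trans dd_le _; rewrite /WW.
  rewrite [leLHS](_ : _ = k1 * C2 * Psi1 * (L ^+ 2 * (QQ / Ne))); last by ring.
  rewrite ler_wpM2r//; apply: le_trans c2; rewrite ler_wpM2l ?mulr_ge0 ?k1_ge0 ?C2_ge0//.
  exact: le_trans Psi1_leGam Gam_le.
- apply: (@le_trans _ _ ((kk * (L * Psi1)) * (L * Psi1 / Ne * k1 * (C2 * L * QQ)))).
    by apply: ler_pM; rewrite ?cmod_ge0 ?zeta_le ?dd_le.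
  rewrite [leLHS](_ : _ = kk * k1 * C2 * (L ^+ 3 * (Psi1 ^+ 2 * (QQ / Ne)))); last by ring.
  rewrite Psi1_sqr.
  apply: (@le_trans _ _ (kk * k1 * C2 * (L ^+ 4 * (C1 * QQ / Ne * (QQ / Ne))))).
    apply: ler_wpM2l.
      by apply: mulr_ge0; [apply: mulr_ge0; [exact: ltW kk0|exact: k1_ge0]|exact: C2_ge0].
    apply: ler_pM; first exact: exprn_ge0.
    - by apply: mulr_ge0 => //; apply: mulr_ge0 => //; exact: ltW Gam0.
    - by rewrite ler_weXn2l.
    - by apply: ler_wpM2r => //; apply: ler_wpM2r => //; exact: Gam_Q.
  rewrite [leLHS](_ : _ = kk * k1 * C2 * C1 * (L ^+ 2 * (QQ / Ne)) ^+ 2); last by ring.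
  rewrite /WW [leRHS]exprMn ler_wpM2r ?sqr_ge0//; apply: le_trans c3 _.
  by rewrite expr2 ler_peMl.
Qed.
End RowBounds.
End SelfConsistent.

(** * Deterministic descent along a sequence of spectral parameters *)

Section Grid.
Variable R : realType.
Local Notation Re := (@complex.Re R).
Local Notation Im := (@complex.Im R).
Local Notation C := R[i].
Variables N M : nat.
Hypothesis N0 : (0 < N)%N.
Hypothesis NM : (N <= M)%N.
Local Notation phi := (mp_ratio R N M).
Local Notation sp := (Num.sqrt phi).
Local Notation c := (entry_var R N M).

(** Admissible spectral parameters, uniformly in [phi]: [|z|] is comparable to [sqrt phi], [z] stays
    at bounded distance from the centre of the spectrum (through [mp_b]), and [Im z] is at most a
    multiple of [Im m_phi]. *)
Definition zdom (K : R) (z : C) : Prop :=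
  [/\ 0 < Im z, cmod z <= K * sp, sp <= K * cmod z, Im z <= K &
      cmod (mp_b phi z) <= K /\ Im z <= K * Im (m_phi phi z)].

Definition ld_ok (L : R) (z : C) (A : 'M[C]_(N, M)) : Prop := forall i,
  cmod (eps_ z A i) <= L * (c * Num.sqrt (hs (resR (rowz i A) z))) /\
  cmod (k2_ z A i - t2_ z A i) <= L * (c * Num.sqrt (hs (resR (rowz i A) z *m resR (rowz i A) z))).

Definition bnd (K1 : R) (z : C) (A : 'M[C]_(N, M)) : Prop :=
  cmod (st z A) <= K1 /\ K1^-1 <= cmod (Yt z A).

(** [qg_le] averaged over the rows. The constant is now [256 K1^2 K^2 = (8 kk)^2], so both parts of
    the bound are at most [1 / (8 kk)] and each summand is at most [1/4]. *)
Lemma weak_law (K K1 L : R) z A : 1 <= K -> 1 <= K1 -> 1 <= L -> zdom K z -> bnd K1 z A ->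
  ld_ok L z A -> 256 * K1 ^+ 2 * K ^+ 2 * K3 K K1 * L ^+ 2 <= N%:R * Im z ->
  cmod (mp_poly phi z (st z A)) <= 4^-1.
Proof.
move=> K_ge1 K1_ge1 L_ge1 [z0 zK Kz etaK [bK imK]] [sK YK] ld small.
have k3 : 1 <= K3 K K1 by apply: (@K3_ge1 R K K1).
have pos : 0 <= K1 ^+ 2 * K ^+ 2 * K3 K K1 * L ^+ 2.
  apply: mulr_ge0; last exact: sqr_ge0.
  by apply: mulr_ge0; [apply: mulr_ge0; exact: sqr_ge0|exact: le_trans k3].
have small' : 16 * K1 ^+ 2 * K ^+ 2 * K3 K K1 * L ^+ 2 <= N%:R * Im z.
  by apply: le_trans small; rewrite -!mulrA !mulrA; lra.
have NC : 0 < N%:R :> R by rewrite ltr0n.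
have Ne0 : 0 < N%:R * Im z by rewrite mulr_gt0.
have kk0 : 0 < kk K K1 by apply: kk0.
have kk8 : 0 < 8 * kk K K1 by apply: mulr_gt0.
have key (i : 'I_N) : cmod (u_ A z i * (q_ A z i - gt z A)) <= 4^-1.
  have [l1 l2] := ld i.
  apply: le_trans (qg_le N0 NM z0 K_ge1 K1_ge1 L_ge1 zK Kz etaK sK YK l1 small') _.
  have b1 : L * Psi1 z K A <= (8 * kk K K1)^-1.
    apply: le_of_sqr; first by rewrite invr_ge0 mulr_ge0// ltW.
    rewrite exprMn Psi1_sqr// exprVn mulrA ler_pdivrMr// ler_pdivlMl ?exprn_gt0//.
    apply: le_trans small.
    have -> : (8 * kk K K1) ^+ 2 * (L ^+ 2 * Gam z K A) = 256 * K1 ^+ 2 * K ^+ 2 * L ^+ 2 * Gam z K A.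
      by rewrite /kk; ring.
    rewrite [leRHS](_ : _ = 256 * K1 ^+ 2 * K ^+ 2 * L ^+ 2 * K3 K K1); last by ring.
    apply: ler_wpM2l.
      by apply: mulr_ge0; [apply: mulr_ge0; [apply: mulr_ge0 => //|]|]; exact: sqr_ge0.
    exact: (Gam_le N0 z0 K_ge1 K1_ge1 L_ge1 etaK sK small').
  have b2 : (N%:R * Im z)^-1 <= (8 * kk K K1)^-1.
    rewrite lef_pV2 ?posrE//; apply: le_trans small.
    have k1 : 1 <= K1 * K by rewrite mulr_ege1.
    have k2 : 1 <= K1 * K * (K3 K K1 * L ^+ 2) by rewrite mulr_ege1// mulr_ege1// exprn_ege1.
    have -> : 8 * kk K K1 = 16 * (K1 * K) by rewrite /kk; ring.
    rewrite [leRHS](_ : _ = 256 * (K1 * K) * (K1 * K * (K3 K K1 * L ^+ 2))); last by ring.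
    have kp : 0 <= K1 * K := le_trans ler01 k1.
    apply: (@le_trans _ _ (256 * (K1 * K) * 1)); first by rewrite mulr1 ler_wpM2r// ler_nat.
    by apply: ler_wpM2l => //; exact: mulr_ge0.
  apply: (@le_trans _ _ (kk K K1 * ((8 * kk K K1)^-1 + (8 * kk K K1)^-1))).
    by apply: ler_wpM2l; [exact: ltW|exact: lerD].
  rewrite le_eqVlt; apply/orP; left; apply/eqP; field; rewrite gt_eqF//.
have := self_consistent N0 NM z0 A => /(congr1 (@cmod R)); rewrite cmodM cmod_nat => e.
rewrite -(ler_pM2l NC) e; apply: le_trans (cmod_sum _ _ _) _.
apply: le_trans (ler_sum _ (fun i _ => key i)) _.
by rewrite sumr_const card_ord mulr_natl.
Qed.

(** A large [s] is excluded by the leading coefficient; and [s (b + a s)], being the polynomial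
    minus 1, has modulus at least [3/4]. With [K1 = 2 K (K + 2)] both conclusions are strictly
    better than [bnd K1], which pays for the next grid step. *)
Lemma poly_bnd (K : R) (a b s : C) : 1 <= K -> 1 <= K * cmod a -> cmod b <= K ->
  cmod (a * s ^+ 2 + b * s + 1) <= 4^-1 ->
  cmod s <= K * (K + 2) /\ 3 / 2 * (2 * K * (K + 2))^-1 <= cmod (b + a * s).
Proof.
move=> K1 aK bK h; have K0 : 0 < K by lra.
have sb : cmod s <= K * (K + 2).
  have [s1|s1] := leP (cmod s) 1; first by nra.
  have h1 : cmod (a * s ^+ 2) <= 4^-1 + (K * cmod s + 1).
    have := cmodB (a * s ^+ 2 + b * s + 1) (b * s + 1).
    have := cmodD (a * s ^+ 2 + b * s + 1) (- (b * s + 1)).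
    have -> : a * s ^+ 2 + b * s + 1 - (b * s + 1) = a * s ^+ 2 by ring.
    rewrite cmodN; have := cmodD (b * s) 1; rewrite cmodM (cmod_nat R 1).
    have : cmod b * cmod s <= K * cmod s by rewrite ler_wpM2r// cmod_ge0.
    lra.
  rewrite cmodM cmodX in h1; have := cmod_ge0 a; move: (cmod a) (cmod s) aK s1 h1 => x y ax y1 h1 x0.
  have y2 : y ^+ 2 <= K * x * y ^+ 2 by rewrite ler_peMl ?sqr_ge0.
  have : K * (x * y ^+ 2) <= K * (4^-1 + (K * y + 1)) by rewrite ler_wpM2l// ltW.
  rewrite mulrA => h2; have h3 := le_trans y2 h2.
  rewrite -(ler_pM2r (lt_trans ltr01 y1)) -expr2; apply: le_trans h3 _; nra.
split=> //; have s0 : 0 < cmod s.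
  rewrite lt_neqAle cmod_ge0 andbT eq_sym; apply/eqP => s0.
  move: h; have /eqP := s0; rewrite cmod_eq0 => /eqP ->.
  by rewrite expr0n /= !mulr0 !add0r (cmod_nat R 1); lra.
have h1 : 3 / 4 <= cmod s * cmod (b + a * s).
  rewrite -cmodM; have := cmodB_ge 1 (a * s ^+ 2 + b * s + 1).
  have -> : 1 - (a * s ^+ 2 + b * s + 1) = - (s * (b + a * s)) by ring.
  by rewrite cmodN (cmod_nat R 1); lra.
have kp : 0 < K * (K + 2) by nra.
rewrite -(ler_pM2l kp); apply: (@le_trans _ _ (3 / 4)).
  by rewrite le_eqVlt; apply/orP; left; apply/eqP; field; rewrite !gt_eqF//; lra.
apply: le_trans h1 _; rewrite ler_wpM2r ?cmod_ge0//.
Qed.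

Variables (A : 'M[C]_(N, M)) (zz : nat -> C).

(** Bootstrap: [bnd] gives the weak law, the weak law improves [bnd] through [poly_bnd], and
    continuity carries it to the next point. It starts from the trivial resolvent bounds where
    [Im z] is at least 1. *)
Lemma phase1 (K L : R) n : let K1 := 2 * K * (K + 2) in 1 <= K -> 1 <= L ->
  (forall k, (k <= n)%N -> [/\ zdom K (zz k), ld_ok L (zz k) A &
     256 * K1 ^+ 2 * K ^+ 2 * K3 K K1 * L ^+ 2 <= N%:R * Im (zz k)]) ->
  1 <= Im (zz 0) ->
  (forall k, (k < n)%N -> cmod (st (zz k) A - st (zz k.+1) A) <= 1 /\
     cmod (Yt (zz k) A - Yt (zz k.+1) A) <= (2 * K1)^-1) ->
  forall k, (k <= n)%N -> bnd K1 (zz k) A.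
Proof.
move=> K1 K_ge1 L_ge1 hz base step.
have K1p : 1 <= K1 by rewrite /K1; nra.
elim=> [_|k IH kn].
  have [[z0 _ _ _ _] _ _] := hz 0 (leq0n _); split.
    by apply: le_trans (cmod_st_le N0 z0 A) _; apply: le_trans K1p; rewrite invf_le1.
  apply: (@le_trans _ _ 1); first by rewrite invf_le1//; apply: lt_le_trans K1p.
  apply: le_trans base _; apply: le_trans (Im_Yt N0 NM z0 A) _; exact: Im_le_cmod.
have [h1 h2 h3] := hz k (ltnW kn); have b := IH (ltnW kn).
have t4 := weak_law K_ge1 K1p L_ge1 h1 b h2 h3.
have [z0 zK Kz etaK [bK imK]] := h1.
have [sk yk] := poly_bnd K_ge1 (cmod_a_ge N0 NM Kz) bK t4.
have [d1 d2] := step k kn; split.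
  have := cmodD (st (zz k) A) (- (st (zz k) A - st (zz k.+1) A)).
  have -> : st (zz k) A - (st (zz k) A - st (zz k.+1) A) = st (zz k.+1) A by ring.
  rewrite cmodN; have : K * (K + 2) + 1 <= K1 by rewrite /K1; nra.
  lra.
have := cmodB_ge (Yt (zz k) A) (Yt (zz k) A - Yt (zz k.+1) A).
have arith (x y w v : R) : 3 / 2 * v <= x -> y <= 2^-1 * v -> x - y <= w -> v <= w by lra.
have -> : Yt (zz k) A - (Yt (zz k) A - Yt (zz k.+1) A) = Yt (zz k.+1) A by ring.
move: yk d2; rewrite -YtE// -/K1 (invfM 2); exact: arith.
Qed.

(* The larger of [x], [y] is at least [b / 2], which bounds the smaller one. *)
Lemma near_root (l x y b X : R) : 1 <= l -> 0 <= x -> 0 <= y -> 0 <= X -> b <= x + y ->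
  x * y <= l * (b * X + X ^+ 2) -> x <= 4 * l * X \/ y <= 4 * l * X.
Proof.
move=> l1 x0 y0 X0 bxy xy.
have [h1|h1] := leP x (4 * l * X); first by left.
have [h2|h2] := leP y (4 * l * X); first by right.
have lX : X <= l * X by rewrite ler_peMl.
have key (u v : R) : 4 * l * X < u -> 4 * l * X < v -> u <= v -> u * v = x * y -> u + v = x + y -> False.
  move=> hu hv uv e1 e2.
  have v0 : 0 < v by apply: le_lt_trans hv; rewrite !mulr_ge0//; lra.
  have e3 : 4 * l * X * v < x * y by rewrite -e1 ltr_pM2r.
  have e4 : l * X * b <= l * X * (2 * v) by rewrite ler_wpM2l ?mulr_ge0//; lra.
  have e5 : l * X * X <= l * X * v by rewrite ler_wpM2l ?mulr_ge0//; lra.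
  nra.
have [xy1|xy1] := leP x y; first by have := key x y h1 h2 xy1 erefl erefl.
by have := key y x h2 h1 (ltW xy1) (mulrC _ _) (addrC _ _).
Qed.

Lemma phase3 (K l : R) n : 1 <= K -> 1 <= l ->
  (forall k, (k <= n)%N -> zdom K (zz k)) ->
  (forall k, (k < n)%N -> Im (zz k.+1) <= Im (zz k) /\ Re (zz k.+1) = Re (zz k)) ->
  (forall k, (k <= n)%N -> K * cmod (mp_poly phi (zz k) (st (zz k) A)) <=
     l * (mp_gap phi (zz k) * (N%:R * Im (zz k))^-1 + (N%:R * Im (zz k))^-1 ^+ 2)) ->
  6 <= Im (zz 0) -> cmod (mp_a phi (zz 0)) <= 2 * Im (zz 0) ->
  12 * l * (N%:R * Im (zz 0))^-1 < 1 ->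
  (forall k, (k < n)%N -> cmod (st (zz k) A - st (zz k.+1) A) + cmod (m_phi phi (zz k) - m_phi phi (zz k.+1))
     < 2 * l * (N%:R * Im (zz k.+1))^-1) ->
  cmod (st (zz n) A - m_phi phi (zz n)) <= 14 * l * (N%:R * Im (zz n))^-1.
Proof.
move=> K_ge1 l1 hz mono hT base6 base_a base_X step.
have NC : 0 < N%:R :> R by rewrite ltr0n.
have phi1 := phi_ge1 R N0 NM.
pose X k := (N%:R * Im (zz k))^-1.
pose x k := cmod (st (zz k) A - m_phi phi (zz k)).
pose y k := cmod (st (zz k) A - m_phi2 phi (zz k)).
have Im0 k : (k <= n)%N -> 0 < Im (zz k) by move=> /hz[].
have X0 k : (k <= n)%N -> 0 < X k by move=> /Im0 h; rewrite invr_gt0 mulr_gt0.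
have tri k : mp_gap phi (zz k) <= x k + y k.
  rewrite /mp_gap /x /y (cmodB (st _ _) (m_phi _ _)); apply: le_trans (cmodD _ _).
  by rewrite addrA subrK.
have near k : (k <= n)%N -> x k <= 4 * l * X k \/ y k <= 4 * l * X k.
  move=> kn; have [z0 zK Kz _ _] := hz k kn.
  apply: (near_root l1 (cmod_ge0 _) (cmod_ge0 _) (ltW (X0 k kn)) (tri k)).
  by apply: le_trans (root_prod_le N0 NM z0 A Kz) (hT k kn).
(* With a small gap at the endpoint both roots are acceptable: [14 = 4 + 10]. Only for a large gap
   must the right root be followed. *)
have [small|big] := ltP (mp_gap phi (zz n)) (10 * l * X n).
  have [h|h] := near n (leqnn n).
    apply: le_trans h _; rewrite ler_wpM2r ?(ltW (X0 n _))//; lra.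
  have : x n <= y n + mp_gap phi (zz n).
    rewrite /mp_gap /x /y (cmodB (m_phi _ _)); apply: le_trans (cmodD _ _).
    by rewrite addrA subrK.
  rewrite /x -/(X n); move: h small; lra.
have mono_le j k : (k + j <= n)%N -> Im (zz (k + j)) <= Im (zz k) /\ Re (zz (k + j)) = Re (zz k).
  elim: j => [|j IHj] h; first by rewrite addn0.
  rewrite addnS in h *; have [m1 m2] := mono _ h; have [i1 i2] := IHj (ltnW h).
  by split; [exact: le_trans m1 i1|rewrite m2].
(* A large gap at the endpoint is large at every earlier point, since both [eta * gap] and
   [eta * X = 1 / N] can be compared along the grid. *)
have gapB k : (k <= n)%N -> 10 * l * X k <= mp_gap phi (zz k).
  move=> kn; have := mono_le (n - k)%N k; rewrite subnKC// => /(_ (leqnn n))[i1 i2].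
  have := mp_gap_mono phi1 (Re (zz k)) (Im0 n (leqnn n)) i1.
  rewrite -{1}i2 => h.
  have e j : zz j = Complex (Re (zz j)) (Im (zz j)) by case: (zz j).
  rewrite -!e in h.
  rewrite -(ler_pM2l (Im0 k kn)); apply: le_trans h.
  have : Im (zz n) * (10 * l * X n) <= Im (zz n) * mp_gap phi (zz n) by rewrite ler_pM2l ?Im0.
  apply: le_trans; rewrite le_eqVlt; apply/orP; left; apply/eqP; rewrite /X; field.
  by rewrite !gt_eqF ?Im0.
suff : forall k, (k <= n)%N -> x k <= 4 * l * X k.
  move=> /(_ n (leqnn n)) h; apply: le_trans h _; rewrite ler_wpM2r ?(ltW (X0 n _))//; lra.
elim=> [_|k IH kn].
  (* At the top [st] and [m_phi] have modulus at most [1/6], while the product of the roots forces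
     [|m_phi2|] to be at least [1/2]; so [st] cannot be near the second root. *)
  have [//|y0] := near 0 (leq0n n); exfalso.
  have z0 := Im0 0 (leq0n n); have [mm _] := mp_roots phi1 z0.
  have := congr1 (@cmod R) mm; rewrite (cmod_nat R 1) 2!cmodM => e.
  have m6 := cmod_m_le phi1 z0; have s6 := cmod_st_le N0 z0 A.
  have m2ge : 2^-1 <= cmod (m_phi2 phi (zz 0)).
    have am : cmod (mp_a phi (zz 0)) * cmod (m_phi phi (zz 0)) <= 2.
      apply: (@le_trans _ _ (2 * Im (zz 0) * (Im (zz 0))^-1)); last by rewrite mulfK ?gt_eqF.
      by apply: ler_pM; rewrite ?cmod_ge0.
    have : cmod (mp_a phi (zz 0)) * cmod (m_phi phi (zz 0)) * cmod (m_phi2 phi (zz 0)) <= 2 * cmod (m_phi2 phi (zz 0)).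
      by rewrite ler_wpM2r ?cmod_ge0.
    rewrite e; lra.
  have e6 : (Im (zz 0))^-1 <= 6^-1 by rewrite lef_pV2 ?posrE.
  have := cmodB_ge (m_phi2 phi (zz 0)) (st (zz 0) A); rewrite cmodB -/(y 0).
  move: y0; rewrite /X; move: (_^-1) base_X e6 s6 => w; nra.
(* Switching roots within one step would give a gap below [(4 + 2) + 4 = 10] times [l * X],
   contradicting [gapB]. *)
have [//|yk] := near k.+1 kn; exfalso.
have xk := IH (ltnW kn); have b := gapB _ kn; have st_ := step k kn.
have Xk : X k <= X k.+1.
  have [i1 _] := mono k kn; rewrite lef_pV2 ?posrE ?mulr_gt0 ?Im0// ?(ltnW kn)//.
  by rewrite ler_pM2l.
have t1 := tri k.+1.
have : x k.+1 <= x k + (cmod (st (zz k) A - st (zz k.+1) A) + cmod (m_phi phi (zz k) - m_phi phi (zz k.+1))).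
  rewrite /x; have -> : st (zz k.+1) A - m_phi phi (zz k.+1) = (st (zz k) A - m_phi phi (zz k)) +
      (- (st (zz k) A - st (zz k.+1) A) + (m_phi phi (zz k) - m_phi phi (zz k.+1))) by ring.
  apply: le_trans (cmodD _ _) _; rewrite lerD2l; apply: le_trans (cmodD _ _) _.
  by rewrite cmodN.
have : l * X k <= l * X k.+1 by rewrite ler_wpM2l//; lra.
move: st_; rewrite -/(X k.+1); lra.
Qed.
End Grid.

(** * The grid and the continuity estimates on it *)

Section GridPoints.
Variable R : realType.
Local Notation Re := (@complex.Re R).
Local Notation Im := (@complex.Im R).
Local Notation C := R[i].
Variables N M : nat.
Hypothesis N0 : (0 < N)%N.
Hypothesis NM : (N <= M)%N.
Local Notation phi := (mp_ratio R N M).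
Local Notation sp := (Num.sqrt phi).

Definition zgrid (E e0 e1 : R) (n k : nat) : C := Complex E (e0 - (e0 - e1) * (k%:R / n%:R)).

Lemma zgrid_end E e0 e1 n : (0 < n)%N -> zgrid E e0 e1 n n = Complex E e1.
Proof. by move=> n0; rewrite /zgrid divff ?pnatr_eq0 -?lt0n// mulr1 opprB addrC subrK. Qed.
Lemma zgrid_start E e0 e1 n : zgrid E e0 e1 n 0 = Complex E e0.
Proof. by rewrite /zgrid mul0r mulr0 subr0. Qed.
Lemma zgrid_Im E e0 e1 n k : e1 <= e0 -> (0 < n)%N -> (k <= n)%N ->
  e1 <= Im (zgrid E e0 e1 n k) <= e0.
Proof.
move=> e10 n0 kn /=; have n0' : 0 < n%:R :> R by rewrite ltr0n.
have h1 : k%:R / n%:R <= 1 :> R by rewrite ler_pdivrMr// mul1r ler_nat.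
have h0 : 0 <= k%:R / n%:R :> R by rewrite divr_ge0.
by apply/andP; split; nra.
Qed.
Lemma zgrid_mono E e0 e1 n k : e1 <= e0 -> (0 < n)%N ->
  Im (zgrid E e0 e1 n k.+1) <= Im (zgrid E e0 e1 n k) /\
  cmod (zgrid E e0 e1 n k - zgrid E e0 e1 n k.+1) = (e0 - e1) / n%:R.
Proof.
move=> e10 n0; have n0' : 0 < n%:R :> R by rewrite ltr0n.
have e : e0 - (e0 - e1) * (k%:R / n%:R) - (e0 - (e0 - e1) * (k.+1%:R / n%:R)) = (e0 - e1) / n%:R.
  by rewrite -natr1; field; rewrite gt_eqF.
have h : 0 <= (e0 - e1) / n%:R by rewrite divr_ge0// subr_ge0.
split; first by rewrite -subr_ge0 /= e.
by rewrite /cmod cReB cImB /= e subrr expr0n add0r sqrtr_sqr ger0_norm.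
Qed.

Lemma st_Lip A (z z' : C) : 0 < Im z -> 0 < Im z' ->
  cmod (st (N:=N) (M:=M) z A - st z' A) <= cmod (z - z') / (Im z * Im z').
Proof.
move=> z0 z0'; have NC : 0 < N%:R :> R by rewrite ltr0n.
rewrite /st !resG_resR -mulrBr cmodM (natC R N) -fmorphV cmod_pos ?invr_ge0//.
rewrite ler_pdivrMl//; apply: le_trans (resR_Lip _ z0 z0') _.
by rewrite le_eqVlt; apply/orP; left; apply/eqP; ring.
Qed.

Lemma Yt_Lip K A (z z' : C) : 0 < Im z -> 0 < Im z' -> cmod z' <= K * sp ->
  cmod (Yt (N:=N) (M:=M) z A - Yt z' A) <= cmod (z - z') * (1 + (Im z)^-1 + K / (Im z * Im z')).
Proof.
move=> z0 z0' zK; have phi1 := phi_ge1 R N0 NM; have s0 := sp0 R N0 NM; have s1 := sp1 R N0 NM.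
have -> : Yt z A - Yt z' A = (z - z') * (1 + sp^-1%:C%C * st z A) + mp_a phi z' * (st z A - st z' A).
  by rewrite !YtE// /mp_a /mp_b spVC//; ring.
apply: le_trans (cmodD _ _) _; rewrite [leRHS]mulrDr; apply: lerD.
  rewrite cmodM ler_wpM2l ?cmod_ge0//; apply: le_trans (cmodD _ _) _.
  rewrite (cmod_nat R 1) lerD2l cmodM cmod_pos ?invr_ge0 ?(ltW s0)//.
  apply: le_trans (cmod_st_le N0 z0 A); rewrite ler_piMl ?cmod_ge0//.
  by rewrite invf_le1.
rewrite cmodM mulrCA; apply: ler_pM; rewrite ?cmod_ge0//.
  by apply: (cmod_a_le N0 NM).
exact: st_Lip.
Qed.

Lemma grid_arith (K w : R) : 1 <= K -> 0 < w -> 48 * (1 + K) ^+ 4 * w <= 1 ->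
  [/\ K * w ^+ 4 <= 1, 3 * K ^+ 2 * w ^+ 4 <= (2 * (2 * K * (K + 2)))^-1 &
     K * w ^+ 4 + 12 * (1 + K) * K * w ^+ 3 < 2 * (w * K^-1)].
Proof.
move=> K1 w0 w48.
have K2 : 1 <= (1 + K) ^+ 4 by rewrite exprn_ege1//; lra.
have w1 : w <= 48^-1 by nra.
have w43 : w ^+ 4 <= w ^+ 3 by rewrite exprS ler_piMl ?exprn_ge0 ?(ltW w0)//; lra.
have w32 : w ^+ 3 <= w ^+ 2 by rewrite exprS ler_piMl ?exprn_ge0 ?(ltW w0)//; lra.
have w21 : w ^+ 2 <= w by rewrite expr2 ler_piMl ?(ltW w0)//; lra.
have w40 : 0 <= w ^+ 4 by rewrite exprn_ge0// ltW.
have w2 : w ^+ 2 <= 48^-1 * w by rewrite expr2 ler_wpM2r// ltW.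
have K4 : (1 + K) ^+ 4 = (1 + K) ^+ 2 * (1 + K) ^+ 2 by rewrite -exprD.
have KK : K <= K ^+ 2 by nra.
have K14 : 4 * K ^+ 2 <= (1 + K) ^+ 4 by rewrite K4; nra.
split.
- nra.
- have kp : 0 < 2 * (2 * K * (K + 2)) by nra.
  rewrite -[_^-1]mul1r ler_pdivlMr//.
  apply: (@le_trans _ _ (w * (48 * (1 + K) ^+ 4))); last by rewrite mulrC.
  have w4w : w ^+ 4 <= w by lra.
  have -> : 3 * K ^+ 2 * w ^+ 4 * (2 * (2 * K * (K + 2))) = w ^+ 4 * (12 * (K ^+ 3 * (K + 2))) by ring.
  apply: ler_pM => //; first by rewrite mulr_ge0// mulr_ge0 ?exprn_ge0//; lra.
  have : K ^+ 3 * (K + 2) <= (1 + K) ^+ 3 * (1 + K + 2).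
    by apply: ler_pM; rewrite ?exprn_ge0 ?lerXn2r ?nnegrE//; lra.
  have : (1 + K) ^+ 3 * (1 + K + 2) <= (1 + K) ^+ 3 * (3 * (1 + K)).
    by apply: ler_wpM2l; rewrite ?exprn_ge0//; lra.
  rewrite [in leRHS](_ : (1 + K) ^+ 3 * (3 * (1 + K)) = 3 * (1 + K) ^+ 4); last by ring.
  lra.
- have K0 : 0 < K by lra.
  rewrite mulrA ltr_pdivlMr//.
  have e1' : (K * w ^+ 4 + 12 * (1 + K) * K * w ^+ 3) * K <= 13 * (1 + K) ^+ 4 * w ^+ 2.
    have a1 : K ^+ 2 * w ^+ 4 <= (1 + K) ^+ 4 * w ^+ 2 by apply: ler_pM => //; nra.
    have a2 : (1 + K) * K ^+ 2 * w ^+ 3 <= (1 + K) ^+ 4 * w ^+ 2.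
      apply: ler_pM => //; [by rewrite mulr_ge0 ?sqr_ge0//; lra|by rewrite exprn_ge0// ltW|].
      by rewrite K4; nra.
    have -> : (K * w ^+ 4 + 12 * (1 + K) * K * w ^+ 3) * K = K ^+ 2 * w ^+ 4 + 12 * ((1 + K) * K ^+ 2 * w ^+ 3) by ring.
    lra.
  apply: le_lt_trans e1' _; have -> : 13 * (1 + K) ^+ 4 * w ^+ 2 = 13 / 48 * w * (48 * (1 + K) ^+ 4 * w) by field.
  have : 13 / 48 * w * (48 * (1 + K) ^+ 4 * w) <= 13 / 48 * w * 1.
    by rewrite ler_wpM2l// mulr_ge0// ltW.
  lra.
Qed.

(** The factor [M] in the number of steps absorbs [sqrt phi], and [N^6] absorbs the Lipschitz
    constants, which are powers of [1 / Im z], hence of [N]. *)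
Lemma grid_steps (K E e0 e1 : R) (A : 'M[C]_(N, M)) : let n := (N ^ 6 * M)%N in let zz := zgrid E e0 e1 n in
  1 <= K -> 0 < e1 -> e1 <= e0 -> e0 <= K -> 1 <= N%:R * e1 -> 48 * (1 + K) ^+ 4 <= N%:R ->
  (forall k, (k <= n)%N -> zdom N M K (zz k)) ->
  forall k, (k < n)%N -> [/\ cmod (st (zz k) A - st (zz k.+1) A) <= 1,
     cmod (Yt (zz k) A - Yt (zz k.+1) A) <= (2 * (2 * K * (K + 2)))^-1 &
     cmod (st (zz k) A - st (zz k.+1) A) + cmod (m_phi phi (zz k) - m_phi phi (zz k.+1))
     < 2 * (N%:R * Im (zz k.+1))^-1].
Proof.
move=> n zz K1 e10 e1e0 e0K Ne NK hz k kn.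
have NC : 0 < N%:R :> R by rewrite ltr0n.
have M0 : (0 < M)%N by exact: leq_trans NM.
have MC : 0 < M%:R :> R by rewrite ltr0n.
have n0 : (0 < n)%N by rewrite muln_gt0 expn_gt0 N0.
have [i1 hE] := zgrid_mono E k e1e0 n0.
have /andP[l1 u1] := zgrid_Im E e1e0 n0 (ltnW kn).
have /andP[l2 u2] := zgrid_Im E e1e0 n0 kn.
have [z0 zK Kz etaK _] := hz k (ltnW kn); have [z0' zK' Kz' etaK' _] := hz k.+1 kn.
have NV : N%:R^-1 <= e1 by rewrite -[_^-1]mul1r ler_pdivrMr// mulrC.
have s0 := sp0 R N0 NM; have s1 := sp1 R N0 NM.
have spM : sp <= M%:R.
  apply: (@le_trans _ _ (sp ^+ 2)); first by rewrite expr2 ler_peMr// ltW.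
  rewrite expr2 spsp// ler_pdivrMr// ler_peMr ?(ltW MC)// ler1n //.
pose h := cmod (zz k - zz k.+1).
have h0 : 0 <= h := cmod_ge0 _.
have hM : h * M%:R <= K * N%:R^-1 ^+ 6.
  rewrite /h hE /n natrM natrX.
  rewrite [leLHS](_ : _ = (e0 - e1) * N%:R^-1 ^+ 6); last by rewrite exprVn; field; rewrite !gt_eqF.
  by rewrite ler_wpM2r ?exprn_ge0 ?invr_ge0//; lra.
have h1 : h <= K * N%:R^-1 ^+ 6.
  by apply: le_trans hM; rewrite ler_peMr// ler1n.
have hs : h * sp <= K * N%:R^-1 ^+ 6.
  by apply: le_trans hM; rewrite ler_wpM2l.
pose w : R := N%:R^-1; rewrite -/w in hM h1 hs NV.
have w0 : 0 < w by rewrite invr_gt0.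
have wN : w * N%:R = 1 by rewrite mulVf ?gt_eqF.
have wz : (Im (zz k))^-1 <= N%:R.
  by rewrite -[N%:R]invrK lef_pV2 ?posrE//; apply: le_trans l1.
have wz' : (Im (zz k.+1))^-1 <= N%:R.
  by rewrite -[N%:R]invrK lef_pV2 ?posrE//; apply: le_trans l2.
have N1 : 1 <= N%:R :> R by rewrite ler1n.
have wzz : (Im (zz k) * Im (zz k.+1))^-1 <= N%:R ^+ 2.
  by rewrite invfM expr2; apply: ler_pM; rewrite ?invr_ge0 ?(ltW z0) ?(ltW z0').
have ds : cmod (st (zz k) A - st (zz k.+1) A) <= K * w ^+ 4.
  apply: le_trans (st_Lip A z0 z0') _.
  apply: (@le_trans _ _ (K * w ^+ 6 * N%:R ^+ 2)).
    by apply: ler_pM; rewrite ?cmod_ge0 ?invr_ge0 ?mulr_ge0 ?(ltW z0) ?(ltW z0').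
  rewrite [leLHS](_ : _ = K * w ^+ 4 * (w * N%:R) ^+ 2); last by ring.
  by rewrite wN expr1n mulr1.
have dY : cmod (Yt (zz k) A - Yt (zz k.+1) A) <= 3 * K ^+ 2 * w ^+ 4.
  apply: le_trans (Yt_Lip A z0 z0' zK') _.
  apply: (@le_trans _ _ (K * w ^+ 6 * (3 * K * N%:R ^+ 2))).
    apply: ler_pM; rewrite ?cmod_ge0//.
      by rewrite !addr_ge0 ?mulr_ge0 ?invr_ge0 ?mulr_ge0 ?(ltW z0) ?(ltW z0')//; lra.
    have KN : K * (Im (zz k) * Im (zz k.+1))^-1 <= K * N%:R ^+ 2 by rewrite ler_wpM2l//; lra.
    have : N%:R <= N%:R ^+ 2 :> R by rewrite expr2 ler_peMr// ltW.
    have : N%:R ^+ 2 <= K * N%:R ^+ 2 :> R by rewrite ler_peMl// sqr_ge0.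
    lra.
  rewrite [leLHS](_ : _ = 3 * K ^+ 2 * w ^+ 4 * (w * N%:R) ^+ 2); last by ring.
  by rewrite wN expr1n mulr1.
have dm : cmod (m_phi phi (zz k) - m_phi phi (zz k.+1)) <= 12 * (1 + K) * K * w ^+ 3.
  have := m_Lip (phi_ge1 R N0 NM) z0 z0' i1; rewrite -/h.
  move: (cmod _) (cmod_ge0 (m_phi phi (zz k) - m_phi phi (zz k.+1))) => y y0 H.
  have min_ge : 4^-1 * w <= Num.min 2^-1 (Im (zz k) / 4).
    rewrite le_min; apply/andP; split; last first.
      by rewrite mulrC ler_wpM2r//; apply: le_trans l1.
    have : w <= 1 by rewrite invf_le1.
    lra.
  have sq : w ^+ 2 <= Im (zz k.+1) ^+ 2.
    by rewrite lerXn2r ?nnegrE ?(ltW w0) ?(ltW z0')//; apply: le_trans l2.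
  have H2 : y * (4^-1 * w * w ^+ 2) <= 3 * (1 + K) * (K * w ^+ 6).
    apply: (@le_trans _ _ (y * (Num.min 2^-1 (Im (zz k) / 4) * Im (zz k.+1) ^+ 2))).
      apply: ler_wpM2l => //; apply: ler_pM => //; first by rewrite mulr_ge0// ltW.
      exact: sqr_ge0.
    apply: le_trans H _; rewrite [leLHS](_ : _ = 3 * (1 + Im (zz k)) * (h * sp)); last by ring.
    apply: ler_pM => //; [by apply: mulr_ge0 => //; lra|exact: mulr_ge0 h0 (ltW s0)|].
    by rewrite ler_wpM2l//; lra.
  have w3 : 0 < w ^+ 3 by rewrite exprn_gt0.
  rewrite -(ler_pM2r w3); move: H2.
  rewrite [X in X <= _](_ : _ = y * w ^+ 3 / 4); last by field.
  rewrite [X in _ <= X -> _](_ : _ = 12 * (1 + K) * K * w ^+ 3 * w ^+ 3 / 4); last by field.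
  lra.
have w48 : 48 * (1 + K) ^+ 4 * w <= 1.
  by rewrite -[X in _ <= X]wN [leRHS]mulrC ler_wpM2r// ltW.
have [a1 a2 a3] := grid_arith K1 w0 w48; split.
- exact: le_trans ds a1.
- exact: le_trans dY a2.
- have X : w * (K^-1) <= (N%:R * Im (zz k.+1))^-1.
    by rewrite invfM /w ler_wpM2l ?invr_ge0// lef_pV2 ?posrE//; apply: lt_le_trans ltr01 K1.
  apply: le_lt_trans (lerD ds dm) _; apply: lt_le_trans a3 _.
  by rewrite ler_wpM2l.
Qed.
End GridPoints.

(** * Fluctuation averaging *)

Section Moments.
Variable R : realType.
Local Notation Re := (@complex.Re R).
Local Notation Im := (@complex.Im R).
Local Notation C := R[i].

(** A mean zero term may be dropped from a pointwise bound. Integrability of [x] is not assumed,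
    since the cancellation takes place between positive and negative parts. *)
Lemma Ex_le_zm d (T : measurableType d) (P : probability T R) (x h u : T -> R) :
  rmeas x -> rmeas h -> rmeas u -> (forall t, 0 <= x t) -> (forall t, 0 <= u t) -> zm P h ->
  (forall t, x t <= h t + u t) -> (Ex P x <= Ex P u)%E.
Proof.
move=> mx mh mu_ x0 u0 zh xhu.
have e : (Ex P (fun t => (x t + rneg (h t))%R) <= Ex P (fun t => (u t + rpos (h t))%R))%E.
  apply: Ex_le.
  - by apply: rmeasD => //; exact: rmeas_neg.
  - by apply: rmeasD => //; exact: rmeas_pos.
  - move=> t; rewrite addr_ge0 ?rneg_ge0//=; have := xhu t; rewrite {1}(rposneg (h t)); lra.
have fin : Ex P (fun t => rneg (h t)) \is a fin_num.
  have [/integrableP[_ hI] _] := zh.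
  rewrite ge0_fin_numE; last by apply: Ex_ge0 => t; exact: rneg_ge0.
  apply: le_lt_trans hI; apply: (@le_trans _ _ (Ex P (fun t => `|h t|))).
    apply: Ex_le; [exact: rmeas_neg|exact: measurableT_comp mh|].
    by move=> t; rewrite rneg_ge0 rneg_le.
  by [].
move: e; rewrite !ExD//; first last.
- by move=> t; exact: rneg_ge0.
- exact: rmeas_neg.
- by move=> t; exact: rpos_ge0.
- exact: rmeas_pos.
by rewrite (zm_posneg zh) leeD2rE.
Qed.

(** The test function of the moment method: [w * odd_pow p w] is the nonnegative number
    [|w|^(2p+2)]. *)
Definition odd_pow p (w : C) : C := (cmod w ^+ (2 * p))%:C%C * conjc w.

Lemma odd_pow_cmod p w : cmod (odd_pow p w) = cmod w ^+ (2 * p).+1.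
Proof. by rewrite /odd_pow cmodM cmodJ cmod_pos ?exprn_ge0 ?cmod_ge0// exprSr. Qed.
Lemma odd_pow_Re p w : Re (w * odd_pow p w) = cmod w ^+ (2 * p.+1).
Proof. by rewrite /odd_pow mulrCA mulJ -rmorphM cRe_real -exprD mulnS addnC. Qed.
Lemma odd_pow_diff p (a b : C) (r : R) : cmod a <= r -> cmod b <= r ->
  cmod (odd_pow p a - odd_pow p b) <= (2 * p).+1%:R * cmod (a - b) * r ^+ (2 * p).
Proof.
move=> ar br; have r0 : 0 <= r := le_trans (cmod_ge0 _) ar.
elim: p => [|p IH]; first by rewrite /odd_pow muln0 !expr0 !rmorph1 !mul1r -rmorphB cmodJ mulr1.
have e w : odd_pow p.+1 w = (cmod w ^+ 2)%:C%C * odd_pow p w.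
  by rewrite /odd_pow mulnS exprD rmorphM mulrA.
have -> : odd_pow p.+1 a - odd_pow p.+1 b =
   (cmod a ^+ 2 - cmod b ^+ 2)%:C%C * odd_pow p a + (cmod b ^+ 2)%:C%C * (odd_pow p a - odd_pow p b).
  by rewrite !e rmorphB /=; ring.
have h1 : cmod ((cmod a ^+ 2 - cmod b ^+ 2)%:C%C * odd_pow p a) <= (cmod (a - b) * (2 * r)) * r ^+ (2 * p).+1.
  rewrite cmodM odd_pow_cmod cmod_real; apply: ler_pM; rewrite ?normr_ge0 ?exprn_ge0 ?cmod_ge0//.
    rewrite subr_sqr normrM; apply: ler_pM; rewrite ?normr_ge0//.
      rewrite ler_norml; have := cmodB_ge a b; have := cmodB_ge b a; rewrite (cmodB b a).
      by move=> h1 h2; apply/andP; split; lra.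
    by rewrite ger0_norm ?addr_ge0 ?cmod_ge0//; lra.
  by rewrite lerXn2r ?nnegrE ?cmod_ge0.
have h2 : cmod ((cmod b ^+ 2)%:C%C * (odd_pow p a - odd_pow p b)) <=
   r ^+ 2 * ((2 * p).+1%:R * cmod (a - b) * r ^+ (2 * p)).
  rewrite cmodM cmod_pos ?sqr_ge0//; apply: ler_pM; rewrite ?sqr_ge0 ?cmod_ge0//.
  by rewrite lerXn2r ?nnegrE ?cmod_ge0.
apply: le_trans (cmodD _ _) _; apply: le_trans (lerD h1 h2) _.
rewrite le_eqVlt; apply/orP; left; apply/eqP.
have -> : (2 * p.+1).+1%:R = (2 * p).+1%:R + 2 :> R by rewrite mulnS -natrD; congr _%:R; rewrite addnC.
rewrite mulnS exprD exprS; ring.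
Qed.

(* Errors [W] of size [lam t + V] are absorbed: either [t] dominates and the left side is a small multiple of
   its power, or everything is bounded by [V]. *)
Lemma absorb p : exists lam C0 : R, [/\ 0 < lam, lam <= 1, 0 <= C0 &
  forall t V W r d zd : R, 0 <= t -> 0 <= V -> 0 <= r <= W -> 0 <= d <= W -> 0 <= zd <= W ^+ 2 ->
    W <= lam * t + V ->
    r * t ^+ (2 * p).+1 + zd * ((2 * p).+1%:R * (t + d) ^+ (2 * p)) <=
    2^-1 * t ^+ (2 * p.+1) + C0 * V ^+ (2 * p.+1)].
Proof.
pose q := (2 * p)%N; pose c : R := q.+1%:R; pose S : R := 2 + 4 * c * 3 ^+ q.
have c1 : 1 <= c by rewrite ler1n.
have T1 : 1 <= 3 ^+ q :> R by rewrite exprn_ege1// ler1n.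
have cT : 1 <= c * 3 ^+ q by rewrite mulr_ege1.
have S0 : 0 < S by rewrite /S -mulrA; lra.
(* If [t] dominates, then [W <= 2 lam t] and [t + d <= 3 t]; the left side is at most
   [(2 lam + 4 lam^2 c 3^q) t^(q+2)], which [lam S = 1/2] brings below one half. *)
have [lam lE] : exists l, l = (2 * S)^-1 by exists (2 * S)^-1.
have lam0 : 0 < lam by rewrite lE invr_gt0 mulr_gt0.
have lam1 : lam <= 1 by rewrite lE invf_le1 ?mulr_gt0//; rewrite /S -mulrA; lra.
have e2p : (2 * p.+1 = q.+2)%N by rewrite mulnS.
exists lam, (2 * lam^-1 ^+ q.+1 + 4 * (c * (lam^-1 + 2) ^+ q)).
have C00 : 0 <= 2 * lam^-1 ^+ q.+1 + 4 * (c * (lam^-1 + 2) ^+ q).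
  have l0 : 0 <= lam^-1 by rewrite invr_ge0 ltW.
  by rewrite addr_ge0 ?mulr_ge0 ?exprn_ge0// ?addr_ge0//; lra.
split=> // t V W r d zd t0 V0 /andP[r0 rW] /andP[d0 dW] /andP[zd0 zdW] Wt.
rewrite -/q -/c e2p; have W0 : 0 <= W := le_trans r0 rW.
have tot u w : 0 <= u -> 0 <= w -> t <= u -> W <= w ->
    r * t ^+ q.+1 + zd * (c * (t + d) ^+ q) <= w * u ^+ q.+1 + w ^+ 2 * (c * (u + w) ^+ q).
  move=> u0 w0 tu Ww; apply: lerD.
    apply: ler_pM; rewrite ?exprn_ge0//; first exact: le_trans rW Ww.
    by rewrite lerXn2r ?nnegrE.
  apply: ler_pM => //; first by rewrite mulr_ge0 ?exprn_ge0 ?addr_ge0//; lra.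
    by apply: le_trans zdW _; rewrite lerXn2r ?nnegrE.
  rewrite (ler_wpM2l (le_trans ler01 c1))//.
  by rewrite lerXn2r ?nnegrE ?addr_ge0// lerD// (le_trans dW).
have [Vt|tV] := leP V (lam * t).
  have Wb : W <= 2 * lam * t.
    have -> : 2 * lam * t = lam * t + lam * t by ring.
    by apply: le_trans Wt _; rewrite lerD2l.
  have l2 : 2 * lam * t <= 2 * t by rewrite ler_wpM2r//; lra.
  apply: (@le_trans _ _ (2 * lam * t * t ^+ q.+1 + (2 * lam * t) ^+ 2 * (c * (3 * t) ^+ q))).
    have h := tot t (2 * lam * t) t0 (le_trans W0 Wb) (lexx _) Wb; apply: le_trans h _.
    rewrite lerD2l ler_wpM2l ?sqr_ge0// (ler_wpM2l (le_trans ler01 c1))//.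
    by rewrite lerXn2r ?nnegrE ?addr_ge0 ?mulr_ge0 ?(ltW lam0)//; lra.
  have -> : (3 * t) ^+ q = 3 ^+ q * t ^+ q by rewrite exprMn.
  have -> : 2 * lam * t * t ^+ q.+1 + (2 * lam * t) ^+ 2 * (c * (3 ^+ q * t ^+ q)) =
     (2 * lam + 4 * lam * lam * (c * 3 ^+ q)) * t ^+ q.+2 by rewrite !exprS; ring.
  apply: (@le_trans _ _ (2^-1 * t ^+ q.+2)); last by rewrite lerDl mulr_ge0 ?exprn_ge0.
  rewrite ler_wpM2r ?exprn_ge0//.
  apply: (@le_trans _ _ (lam * S)); last first.
    by rewrite lE le_eqVlt; apply/orP; left; apply/eqP; move: (S) S0 => y y0; field; rewrite gt_eqF.
  rewrite /S; have : lam * lam * (c * 3 ^+ q) <= lam * 1 * (c * 3 ^+ q).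
    by rewrite ler_wpM2r ?ler_wpM2l ?(ltW lam0)//; lra.
  lra.
have tu : t <= lam^-1 * V by rewrite ler_pdivlMl// ltW.
have Ww : W <= 2 * V.
  by apply: le_trans Wt _; rewrite mulr_natl mulr2n lerD2r ltW.
have l0 : 0 <= lam^-1 by rewrite invr_ge0 ltW.
have h := tot (lam^-1 * V) (2 * V) (mulr_ge0 l0 V0) (mulr_ge0 (ler0n _ 2) V0) tu Ww.
apply: le_trans h _.
have -> : lam^-1 * V + 2 * V = (lam^-1 + 2) * V by ring.
have -> : 2 * V * (lam^-1 * V) ^+ q.+1 = 2 * lam^-1 ^+ q.+1 * V ^+ q.+2.
  by rewrite exprMn [V ^+ q.+2]exprS; ring.
have -> : ((lam^-1 + 2) * V) ^+ q = (lam^-1 + 2) ^+ q * V ^+ q by rewrite exprMn.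
have -> : (2 * V) ^+ 2 * (c * ((lam^-1 + 2) ^+ q * V ^+ q)) = 4 * (c * (lam^-1 + 2) ^+ q) * V ^+ q.+2.
  by rewrite !exprS; ring.
by rewrite -mulrDl lerDr mulr_ge0 ?exprn_ge0.
Qed.

End Moments.

(** * Polynomial bounds valid on the whole probability space *)

Section Crude.
Variable R : realType.
Local Notation Re := (@complex.Re R).
Local Notation Im := (@complex.Im R).
Local Notation C := R[i].
Variables N M : nat.
Hypothesis N0 : (0 < N)%N.
Hypothesis NM : (N <= M)%N.
Variable z : C.
Hypothesis z0 : 0 < Im z.
Local Notation phi := (mp_ratio R N M).
Local Notation sp := (Num.sqrt phi).
Local Notation c := (entry_var R N M).
Local Notation TT A := (mp_poly phi z (st z A)).
Local Notation dT A i := (dd z A i).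

Variable D : R.
Hypothesis D1 : 1 <= D.
Hypothesis zD : cmod z <= D.
Hypothesis eD : (Im z)^-1 <= D.
Hypothesis MD : M%:R <= D.

(** The exponent 11 arises from inserting the bound [2 D^5] for [spp_] into the quadratic
    polynomial, whose leading coefficient is at most [D]. *)
Definition YD : R := 16 * D ^+ 11.

Lemma c_le1 : c <= 1.
Proof.
rewrite invf_le1 ?mulr_gt0 ?(sp0 _ N0 NM) ?ltr0n// mulr_ege1//; first exact: sp1.
by rewrite ler1n.
Qed.
Lemma Dp0 n : 0 <= D ^+ n. Proof. by rewrite exprn_ge0// (le_trans ler01). Qed.
Lemma Dpow m n : (m <= n)%N -> D ^+ m <= D ^+ n. Proof. by move=> h; rewrite ler_weXn2l. Qed.
Lemma sp_leD : sp <= D.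
Proof.
apply: le_trans MD; have s1 := sp1 R N0 NM; have MC : 0 < M%:R :> R by rewrite ltr0n (leq_trans N0).
apply: (@le_trans _ _ (sp ^+ 2)); first by rewrite expr2 ler_peMr// (le_trans ler01).
by rewrite expr2 spsp// ler_pdivrMr ?ltr0n// ler_peMr ?(ltW MC)// ler1n.
Qed.
Lemma poly_crude (s : C) r : cmod s <= r -> cmod (mp_poly phi z s) <= D * r ^+ 2 + 3 * D * r + 1.
Proof.
move=> sr; have r0 : 0 <= r := le_trans (cmod_ge0 _) sr; have D0 : 0 <= D := le_trans ler01 D1.
have s0 := sp0 R N0 NM; have s1 := sp1 R N0 NM; have sV : sp^-1 <= 1 by rewrite invf_le1.
have sV0 : 0 <= sp^-1 by rewrite invr_ge0 ltW.
apply: le_trans (cmodD _ _) _; rewrite (cmod_nat R 1) lerD2r.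
apply: le_trans (cmodD _ _) _; apply: lerD.
  rewrite cmodM cmodX; apply: ler_pM; rewrite ?exprn_ge0 ?cmod_ge0//.
    rewrite cmod_aE//; apply: le_trans zD; rewrite ler_piMr ?cmod_ge0//.
  by rewrite lerXn2r ?nnegrE ?cmod_ge0.
rewrite cmodM; apply: ler_pM; rewrite ?cmod_ge0//.
rewrite /mp_b; apply: le_trans (cmodD _ _) _; rewrite [cmod sp^-1%:C%C]cmod_pos//.
have := cmodD z (- sp%:C%C); rewrite cmodN [cmod sp%:C%C]cmod_pos ?(ltW s0)//.
move=> h2; apply: le_trans (lerD h2 sV) _.
have -> : 3 * D = D + D + D by ring.
exact: lerD (lerD zD sp_leD) D1.
Qed.

Variables (A : 'M[C]_(N, M)) (i : 'I_N).
Local Notation e := (cmod (eps_ z A i)).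

Lemma up_crude : cmod (up_ z A i) <= D ^+ 2.
Proof.
rewrite /up_ cmodV; apply: (@le_trans _ _ (cmod z / Im z)); last first.
  by rewrite expr2; apply: ler_pM; rewrite ?cmod_ge0 ?invr_ge0 ?(ltW z0).
have g0 := gt_neq0 N0 NM z0 (rowz i A).
rewrite -[_^-1]mul1r ler_pdivrMr ?cmod_gt0// mulrAC ler_pdivlMr// mul1r -cmodM.
by apply: le_trans (Im_Yt N0 NM z0 (rowz i A)) _; exact: Im_le_cmod.
Qed.
Lemma u_crude : cmod (u_ A z i) <= D ^+ 2.
Proof.
apply: le_trans (cmod_u A i z0) _.
by rewrite expr2; apply: ler_pM; rewrite ?cmod_ge0 ?invr_ge0 ?(ltW z0).
Qed.
Lemma hs_crude (B : 'M[C]_(N, M)) : hs (resR B z) <= D ^+ 3.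
Proof.
apply: le_trans (hs_res B z0) _; rewrite -exprVn [D ^+ 3]exprS; apply: ler_pM; rewrite ?sqr_ge0//.
by rewrite lerXn2r ?nnegrE ?invr_ge0 ?(ltW z0)// (le_trans ler01).
Qed.
(** Needed on the exceptional event, where no large deviation bound is available. The fluctuation
    [eps_] has no deterministic bound and is kept as a factor, to be controlled through its second
    moment. *)
Lemma row_crude : [/\ cmod (TT A) <= YD, cmod (dT A i) <= YD, cmod (zeta_ z A i) <= YD * e &
  cmod (rho_ z A i) <= YD * (1 + e)].
Proof.
have ar1 (x a b m : R) : x <= a + 3 * b + 1 -> a <= m -> b <= m -> 1 <= m -> x <= 5 * m by lra.
have ar2 (x y a b : R) : x <= 1 * a -> y <= b -> b <= a -> y + x <= 2 * a by lra.
have ar3 (x y b m : R) : x <= 5 * m -> y <= 4 * m + 6 * b + 1 -> b <= m -> 1 <= m -> x + y <= 16 * m by lra.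
have ar4 (x m : R) : x <= 5 * m -> 1 <= m -> x <= 16 * m by lra.
have ar5 (x m a : R) : x <= m -> a <= m -> x + a <= 2 * m by lra.
have ar6 (x m y : R) : x <= y -> y <= m -> 0 <= m -> x <= 16 * m by lra.
have ar7 (x a b m n : R) : x <= a + 2 * b -> a <= m -> b <= n -> 0 <= m -> 0 <= n -> x <= 16 * (m + n) by lra.
have D0 : 0 <= D := le_trans ler01 D1; have e0 := cmod_ge0 (eps_ z A i).
have sD : cmod (st z A) <= D := le_trans (cmod_st_le N0 z0 A) eD.
have sD' : cmod (st z (rowz i A)) <= D := le_trans (cmod_st_le N0 z0 _) eD.
have p1 := Dpow (isT : 1 <= 11)%N; have p2 := Dpow (isT : 2 <= 11)%N.
have p3 := Dpow (isT : 3 <= 11)%N; have p6 := Dpow (isT : 6 <= 11)%N.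
have p0 := Dpow (isT : 0 <= 11)%N; rewrite expr0 in p0; rewrite expr1 in p1.
have tb : cmod (TT A) <= 5 * D ^+ 11.
  have := poly_crude sD; have -> : D * D ^+ 2 + 3 * D * D + 1 = D ^+ 3 + 3 * D ^+ 2 + 1 by ring.
  by move=> h; exact: ar1 h p3 p2 p0.
have t2b : cmod (t2_ z A i) <= D ^+ 3.
  rewrite /t2_ cmodM cmod_pos ?(ltW (c0 _ N0 NM))//; apply: le_trans (hs_crude (rowz i A)).
  apply: (@le_trans _ _ (1 * hs (resR (rowz i A) z))); last by rewrite mul1r.
  apply: ler_pM; rewrite ?cmod_ge0 ?(ltW (c0 _ N0 NM)) ?c_le1//; exact: cmod_trG2.
have sppb : cmod (spp_ z A i) <= 2 * D ^+ 5.
  rewrite /spp_; apply: le_trans (cmodD _ _) _; rewrite cmodN.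
  have : cmod (N%:R^-1 * (up_ z A i * t2_ z A i)) <= 1 * (D ^+ 2 * D ^+ 3).
    rewrite cmodM (natC R N) -fmorphV cmod_pos ?invr_ge0// cmodM.
    apply: ler_pM; rewrite ?invr_ge0 ?mulr_ge0 ?cmod_ge0//.
      by rewrite invf_le1 ?ltr0n// ler1n.
    by apply: ler_pM; rewrite ?cmod_ge0 ?up_crude.
  rewrite -exprD => h; exact: ar2 h sD' (Dpow (isT : 1 <= 5)%N).
have db : cmod (dT A i) <= 16 * D ^+ 11.
  rewrite /dd; apply: le_trans (cmodD _ _) _; rewrite cmodN.
  have := poly_crude sppb.
  have -> : D * (2 * D ^+ 5) ^+ 2 + 3 * D * (2 * D ^+ 5) + 1 = 4 * D ^+ 11 + 6 * D ^+ 6 + 1 by ring.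
  by move=> h; exact: ar3 tb h p6 p0.
have De (n : nat) : (n <= 11)%N -> D ^+ n * e <= D ^+ 11 * e by move=> /Dpow h; rewrite ler_wpM2r.
have e2 := De 2 isT; have De0 : 0 <= D ^+ 11 * e by rewrite mulr_ge0 ?Dp0.
have z1 : cmod (zeta_ z A i) <= D ^+ 2 * e.
  by rewrite /zeta_ cmodM ler_wpM2r// up_crude.
have r1 : cmod (rho_ z A i) <= D ^+ 3 + 2 * (D ^+ 2 * e).
  have -> : rho_ z A i = c%:C%C * (u_ A z i * (u_ A z i * k2_ z A i)) + (u_ A z i - up_ z A i) * eps_ z A i.
    by rewrite /rho_ uB//; ring.
  apply: le_trans (cmodD _ _) _; apply: lerD.
    rewrite cmodM cmod_pos ?(ltW (c0 _ N0 NM))// cmodM -[D ^+ 3]mul1r exprSr.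
    apply: ler_pM; rewrite ?mulr_ge0 ?cmod_ge0 ?(ltW (c0 _ N0 NM)) ?c_le1//.
    apply: ler_pM; rewrite ?cmod_ge0 ?u_crude//.
    by apply: le_trans (cmod_u_qf2 A i z0) eD.
  rewrite cmodM mulrA ler_wpM2r//; apply: le_trans (cmodD _ _) _; rewrite cmodN.
  exact: ar5 u_crude up_crude.
rewrite /YD; split => //; first exact: ar4 tb p0.
  by rewrite -mulrA; exact: ar6 z1 e2 De0.
by rewrite -mulrA mulrDr mulr1; exact: ar7 r1 p3 e2 (Dp0 11) De0.
Qed.
End Crude.

(** * Moments of the self-consistent polynomial *)

Section MomentBound.
Variable R : realType.
Local Notation Re := (@complex.Re R).
Local Notation Im := (@complex.Im R).
Local Notation C := R[i].

(** [spp_ z A i] is [spF z (rowz i A)]: in this form its independence of row [i] is visible. *)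
Definition spF N M (z : C) (B : 'M[C]_(N, M)) : C :=
  st z B - (N%:R)^-1 * ((1 + gt z B)^-1 * ((entry_var R N M)%:C%C * \tr (resR B z *m resR B z))).

Lemma cmeas_st d (T : measurableType d) N M z (A : T -> 'M[C]_(N, M)) : 0 < Im z -> mxmeas A ->
  cmeas (fun t => st z (A t)).
Proof.
move=> z0 mA; apply: cmeasM; first exact: cmeas_cst.
apply: cmeas_tr; under [X in mxmeas X]eq_fun do rewrite resG_resR.
by apply: mxmeas_resR => //; exact: mxmeas_adj.
Qed.
Lemma cmeas_gt d (T : measurableType d) N M z (A : T -> 'M[C]_(N, M)) : 0 < Im z -> mxmeas A ->
  cmeas (fun t => gt z (A t)).
Proof.
move=> z0 mA; apply: cmeasM; first exact: cmeas_cst.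
by apply: cmeas_tr; exact: mxmeas_resR.
Qed.
Lemma cmeas_poly d (T : measurableType d) phi z (f : T -> C) : cmeas f -> cmeas (fun t => mp_poly phi z (f t)).
Proof.
move=> mf; apply: cmeasD; last exact: cmeas_cst.
by apply: cmeasD; apply: cmeasM; rewrite ?cmeas_cst//; [exact: cmeas_cst|exact: cmeasX|exact: cmeas_cst].
Qed.
Lemma cmeas_spF d (T : measurableType d) N M z (A : T -> 'M[C]_(N, M)) : 0 < Im z -> mxmeas A ->
  cmeas (fun t => spF z (A t)).
Proof.
move=> z0 mA; apply: cmeasB; first exact: cmeas_st.
apply: cmeasM; first exact: cmeas_cst.
apply: cmeasM; first by apply: cmeasV; apply: cmeasD; [exact: cmeas_cst|exact: cmeas_gt].
apply: cmeasM; first exact: cmeas_cst.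
by apply: cmeas_tr; apply: mxmeasM; exact: mxmeas_resR.
Qed.
Lemma cmeas_odd_pow d (T : measurableType d) p (f : T -> C) : cmeas f -> cmeas (fun t => odd_pow p (f t)).
Proof.
move=> mf; apply: cmeasM; last exact: cmeasJ.
by apply: cmeas_real; apply: rmeasX; exact: rmeas_cmod.
Qed.
Lemma cmeas_q d (T : measurableType d) N M z (A : T -> 'M[C]_(N, M)) i : 0 < Im z -> mxmeas A ->
  cmeas (fun t => q_ (A t) z i).
Proof.
move=> z0 mA; apply: cmeas_qf; [exact: mxmeas_row|exact: mxmeas_row|].
by apply: mxmeas_resR => //; exact: mxmeas_rowz.
Qed.
Lemma cmeas_eps d (T : measurableType d) N M z (A : T -> 'M[C]_(N, M)) i : 0 < Im z -> mxmeas A ->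
  cmeas (fun t => eps_ z (A t) i).
Proof.
move=> z0 mA; apply: cmeasB; first exact: cmeas_q.
by apply: cmeas_gt => //; exact: mxmeas_rowz.
Qed.
Lemma cmeas_u d (T : measurableType d) N M z (A : T -> 'M[C]_(N, M)) i : 0 < Im z -> mxmeas A ->
  cmeas (fun t => u_ (A t) z i).
Proof. by move=> z0 mA; apply: cmeasV; apply: cmeasD; [exact: cmeas_cst|exact: cmeas_q]. Qed.
Lemma cmeas_up d (T : measurableType d) N M z (A : T -> 'M[C]_(N, M)) i : 0 < Im z -> mxmeas A ->
  cmeas (fun t => up_ z (A t) i).
Proof.
move=> z0 mA; apply: cmeasV; apply: cmeasD; first exact: cmeas_cst.
by apply: cmeas_gt => //; exact: mxmeas_rowz.
Qed.
Lemma cmeas_k2 d (T : measurableType d) N M z (A : T -> 'M[C]_(N, M)) i : 0 < Im z -> mxmeas A ->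
  cmeas (fun t => k2_ z (A t) i).
Proof.
move=> z0 mA; apply: cmeas_qf; [exact: mxmeas_row|exact: mxmeas_row|].
by apply: mxmeasM; apply: mxmeas_resR => //; exact: mxmeas_rowz.
Qed.
Lemma cmeas_rho d (T : measurableType d) N M z (A : T -> 'M[C]_(N, M)) i : 0 < Im z -> mxmeas A ->
  cmeas (fun t => rho_ z (A t) i).
Proof.
move=> z0 mA; have mu_ := cmeas_u i z0 mA; apply: cmeasB; apply: cmeasM.
- by apply: cmeasM; [exact: cmeas_cst|exact: cmeasX].
- exact: cmeas_k2.
- by apply: cmeasM => //; exact: cmeas_up.
- by apply: cmeasX; exact: cmeas_eps.
Qed.

(** One factor of the polynomial is replaced by [self_consistent], and the test function is moved
    from [st] to [spp_] in the leading term only, where this makes the mean vanish. *)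
Lemma row_split p N M (N0 : (0 < N)%N) (NM : (N <= M)%N) z (z0 : 0 < Im z) (A : 'M[C]_(N, M)) t :
  t = cmod (mp_poly (mp_ratio R N M) z (st z A)) ->
  N%:R * t ^+ (2 * p.+1) <= \sum_i (Re (zeta_ z A i * odd_pow p (mp_poly (mp_ratio R N M) z (spp_ z A i))) +
    (cmod (rho_ z A i) * t ^+ (2 * p).+1 +
     cmod (zeta_ z A i) * cmod (dd z A i) * ((2 * p).+1%:R * (t + cmod (dd z A i)) ^+ (2 * p)))).
Proof.
move=> tE; set TT := mp_poly _ _ (st z A) in tE.
have -> : N%:R * t ^+ (2 * p.+1) = Re (N%:R * TT * odd_pow p TT).
  by rewrite -mulrA (natC R N) cReZ odd_pow_Re tE.
rewrite (self_consistent N0 NM z0) mulr_suml cRe_sum; apply: ler_sum => i _.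
rewrite decomp//; set T2 := mp_poly _ _ (spp_ _ _ _).
have -> : (zeta_ z A i + rho_ z A i) * odd_pow p TT = zeta_ z A i * odd_pow p T2 +
   (rho_ z A i * odd_pow p TT + zeta_ z A i * (odd_pow p TT - odd_pow p T2)) by ring.
rewrite cReD lerD2l cReD; apply: lerD.
  by apply: le_trans (Re_le_cmod _) _; rewrite cmodM odd_pow_cmod tE.
apply: le_trans (Re_le_cmod _) _; rewrite cmodM -mulrA ler_wpM2l ?cmod_ge0//.
have T2t : cmod T2 <= t + cmod (dd z A i).
  have := cmodD TT (- (TT - T2)); rewrite cmodN tE.
  by have -> : TT - (TT - T2) = T2 by ring.
have tt : cmod TT <= t + cmod (dd z A i) by rewrite tE lerDl cmod_ge0.
apply: le_trans (odd_pow_diff p tt T2t) _.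
by rewrite mulrA (mulrC (cmod _)).
Qed.

(** [lam], [C0] and [r] depend on [mu] and [p] alone. On [G] the errors are absorbed; off [G] only
    polynomial bounds in [D] are known, and [delta] balances them against the probability [beta] of
    the complement. *)
Lemma moment_T (mu : nat -> R) p : exists lam C0 : R, exists r : nat, [/\ 0 < lam, lam <= 1, 0 <= C0 &
  forall d (T : measurableType d) (P : probability T R) N M (A : T -> 'M[C]_(N, M)) (z : C) (D : R),
  (0 < N)%N -> (N <= M)%N -> 0 < Im z -> 1 <= D -> cmod z <= D -> (Im z)^-1 <= D -> M%:R <= D ->
  row_model P A (entry_var R N M) mu ->
  forall (G : set T) (V delta beta : R), measurable G -> 0 <= V -> 0 < delta -> (P (~` G) <= beta%:E)%E ->
  (forall t, G t -> forall i, exists W, [/\ cmod (rho_ z (A t) i) <= W, cmod (dd z (A t) i) <= W,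
     cmod (zeta_ z (A t) i) * cmod (dd z (A t) i) <= W ^+ 2 &
     W <= lam * cmod (mp_poly (mp_ratio R N M) z (st z (A t))) + V]) ->
  (\E_[P]_t (cmod (mp_poly (mp_ratio R N M) z (st z (A t))) ^+ (2 * p.+1)) <=
    (C0 * V ^+ (2 * p.+1) + beta / delta + delta * (C0 * D ^+ r))%:E)%E].
Proof.
have [lam [Ca [l0 l1 Ca0 ab]]] := absorb R p.
have [Kq Kq0 hq] := ld_quadratic_moment mu 0.
pose q := (2 * p)%N; pose kap : R := 1 + q.+1%:R * 2 ^+ q.
have kap0 : 0 <= kap by rewrite addr_ge0 ?mulr_ge0.
pose Cb : R := 2 * kap ^+ 2 * 16 ^+ (2 * q.+2) * (1 + Kq).
have Cb0 : 0 <= Cb.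
  by apply: mulr_ge0; [apply: mulr_ge0; [apply: mulr_ge0 => //; exact: sqr_ge0|exact: exprn_ge0]|exact: addr_ge0].
exists lam, (2 * Ca + Cb), (11 * (2 * q.+2) + 3)%N; split => //; first by rewrite addr_ge0// mulr_ge0.
move=> d T P N M A z D N0 NM z0 D1 zD eD MD rm G V delta beta mG V0 d0 PG good.
have [mA _ _ _] := rm.
pose TT t := mp_poly (mp_ratio R N M) z (st z (A t)).
pose tT t := cmod (TT t).
pose e i t := cmod (eps_ z (A t) i).
pose h i t := Re (zeta_ z (A t) i * odd_pow p (mp_poly (mp_ratio R N M) z (spp_ z (A t) i))).
pose g i t := cmod (rho_ z (A t) i) * tT t ^+ q.+1 +
   cmod (zeta_ z (A t) i) * cmod (dd z (A t) i) * (q.+1%:R * (tT t + cmod (dd z (A t) i)) ^+ q).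
have N1 : 0 < N%:R :> R by rewrite ltr0n.
have YD0 : 0 <= YD D by rewrite mulr_ge0// exprn_ge0// (le_trans ler01).
have crude i t := row_crude N0 NM z0 D1 zD eD MD (A t) i.
have mTT : cmeas TT by apply: cmeas_poly; exact: cmeas_st.
have mtT : rmeas tT by exact: rmeas_cmod.
have me i : rmeas (e i) by apply: rmeas_cmod; exact: cmeas_eps.
have mrz i : mxmeas (fun t => rowz i (A t)) by exact: mxmeas_rowz.
have mspp i : cmeas (fun t => spp_ z (A t) i) by apply: cmeas_spF.
have mdd i : rmeas (fun t => cmod (dd z (A t) i)).
  by apply: rmeas_cmod; apply: cmeasB => //; exact: cmeas_poly.
have mzeta i : cmeas (fun t => zeta_ z (A t) i).
  by apply: cmeasM; [exact: cmeas_up|exact: cmeas_eps].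
have mg i : rmeas (g i).
  apply: rmeasD; apply: rmeasM.
  - by apply: rmeas_cmod; exact: cmeas_rho.
  - exact: rmeasX.
  - by apply: rmeasM => //; exact: rmeas_cmod.
  - by apply: rmeasM; [exact: rmeas_cst|apply: rmeasX; exact: rmeasD].
have g0 i t : 0 <= g i t.
  by rewrite addr_ge0 ?mulr_ge0 ?exprn_ge0 ?addr_ge0 ?cmod_ge0.
have Ee i : (\E_[P]_t (e i t ^+ 2) <= (Kq * D ^+ 3)%:E)%E.
  have := hq d T P N M A _ (c0 R N0 NM) rm i (fun B => resR (B : 'M[C]_(N, M)) z) (D ^+ 3)
     (mxmeas_resR z0 (@mxmeas_id R N M)) (hs_crude z0 D1 eD MD).
  rewrite muln1 expr1 => /le_trans; apply; rewrite lee_fin ler_wpM2l//.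
  rewrite ler_piMl ?exprn_ge0 ?(le_trans ler01 D1)// exprn_ile1 ?c_le1//.
  exact: ltW (c0 R N0 NM).
have Ee1 i : (\E_[P]_t (1 + e i t ^+ 2) <= ((1 + Kq) * D ^+ 3)%:E)%E.
  rewrite ExD//; [|exact: rmeas_cst|exact: rmeasX|by move=> t; exact: sqr_ge0].
  rewrite Ex_cst; apply: le_trans (leeD2l _ (Ee i)) _.
  by rewrite -EFinD lee_fin mulrDl lerD2r mul1r exprn_ege1.
have mE1 i : rmeas (fun t => 1 + e i t ^+ 2) by apply: rmeasD; [exact: rmeas_cst|exact: rmeasX].
have gY i t : g i t <= kap * YD D ^+ q.+2 * (1 + e i t).
  have [c1 c2 c3 c4] := crude i t; have e0 : 0 <= e i t := cmod_ge0 _.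
  have -> : kap * YD D ^+ q.+2 * (1 + e i t) = YD D * (1 + e i t) * YD D ^+ q.+1 +
     YD D * (1 + e i t) * YD D * (q.+1%:R * (2 * YD D) ^+ q).
    by rewrite /kap [(2 * _) ^+ q]exprMn [YD D ^+ q.+2]exprS [YD D ^+ q.+1]exprS; ring.
  apply: lerD.
    apply: ler_pM; rewrite ?exprn_ge0 ?cmod_ge0//.
    by rewrite lerXn2r ?nnegrE ?cmod_ge0.
  apply: ler_pM; rewrite ?mulr_ge0 ?exprn_ge0 ?addr_ge0 ?cmod_ge0//.
    apply: ler_pM; rewrite ?cmod_ge0//; apply: le_trans c3 _.
    by rewrite ler_wpM2l// lerDr.
  have t2 : tT t + cmod (dd z (A t) i) <= 2 * YD D by rewrite mulr_natl mulr2n lerD.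
  apply: ler_wpM2l => //; apply: lerXn2r => //; rewrite nnegrE; first by rewrite addr_ge0 ?cmod_ge0.
  exact: mulr_ge0.
have g2Y i t : g i t ^+ 2 <= 2 * (kap * YD D ^+ q.+2) ^+ 2 * (1 + e i t ^+ 2).
  apply: (@le_trans _ _ ((kap * YD D ^+ q.+2 * (1 + e i t)) ^+ 2)).
    by rewrite lerXn2r ?nnegrE ?(le_trans (g0 i t) (gY i t)).
  move: (kap * _) (e i t) => k x; rewrite [leLHS](_ : _ = k ^+ 2 * (1 + x) ^+ 2); last by ring.
  rewrite [leRHS](_ : _ = k ^+ 2 * (2 * (1 + x ^+ 2))); last by ring.
  by rewrite ler_wpM2l ?sqr_ge0//; have := sqr_ge0 (1 - x); rewrite sqrrB sqrrD; lra.
have Eg i : (\E_[P]_t (g i t ^+ 2) <= (Cb * D ^+ (11 * (2 * q.+2) + 3))%:E)%E.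
  have k0 : 0 <= 2 * (kap * YD D ^+ q.+2) ^+ 2 by rewrite mulr_ge0 ?sqr_ge0.
  apply: (@le_trans _ _ (\E_[P]_t (2 * (kap * YD D ^+ q.+2) ^+ 2 * (1 + e i t ^+ 2)))%E).
    apply: Ex_le; [exact: rmeasX|by apply: rmeasM => //; exact: rmeas_cst|].
    by move=> t; rewrite sqr_ge0 g2Y.
  rewrite ExZ//; last by move=> t; rewrite addr_ge0 ?sqr_ge0.
  apply: le_trans (lee_wpmul2l _ (Ee1 i)) _; first by rewrite lee_fin.
  rewrite -EFinM lee_fin /YD /Cb exprD le_eqVlt; apply/orP; left; apply/eqP.
  have -> : (kap * (16 * D ^+ 11) ^+ q.+2) ^+ 2 = kap ^+ 2 * 16 ^+ (2 * q.+2) * D ^+ (11 * (2 * q.+2)).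
    rewrite exprMn -[_ ^+ q.+2 ^+ 2]exprM exprMn -exprM (mulnC q.+2); ring.
  ring.
(* The leading terms are quadratic fluctuations of row [i] with a weight depending on the other
   rows, so only integrability has to be checked. *)
have zh i : zm P (h i).
  pose F (B : mxS R N M) := (1 + gt z (B : 'M[C]_(N, M)))^-1 * odd_pow p (mp_poly (mp_ratio R N M) z (spF z (B : 'M[C]_(N, M)))).
  have mid := @mxmeas_id R N M.
  have mF : cmeas F.
    apply: cmeasM; first by apply: cmeasV; apply: cmeasD; [exact: cmeas_cst|exact: cmeas_gt].
    by apply: cmeas_odd_pow; apply: cmeas_poly; exact: cmeas_spF.
  have eq_h t : h i t = Re (F (rowz i (A t)) * eps_ z (A t) i).
    by rewrite /h /zeta_ mulrAC.
  suff fin : (\E_[P]_t (`|Re (F (rowz i (A t)) * (qf (row i (A t)) (row i (A t)) (resR (rowz i (A t)) z) -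
         (entry_var R N M)%:C%C * \tr (resR (rowz i (A t)) z)))|%R) < +oo)%E.
    have zq := zm_quadratic_row (Bm := fun B => resR (B : 'M[C]_(N, M)) z) rm (mxmeas_resR z0 mid) mF fin.
    by have -> : h i = _ := funext (eq_h); exact: zq.
  have Y2 : 0 <= YD D * (2 * YD D) ^+ q.+1 by rewrite mulr_ge0 ?exprn_ge0// mulr_ge0.
  apply: (@le_lt_trans _ _ (\E_[P]_t (YD D * (2 * YD D) ^+ q.+1 * (1 + e i t ^+ 2)))%E).
    apply: Ex_le.
    - apply: measurableT_comp => //; have := (mzeta i); move=> mz.
      have : cmeas (fun t => zeta_ z (A t) i * odd_pow p (mp_poly (mp_ratio R N M) z (spp_ z (A t) i))).
        by apply: cmeasM => //; apply: cmeas_odd_pow; exact: cmeas_poly.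
      move=> [mm _]; have -> // : (fun t => Re (F (rowz i (A t)) * (qf (row i (A t)) (row i (A t)) (resR (rowz i (A t)) z) -
         (entry_var R N M)%:C%C * \tr (resR (rowz i (A t)) z)))) = h i.
      by apply/funext => t; rewrite eq_h.
    - by apply: rmeasM => //; exact: rmeas_cst.
    - move=> t; rewrite normr_ge0/= -/(gt z (rowz i (A t))) -/(q_ (A t) z i) -/(eps_ z (A t) i) -eq_h.
      have [c1 c2 c3 c4] := crude i t.
      apply: (@le_trans _ _ (cmod (zeta_ z (A t) i) * cmod (mp_poly (mp_ratio R N M) z (spp_ z (A t) i)) ^+ q.+1)).
        by rewrite -odd_pow_cmod -cmodM ler_norml lerNl -cReN -{1}cmodN !Re_le_cmod.
      have e0 : 0 <= e i t := cmod_ge0 _.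
      apply: (@le_trans _ _ (YD D * e i t * (2 * YD D) ^+ q.+1)); last first.
        rewrite [leRHS]mulrAC; apply: ler_wpM2r; first by apply: exprn_ge0; exact: mulr_ge0.
        by rewrite ler_wpM2l//; move: (e i t) e0 => x x0; nra.
      apply: ler_pM; rewrite ?exprn_ge0 ?cmod_ge0//.
      apply: lerXn2r; rewrite ?nnegrE ?cmod_ge0//; first exact: mulr_ge0.
      have := cmodD (TT t) (- (TT t - mp_poly (mp_ratio R N M) z (spp_ z (A t) i))); rewrite cmodN.
      have -> : TT t - (TT t - mp_poly (mp_ratio R N M) z (spp_ z (A t) i)) = mp_poly (mp_ratio R N M) z (spp_ z (A t) i) by ring.
      by move=> h1; apply: le_trans h1 _; rewrite mulr_natl mulr2n lerD.
  rewrite ExZ//; last by move=> t; rewrite addr_ge0 ?sqr_ge0.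
  apply: le_lt_trans (lee_wpmul2l _ (Ee1 i)) _; first by rewrite lee_fin.
  by rewrite -EFinM ltry.
pose bad t : R := \1_(~` G) t.
have mbad : rmeas bad by apply: measurable_indic; exact: measurableC.
pose U t := (2 * Ca * V ^+ (2 * p.+1) + delta^-1 * bad t) + delta / N%:R * \sum_i g i t ^+ 2.
have key t : tT t ^+ (2 * p.+1) <= 2 / N%:R * (\sum_i h i t) + U t.
  have sp_ := row_split p N0 NM z0 (erefl (tT t)).
  (* On [G] this is [absorb]; off [G] it is [2 g <= 1/delta + delta g^2], which trades the unbounded
     error for its second moment. *)
  have gi i : g i t <= 2^-1 * tT t ^+ (2 * p.+1) + Ca * V ^+ (2 * p.+1) + 2^-1 * (delta^-1 * bad t + delta * g i t ^+ 2).
    have x0 : 0 <= 2^-1 * tT t ^+ (2 * p.+1) by rewrite mulr_ge0 ?exprn_ge0 ?cmod_ge0.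
    have v0 : 0 <= Ca * V ^+ (2 * p.+1) by rewrite mulr_ge0 ?exprn_ge0.
    have s0 : 0 <= delta * g i t ^+ 2 by rewrite mulr_ge0 ?sqr_ge0// ltW.
    have [Gt|nG] := pselect (G t).
      have b0 : bad t = 0 by rewrite /bad indicE memNset//=; apply/not_notP.
      have [W [w1 w2 w3 w4]] := good t Gt i.
      have h1 := ab _ V W _ _ _ (cmod_ge0 (TT t)) V0 _ _ _ w4.
      have := h1 _ _ _ (introT andP (conj (cmod_ge0 _) w1)) (introT andP (conj (cmod_ge0 _) w2))
        (introT andP (conj (mulr_ge0 (cmod_ge0 _) (cmod_ge0 _)) w3)).
      rewrite -/(tT t) -/(g i t) b0 mulr0 add0r => h2; apply: le_trans h2 _.
      by rewrite lerDl mulr_ge0.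
    have -> : bad t = 1 by rewrite /bad indicE mem_set.
    rewrite mulr1; apply: (@le_trans _ _ (2^-1 * (delta^-1 + delta * g i t ^+ 2))); last first.
      by rewrite lerDr addr_ge0.
    have := sqr_ge0 (1 - delta * g i t) => h1.
    rewrite -(ler_pM2l d0).
    have -> : delta * (2^-1 * (delta^-1 + delta * g i t ^+ 2)) = 2^-1 * (1 + (delta * g i t) ^+ 2).
      by move: (g i t) => y; field; rewrite gt_eqF.
    move: h1; move: (delta * g i t) => y; rewrite sqrrB expr1n mul1r; lra.
  have h3 : N%:R * tT t ^+ (2 * p.+1) <= \sum_i h i t + \sum_(i < N) (2^-1 * tT t ^+ (2 * p.+1) + Ca * V ^+ (2 * p.+1) +
      2^-1 * (delta^-1 * bad t + delta * g i t ^+ 2)).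
    by apply: le_trans sp_ _; rewrite -big_split; apply: ler_sum => i _; rewrite lerD2l; exact: gi.
  rewrite /U; have sE : \sum_(i < N) (2^-1 * tT t ^+ (2 * p.+1) + Ca * V ^+ (2 * p.+1) +
      2^-1 * (delta^-1 * bad t + delta * g i t ^+ 2)) =
      N%:R * (2^-1 * tT t ^+ (2 * p.+1) + Ca * V ^+ (2 * p.+1) + 2^-1 * (delta^-1 * bad t)) +
      2^-1 * delta * \sum_i g i t ^+ 2.
    transitivity (\sum_(i < N) ((2^-1 * tT t ^+ (2 * p.+1) + Ca * V ^+ (2 * p.+1) + 2^-1 * (delta^-1 * bad t)) +
        2^-1 * delta * g i t ^+ 2)); first by apply: eq_bigr => i _; ring.
    by rewrite big_split /= sumr_const card_ord mulr_natl mulr_sumr.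
  rewrite sE in h3; move: h3.
  move: (\sum_i h i t) (\sum_i g i t ^+ 2) (tT t ^+ _) (V ^+ _) => H S x v h3.
  rewrite -(ler_pM2l N1).
  have -> : N%:R * (2 / N%:R * H + (2 * Ca * v + delta^-1 * bad t + delta / N%:R * S)) =
    2 * H + N%:R * (2 * Ca * v + delta^-1 * bad t) + delta * S by field; rewrite !gt_eqF.
  have : 2 * (N%:R * x) <= 2 * (H + (N%:R * (2^-1 * x + Ca * v + 2^-1 * (delta^-1 * bad t)) + 2^-1 * delta * S)).
    by rewrite ler_wpM2l.
  lra.
have mU : rmeas U.
  apply: rmeasD; first by apply: rmeasD; [exact: rmeas_cst|apply: rmeasM => //; exact: rmeas_cst].
  by apply: rmeasM; [exact: rmeas_cst|apply: rmeas_sum => i; exact: rmeasX].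
have bad0 t : 0 <= bad t by rewrite /bad indicE.
have dV0 : 0 <= delta^-1 by rewrite invr_ge0 ltW.
have S0 t : 0 <= \sum_i g i t ^+ 2 by apply: sumr_ge0 => i _; exact: sqr_ge0.
have dN0 : 0 <= delta / N%:R by rewrite divr_ge0// ltW.
have U1 : 0 <= 2 * Ca * V ^+ (2 * p.+1) by rewrite !mulr_ge0 ?exprn_ge0.
have U0 t : 0 <= U t.
  by apply: addr_ge0; [apply: addr_ge0 => //|]; exact: mulr_ge0.
have zH : zm P (fun t => 2 / N%:R * \sum_i h i t).
  apply: zmZ; exact: (zm_sum (p := xpredT) (index_enum _) (fun i _ => zh i)).
have mH : rmeas (fun t => 2 / N%:R * \sum_i h i t).
  have [/integrableP[mm _] _] := zH; exact/measurable_EFinP.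
have := Ex_le_zm (rmeasX (2 * p.+1) mtT) mH mU (fun t => exprn_ge0 _ (cmod_ge0 _)) U0 zH key.
move=> /le_trans; apply; rewrite /U ExD//; first last.
- by move=> t; exact: mulr_ge0.
- by move=> t; apply: addr_ge0 => //; exact: mulr_ge0.
- by apply: rmeasM; [exact: rmeas_cst|apply: rmeas_sum => i; exact: rmeasX].
- by apply: rmeasD; [exact: rmeas_cst|apply: rmeasM => //; exact: rmeas_cst].
rewrite ExD//; first last.
- by move=> t; exact: mulr_ge0.
- by apply: rmeasM => //; exact: rmeas_cst.
- exact: rmeas_cst.
have mS : rmeas (fun t => \sum_i g i t ^+ 2) by apply: rmeas_sum => i; exact: rmeasX.
rewrite Ex_cst (ExZ P mS)// (ExZ P mbad)//.
rewrite Ex_sum; [|by move=> i; exact: rmeasX|by move=> i t; exact: sqr_ge0].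
have E2 : (\sum_(i < N) \E_[P]_t (g i t ^+ 2) <= (N%:R * (Cb * D ^+ (11 * (2 * q.+2) + 3)))%:E)%E.
  apply: le_trans (lee_sum _ (fun i _ => Eg i)) _.
  by rewrite sumEFin lee_fin sumr_const card_ord mulr_natl.
have E1 : (\E_[P]_t (bad t) <= beta%:E)%E.
  by rewrite /bad Ex_indic//; exact: measurableC.
apply: (@le_trans _ _ ((2 * Ca * V ^+ (2 * p.+1))%:E + (delta^-1)%:E * beta%:E +
   (delta / N%:R)%:E * (N%:R * (Cb * D ^+ (11 * (2 * q.+2) + 3)))%:E)%E).
  by apply: leeD; [apply: leeD2l; apply: lee_wpmul2l|apply: lee_wpmul2l]; rewrite ?lee_fin.
rewrite -!EFinM -!EFinD lee_fin.
have -> : delta / N%:R * (N%:R * (Cb * D ^+ (11 * (2 * q.+2) + 3))) = delta * (Cb * D ^+ (11 * (2 * q.+2) + 3)).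
  by field; rewrite gt_eqF.
have a1 : 2 * Ca * V ^+ (2 * p.+1) <= (2 * Ca + Cb) * V ^+ (2 * p.+1).
  by rewrite ler_wpM2r ?exprn_ge0// lerDl.
have a2 : delta * (Cb * D ^+ (11 * (2 * q.+2) + 3)) <= delta * ((2 * Ca + Cb) * D ^+ (11 * (2 * q.+2) + 3)).
  rewrite ler_wpM2l ?(ltW d0)// ler_wpM2r ?exprn_ge0 ?(le_trans ler01 D1)//.
  by rewrite lerDr mulr_ge0.
by rewrite [delta^-1 * beta]mulrC; apply: lerD => //; rewrite lerD2r.
Qed.
End MomentBound.

(** * Entries of the resolvents *)

Section Entries.
Variable R : realType.
Local Notation Re := (@complex.Re R).
Local Notation Im := (@complex.Im R).
Local Notation C := R[i].

(** Both [G'] and its adjoint occur because removing row [i] produces the forms with row [i] on the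
    left and on the right. The variance is a parameter since the condition is used for [A] and for
    its adjoint. *)
Definition lin_ok (c L : R) (z : C) m n (A : 'M[C]_(m, n)) : Prop := forall i j : 'I_m, i != j ->
  let b1 := resR (rowz i A) z *m adjmx (row j (rowz i A)) in
  let b2 := adjmx (resR (rowz i A) z) *m adjmx (row j (rowz i A)) in
  cmod (\tr (row i A *m b1)) <= L * Num.sqrt (c * hs b1) /\
  cmod (\tr (row i A *m b2)) <= L * Num.sqrt (c * hs b2).

Lemma row_rowz m n (A : 'M[C]_(m, n)) i j : i != j -> row j (rowz i A) = row j A.
Proof. by move=> ij; apply/rowP => k; rewrite !mxE eq_sym (negbTE ij). Qed.

(* [|G' y|^2] is [Im (y G' y)] up to a factor, and [G'] may be replaced by the full resolvent because the
   correction is itself controlled by the linear bounds. *)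
Lemma offdiag m n (A : 'M[C]_(m, n)) (c L U Qb : R) z i j : 0 < Im z -> 0 < c -> 0 < L -> i != j ->
  lin_ok c L z A -> 0 <= U -> cmod (u_ A z i) <= U -> cmod (u_ A z j) <= U -> Im (q_ A z j) <= Qb ->
  2 * U * L ^+ 2 * (c / Im z) <= 1 ->
  cmod (z * resG A z i j) <= U * (L * Num.sqrt (2 * U ^+ 2 * Qb * (c / Im z))).
Proof.
have half (x y : R) : 2 * x <= y -> x <= 2^-1 * y by lra.
have ar (g v w x x' : R) : g = w - v -> x <= x' -> x' <= 2^-1 * w -> v <= x -> w <= 2 * g by lra.
move=> z0 c0 L0 ij lin U0 ui uj qj small.
have [] := lin i j ij; rewrite (row_rowz A ij).
set G' := resR _ z; set y := row j A; set b1 := G' *m _; set b2 := adjmx G' *m _ => l1 l2.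
have h12 : hs b2 = hs b1.
  have e1 := Im_tr_res (rowz i A) z0 y; have e2 := Im_tr_res_col (rowz i A) z0 y.
  have -> : b2 = adjmx (y *m G') by rewrite /b2 adjmxM.
  by rewrite hs_adj; apply: (mulfI (lt0r_neq0 z0)); rewrite -e1 -e2.
have h1 : Im (qf y y G') = Im z * hs b1 by exact: Im_tr_res_col.
have x1 : qf (row i A) y G' = \tr (row i A *m b1) by rewrite /qf -mulmxA.
have x2 : cmod (qf y (row i A) G') = cmod (\tr (row i A *m b2)).
  have trJ (W : 'M[C]_1) : conjc (\tr W) = \tr (adjmx W) by rewrite /mxtrace !big_ord1 !mxE.
  rewrite -cmodJ /qf trJ; congr cmod; congr (\tr _).
  by rewrite /b2 !adjmxM !adjmxK mulmxA.
pose h := hs b1; have h0 : 0 <= h := hs_ge0 _.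
have sq (x : R) : 0 <= x -> x <= L * Num.sqrt (c * h) -> x ^+ 2 <= L ^+ 2 * (c * h).
  move=> x0 xl; rewrite -[c * h](sqr_sqrtr (mulr_ge0 (ltW c0) h0)) -exprMn.
  apply: lerXn2r xl; rewrite nnegrE; [exact: x0|exact: mulr_ge0 (ltW L0) (sqrtr_ge0 _)].
have ch0 : 0 <= L * Num.sqrt (c * h) by exact: mulr_ge0 (ltW L0) (sqrtr_ge0 _).
have prod : cmod (u_ A z i * (qf y (row i A) G' * qf (row i A) y G')) <= U * (L ^+ 2 * (c * h)).
  rewrite cmodM; apply: (ler_pM (cmod_ge0 _) (cmod_ge0 _) ui); rewrite cmodM x1 x2.
  rewrite h12 in l2; apply: le_trans (sq _ ch0 (lexx _)); rewrite expr2.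
  exact: (ler_pM (cmod_ge0 _) (cmod_ge0 _) l2 l1).
(* [Im z * h] is the form of row [j] in the minor; the condition [small] makes the correction to the
   full resolvent at most half of it. *)
have Gh : Im z * h <= 2 * Im (qf y y (resR A z)).
  have e' : Im (qf y y (resR A z)) = Im z * h - Im (u_ A z i * (qf y (row i A) G' * qf (row i A) y G')).
    by rewrite (qf_res_s A i z0 y) cImB h1.
  have hb : U * (L ^+ 2 * (c * h)) <= 2^-1 * (Im z * h).
    have := ler_wpM2r (mulr_ge0 (ltW z0) h0) small.
    rewrite [X in X <= _ -> _](_ : _ = 2 * (U * (L ^+ 2 * (c * h)))); last by field; rewrite gt_eqF.
    by rewrite mul1r => w; exact: half.
  have := Im_le_cmod (u_ A z i * (qf y (row i A) G' * qf (row i A) y G')).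
  exact: ar e' prod hb.
(* In the full resolvent the form of row [j] is [1 - u_j], with imaginary part
   [Im q_j * |u_j|^2]. *)
have Gu : Im (qf y y (resR A z)) <= U ^+ 2 * Qb.
  have -> : qf y y (resR A z) = 1 - u_ A z j := qf_res A j z0.
  have I1 : Im (1 : C) = 0 by [].
  rewrite cImB I1 sub0r /u_ cImV cImD I1 add0r mulNr opprK mulrC.
  apply: (ler_pM _ (Im_q_ge0 A j z0) _ qj); first by rewrite invr_ge0 sqr_ge0.
  have uj' : (cmod (1 + q_ A z j))^-1 <= U by move: uj; rewrite /u_ cmodV.
  rewrite -exprVn; apply: lerXn2r uj'; rewrite nnegrE; last exact: U0.
  by rewrite invr_ge0 cmod_ge0.
have hb : c * h <= 2 * U ^+ 2 * Qb * (c / Im z).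
  have w : h <= 2 * U ^+ 2 * Qb / Im z.
    rewrite (ler_pdivlMr _ _ z0) mulrC; apply: le_trans Gh _; rewrite -mulrA.
    exact: ler_wpM2l (ler0n _ 2) _ _ Gu.
  rewrite [leRHS](_ : _ = c * (2 * U ^+ 2 * Qb / Im z)); last by ring.
  exact: ler_wpM2l (ltW c0) _ _ w.
rewrite (resG_ij A z0 ij) cmodM; apply: (ler_pM (cmod_ge0 _) (cmod_ge0 _) ui).
rewrite x1; apply: le_trans l1 _; apply: (ler_wpM2l (ltW L0)).
exact: ler_wsqrtr hb.
Qed.

Variables N M : nat.
Hypothesis N0 : (0 < N)%N.
Hypothesis NM : (N <= M)%N.
Local Notation phi := (mp_ratio R N M).
Local Notation sp := (Num.sqrt phi).
Local Notation c := (entry_var R N M).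
Variables (z : C) (K nu : R) (A : 'M[C]_(N, M)).
Local Notation K1 := (2 * K * (K + 2)).
Local Notation X := (N%:R * Im z)^-1.
Local Notation Lam := (cmod (st z A - m_phi phi z)).
Local Notation Ps := (Num.sqrt (Im (m_phi phi z) / (N%:R * Im z)) + X).
Hypothesis K_ge1 : 1 <= K.
Hypothesis nu_ge1 : 1 <= nu.
Hypothesis zd : zdom N M K z.
Hypothesis bd : bnd K1 z A.
Hypothesis ld : ld_ok nu z A.
Hypothesis nuN : nu ^+ 10 <= N%:R * Im z.
Hypothesis nu_large : 256 * K1 ^+ 2 * K ^+ 2 * K3 K K1 <= nu.
Hypothesis Lam_le : Lam <= nu ^+ 7 * X.

Lemma ent_z0 : 0 < Im z. Proof. by case: zd. Qed.
Lemma ent_K1 : 1 <= K1.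
Proof. by rewrite -mulrA mulr_ege1 ?ler1n// mulr_ege1//; apply: le_trans K_ge1 _; rewrite lerDl. Qed.
Lemma nup (a b : nat) : (a <= b)%N -> nu ^+ a <= nu ^+ b. Proof. by move=> h; rewrite ler_weXn2l. Qed.
Lemma nu0 a : 0 <= nu ^+ a. Proof. by rewrite exprn_ge0// (le_trans ler01). Qed.
Lemma ent_k3 : 1 <= K3 K K1. Proof. by apply: (@K3_ge1 R K K1 K_ge1 ent_K1). Qed.
Lemma ent_small : 16 * K1 ^+ 2 * K ^+ 2 * K3 K K1 * nu ^+ 2 <= N%:R * Im z.
Proof.
apply: le_trans nuN; apply: le_trans (nup (isT : 3 <= 10)%N).
rewrite [nu ^+ 3]exprS; apply: ler_wpM2r; first exact: nu0.
apply: le_trans nu_large.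
have pos : 0 <= K1 ^+ 2 * K ^+ 2 * K3 K K1.
  by apply: mulr_ge0; [apply: mulr_ge0; exact: sqr_ge0|exact: le_trans ent_k3].
rewrite -!(mulrA _ (K1 ^+ 2)) -!(mulrA _ (K1 ^+ 2 * K ^+ 2)).
by apply: ler_wpM2r => //; rewrite ler_nat.
Qed.
Lemma ent_X0 : 0 < X. Proof. by rewrite invr_gt0 mulr_gt0 ?ltr0n ?ent_z0. Qed.
Lemma ent_nuX : nu ^+ 10 * X <= 1.
Proof. by rewrite ler_pdivrMr ?mul1r// mulr_gt0 ?ltr0n ?ent_z0. Qed.
Lemma ent_Im : 0 <= Im (m_phi phi z).
Proof. by have [_ _ /ltW] := mp_facts (phi_ge1 R N0 NM) ent_z0. Qed.
Lemma XPs : X <= Ps. Proof. by rewrite lerDr sqrtr_ge0. Qed.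
Lemma Ps0 : 0 <= Ps. Proof. exact: le_trans (ltW ent_X0) XPs. Qed.

(** The error [nu^7 X] of the averaged law sits under a square root; its half power is rounded up to
    [nu^4]. *)
Lemma Psi1_le : Psi1 z K A <= (2 + K ^+ 3) * (nu ^+ 4 * Ps).
Proof.
have z0 := ent_z0; have K0 : 0 <= K := le_trans ler01 K_ge1.
have X0 := ltW ent_X0; have k3 : 0 <= K ^+ 3 by exact: exprn_ge0.
apply: le_of_sqr; first by rewrite mulr_ge0 ?addr_ge0// mulr_ge0 ?nu0 ?Ps0.
rewrite Psi1_sqr//.
have g : Gam z K A <= (1 + K ^+ 3) * Im (m_phi phi z) + 2 * nu ^+ 7 * X.
  rewrite /Gam.
  have a1 : Im (st z A) <= Im (m_phi phi z) + nu ^+ 7 * X.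
    by rewrite -lerBlDl -cImB; apply: le_trans (Im_le_cmod _) _.
  have a2 : K ^+ 2 * Im z <= K ^+ 3 * Im (m_phi phi z).
    case: zd => _ _ _ _ [_ h]; rewrite [K ^+ 3]exprSr -mulrA; exact: ler_wpM2l (sqr_ge0 _) _ _ h.
  have a3 : X <= nu ^+ 7 * X by rewrite ler_peMl// exprn_ege1.
  have -> : (1 + K ^+ 3) * Im (m_phi phi z) + 2 * nu ^+ 7 * X =
    (Im (m_phi phi z) + nu ^+ 7 * X) + K ^+ 3 * Im (m_phi phi z) + nu ^+ 7 * X by ring.
  by apply: lerD => //; apply: lerD.
pose y := Num.sqrt (Im (m_phi phi z) * X); have y0 : 0 <= y := sqrtr_ge0 _.
have y2 : y ^+ 2 = Im (m_phi phi z) * X by rewrite sqr_sqrtr// mulr_ge0 ?ent_Im.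
apply: (@le_trans _ _ ((1 + K ^+ 3) * y ^+ 2 + 2 * nu ^+ 7 * X ^+ 2)).
  by rewrite y2 expr2 mulrA [2 * _ * (X * X)]mulrA -mulrDl; apply: ler_wpM2r.
rewrite -/y; have n8 : 1 <= nu ^+ 8 by exact: exprn_ege1.
have n78 := nup (isT : 7 <= 8)%N.
rewrite [leRHS](_ : _ = (2 + K ^+ 3) ^+ 2 * (nu ^+ 8 * (y + X) ^+ 2)); last by ring.
apply: (@le_trans _ _ ((2 + K ^+ 3) * (nu ^+ 8 * (y + X) ^+ 2))); last first.
  apply: ler_wpM2r; first by rewrite mulr_ge0 ?nu0 ?sqr_ge0.
  by rewrite expr2 ler_peMl ?addr_ge0// (le_trans _ (_ : 2 <= _)) ?ler1n ?lerDl.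
have b1 : y ^+ 2 <= nu ^+ 8 * y ^+ 2 by rewrite ler_peMl ?sqr_ge0.
have b2 : nu ^+ 7 * X ^+ 2 <= nu ^+ 8 * X ^+ 2 by rewrite ler_wpM2r ?sqr_ge0.
have b3 : nu ^+ 8 * y ^+ 2 + nu ^+ 8 * X ^+ 2 <= nu ^+ 8 * (y + X) ^+ 2.
  by rewrite -mulrDr ler_wpM2l ?nu0// sqrrD lerD2r lerDl mulrn_wge0// mulr_ge0.
apply: (@le_trans _ _ ((2 + K ^+ 3) * (nu ^+ 8 * y ^+ 2 + nu ^+ 8 * X ^+ 2))); last first.
  by rewrite ler_wpM2l ?addr_ge0.
rewrite mulrDr; apply: lerD.
  by apply: ler_pM; rewrite ?sqr_ge0 ?addr_ge0// lerD2r ler1n.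
rewrite -mulrA; apply: ler_pM => //; first by rewrite mulr_ge0 ?nu0 ?sqr_ge0.
by rewrite lerDl.
Qed.

(** [sqrt phi] times the deviation of [1 + q_] from its limit: fluctuation of the row, clearing of
    the row, and error of the averaged law. *)
Definition Del : R := nu * Psi1 z K A + X + Lam.
Lemma Del_le : Del <= (4 + K ^+ 3) * (nu ^+ 7 * Ps).
Proof.
have K0 : 0 <= K := le_trans ler01 K_ge1; have k3 : 0 <= K ^+ 3 by exact: exprn_ge0.
have n0 : 0 <= nu := le_trans ler01 nu_ge1.
have a1 : nu * Psi1 z K A <= (2 + K ^+ 3) * (nu ^+ 7 * Ps).
  apply: le_trans (ler_wpM2l n0 Psi1_le) _.
  rewrite [leLHS](_ : _ = (2 + K ^+ 3) * (nu ^+ 5 * Ps)); last by ring.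
  by apply: ler_wpM2l; rewrite ?addr_ge0//; apply: ler_wpM2r; rewrite ?Ps0 ?nup.
have a2 : nu ^+ 7 * X <= nu ^+ 7 * Ps by rewrite ler_wpM2l ?nu0 ?XPs.
have a3 : X <= nu ^+ 7 * Ps.
  by apply: le_trans a2; rewrite ler_peMl ?(ltW ent_X0)// exprn_ege1.
rewrite /Del [leRHS](_ : _ = (2 + K ^+ 3) * (nu ^+ 7 * Ps) + nu ^+ 7 * Ps + nu ^+ 7 * Ps); last by ring.
by apply: lerD; [exact: lerD|exact: le_trans Lam_le a2].
Qed.
Lemma nu_256 : 256 <= nu.
Proof.
apply: le_trans nu_large.
have h : 1 <= K1 ^+ 2 * K ^+ 2 * K3 K K1.
  apply: mulr_ege1 ent_k3; apply: mulr_ege1; apply: exprn_ege1; [exact: ent_K1|exact: K_ge1].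
rewrite -(mulrA _ (K1 ^+ 2)) -(mulrA _ (K1 ^+ 2 * K ^+ 2)).
exact: ler_peMr (ler0n _ 256) h.
Qed.
Lemma Del_small : Del <= 4^-1.
Proof.
have [z0 zK Kz etaK _] := zd; have [sK YK] := bd.
have h := LPsi1_le N0 z0 K_ge1 ent_K1 nu_ge1 etaK sK ent_small.
have k8 : 8 <= 2 * kk K K1.
  have -> : 2 * kk K K1 = 8 * ((K + 2) * K ^+ 2) by rewrite /kk; ring.
  rewrite ler_peMr// mulr_ege1 ?exprn_ege1//; apply: le_trans K_ge1 _; by rewrite lerDl.
have h8 : (2 * kk K K1)^-1 <= 8^-1 by rewrite lef_pV2 ?posrE// (lt_le_trans _ k8).
have X7 : nu ^+ 7 * X <= 256^-1.
  have h1 : 256 * nu ^+ 7 <= nu ^+ 10.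
    apply: le_trans (nup (isT : 8 <= 10)%N); rewrite [nu ^+ 8]exprS.
    exact: ler_wpM2r (nu0 7) _ _ nu_256.
  have h2 := ler_wpM2r (ltW ent_X0) h1; have h3 := le_trans h2 ent_nuX.
  by rewrite -[256^-1]mul1r (ler_pdivlMr _ _ (ltr0n R 256)) mulrC mulrA.
have X1 : X <= nu ^+ 7 * X by rewrite ler_peMl ?(ltW ent_X0)// exprn_ege1.
have ar (x y w v h' : R) : x <= h' -> h' <= 8^-1 -> y <= v -> w <= v -> v <= 256^-1 -> x + y + w <= 4^-1 by lra.
exact: ar h h8 X1 Lam_le X7.
Qed.

Lemma szK : sp / cmod z <= K.
Proof. by case: zd => z0 _ Kz _ _; rewrite ler_pdivrMr// cmod_gt0 zn0. Qed.

(** On the diagonal, the entry and [m_phi] are both negative inverses, of [z (1 + q_)] and of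
    [b + a m], so their difference is their product times the difference of the denominators. Off
    the diagonal, [offdiag] applies. *)
Lemma entry_R i j : lin_ok c nu z A ->
  cmod (resG A z i j - kdelta R i j * m_phi phi z) <=
   (K * kk K K1 * K1 * K + 2 * K * kk K K1 ^+ 2) * (4 + K ^+ 3) * (nu ^+ 7 * Ps).
Proof.
move=> lin; have [z0 zK Kz etaK [bK imK]] := zd; have [sK YK] := bd.
have phi1 := phi_ge1 R N0 NM; have s0 := sp0 R N0 NM; have K0 : 0 <= K := le_trans ler01 K_ge1.
have kk0 : 0 < kk K K1 by exact: (@kk0 R K K1 K_ge1 ent_K1).
have k3 : 0 <= K ^+ 3 by exact: exprn_ge0.
have n0 : 0 <= nu := le_trans ler01 nu_ge1.
have zp : 0 < cmod z by rewrite cmod_gt0 zn0.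
have ub k := u_le N0 NM z0 K_ge1 ent_K1 nu_ge1 zK Kz etaK sK YK (ld k).1 ent_small.
have nP : 0 <= nu ^+ 7 * Ps by rewrite mulr_ge0 ?nu0 ?Ps0.
have K1p : 0 <= K1 := le_trans ler01 ent_K1.
have P1 : 0 <= K * kk K K1 * K1 * K by exact: mulr_ge0 (mulr_ge0 (mulr_ge0 K0 (ltW kk0)) K1p) K0.
have P2 : 0 <= 2 * K * kk K K1 ^+ 2 by exact: mulr_ge0 (mulr_ge0 (ler0n _ 2) K0) (sqr_ge0 _).
have Psi0 : 0 <= Psi1 z K A := sqrtr_ge0 _.
rewrite /kdelta; case: eqP => [<-|/eqP ij].
  rewrite mul1r; set Gi := resG A z i i; set m := m_phi phi z.
  have e1 : z * (1 + q_ A z i) * Gi = -1.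
    rewrite mulrAC resG_ii// /u_ mulNr mulVf// q_neq0//.
  have [mn eq _ _ _] := mp_facts phi1 z0; rewrite -/m in mn eq.
  have e2 : m * (mp_b phi z + mp_a phi z * m) = -1.
    apply/eqP; rewrite -subr_eq0 opprK; apply/eqP; rewrite -[RHS]eq; ring.
  have e3 : Gi - m = Gi * m * (z * (1 + q_ A z i) - (mp_b phi z + mp_a phi z * m)).
    have -> : Gi * m * (z * (1 + q_ A z i) - (mp_b phi z + mp_a phi z * m)) =
       m * (z * (1 + q_ A z i) * Gi) - Gi * (m * (mp_b phi z + mp_a phi z * m)) by ring.
    by rewrite e1 e2; ring.
  have Gb : cmod Gi <= K * kk K K1.
    have := congr1 (@cmod R) (resG_ii A i z0); rewrite cmodM cmodN -/Gi => h.
    rewrite -(ler_pM2l zp) h; apply: le_trans (ub i) _.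
    rewrite [leRHS]mulrA (mulrC (cmod z)); exact: ler_wpM2r (ltW kk0) _ _ Kz.
  (* [m_phi] is an exact root, so the a priori bound [poly_bnd] applies to it. *)
  have mb : cmod m <= K1.
    have t0 : cmod (mp_a phi z * m ^+ 2 + mp_b phi z * m + 1) <= 4^-1.
      by rewrite eq (cmod_nat R 0) invr_ge0.
    have [] := poly_bnd K_ge1 (cmod_a_ge N0 NM Kz) bK t0.
    move=> h1 _; apply: le_trans h1 _; rewrite -mulrA ler_peMl ?ler1n//.
    by rewrite mulr_ge0 ?addr_ge0.
  have db : cmod (z * (1 + q_ A z i) - (mp_b phi z + mp_a phi z * m)) <= K * Del.
    have -> : z * (1 + q_ A z i) - (mp_b phi z + mp_a phi z * m) =
       z * (eps_ z A i - (gt z A - gt z (rowz i A))) + mp_a phi z * (st z A - m).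
      have := YtE N0 NM z0 A; rewrite /Yt => y.
      have -> : mp_b phi z + mp_a phi z * m = z * (1 + gt z A) - mp_a phi z * (st z A - m) by rewrite y; ring.
      by rewrite /eps_; ring.
    apply: le_trans (cmodD _ _) _; rewrite /Del [leRHS]mulrDr; apply: lerD.
      rewrite cmodM; apply: (@le_trans _ _ (K * sp * (sp^-1 * (nu * Psi1 z K A) + sp^-1 * X))).
        apply: ler_pM; rewrite ?cmod_ge0//; apply: le_trans (cmodD _ _) _; rewrite cmodN.
        apply: lerD; first by apply: (eps_le N0 NM z0 K_ge1 nu_ge1 Kz (ld i).1).
        by rewrite -c_eta; apply: gt_rowz.
      by rewrite -mulrDr mulrA mulfK ?gt_eqF.
    rewrite cmodM; apply: ler_pM; rewrite ?cmod_ge0//; exact: (cmod_a_le N0 NM zK).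
  rewrite e3 cmodM cmodM.
  apply: (@le_trans _ _ (K * kk K K1 * K1 * (K * Del))).
    apply: ler_pM; rewrite ?mulr_ge0 ?cmod_ge0//; apply: ler_pM; rewrite ?cmod_ge0//.
  rewrite [leLHS]mulrA; apply: le_trans (ler_wpM2l P1 Del_le) _.
  rewrite -[leRHS]mulrA; apply: ler_wpM2r; last by rewrite lerDl.
  by apply: mulr_ge0 nP; rewrite addr_ge0.
rewrite mul0r subr0.
have Qb := Im_q_le N0 NM z0 K_ge1 nu_ge1 Kz (ld j).1.
have U0 : 0 <= sp * kk K K1 by rewrite mulr_ge0 ?ltW.
have sm : 2 * (sp * kk K K1) * nu ^+ 2 * (c / Im z) <= 1.
  rewrite c_eta; rewrite [leLHS](_ : _ = 2 * kk K K1 * nu ^+ 2 * X); last first.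
    by field; rewrite !gt_eqF ?ltr0n.
  apply: le_trans ent_nuX; apply: ler_wpM2r; first exact: ltW ent_X0.
  apply: (@le_trans _ _ (nu * nu ^+ 2)); last by rewrite -exprS nup.
  apply: ler_wpM2r; first exact: sqr_ge0.
  apply: le_trans nu_large; have -> : 2 * kk K K1 = 4 * (K1 * K) by rewrite /kk; ring.
  have k1 : 1 <= K1 * K by rewrite mulr_ege1// ent_K1.
  have k2 : 1 <= K1 * K * K3 K K1 by rewrite mulr_ege1// ent_k3.
  rewrite [leRHS](_ : _ = 256 * (K1 * K) * (K1 * K * K3 K K1)); last by ring.
  apply: (@le_trans _ _ (256 * (K1 * K))); last by rewrite ler_peMr// mulr_ge0// (le_trans ler01).
  by rewrite ler_wpM2r ?ler_nat// (le_trans ler01).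
have h := offdiag z0 (c0 R N0 NM) (lt_le_trans ltr01 nu_ge1) ij lin U0 (ub i) (ub j) Qb sm.
rewrite cmodM in h.
have sqE : Num.sqrt (2 * (sp * kk K K1) ^+ 2 * (sp^-1 * (2 * nu * Gam z K A)) * (c / Im z)) <= 2 * kk K K1 * (nu * Psi1 z K A).
  have r0 : 0 <= 2 * kk K K1 * (nu * Psi1 z K A).
    exact: mulr_ge0 (mulr_ge0 (ler0n _ 2) (ltW kk0)) (mulr_ge0 n0 Psi0).
  rewrite -[leRHS]ger0_norm// -sqrtr_sqr; apply: ler_wsqrtr.
  rewrite c_eta; rewrite [leLHS](_ : _ = 4 * kk K K1 ^+ 2 * nu * (Gam z K A * X)); last first.
    by field; rewrite !gt_eqF ?ltr0n.
  rewrite -(Psi1_sqr N0 z0).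
  rewrite [leRHS](_ : _ = 4 * kk K K1 ^+ 2 * nu ^+ 2 * Psi1 z K A ^+ 2); last by ring.
  apply: ler_wpM2r; first exact: sqr_ge0.
  apply: ler_wpM2l; first by rewrite mulr_ge0 ?sqr_ge0.
  by rewrite expr2 ler_peMl.
have h2 : cmod z * cmod (resG A z i j) <= sp * kk K K1 * (nu * (2 * kk K K1 * (nu * Psi1 z K A))).
  by apply: le_trans h _; apply: (ler_wpM2l U0); apply: (ler_wpM2l n0); exact: sqE.
have gen (V x : R) : 0 <= V -> cmod z * x <= sp * kk K K1 * V -> x <= K * (kk K K1 * V).
  move=> V0 hV; rewrite -(ler_pM2l zp); apply: le_trans hV _.
  rewrite -[leLHS]mulrA [leRHS]mulrA (mulrC (cmod z)).
  exact: ler_wpM2r (mulr_ge0 (ltW kk0) V0) _ _ Kz.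
have h3 : cmod (resG A z i j) <= K * (kk K K1 * (nu * (2 * kk K K1 * (nu * Psi1 z K A)))).
  apply: gen h2; apply: (mulr_ge0 n0).
  exact: mulr_ge0 (mulr_ge0 (ler0n _ 2) (ltW kk0)) (mulr_ge0 n0 Psi0).
apply: le_trans h3 _.
rewrite [leLHS](_ : _ = 2 * K * kk K K1 ^+ 2 * (nu ^+ 2 * Psi1 z K A)); last by ring.
have n2 : nu ^+ 2 * Psi1 z K A <= (4 + K ^+ 3) * (nu ^+ 7 * Ps).
  apply: le_trans (ler_wpM2l (nu0 2) Psi1_le) _.
  rewrite [leLHS](_ : _ = (2 + K ^+ 3) * (nu ^+ 6 * Ps)); last by ring.
  apply: ler_pM; rewrite ?addr_ge0 ?mulr_ge0 ?nu0 ?Ps0//; first by rewrite lerD2r ler_nat.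
  by apply: ler_wpM2r; rewrite ?Ps0 ?nup.
rewrite -[leRHS]mulrA; apply: (ler_pM P2 _ _ n2); first exact: mulr_ge0 (nu0 2) Psi0.
by rewrite lerDr.
Qed.

(** For the other Gram matrix the limit of [1 + q_] is [1 + m / sqrt phi], of modulus at least
    [1/2]. So [u_] is bounded by 4 instead of a multiple of [sqrt phi], and this produces the factor
    [1 / phi]. *)
Lemma entry_G (i j : 'I_M) :
  (forall i : 'I_M, cmod (q_ (adjmx A) z i - c%:C%C * \tr (resR (rowz i (adjmx A)) z)) <=
     nu * (c * Num.sqrt (hs (resR (rowz i (adjmx A)) z)))) ->
  lin_ok c nu z (adjmx A) ->
  cmod (resG (adjmx A) z i j - kdelta R i j * m_phi_inv phi z) <=
   phi^-1 * ((40 * K) * (4 + K ^+ 3) * (nu ^+ 7 * Ps)).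
Proof.
move=> ldx lin; set B := adjmx A in ldx lin *.
have [z0 zK Kz etaK [bK imK]] := zd; have [sK YK] := bd.
have phi1 := phi_ge1 R N0 NM; have s0 := sp0 R N0 NM; have K0 : 0 <= K := le_trans ler01 K_ge1.
have k3 : 0 <= K ^+ 3 by exact: exprn_ge0.
have n0 : 0 <= nu := le_trans ler01 nu_ge1.
have zp : 0 < cmod z by rewrite cmod_gt0 zn0.
have Psi0 : 0 <= Psi1 z K A := sqrtr_ge0 _; have c0 := c0 R N0 NM.
have sV0 : 0 <= sp^-1 by rewrite invr_ge0 ltW.
have NC : 0 < N%:R :> R by rewrite ltr0n.
(* The partial average of the new [q_] is [st / sqrt phi] without any shift, so the averaged law
   already proved for [A] can be used. *)
have trB : c%:C%C * \tr (resR B z) = sp^-1%:C%C * st z A.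
  rewrite /st resG_resR -/B mulrA (natC R N) -fmorphV -rmorphM; congr (_%:C%C * _).
  by rewrite /entry_var invfM.
have dB k : cmod (c%:C%C * \tr (resR B z) - c%:C%C * \tr (resR (rowz k B) z)) <= sp^-1 * X.
  rewrite -mulrBr cmodM cmod_pos ?(ltW c0)// -c_eta ler_wpM2l ?(ltW c0)//; exact: tr_res_diff.
have ImB k : c * hs (resR (rowz k B) z) * Im z <= sp^-1 * Gam z K A.
  have -> : c * hs (resR (rowz k B) z) * Im z = Im (c%:C%C * \tr (resR (rowz k B) z)).
    by rewrite cImZ Im_trG//; ring.
  have h1 : Im (c%:C%C * \tr (resR (rowz k B) z)) <= Im (c%:C%C * \tr (resR B z)) + sp^-1 * X.
    by rewrite -lerBlDl -cImB; apply: le_trans (Im_le_cmod _) _; rewrite cmodB dB.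
  apply: le_trans h1 _; rewrite trB cImZ -mulrDr ler_wpM2l// /Gam lerD2r lerDl.
  by rewrite mulr_ge0 ?sqr_ge0// ltW.
have sqB k : c * Num.sqrt (hs (resR (rowz k B) z)) <= sp^-1 * Psi1 z K A.
  apply: le_of_sqr; first by rewrite mulr_ge0.
  rewrite exprMn sqr_sqrtr ?hs_ge0// [leRHS]exprMn Psi1_sqr//.
  rewrite [leRHS](_ : _ = c * (sp^-1 * Gam z K A / Im z)); last first.
    by rewrite /entry_var; field; rewrite !gt_eqF.
  rewrite expr2 -mulrA; apply: ler_wpM2l; first exact: ltW.
  by rewrite ler_pdivlMr.
have epsB k : cmod (q_ B z k - c%:C%C * \tr (resR (rowz k B) z)) <= sp^-1 * (nu * Psi1 z K A).
  by apply: le_trans (ldx k) _; rewrite [leRHS]mulrCA ler_wpM2l.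
set m := m_phi phi z.
have qd k : cmod ((1 + q_ B z k) - (1 + sp^-1%:C%C * m)) <= sp^-1 * Del.
  have -> : (1 + q_ B z k) - (1 + sp^-1%:C%C * m) = (q_ B z k - c%:C%C * \tr (resR (rowz k B) z)) -
     (c%:C%C * \tr (resR B z) - c%:C%C * \tr (resR (rowz k B) z)) + sp^-1%:C%C * (st z A - m).
    by rewrite mulrBr -trB; ring.
  apply: le_trans (cmodD _ _) _; rewrite /Del [leRHS]mulrDr [X in _ <= X + _]mulrDr; apply: lerD.
    by apply: le_trans (cmodD _ _) _; rewrite cmodN; apply: lerD.
  by rewrite cmodM cmod_pos.
have [_ _ _ _ [_ mh _]] := mp_facts phi1 z0; rewrite -/m in mh.
have spV1 : sp^-1 <= 1 by rewrite invf_le1 ?sp1.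
have D0 : 0 <= Del by rewrite !addr_ge0 ?cmod_ge0 ?(ltW ent_X0)// mulr_ge0.
have q4 k : 4^-1 <= cmod (1 + q_ B z k).
  have := cmodB_ge (1 + sp^-1%:C%C * m) ((1 + sp^-1%:C%C * m) - (1 + q_ B z k)).
  rewrite opprB addrCA subrr addr0 [cmod (_ - (1 + q_ _ _ _))]cmodB => h.
  have h1 : cmod ((1 + q_ B z k) - (1 + sp^-1%:C%C * m)) <= 4^-1.
    by apply: le_trans (qd k) _; apply: le_trans Del_small; rewrite ler_piMl.
  have ar (x y w : R) : 2^-1 <= x -> y <= 4^-1 -> x - y <= w -> 4^-1 <= w by lra.
  exact: ar mh h1 h.
have u4 k : cmod (u_ B z k) <= 4.
  by rewrite /u_ -[4]invrK; apply: ler_cmodV; rewrite ?q4.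
have pE : phi^-1 = sp^-1 * sp^-1 by rewrite -invfM spsp.
have sz : sp^-1 / cmod z <= K * phi^-1.
  rewrite pE mulrA -[sp^-1 / _]mulrC; apply: ler_wpM2r => //.
  by rewrite ler_pdivlMr// mulrC szK.
have nP : 0 <= nu ^+ 7 * Ps by rewrite mulr_ge0 ?nu0 ?Ps0.
have zinv (x : C) (y : R) : cmod (z * x) <= sp^-1 * y -> 0 <= y -> cmod x <= K * phi^-1 * y.
  move=> h y0; rewrite cmodM in h; apply: (@le_trans _ _ (sp^-1 / cmod z * y)).
    by rewrite mulrAC ler_pdivlMr// mulrC.
  exact: ler_wpM2r.
have fin (x : R) : x <= K * phi^-1 * (40 * ((4 + K ^+ 3) * (nu ^+ 7 * Ps))) ->
   x <= phi^-1 * ((40 * K) * (4 + K ^+ 3) * (nu ^+ 7 * Ps)).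
  by move=> h; apply: le_trans h _; rewrite le_eqVlt; apply/orP; left; apply/eqP; ring.
have DP0 : 0 <= (4 + K ^+ 3) * (nu ^+ 7 * Ps) by rewrite mulr_ge0// addr_ge0.
have KV : 0 <= K * phi^-1 by rewrite mulr_ge0// invr_ge0 (le_trans ler01).
apply: fin; rewrite /kdelta; case: eqP => [<-|/eqP ij].
  rewrite mul1r; apply: (@le_trans _ _ (K * phi^-1 * (8 * Del))); last first.
    apply: ler_wpM2l => //; apply: ler_pM => //; [by rewrite ler_nat|exact: Del_le].
  apply: zinv; last exact: mulr_ge0.
  have e1 := resG_ii B i z0; have e2 := m_phi_invE phi1 z0; rewrite -/m in e2.
  have q0 := q_neq0 B i z0.
  have m0 : 1 + sp^-1%:C%C * m != 0 by rewrite -cmod_gt0; apply: lt_le_trans mh.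
  have -> : z * (resG B z i i - m_phi_inv phi z) =
    ((1 + q_ B z i) - (1 + sp^-1%:C%C * m)) * ((1 + q_ B z i)^-1 * (1 + sp^-1%:C%C * m)^-1).
    have e3 : z * m_phi_inv phi z = - (1 + sp^-1%:C%C * m)^-1.
      by apply: (mulfI m0); rewrite mulrN mulfV// -e2; ring.
    rewrite mulrBr e1 e3 /u_; move: (1 + q_ B z i) (1 + _ * m) q0 m0 => x y x0 y0; field.
    by rewrite x0 y0.
  rewrite cmodM [leRHS](_ : _ = sp^-1 * Del * 8); last by ring.
  apply: (ler_pM (cmod_ge0 _) (cmod_ge0 _) (qd i)).
  have -> : 8 = 4 * 2 :> R by ring.
  rewrite cmodM; apply: (ler_pM (cmod_ge0 _) (cmod_ge0 _) (u4 i)).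
  by rewrite -[2]invrK; apply: ler_cmodV.
rewrite mul0r subr0.
apply: (@le_trans _ _ (K * phi^-1 * (32 * (nu ^+ 2 * Psi1 z K A)))); last first.
  apply: ler_wpM2l => //; apply: ler_pM => //; first by rewrite mulr_ge0 ?nu0.
    by rewrite ler_nat.
  apply: le_trans (ler_wpM2l (nu0 2) Psi1_le) _.
  rewrite [leLHS](_ : _ = (2 + K ^+ 3) * (nu ^+ 6 * Ps)); last by ring.
  apply: ler_pM; rewrite ?addr_ge0 ?mulr_ge0 ?nu0 ?Ps0//; first by rewrite lerD2r ler_nat.
  by apply: ler_wpM2r; rewrite ?Ps0 ?nup.
apply: zinv; last by rewrite mulr_ge0// mulr_ge0 ?nu0.
have G0 := Gam0 N0 z0 K A.
have Qb : Im (q_ B z j) <= sp^-1 * (2 * nu * Gam z K A).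
  have -> : q_ B z j = c%:C%C * \tr (resR (rowz j B) z) + (q_ B z j - c%:C%C * \tr (resR (rowz j B) z)) by ring.
  rewrite cImD; apply: (@le_trans _ _ (sp^-1 * Gam z K A + sp^-1 * (nu * Psi1 z K A))).
    apply: lerD; last exact: le_trans (Im_le_cmod _) (epsB j).
    by have := ImB j; rewrite cImZ Im_trG// [Im z * _]mulrC mulrA.
  rewrite -mulrDr ler_wpM2l//.
  have h : nu * Psi1 z K A <= nu * Gam z K A by rewrite ler_wpM2l// Psi1_leGam.
  have h' : 1 * Gam z K A <= nu * Gam z K A by rewrite ler_wpM2r// ltW.
  rewrite mul1r in h'; apply: le_trans (lerD h' h) _.
  by rewrite le_eqVlt; apply/orP; left; apply/eqP; ring.
have sm : 2 * 4 * nu ^+ 2 * (c / Im z) <= 1.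
  rewrite c_eta; apply: le_trans ent_nuX.
  have e8 : 2 * 4 * nu ^+ 2 <= nu ^+ 10.
    apply: (@le_trans _ _ (nu * nu ^+ 2)); last by rewrite -exprS nup.
    apply: ler_wpM2r; first exact: sqr_ge0.
    by apply: le_trans nu_256; rewrite -natrM ler_nat.
  apply: ler_pM => //; first by rewrite mulr_ge0// sqr_ge0.
    by rewrite mulr_ge0// (ltW ent_X0).
  by rewrite ler_piMl// (ltW ent_X0).
have h := offdiag z0 c0 (lt_le_trans ltr01 nu_ge1) ij lin (ler0n _ 4) (u4 i) (u4 j) Qb sm.
apply: le_trans h _; rewrite [leRHS](_ : _ = 4 * (nu * (8 * sp^-1 * (nu * Psi1 z K A)))); last by ring.
rewrite ler_wpM2l// ler_wpM2l//.
have r0 : 0 <= 8 * sp^-1 * (nu * Psi1 z K A) by rewrite !mulr_ge0.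
rewrite -[leRHS]ger0_norm// -sqrtr_sqr; apply: ler_wsqrtr.
rewrite c_eta; rewrite [leLHS](_ : _ = 64 * sp^-1 ^+ 2 * nu * (Gam z K A * X)); last by ring.
rewrite -(Psi1_sqr N0 z0).
rewrite [leRHS](_ : _ = 64 * sp^-1 ^+ 2 * nu ^+ 2 * Psi1 z K A ^+ 2); last by ring.
apply: ler_wpM2r; first exact: sqr_ge0.
apply: ler_wpM2l; first by rewrite mulr_ge0 ?sqr_ge0.
by rewrite expr2 ler_peMl.
Qed.
End Entries.

(** * Rare events *)

Section RareEvents.
Variable R : realType.
Local Notation Re := (@complex.Re R).
Local Notation Im := (@complex.Im R).
Local Notation C := R[i].

(* Outer bounds, so that only the covering sets need to be measurable. *)
Definition covered d (T : measurableType d) (P : probability T R) (S : set T) (b : R) : Prop :=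
  exists2 B, measurable B & (S `<=` B) /\ (P B <= b%:E)%E.

Lemma covered_le d (T : measurableType d) (P : probability T R) (S S' : set T) (b b' : R) :
  covered P S b -> S' `<=` S -> b <= b' -> covered P S' b'.
Proof.
move=> [B mB [SB Pb]] SS bb; exists B => //; split; first exact: subset_trans SS SB.
by apply: le_trans Pb _; rewrite lee_fin.
Qed.
Lemma coveredU d (T : measurableType d) (P : probability T R) (S S' : set T) (b b' : R) :
  covered P S b -> covered P S' b' -> covered P (S `|` S') (b + b').
Proof.
move=> [B mB [SB Pb]] [B' mB' [SB' Pb']]; exists (B `|` B'); first exact: measurableU.
split; first exact: setUSS.
by apply: le_trans (measureU2 _ mB mB') _; rewrite EFinD; exact: leeD.
Qed.
Lemma covered_fin d (T : measurableType d) (P : probability T R) (I : finType) (S : I -> set T) (b : R) :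
  0 <= b -> (forall i, covered P (S i) b) -> covered P [set t | exists i, S i t] (#|I|%:R * b).
Proof.
move=> b0 h; have key (s : seq I) : covered P [set t | exists2 i, i \in s & S i t] ((size s)%:R * b).
  elim: s => [|i s IH].
    exists set0 => //; rewrite measure0 mul0r; split => //.
    by move=> t /= [j]; rewrite in_nil.
  apply: covered_le (coveredU (h i) IH) _ _.
    move=> t [j]; rewrite in_cons => /orP[/eqP->|js] St; first by left.
    by right; exists j.
  by rewrite /= -natr1 mulrDl mul1r addrC.
apply: covered_le (key (enum I)) _ _; last by rewrite -cardE.
by move=> t [i Si]; exists i => //; rewrite mem_enum.
Qed.

Lemma covered_lt d (T : measurableType d) (P : probability T R) (f g : T -> R) (b : R) :
  rmeas f -> rmeas g -> (P [set t | (f t < g t)%R] <= b%:E)%E -> covered P [set t | ~ (g t <= f t)] b.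
Proof.
move=> mf mg Pb; exists [set t | f t < g t]; first exact: measurable_lt.
by split => // t /= /negP; rewrite -ltNge.
Qed.

Lemma inv_pow_le (nu : R) a b : 1 <= nu -> (a <= b)%N -> nu^-1 ^+ b <= nu^-1 ^+ a.
Proof. by move=> n1 ab; rewrite ler_wiXn2l ?invr_ge0 ?invf_le1 ?(le_trans ler01)// (lt_le_trans ltr01). Qed.

(** The flag treats the resolvent and its square as one family, so that a single tail bound and a
    single union bound serve both. *)
Definition res_pow (sq : bool) (z : C) m n (B : 'M[C]_(m, n)) : 'M[C]_n :=
  if sq then resR B z *m resR B z else resR B z.

Lemma mxmeas_res_pow sq z d (T : measurableType d) m n (A : T -> 'M[C]_(m, n)) : 0 < Im z ->
  mxmeas A -> mxmeas (fun t => res_pow sq z (A t)).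
Proof. by move=> z0 mA; case: sq; [apply: mxmeasM; exact: mxmeas_resR|exact: mxmeas_resR]. Qed.

Lemma quad_tail (mu : nat -> R) D : exists2 K : R, 0 <= K &
  forall d (T : measurableType d) (P : probability T R) m n (A : T -> 'M[C]_(m, n)) c z nu sq i,
  0 < c -> row_model P A c mu -> 0 < Im z -> 1 <= nu ->
  covered P [set t | ~ (cmod (qf (row i (A t)) (row i (A t)) (res_pow sq z (rowz i (A t))) -
      c%:C%C * \tr (res_pow sq z (rowz i (A t)))) <=
      nu * (c * Num.sqrt (hs (res_pow sq z (rowz i (A t))))))] (K * nu^-1 ^+ D).
Proof.
have [K K0 hK] := ld_quadratic_tail mu D; exists K => // d T P m n A c z nu sq i c0 rm z0 n1.
have nu0 : 0 < nu := lt_le_trans ltr01 n1; have [mA _ _ _] := rm.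
have mBz : mxmeas (fun t => res_pow sq z (rowz i (A t))) by apply: mxmeas_res_pow => //; exact: mxmeas_rowz.
apply: covered_lt.
- apply: rmeasM; first exact: rmeas_cst.
  by apply: rmeasM; [exact: rmeas_cst|apply: rmeas_sqrt; exact: rmeas_hs].
- apply: rmeas_cmod; apply: cmeasB.
    by apply: cmeas_qf => //; exact: mxmeas_row.
  by apply: cmeasM; [exact: cmeas_cst|exact: cmeas_tr].
have := hK d T P m n A c c0 rm i (fun B => res_pow sq z (B : 'M[C]_(m, n))) nu nu0
  (mxmeas_res_pow sq z0 (@mxmeas_id R m n)).
move=> /le_trans; apply; rewrite lee_fin -exprVn; apply: ler_wpM2l => //.
by apply: inv_pow_le => //; rewrite mulnS (leq_trans _ (leq_addl _ _))// leq_pmull.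
Qed.

Definition res_col (adj : bool) (z : C) m n (j : 'I_m) (B : 'M[C]_(m, n)) : 'cV[C]_n :=
  (if adj then adjmx (resR B z) else resR B z) *m adjmx (row j B).

Lemma mxmeas_res_col adj z d (T : measurableType d) m n (A : T -> 'M[C]_(m, n)) j : 0 < Im z ->
  mxmeas A -> mxmeas (fun t => res_col adj z j (A t)).
Proof.
move=> z0 mA; rewrite /res_col; case: adj; apply: mxmeasM.
- by apply: mxmeas_adj; exact: mxmeas_resR.
- by apply: mxmeas_adj; exact: mxmeas_row.
- exact: mxmeas_resR.
- by apply: mxmeas_adj; exact: mxmeas_row.
Qed.

Lemma lin_tail (mu : nat -> R) D : exists2 K : R, 0 <= K &
  forall d (T : measurableType d) (P : probability T R) m n (A : T -> 'M[C]_(m, n)) c z nu adj i j,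
  0 < c -> row_model P A c mu -> 0 < Im z -> 1 <= nu ->
  covered P [set t | ~ (cmod (\tr (row i (A t) *m res_col adj z j (rowz i (A t)))) <=
      nu * Num.sqrt (c * hs (res_col adj z j (rowz i (A t)))))] (K * nu^-1 ^+ D).
Proof.
have [K K0 hK] := ld_linear_tail mu D; exists K => // d T P m n A c z nu adj i j c0 rm z0 n1.
have nu0 : 0 < nu := lt_le_trans ltr01 n1; have [mA _ _ _] := rm.
have mBz : mxmeas (fun t => res_col adj z j (rowz i (A t))) by apply: mxmeas_res_col => //; exact: mxmeas_rowz.
apply: covered_lt.
- apply: rmeasM; first exact: rmeas_cst.
  by apply: rmeas_sqrt; apply: rmeasM; [exact: rmeas_cst|exact: rmeas_hs].
- by apply: rmeas_cmod; apply: cmeas_tr; apply: mxmeasM => //; exact: mxmeas_row.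
have := hK d T P m n A c c0 rm i (fun B => res_col adj z j (B : 'M[C]_(m, n))) nu nu0
  (mxmeas_res_col adj j z0 (@mxmeas_id R m n)).
move=> /le_trans; apply; rewrite lee_fin -exprVn; apply: ler_wpM2l => //.
by apply: inv_pow_le => //; rewrite mulnS (leq_trans _ (leq_addl _ _))// leq_pmull.
Qed.

(** * Exceptional events of the descent and of the entries *)

Section Rare.
Variables (K e0 : R) (mu : nat -> R) (q r : nat).
Hypothesis K_ge1 : 1 <= K.
Hypothesis q0 : (0 < q)%N.

(** [nu] is [N^(1/q)], and [e0] is the height at which the descent starts. The condition on [z]
    concerns the whole vertical segment up to [e0], so it is inherited by all grid points above
    [z]. *)
Definition okay d (T : measurableType d) (P : probability T R) N M (A : T -> 'M[C]_(N, M)) (z : C) (nu : R) : Prop :=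
 [/\ [/\ (0 < N)%N, (N <= M)%N, row_model P A (entry_var R N M) mu &
      row_model P (fun t => adjmx (A t)) (entry_var R N M) mu],
     [/\ 1 <= nu, nu ^+ q = N%:R, M%:R <= nu ^+ r & nu ^+ 10 <= N%:R * Im z] &
     [/\ 6 <= e0, e0 <= K, Im z <= e0, cmod (mp_a (mp_ratio R N M) (Complex (Re z) e0)) <= 2 * e0 &
      forall e, Im z <= e <= e0 -> zdom N M K (Complex (Re z) e)]].

(* Events attached to every instance of the model; [rare] bounds are uniform over all instances. *)
Definition event := forall d (T : measurableType d) N M, (T -> 'M[C]_(N, M)) -> C -> R -> set T.

Definition rare_from (v0 : R) (Ev : event) : Prop := forall D : nat, exists2 Cn : R, 0 <= Cn &
  forall d (T : measurableType d) (P : probability T R) N M (A : T -> 'M[C]_(N, M)) z nu,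
  okay P A z nu -> v0 <= nu -> covered P (Ev d T N M A z nu) (Cn * nu^-1 ^+ D).
Definition rare := rare_from 1.

Lemma okay_nu d (T : measurableType d) (P : probability T R) N M (A : T -> 'M[C]_(N, M)) z nu :
  okay P A z nu -> 1 <= nu.
Proof. by case=> _ []. Qed.

(** Small [nu] are harmless: there [v0^D * nu^-D] is at least 1, so enlarging the constant makes the
    bound trivial. *)
Lemma rare_of v0 (Ev : event) : 1 <= v0 -> rare_from v0 Ev -> rare Ev.
Proof.
move=> v1 h D; have [Cn C0 hC] := h D.
have vD : 0 <= v0 ^+ D by rewrite exprn_ge0// (le_trans ler01).
exists (Cn + v0 ^+ D); first exact: addr_ge0.
move=> d T P N M A z nu ok n1; have i0 : 0 <= nu^-1 ^+ D by rewrite exprn_ge0// invr_ge0 (le_trans ler01).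
have [vn|vn] := leP v0 nu.
  apply: covered_le (hC _ _ _ _ _ _ _ _ ok vn) _ _ => //.
  by rewrite ler_wpM2r// lerDl.
exists setT => //; split => //; rewrite probability_setT lee_fin.
apply: (@le_trans _ _ (v0 ^+ D * nu^-1 ^+ D)); last by rewrite ler_wpM2r// lerDr.
rewrite -exprMn exprn_ege1// -[nu^-1]div1r mulrA mulr1 ler_pdivlMr ?mul1r ?(ltW vn)//.
exact: lt_le_trans n1.
Qed.

Lemma rare_sub v0 (E1 E : event) : 1 <= v0 -> rare E1 ->
  (forall d (T : measurableType d) (P : probability T R) N M (A : T -> 'M[C]_(N, M)) z nu,
     okay P A z nu -> v0 <= nu -> E d T N M A z nu `<=` E1 d T N M A z nu) -> rare E.
Proof.
move=> v1 r1 sub; apply: (rare_of v1) => D; have [Cn C0 hC] := r1 D; exists Cn => //.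
move=> d T P N M A z nu ok vn; have n1 := okay_nu ok.
by apply: covered_le (hC _ _ _ _ _ _ _ _ ok n1) _ _ => //; exact: sub ok vn.
Qed.
Lemma rareU (E1 E2 : event) : rare E1 -> rare E2 ->
  rare (fun d T N M A z nu => E1 d T N M A z nu `|` E2 d T N M A z nu).
Proof.
move=> r1 r2 D; have [C1 C10 h1] := r1 D; have [C2 C20 h2] := r2 D; exists (C1 + C2); first exact: addr_ge0.
move=> d T P N M A z nu ok n1; rewrite mulrDl.
exact: coveredU (h1 _ _ _ _ _ _ _ _ ok n1) (h2 _ _ _ _ _ _ _ _ ok n1).
Qed.
Lemma rare_fin (I : nat -> nat -> finType) s
    (Ev : forall d (T : measurableType d) N M, I N M -> (T -> 'M[C]_(N, M)) -> C -> R -> set T) :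
  (forall d (T : measurableType d) (P : probability T R) N M (A : T -> 'M[C]_(N, M)) z nu,
     okay P A z nu -> #|I N M|%:R <= 2 * nu ^+ s) ->
  (forall D : nat, exists2 Cn : R, 0 <= Cn &
    forall d (T : measurableType d) (P : probability T R) N M (A : T -> 'M[C]_(N, M)) z nu i,
    okay P A z nu -> covered P (Ev d T N M i A z nu) (Cn * nu^-1 ^+ D)) ->
  rare (fun d T N M A z nu => [set t | exists i, Ev d T N M i A z nu t]).
Proof.
move=> cnt h D; have [Cn C0 hC] := h (D + s)%N; exists (2 * Cn); first exact: mulr_ge0.
move=> d T P N M A z nu ok n1; have nu0 : 0 < nu := lt_le_trans ltr01 n1.
have b0 : 0 <= Cn * nu^-1 ^+ (D + s) by rewrite mulr_ge0// exprn_ge0// invr_ge0 ltW.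
apply: covered_le (covered_fin b0 (fun i => hC _ _ _ _ _ _ _ _ i ok)) _ _ => //.
apply: le_trans (ler_wpM2r b0 (cnt _ _ _ _ _ _ _ _ ok)) _.
rewrite exprD le_eqVlt; apply/orP; left; apply/eqP; rewrite !exprVn; field.
by rewrite !gt_eqF ?exprn_gt0.
Qed.

Lemma cnt_N d (T : measurableType d) (P : probability T R) N M (A : T -> 'M[C]_(N, M)) z nu :
  okay P A z nu -> [/\ N%:R <= nu ^+ q, M%:R <= nu ^+ r & 0 < Im z].
Proof.
case=> [[N0 NM _ _] [n1 nq Mr nN] [_ _ ze _ hz]]; rewrite nq; split => //.
by have := hz (Im z); rewrite lexx ze => /(_ isT)[].
Qed.

Lemma rare_ld : rare (fun d T N M A z nu => [set t | ~ ld_ok nu z (A t)]).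
Proof.
pose Ev d (T : measurableType d) N M (p : 'I_N * bool) (A : T -> 'M[C]_(N, M)) (z : C) (nu : R) : set T :=
  [set t | ~ (cmod (qf (row p.1 (A t)) (row p.1 (A t)) (res_pow p.2 z (rowz p.1 (A t))) -
      (entry_var R N M)%:C%C * \tr (res_pow p.2 z (rowz p.1 (A t)))) <=
      nu * (entry_var R N M * Num.sqrt (hs (res_pow p.2 z (rowz p.1 (A t))))))].
have rE : rare (fun d T N M A z nu => [set t | exists i, Ev d T N M i A z nu t]).
  apply: (@rare_fin (fun N _ => ('I_N * bool)%type) q).
    move=> d T P N M A z nu /cnt_N[Nn _ _].
    by rewrite card_prod card_ord card_bool natrM mulrC ler_wpM2l.
  move=> D; have [Kp Kp0 hK] := quad_tail mu D; exists Kp => // d T P N M A z nu p ok.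
  have [_ _ z0] := cnt_N ok; have n1 := okay_nu ok; have [[N0 NM rm _] _ _] := ok.
  exact: hK (c0 R N0 NM) rm z0 n1.
apply: (rare_sub (lexx 1) rE) => d T P N M A z nu _ _ t /= nld.
apply: contra_notP nld => hn i; split.
  have /contrapT h : ~ Ev d T N M (i, false) A z nu t by move=> h; apply: hn; exists (i, false).
  exact: h.
have /contrapT h : ~ Ev d T N M (i, true) A z nu t by move=> h; apply: hn; exists (i, true).
by move: h; rewrite /k2_ /t2_.
Qed.

Lemma rare_ldG : rare (fun d T N M A z nu => [set t | ~ forall i : 'I_M,
  cmod (q_ (adjmx (A t)) z i - (entry_var R N M)%:C%C * \tr (resR (rowz i (adjmx (A t))) z)) <=
     nu * (entry_var R N M * Num.sqrt (hs (resR (rowz i (adjmx (A t))) z)))]).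
Proof.
pose Ev d (T : measurableType d) N M (i : 'I_M) (A : T -> 'M[C]_(N, M)) (z : C) (nu : R) : set T :=
  [set t | ~ (cmod (q_ (adjmx (A t)) z i - (entry_var R N M)%:C%C * \tr (resR (rowz i (adjmx (A t))) z)) <=
     nu * (entry_var R N M * Num.sqrt (hs (resR (rowz i (adjmx (A t))) z))))].
have rE : rare (fun d T N M A z nu => [set t | exists i, Ev d T N M i A z nu t]).
  apply: (@rare_fin (fun _ M => 'I_M : finType) r).
    move=> d T P N M A z nu ok; have [_ Mn _] := cnt_N ok; rewrite card_ord; apply: le_trans Mn _.
    by rewrite ler_peMl ?ler1n// exprn_ge0// (le_trans ler01)// (okay_nu ok).
  move=> D; have [Kp Kp0 hK] := quad_tail mu D; exists Kp => // d T P N M A z nu i ok.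
  have [_ _ z0] := cnt_N ok; have n1 := okay_nu ok; have [[N0 NM _ rm] _ _] := ok.
  exact: (hK _ _ _ _ _ _ _ z nu false i (c0 R N0 NM) rm z0 n1).
apply: (rare_sub (lexx 1) rE) => d T P N M A z nu _ _ t /= nld.
apply: contra_notP nld => hn i.
by have /contrapT : ~ Ev d T N M i A z nu t by move=> h; apply: hn; exists i.
Qed.

Lemma lin_ok_of c (nu : R) z m n (B : 'M[C]_(m, n)) :
  (forall p : 'I_m * 'I_m * bool, cmod (\tr (row p.1.1 B *m res_col p.2 z p.1.2 (rowz p.1.1 B))) <=
      nu * Num.sqrt (c * hs (res_col p.2 z p.1.2 (rowz p.1.1 B)))) -> lin_ok c nu z B.
Proof. by move=> h i j _ b1 b2; split; [exact: (h (i, j, false))|exact: (h (i, j, true))]. Qed.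

Lemma rare_lin (G : bool) : rare (fun d T N M A z nu => [set t |
  ~ if G then lin_ok (entry_var R N M) nu z (adjmx (A t)) else lin_ok (entry_var R N M) nu z (A t)]).
Proof.
pose bad (c nu : R) z m n (B : 'M[C]_(m, n)) (p : 'I_m * 'I_m * bool) : Prop :=
  ~ (cmod (\tr (row p.1.1 B *m res_col p.2 z p.1.2 (rowz p.1.1 B))) <=
      nu * Num.sqrt (c * hs (res_col p.2 z p.1.2 (rowz p.1.1 B)))).
have card2 (n s : nat) (nu : R) : n%:R <= nu ^+ s -> 
    #|(('I_n * 'I_n) * bool)%type : finType|%:R <= 2 * nu ^+ (s + s).
  move=> h; rewrite !card_prod !card_ord card_bool natrM mulrC ler_wpM2l// natrM exprD.
  exact: ler_pM.
case: G.
  have rE : rare (fun d T N M A z nu => [set t | exists p, bad (entry_var R N M) nu z M N (adjmx (A t)) p]).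
    apply: (@rare_fin (fun _ M => (('I_M * 'I_M) * bool)%type : finType) (r + r)%N
       (fun d T N M p A z nu => [set t | bad (entry_var R N M) nu z M N (adjmx (A t)) p])).
      by move=> d T P N M A z nu ok; apply: card2; have [] := cnt_N ok.
    move=> D; have [Kp Kp0 hK] := lin_tail mu D; exists Kp => // d T P N M A z nu p ok.
    have [_ _ z0] := cnt_N ok; have n1 := okay_nu ok; have [[N0 NM _ rm] _ _] := ok.
    exact: (hK _ _ _ _ _ _ _ z nu p.2 p.1.1 p.1.2 (c0 R N0 NM) rm z0 n1).
  apply: (rare_sub (lexx 1) rE) => d T P N M A z nu _ _ t /= nl.
  apply: contra_notP nl => hn; apply: lin_ok_of => p.
  by have /contrapT : ~ bad (entry_var R N M) nu z M N (adjmx (A t)) p by move=> h; apply: hn; exists p.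
have rE : rare (fun d T N M A z nu => [set t | exists p, bad (entry_var R N M) nu z N M (A t) p]).
  apply: (@rare_fin (fun N _ => (('I_N * 'I_N) * bool)%type : finType) (q + q)%N
     (fun d T N M p A z nu => [set t | bad (entry_var R N M) nu z N M (A t) p])).
    by move=> d T P N M A z nu ok; apply: card2; have [] := cnt_N ok.
  move=> D; have [Kp Kp0 hK] := lin_tail mu D; exists Kp => // d T P N M A z nu p ok.
  have [_ _ z0] := cnt_N ok; have n1 := okay_nu ok; have [[N0 NM rm _] _ _] := ok.
  exact: (hK _ _ _ _ _ _ _ z nu p.2 p.1.1 p.1.2 (c0 R N0 NM) rm z0 n1).
apply: (rare_sub (lexx 1) rE) => d T P N M A z nu _ _ t /= nl.
apply: contra_notP nl => hn; apply: lin_ok_of => p.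
by have /contrapT : ~ bad (entry_var R N M) nu z N M (A t) p by move=> h; apply: hn; exists p.
Qed.

Local Notation grid z N M := (zgrid (Re z) e0 (Im z) (N ^ 6 * M)%N).

Lemma grid_n0 N M : (0 < N)%N -> (N <= M)%N -> (0 < N ^ 6 * M)%N.
Proof. by move=> N0 NM; rewrite muln_gt0 expn_gt0 N0 (leq_trans N0). Qed.

Lemma okay_grid d (T : measurableType d) (P : probability T R) N M (A : T -> 'M[C]_(N, M)) z nu k :
  okay P A z nu -> (k <= N ^ 6 * M)%N -> okay P A (grid z N M k) nu.
Proof.
move=> ok kn; have [[N0 NM r1 r2] [n1 nq Mr nN] [e6 eK ze ae hz]] := ok.
have /andP[l u] := zgrid_Im (Re z) ze (grid_n0 N0 NM) kn.
split; [by split| |].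
  split => //; apply: le_trans nN _; rewrite ler_wpM2l//.
split=> //= e /andP[h1 h2]; apply: hz; rewrite h2 andbT; exact: le_trans l h1.
Qed.

(** The grid has polynomially many points and each satisfies [okay] with the same constants, so the
    union bound applies to it. *)
Lemma rare_grid (Ev : event) : rare Ev -> rare (fun d T N M A z nu =>
  [set t | exists k : 'I_(N ^ 6 * M).+1, Ev d T N M A (grid z N M k) nu t]).
Proof.
move=> rE; apply: (@rare_fin (fun N M => 'I_(N ^ 6 * M).+1 : finType) (q * 6 + r)%N
   (fun d T N M k A z nu => Ev d T N M A (grid z N M k) nu)).
  move=> d T P N M A z nu ok; have [[N0 NM _ _] [n1 nq Mr _] _] := ok.
  rewrite card_ord mulr_natl mulr2n -natr1.
  have h : (N ^ 6 * M)%:R <= nu ^+ (q * 6 + r).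
    by rewrite natrM natrX -nq exprD -exprM ler_wpM2l// exprn_ge0// (le_trans ler01).
  by apply: lerD => //; rewrite exprn_ege1.
move=> D; have [Cn C0 hC] := rE D; exists Cn => // d T P N M A z nu k ok.
have kn : (k <= N ^ 6 * M)%N by rewrite -ltnS.
exact: hC (okay_grid ok kn) (okay_nu ok).
Qed.

Definition Kone : R := 2 * K * (K + 2).
Lemma Kone_ge1 : 1 <= Kone.
Proof. by rewrite /Kone -mulrA mulr_ege1 ?ler1n// mulr_ege1//; apply: le_trans K_ge1 _; rewrite lerDl. Qed.
(** A sum of the thresholds needed for the weak law, for the grid steps, and for absorbing the
    factor [14 K] of the root selection. *)
Definition vlarge : R := 256 * Kone ^+ 2 * K ^+ 2 * K3 K Kone + 48 * (1 + K) ^+ 4 + 14 * K + 1.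
Lemma vlarge_parts : [/\ 256 * Kone ^+ 2 * K ^+ 2 * K3 K Kone <= vlarge, 48 * (1 + K) ^+ 4 <= vlarge,
  14 * K <= vlarge & 1 <= vlarge].
Proof.
have K0 : 0 <= K := le_trans ler01 K_ge1.
have p1 : 0 <= 256 * Kone ^+ 2 * K ^+ 2 * K3 K Kone.
  apply: mulr_ge0; last by exact: le_trans (@K3_ge1 R K Kone K_ge1 Kone_ge1).
  by apply: mulr_ge0; [apply: mulr_ge0 => //|]; exact: sqr_ge0.
have p2 : 0 <= 48 * (1 + K) ^+ 4 by rewrite mulr_ge0// exprn_ge0// addr_ge0.
have p3 : 0 <= 14 * K by rewrite mulr_ge0.
rewrite /vlarge; move: p1 p2 p3; move: (256 * _ * _ * _) (48 * _) (14 * K) => x y w x0 y0 w0.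
by split; lra.
Qed.

Lemma grid_facts d (T : measurableType d) (P : probability T R) N M (A : T -> 'M[C]_(N, M)) z nu :
  okay P A z nu -> vlarge <= nu -> let n := (N ^ 6 * M)%N in
  [/\ grid z N M n = z, grid z N M 0 = Complex (Re z) e0,
   forall k, (k <= n)%N -> zdom N M K (grid z N M k) &
   forall B k, (k < n)%N -> [/\ cmod (st (grid z N M k) B - st (grid z N M k.+1) B) <= 1,
     cmod (Yt (grid z N M k) B - Yt (N:=N) (M:=M) (grid z N M k.+1) B) <= (2 * Kone)^-1 &
     cmod (st (grid z N M k) B - st (grid z N M k.+1) B) +
       cmod (m_phi (mp_ratio R N M) (grid z N M k) - m_phi (mp_ratio R N M) (grid z N M k.+1))
     < 2 * (N%:R * Im (grid z N M k.+1))^-1]].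
Proof.
move=> ok vn n; have [[N0 NM r1 r2] [n1 nq Mr nN] [e6 eK ze ae hz]] := ok.
have [_ _ z0] := cnt_N ok; have [v1 v2 v3 v4] := vlarge_parts.
have hz' k : (k <= n)%N -> zdom N M K (grid z N M k).
  by move=> kn; have h := zgrid_Im (Re z) ze (grid_n0 N0 NM) kn; apply: hz; exact: h.
split=> //.
- by rewrite zgrid_end ?grid_n0//; case: (z).
- exact: zgrid_start.
- move=> B; apply: (@grid_steps R N M N0 NM K (Re z) e0 (Im z) B) => //.
    by apply: le_trans nN; exact: exprn_ege1.
  by rewrite -nq; apply: le_trans v2 _; apply: le_trans vn _; rewrite -[leLHS]expr1 ler_weXn2l.
Qed.

Lemma rare_bnd : rare (fun d T N M A z nu => [set t | ~ bnd Kone z (A t)]).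
Proof.
have [v1 v2 v3 v4] := vlarge_parts.
apply: (rare_sub v4 (rare_grid rare_ld)) => d T P N M A z nu ok vn t /= nb.
apply: contra_notP nb => hn; have [[N0 NM r1 r2] [n1 nq Mr nN] [e6 eK ze ae hz]] := ok.
have [gn g0 gz gs] := grid_facts ok vn; set n := (N ^ 6 * M)%N in gn gz gs *.
rewrite -gn; apply: (@phase1 R N M N0 NM (A t) (grid z N M) K nu n) => //.
- move=> k kn; split; first exact: gz.
    have /contrapT// : ~ ~ ld_ok nu (grid z N M k) (A t).
    have kn' : (k < n.+1)%N by [].
    by move=> h; apply: hn; exists (Ordinal kn').
  have okk := okay_grid ok kn; have [_ [_ _ _ nN'] _] := okk.
  apply: le_trans nN'; apply: (@le_trans _ _ (nu * nu ^+ 2)).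
    by apply: ler_wpM2r; [exact: sqr_ge0|exact: le_trans v1 vn].
  by rewrite -exprS ler_weXn2l.
- by rewrite g0 /=; apply: le_trans e6; rewrite ler1n.
- by move=> k kn; have [a b _] := gs (A t) k kn.
Qed.


Definition gap_err N M (z : C) : R :=
  mp_gap (mp_ratio R N M) z * (N%:R * Im z)^-1 + (N%:R * Im z)^-1 ^+ 2.

(** The term [sqrt |T| / (N eta)] hidden in [WW] is split between [lam * |T|] and a multiple of
    [(N eta)^-2]; this is the form required by [absorb]. *)
Lemma WW_le N M (A : 'M[C]_(N, M)) z nu lam : (0 < N)%N -> 0 < Im z -> 1 <= nu -> 0 < lam ->
  0 <= Crow K Kone ->
  WW z K Kone nu A <= lam * cmod (mp_poly (mp_ratio R N M) z (st z A)) +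
    (Crow K Kone + Crow K Kone ^+ 2 / lam) * nu ^+ 4 * gap_err N M z.
Proof.
move=> N0 z0 n1 l0; rewrite /WW /QQ /gap_err; move: (Crow K Kone) => Cr Cr0.
have B0 : 0 <= mp_gap (mp_ratio R N M) z := cmod_ge0 _.
have X0 : 0 <= (N%:R * Im z)^-1 by rewrite invr_ge0 mulr_ge0// ltW.
have s0 := sqrtr_ge0 (cmod (mp_poly (mp_ratio R N M) z (st z A))).
rewrite -[X in lam * X](sqr_sqrtr (cmod_ge0 _)).
move: (Num.sqrt _) s0 (mp_gap _ _) B0 ((N%:R * Im z)^-1) X0 => s s0 B B0 X X0.
have n24 : nu ^+ 2 <= nu ^+ 4 by rewrite ler_weXn2l.
have e1 : Cr * (nu ^+ 2 * (B * X + X ^+ 2)) <= Cr * (nu ^+ 4 * (B * X + X ^+ 2)).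
  by apply: ler_wpM2l => //; apply: ler_wpM2r => //; rewrite addr_ge0 ?sqr_ge0// mulr_ge0.
have e2 : Cr * nu ^+ 2 * X * s <= lam * s ^+ 2 + Cr ^+ 2 / lam * nu ^+ 4 * X ^+ 2.
  have -> : Cr ^+ 2 / lam * nu ^+ 4 * X ^+ 2 = (Cr * nu ^+ 2 * X) ^+ 2 / lam by field; rewrite gt_eqF.
  have k0 : 0 <= Cr * nu ^+ 2 * X by apply: mulr_ge0 => //; apply: mulr_ge0 => //; exact: sqr_ge0.
  move: (Cr * nu ^+ 2 * X) k0 => k k0; rewrite -(ler_pM2l l0) mulrDr (mulrCA lam (k ^+ 2)) divff ?gt_eqF// mulr1.
  have h := sqr_ge0 (lam * s - k); have h2 : 0 <= lam * (k * s) by rewrite !mulr_ge0// ltW.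
  have e : lam * (lam * s ^+ 2) = (lam * s) ^+ 2 by ring.
  rewrite e; have e' : lam * (k * s) = (lam * s) * k by ring.
  rewrite e' in h2 *; move: h h2; move: (lam * s) => y; rewrite sqrrB; move: (y * k) (y ^+ 2) (k ^+ 2) => a b c'.
  rewrite mulr2n; lra.
have e3 : Cr ^+ 2 / lam * nu ^+ 4 * X ^+ 2 <= Cr ^+ 2 / lam * nu ^+ 4 * (B * X + X ^+ 2).
  apply: ler_wpM2l; last by rewrite lerDr mulr_ge0.
  by apply: mulr_ge0; [apply: divr_ge0; [exact: sqr_ge0|exact: ltW]|rewrite exprn_ge0// (le_trans ler01)].
have -> : Cr * (nu ^+ 2 * ((B + s + X) * X)) = Cr * (nu ^+ 2 * (B * X + X ^+ 2)) + Cr * nu ^+ 2 * X * s by ring.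
have -> : (Cr + Cr ^+ 2 / lam) * nu ^+ 4 * (B * X + X ^+ 2) =
  Cr * (nu ^+ 4 * (B * X + X ^+ 2)) + Cr ^+ 2 / lam * nu ^+ 4 * (B * X + X ^+ 2) by ring.
rewrite addrCA; apply: lerD => //; apply: le_trans e2 _; by rewrite lerD2l.
Qed.

(** Markov's inequality for a high moment: the threshold has [nu^6] where the moment bound has
    [nu^4], so each power gains [nu^-2]. *)
Lemma rare_poly : rare (fun d T N M A z nu => [set t |
  ~ (cmod (mp_poly (mp_ratio R N M) z (st z (A t))) <= nu ^+ 6 * gap_err N M z)]).
Proof.
have [v1 v2 v3 v4] := vlarge_parts; have K0 : 0 <= K := le_trans ler01 K_ge1.
apply: (rare_of v4) => D.
have [lam [C0 [r' [l0 l1 C00 hM]]]] := moment_T mu D.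
(* [a] beats the inverse threshold, at most of order [nu^(2 q m)], and the crude bound [Dc^r'],
   still leaving [nu^-D]. The good event is taken with exponent [a + a], because [delta = nu^-a]
   divides its failure probability. *)
pose m := (2 * D.+1)%N; pose a := (2 * q * m + (r + q) * r' + D)%N.
have [Cn Cn0 hC] := rareU rare_ld rare_bnd (a + a)%N.
have [_ _ _ Cr1] := @Crow_parts R K Kone K_ge1 Kone_ge1.
have Cr0 : 0 <= Crow K Kone := le_trans ler01 Cr1.
pose CV := Crow K Kone + Crow K Kone ^+ 2 / lam.
have CV0 : 0 <= CV by rewrite addr_ge0// divr_ge0 ?sqr_ge0// ltW.
exists (C0 * CV ^+ m + K ^+ (2 * m) * (Cn + C0 * K ^+ r')).
  by rewrite addr_ge0 ?mulr_ge0 ?exprn_ge0// addr_ge0// mulr_ge0// exprn_ge0.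
move=> d T P N M A z nu ok vn.
have [[N0 NM rm _] [n1 nq Mr nN] [e6 eK ze ae hz]] := ok; have [_ _ z0] := cnt_N ok.
have zd : zdom N M K z.
  by have := hz (Im z); rewrite lexx ze => /(_ isT); case: (z).
have [_ zK Kz etaK [bK imK]] := zd.
have nu0 : 0 < nu := lt_le_trans ltr01 n1; have nV0 : 0 <= nu^-1 by rewrite invr_ge0 ltW.
have NC : 0 < N%:R :> R by rewrite ltr0n.
have [B mB [BS PB]] := hC _ _ _ _ _ _ _ _ ok n1.
have [mA _ _ _] := rm.
pose Dc := K * nu ^+ (r + q).
have nrD : nu ^+ r <= nu ^+ (r + q) by rewrite ler_weXn2l// leq_addr.
have nqD : nu ^+ q <= nu ^+ (r + q) by rewrite ler_weXn2l// leq_addl.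
have nD : nu ^+ (r + q) <= Dc by rewrite ler_peMl// exprn_ge0// ltW.
have D1 : 1 <= Dc by apply: le_trans nD; exact: exprn_ege1.
have MD : M%:R <= Dc := le_trans Mr (le_trans nrD nD).
have zD : cmod z <= Dc.
  apply: le_trans zK _; apply: ler_wpM2l => //; apply: le_trans nrD.
  by apply: (sp_leD N0 NM) => //; exact: exprn_ege1.
have eD : (Im z)^-1 <= Dc.
  apply: le_trans (le_trans nqD nD); rewrite nq -[leLHS]mul1r ler_pdivrMr//.
  by apply: le_trans nN; exact: exprn_ege1.
pose W0 := gap_err N M z; pose V := CV * nu ^+ 4 * W0; pose X := (N%:R * Im z)^-1.
have X0 : 0 < X by rewrite invr_gt0 mulr_gt0.
have XW : X ^+ 2 <= W0 by rewrite /W0 /gap_err lerDr mulr_ge0 ?cmod_ge0// ltW.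
have W00 : 0 < W0 by apply: lt_le_trans XW; rewrite exprn_gt0.
have V0 : 0 <= V by rewrite /V !mulr_ge0 ?exprn_ge0// ltW.
have dl0 : 0 < nu^-1 ^+ a by rewrite exprn_gt0 ?invr_gt0.
have PG : (P (~` (~` B)) <= (Cn * nu^-1 ^+ (a + a))%:E)%E by rewrite setCK.
have good t : (~` B) t -> forall i, exists W, [/\ cmod (rho_ z (A t) i) <= W, cmod (dd z (A t) i) <= W,
     cmod (zeta_ z (A t) i) * cmod (dd z (A t) i) <= W ^+ 2 &
     W <= lam * cmod (mp_poly (mp_ratio R N M) z (st z (A t))) + V].
  move=> nB i; exists (WW z K Kone nu (A t)).
  have ld : ld_ok nu z (A t) by apply: contrapT => h; apply: nB; apply: BS; left.
  have bd : bnd Kone z (A t) by apply: contrapT => h; apply: nB; apply: BS; right.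
  have small : 16 * Kone ^+ 2 * K ^+ 2 * K3 K Kone * nu ^+ 2 <= N%:R * Im z.
    have nK := le_trans v1 vn.
    have dom K' : 256 * K' ^+ 2 * K ^+ 2 * K3 K Kone <= nu -> 0 <= K' ^+ 2 * K ^+ 2 * K3 K Kone ->
       16 * K' ^+ 2 * K ^+ 2 * K3 K Kone * nu ^+ 2 <= N%:R * Im z.
      move=> h h0; apply: le_trans nN; apply: (@le_trans _ _ (nu * nu ^+ 2)).
        apply: ler_wpM2r; first exact: sqr_ge0.
        apply: le_trans h; rewrite -!(mulrA _ (K' ^+ 2)) -!(mulrA _ (K' ^+ 2 * K ^+ 2)).
        by apply: ler_wpM2r => //; rewrite ler_nat.
      by rewrite -exprS ler_weXn2l.
    apply: dom nK _; apply: mulr_ge0; last exact: le_trans (@K3_ge1 R K Kone K_ge1 Kone_ge1).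
    by apply: mulr_ge0; exact: sqr_ge0.
  have [b1 b2 b3] := row_W N0 NM z0 K_ge1 Kone_ge1 n1 zK Kz etaK bd.1 bd.2 (ld i).1 (ld i).2 small imK.
  by split => //; exact: WW_le.
have E := hM d T P N M A z Dc N0 NM z0 D1 zD eD MD rm (~` B) V (nu^-1 ^+ a) _ (measurableC mB) V0 dl0 PG good.
set TT := fun t => cmod (mp_poly (mp_ratio R N M) z (st z (A t))) in E *.
have mTT : rmeas TT by apply: rmeas_cmod; apply: cmeas_poly; exact: cmeas_st.
apply: covered_lt => //; first exact: rmeas_cst.
have w0 : 0 < (nu ^+ 6 * W0) ^+ m by rewrite exprn_gt0// mulr_gt0// exprn_gt0.
have mk := markov_Ex P (rmeasX m mTT) (fun t => exprn_ge0 m (cmod_ge0 _)) w0.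
apply: (@le_trans _ _ (P [set t | ((nu ^+ 6 * W0) ^+ m < TT t ^+ m)%R])).
  apply: le_measure; rewrite ?inE.
  - by apply: measurable_lt => //; exact: rmeas_cst.
  - by apply: measurable_lt; [exact: rmeas_cst|exact: rmeasX].
  - move=> t /= h; apply: ltrXn2r => //; rewrite ?nnegrE.
    by rewrite mulr_ge0 ?exprn_ge0// ltW.
apply: le_trans mk _; apply: le_trans (lee_wpmul2l _ E) _; first by rewrite lee_fin invr_ge0 ltW.
rewrite -EFinM lee_fin mulrDr mulrDr.
have W0V : W0^-1 <= K ^+ 2 * nu ^+ (2 * q).
  have XK : X^-1 <= K * nu ^+ q by rewrite /X invrK nq mulrC ler_wpM2r// ltW.
  apply: (@le_trans _ _ (X ^+ 2)^-1); first by rewrite lef_pV2 ?posrE ?exprn_gt0.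
  rewrite -exprVn mulnC exprM -exprMn; apply: lerXn2r XK; rewrite nnegrE.
    by rewrite invr_ge0 ltW.
  by rewrite mulr_ge0// exprn_ge0// ltW.
have nD0 : 0 <= nu^-1 ^+ D by rewrite exprn_ge0.
have t1 : ((nu ^+ 6 * W0) ^+ m)^-1 * (C0 * V ^+ m) <= C0 * CV ^+ m * nu^-1 ^+ D.
  have -> : ((nu ^+ 6 * W0) ^+ m)^-1 * (C0 * V ^+ m) = C0 * CV ^+ m * (nu^-1 ^+ 2) ^+ m.
    rewrite -exprVn mulrCA -exprMn -mulrA -exprMn; congr (_ * _ ^+ m).
    by rewrite /V; field; rewrite !gt_eqF.
  apply: ler_wpM2l; first by rewrite mulr_ge0 ?exprn_ge0.
  by rewrite -exprM; apply: inv_pow_le => //; rewrite /m mulnA (leq_trans (leqnSn D))// leq_pmull.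
have wV : ((nu ^+ 6 * W0) ^+ m)^-1 <= K ^+ (2 * m) * nu ^+ (2 * q * m).
  apply: (@le_trans _ _ ((K ^+ 2 * nu ^+ (2 * q)) ^+ m)); last by rewrite exprMn -!exprM.
  rewrite -exprVn; apply: lerXn2r; rewrite ?nnegrE.
  - by rewrite invr_ge0 mulr_ge0 ?exprn_ge0// ltW.
  - by rewrite mulr_ge0 ?exprn_ge0// ltW.
  apply: le_trans W0V; rewrite lef_pV2 ?posrE ?mulr_gt0 ?exprn_gt0//.
  by rewrite ler_peMl ?(ltW W00)// exprn_ege1.
have nVn k l : nu ^+ k * nu^-1 ^+ (k + l) = nu^-1 ^+ l.
  by rewrite exprD mulrA -exprMn divff ?gt_eqF// expr1n mul1r.
have t2 : ((nu ^+ 6 * W0) ^+ m)^-1 * (Cn * nu^-1 ^+ (a + a) / nu^-1 ^+ a) +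
   ((nu ^+ 6 * W0) ^+ m)^-1 * (nu^-1 ^+ a * (C0 * Dc ^+ r')) <=
   K ^+ (2 * m) * (Cn + C0 * K ^+ r') * nu^-1 ^+ D.
  have -> : Cn * nu^-1 ^+ (a + a) / nu^-1 ^+ a = Cn * nu^-1 ^+ a.
    by rewrite exprD mulrA mulfK// gt_eqF.
  rewrite -mulrDr; apply: le_trans (ler_wpM2r _ wV) _.
    by rewrite addr_ge0 ?mulr_ge0 ?exprn_ge0// (le_trans ler01).
  have aE : nu ^+ (2 * q * m) * nu^-1 ^+ a = nu^-1 ^+ ((r + q) * r' + D) by rewrite /a -addnA nVn.
  have -> : K ^+ (2 * m) * nu ^+ (2 * q * m) * (Cn * nu^-1 ^+ a + nu^-1 ^+ a * (C0 * Dc ^+ r')) =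
     K ^+ (2 * m) * (Cn + C0 * Dc ^+ r') * (nu ^+ (2 * q * m) * nu^-1 ^+ a) by ring.
  rewrite aE -2!mulrA; apply: ler_wpM2l; first exact: exprn_ge0.
  rewrite !mulrDl; apply: lerD.
    by apply: ler_wpM2l => //; apply: inv_pow_le => //; rewrite leq_addl.
  rewrite /Dc exprMn -exprM.
  have -> : C0 * (K ^+ r' * nu ^+ ((r + q) * r')) * nu^-1 ^+ ((r + q) * r' + D) =
    C0 * K ^+ r' * (nu ^+ ((r + q) * r') * nu^-1 ^+ ((r + q) * r' + D)) by ring.
  by rewrite nVn.
by rewrite mulrDl -addrA; apply: lerD.
Qed.

(** [phase3] with [l = K * nu^6], on the event that [rare_poly] holds at all grid points; one more
    power of [nu] absorbs [14 K]. *)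
Lemma rare_avg : rare (fun d T N M A z nu => [set t |
  ~ (cmod (st z (A t) - m_phi (mp_ratio R N M) z) <= nu ^+ 7 * (N%:R * Im z)^-1)]).
Proof.
have [v1 v2 v3 v4] := vlarge_parts; have K0 : 0 <= K := le_trans ler01 K_ge1.
apply: (rare_sub v4 (rare_grid rare_poly)) => d T P N M A z nu ok vn t /= nb.
apply: contra_notP nb => hn; have [[N0 NM r1 r2] [n1 nq Mr nN] [e6 eK ze ae hz]] := ok.
have [_ _ z0] := cnt_N ok.
have [gn g0 gz gs] := grid_facts ok vn; set n := (N ^ 6 * M)%N in gn gz gs *.
have NC : 0 < N%:R :> R by rewrite ltr0n.
have n6 : 1 <= nu ^+ 6 by exact: exprn_ege1.
have l1 : 1 <= K * nu ^+ 6 by exact: mulr_ege1.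
have X0 : 0 < (N%:R * Im z)^-1 by rewrite invr_gt0 mulr_gt0.
have K7 : 14 * (K * nu ^+ 6) <= nu ^+ 7.
  by rewrite mulrA [nu ^+ 7]exprS; apply: ler_wpM2r; [exact: le_trans ler01 n6|exact: le_trans v3 vn].
have := @phase3 R N M N0 NM (A t) (grid z N M) K (K * nu ^+ 6) n K_ge1 l1 gz.
rewrite gn g0 => h; apply: le_trans (h _ _ _ _ _ _) _.
- move=> k kn; split => //; exact: (zgrid_mono (Re z) k ze (grid_n0 N0 NM)).1.
- move=> k kn; rewrite -mulrA; apply: ler_wpM2l => //; rewrite -/(gap_err N M (grid z N M k)).
  have kn' : (k < n.+1)%N by [].
  by apply: contrapT => hk; apply: hn; exists (Ordinal kn').
- exact: e6.
- exact: ae.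
- have X0' : (N%:R * e0)^-1 <= (N%:R * Im z)^-1.
    by rewrite lef_pV2 ?posrE ?mulr_gt0 ?ler_pM2l// (lt_le_trans z0).
  have e00 : 0 < (N%:R * e0)^-1 by rewrite invr_gt0 mulr_gt0// (lt_le_trans z0).
  have lp : 0 < K * nu ^+ 6 := lt_le_trans ltr01 l1.
  apply: (@lt_le_trans _ _ (14 * (K * nu ^+ 6) * (N%:R * e0)^-1)).
    by rewrite ltr_pM2r// ltr_pM2r// ltr_nat.
  apply: (@le_trans _ _ (nu ^+ 10 * (N%:R * Im z)^-1)); last by rewrite ler_pdivrMr ?mul1r// mulr_gt0.
  apply: ler_pM => //; [by rewrite mulr_ge0// ltW|exact: ltW|].
  by apply: le_trans K7 _; rewrite ler_weXn2l.
- move=> k kn; have [_ _ hk] := gs (A t) k kn; apply: lt_le_trans hk _.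
  have [zk _ _ _ _] := gz k.+1 kn.
  apply: ler_wpM2r; first by rewrite invr_ge0 mulr_ge0// ltW.
  by rewrite ler_peMr.
- by apply: ler_wpM2r => //; exact: ltW.
Qed.

Local Notation PsE N M z := (Num.sqrt (Im (m_phi (mp_ratio R N M) z) / (N%:R * Im z)) + (N%:R * Im z)^-1).
Definition Cfin : R := vlarge + (K * kk K Kone * Kone * K + 2 * K * kk K Kone ^+ 2) * (4 + K ^+ 3) + (40 * K) * (4 + K ^+ 3).
Lemma Cfin_parts : [/\ vlarge <= Cfin, (K * kk K Kone * Kone * K + 2 * K * kk K Kone ^+ 2) * (4 + K ^+ 3) <= Cfin,
  (40 * K) * (4 + K ^+ 3) <= Cfin & 1 <= Cfin].
Proof.
have [_ _ _ v4] := vlarge_parts; have K0 : 0 <= K := le_trans ler01 K_ge1.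
have k0 : 0 <= kk K Kone by rewrite ltW// (@kk0 R K Kone K_ge1 Kone_ge1).
have k10 : 0 <= Kone := le_trans ler01 Kone_ge1.
have k4 : 0 <= 4 + K ^+ 3 by rewrite addr_ge0// exprn_ge0.
have p1 : 0 <= (K * kk K Kone * Kone * K + 2 * K * kk K Kone ^+ 2) * (4 + K ^+ 3).
  apply: (mulr_ge0 _ k4); apply: addr_ge0; first exact: mulr_ge0 (mulr_ge0 (mulr_ge0 K0 k0) k10) K0.
  exact: mulr_ge0 (mulr_ge0 (ler0n _ 2) K0) (sqr_ge0 _).
have p2 : 0 <= (40 * K) * (4 + K ^+ 3) by apply: (mulr_ge0 _ k4); exact: mulr_ge0.
rewrite /Cfin; move: v4 p1 p2; move: vlarge (_ * (4 + _)) (_ * (4 + _)) => x y w x1 y0 w0.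
by split; lra.
Qed.

(** The eighth power of [nu] absorbs the constant [Cfin] in front of the [nu^7] of the deterministic
    entry bound. *)
Lemma rare_R : rare (fun d T N M A z nu => [set t | exists i j : 'I_N,
  nu ^+ 8 * PsE N M z < cmod (resG (A t) z i j - kdelta R i j * m_phi (mp_ratio R N M) z)]).
Proof.
have [c1 c2 c3 c4] := Cfin_parts; have [v1 v2 v3 v4] := vlarge_parts.
apply: (rare_sub c4 (rareU (rareU rare_ld rare_bnd) (rareU rare_avg (rare_lin false)))).
move=> d T P N M A z nu ok cn t /= [i [j hij]]; apply: contrapT => hn.
have [[N0 NM r1 r2] [n1 nq Mr nN] [e6 eK ze ae hz]] := ok; have [_ _ z0] := cnt_N ok.
have zd : zdom N M K z by have := hz (Im z); rewrite lexx ze => /(_ isT); case: (z).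
have ld : ld_ok nu z (A t) by apply: contrapT => h; apply: hn; left; left.
have bd : bnd Kone z (A t) by apply: contrapT => h; apply: hn; left; right.
have av : cmod (st z (A t) - m_phi (mp_ratio R N M) z) <= nu ^+ 7 * (N%:R * Im z)^-1.
  by apply: contrapT => h; apply: hn; right; left.
have ln : lin_ok (entry_var R N M) nu z (A t) by apply: contrapT => h; apply: hn; right; right.
have := entry_R N0 NM K_ge1 n1 zd bd ld nN (le_trans v1 (le_trans c1 cn)) av i j ln.
move=> h; have := lt_le_trans hij h; rewrite ltNge => /negP; apply.
rewrite [nu ^+ 8]exprS -[leRHS]mulrA; apply: ler_wpM2r; last exact: le_trans c2 cn.
apply: mulr_ge0; first by rewrite exprn_ge0// (le_trans ler01).
by rewrite addr_ge0 ?sqrtr_ge0// invr_ge0 mulr_ge0// ltW.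
Qed.

Lemma rare_G : rare (fun d T N M A z nu => [set t | exists i j : 'I_M,
  nu ^+ 8 * ((mp_ratio R N M)^-1 * PsE N M z) <
  cmod (resG (adjmx (A t)) z i j - kdelta R i j * m_phi_inv (mp_ratio R N M) z)]).
Proof.
have [c1 c2 c3 c4] := Cfin_parts; have [v1 v2 v3 v4] := vlarge_parts.
apply: (rare_sub c4 (rareU (rareU rare_ldG (rareU rare_ld rare_bnd)) (rareU rare_avg (rare_lin true)))).
move=> d T P N M A z nu ok cn t /= [i [j hij]]; apply: contrapT => hn.
have [[N0 NM r1 r2] [n1 nq Mr nN] [e6 eK ze ae hz]] := ok; have [_ _ z0] := cnt_N ok.
have zd : zdom N M K z by have := hz (Im z); rewrite lexx ze => /(_ isT); case: (z).
have ldG : forall i : 'I_M, cmod (q_ (adjmx (A t)) z i - (entry_var R N M)%:C%C * \tr (resR (rowz i (adjmx (A t))) z)) <=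
     nu * (entry_var R N M * Num.sqrt (hs (resR (rowz i (adjmx (A t))) z))).
  by apply: contrapT => h; apply: hn; left; left.
have bd : bnd Kone z (A t) by apply: contrapT => h; apply: hn; left; right; right.
have av : cmod (st z (A t) - m_phi (mp_ratio R N M) z) <= nu ^+ 7 * (N%:R * Im z)^-1.
  by apply: contrapT => h; apply: hn; right; left.
have ln : lin_ok (entry_var R N M) nu z (adjmx (A t)) by apply: contrapT => h; apply: hn; right; right.
have := entry_G N0 NM K_ge1 n1 zd bd nN (le_trans v1 (le_trans c1 cn)) av i j ldG ln.
move=> h; have := lt_le_trans hij h; rewrite ltNge => /negP; apply.
rewrite [leRHS]mulrCA; apply: ler_wpM2l; first by rewrite invr_ge0 (le_trans ler01)// phi_ge1.
rewrite [nu ^+ 8]exprS -[leRHS]mulrA; apply: ler_wpM2r; last exact: le_trans c3 cn.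
apply: mulr_ge0; first by rewrite exprn_ge0// (le_trans ler01).
by rewrite addr_ge0 ?sqrtr_ge0// invr_ge0 mulr_ge0// ltW.
Qed.
End Rare.
End RareEvents.

(** * From the hypotheses on the entries to the rare event bounds *)

Section Interface.
Variable R : realType.
Local Notation Re := (@complex.Re R).
Local Notation Im := (@complex.Im R).
Local Notation C := R[i].

Lemma adjmx_mix m n (J : {set 'I_n * 'I_m}) (A B : 'M[C]_(m, n)) :
  mix J (adjmx A) (adjmx B) = adjmx (mix [set p | (p.2, p.1) \in J]%SET A B).
Proof. by apply/matrixP => i j; rewrite !mxE inE /=; case: ifP. Qed.

Lemma row_model_adj d (T : measurableType d) (P : probability T R) m n (A : T -> 'M[C]_(m, n)) c mu :
  row_model P A c mu -> row_model P (fun t => adjmx (A t)) c mu.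
Proof.
move=> [mA rA hz hm]; split.
- exact: mxmeas_adj.
- move=> J Phi mPhi Phi0.
  have mad : measurable_fun setT (fun B : mxS R m n => adjmx (B : 'M[C]_(m, n)) : mxS R n m).
    exact: mxmeas_measurable (mxmeas_adj (@mxmeas_id R m n)).
  have := rA [set p | (p.2, p.1) \in J]%SET (fun B => Phi (adjmx (B : 'M[C]_(m, n))))
    (measurableT_comp mPhi mad) (fun B => Phi0 _).
  move=> ->; apply: eq_integral => t _; apply: eq_integral => s _.
  by rewrite adjmx_mix.
- move=> i k; have [h1 h2 h3] := hz k i; split.
  + by apply: zm_ext h1 => t; rewrite mxE cReJ.
  + by apply: zm_ext (zmZ (-1) h2) => t; rewrite mxE cImJ mulN1r.
  + by apply: zm_ext h3 => t; rewrite mxE cmodJ.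
- move=> i k p; have := hm k i p; congr (_ <= _)%E; rewrite /Ex.
  by apply: eq_integral => t _; rewrite mxE cmodJ.
Qed.

Lemma entry_var_powR N M : (0 < N)%N -> (0 < M)%N -> entry_var R N M = (N%:R * M%:R) `^ (- 2^-1).
Proof.
move=> N0 M0; have NC : 0 < N%:R :> R by rewrite ltr0n.
have h : 0 <= N%:R * M%:R :> R by rewrite mulr_ge0.
rewrite powRN powR12_sqrt// /entry_var; congr (_^-1).
have e : N%:R = Num.sqrt (N%:R ^+ 2) :> R by rewrite sqrtr_sqr gtr0_norm.
rewrite [X in _ * X]e -sqrtrM ?divr_ge0//; congr Num.sqrt.
by rewrite /mp_ratio; field; rewrite gt_eqF.
Qed.

Lemma zm_of_sq d (T : measurableType d) (P : probability T R) (f g : T -> R) (b : R) :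
  rmeas f -> rmeas g -> (forall t, `|f t| <= g t) -> (Ex P (fun t => (g t ^+ 2)%R) <= b%:E)%E ->
  P.-integrable setT (EFin \o f).
Proof.
move=> mf mg fg Eg; apply/integrableP; split; first exact: rmeasE.
apply: (@le_lt_trans _ _ (Ex P (fun t => 1 + g t ^+ 2))).
  apply: (@le_trans _ _ (Ex P (fun t => `|f t|))) => //.
  apply: Ex_le; [exact: measurableT_comp mf|by apply: rmeasD; [exact: rmeas_cst|exact: rmeasX]|].
  move=> t; rewrite normr_ge0/=; apply: le_trans (fg t) _.
  by have := sqr_ge0 (1 - g t); rewrite sqrrB expr1n mul1r; have := sqr_ge0 (g t); lra.
rewrite ExD ?Ex_cst//; [|exact: rmeas_cst|exact: rmeasX|by move=> t; exact: sqr_ge0].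
by apply: le_lt_trans (leeD2l _ Eg) _; rewrite -EFinD ltry.
Qed.

(** The hypotheses state only that the first moments vanish as integrals; integrability is recovered
    from the second moment. The normalization [(N M)^(1/4)] to the power [2p] is [c^-p], which gives
    [mu p = Cp (2 p)]. *)
Lemma row_model_hyp Cc (Cp : nat -> R) N M d (T : measurableType d) (P : probability T R)
    (X : T -> 'M[C]_(M, N)) : (0 < N)%N -> (N <= M)%N -> model_hyp Cc Cp P X ->
  row_model P X (entry_var R N M) (fun p => Cp (2 * p)%N).
Proof.
move=> N0 NM [_ mX ind h2 hp]; have M0 : (0 < M)%N := leq_trans N0 NM.
have c0 := c0 R N0 NM; set c := entry_var R N M in c0 *.
have mA : mxmeas X by move=> i k; have [a b] := mX i k.
have Ec i k : Ex P (fun t => cmod (X t i k) ^+ 2) = c%:E.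
  by have [_ [_]] := h2 i k; rewrite -entry_var_powR.
have mc i k : rmeas (fun t => cmod (X t i k)) by apply: rmeas_cmod; exact: mA.
have bc i k : (Ex P (fun t => (cmod (X t i k) ^+ 2)%R) <= c%:E)%E by rewrite Ec.
split => //; first exact: resample_indep.
- move=> i k; have [e1 [e2 e3]] := h2 i k; split.
  + split; last exact: e1.
    apply: (zm_of_sq _ (mc i k) _ (bc i k)); first exact: (mA i k).1.
    by move=> t; rewrite ler_norml lerNl -cReN -{1}cmodN !Re_le_cmod.
  + split; last exact: e2.
    apply: (zm_of_sq _ (mc i k) _ (bc i k)); first exact: (mA i k).2.
    by move=> t; rewrite ler_norml lerNl -cImN -{1}cmodN !Im_le_cmod.
  + have Isq : P.-integrable setT (EFin \o (fun t => cmod (X t i k) ^+ 2)).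
      apply/integrableP; split; first by apply: rmeasE; exact: rmeasX.
      apply: (@le_lt_trans _ _ (Ex P (fun t => cmod (X t i k) ^+ 2))); last by rewrite Ec ltry.
      rewrite /Ex le_eqVlt; apply/orP; left; apply/eqP; apply: eq_integral => t _.
      by rewrite /= ger0_norm ?sqr_ge0.
    have Ic : P.-integrable setT (EFin \o (fun=> c)).
      by apply: finite_measure_integrable_cst.
    split; first by have := integrableB measurableT Isq Ic.
    rewrite /Ex; transitivity (\int[P]_t ((EFin \o (fun t => (cmod (X t i k) ^+ 2)%R)) t - (EFin \o (fun=> c)) t))%E.
      by apply: eq_integral.
    rewrite integralB//; have := Ec i k; rewrite /Ex => ->.
    by have := Ex_cst P c; rewrite /Ex => ->; rewrite subee.
- move=> i k p; have h := hp (2 * p)%N i k.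
  have NMp : 0 < N%:R * M%:R :> R by rewrite mulr_gt0 ?ltr0n.
  have w0 : 0 < (N%:R * M%:R) `^ (4^-1) :> R by exact: powR_gt0.
  have wc : (N%:R * M%:R) `^ (4^-1) ^+ (2 * p) = c^-1 ^+ p :> R.
    rewrite exprM; congr (_ ^+ p); rewrite -powR_mulrn ?powR_ge0// -powRrM.
    by rewrite /c entry_var_powR// powRN invrK; congr (_ `^ _); field.
  have e : Ex P (fun t => ((N%:R * M%:R) `^ (4^-1) * cmod (X t i k)) ^+ (2 * p)) =
      ((c^-1 ^+ p)%:E * Ex P (fun t => (cmod (X t i k) ^+ (2 * p))%R))%E.
    rewrite -ExZ; last by rewrite exprn_ge0// invr_ge0 ltW.
    - by rewrite /Ex; apply: eq_integral => t _; rewrite exprMn wc.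
    - exact: rmeasX.
    - by move=> t; rewrite exprn_ge0 ?cmod_ge0.
  have cp0 : 0 < c ^+ p by exact: exprn_gt0.
  rewrite -[leLHS]mul1e -(divff (lt0r_neq0 cp0)) EFinM -muleA.
  rewrite -exprVn -e (mulrC (Cp _)) EFinM; apply: lee_wpmul2l; first by rewrite lee_fin ltW.
  exact: h.
Qed.

Variables (Cc omega : R) (Cp : nat -> R).
Hypotheses (Cc0 : 0 < Cc) (w0 : 0 < omega) (w1 : omega < 1).
Local Notation y := omega^-1.
(** The starting height of the descent: at least 6, as the selection of the root requires, and above
    every [Im z] in the domain. *)
Definition eta_top : R := 6 + y.
Definition Kdom : R := 4 * (10 + 2 * y) ^+ 2 + 2 * (2 + y) * y + 2.
Lemma y_ge1 : 1 <= y. Proof. by rewrite invf_ge1// ltW. Qed.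
Lemma Kdom_parts : [/\ 10 + 2 * y <= Kdom, 4 * (10 + 2 * y) ^+ 2 <= Kdom & 2 * (2 + y) * y + 2 <= Kdom].
Proof.
have y1 := y_ge1; rewrite /Kdom; move: y y1 => x x1.
have a : 10 + 2 * x <= (10 + 2 * x) ^+ 2 by rewrite expr2 ler_peMl//; lra.
have b : 0 <= (2 + x) * x by apply: mulr_ge0; lra.
by split; lra.
Qed.
Lemma Kdom_ge1 : 1 <= Kdom.
Proof. have [h _ _] := Kdom_parts; apply: le_trans h; have := y_ge1; lra. Qed.

(** The condition on [kappa] places the real part within [2 + 1/omega] of [sqrt phi + 1 / sqrt phi],
    which yields the upper bounds; the lower bound on [|z|] is the only place where [|z| >= omega]
    enters. *)
Lemma domain N M z e : (0 < N)%N -> (N <= M)%N -> 0 < Im z -> in_S omega N M z -> Im z <= e <= eta_top ->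
  zdom N M Kdom (Complex (Re z) e) /\ cmod (Complex (Re z) e) <= (10 + 2 * y) * Num.sqrt (mp_ratio R N M).
Proof.
move=> N0 NM z0 [kap _ _ zw] /andP[ze et]; have e0 : 0 < e := lt_le_trans z0 ze.
have phi1 := phi_ge1 R N0 NM; have s1 := sp1 R N0 NM; have y1 := y_ge1; have [k1 k2 k3] := Kdom_parts.
rewrite -/(mp_ratio R N M) /gamma_p /gamma_m in kap.
set sp := Num.sqrt (mp_ratio R N M) in kap s1 *.
have sV0 : 0 < sp^-1 by rewrite invr_gt0 (lt_le_trans ltr01).
have sV1 : sp^-1 <= 1 by rewrite invf_le1 ?(lt_le_trans ltr01).
have Eg : `|Re z - (sp + sp^-1)| <= 2 + y.
  have h (u : R) : `|sp + sp^-1 + u - Re z| <= y -> `|u| = 2 -> `|Re z - (sp + sp^-1)| <= 2 + y.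
    move=> h1 h2; have -> : Re z - (sp + sp^-1) = u - (sp + sp^-1 + u - Re z) by ring.
    by apply: le_trans (ler_normB _ _) _; rewrite h2 lerD2l.
  move: kap; rewrite ge_min => /orP[h1|h1]; first by apply: (h 2) => //; rewrite ger0_norm.
  by apply: (h (-2)) => //; rewrite normrN ger0_norm.
have [Eg1 Eg2] : - (2 + y) <= Re z - (sp + sp^-1) /\ Re z - (sp + sp^-1) <= 2 + y.
  by move: Eg; rewrite ler_norml => /andP[].
have cE (x v : R) : cmod (Complex x v) <= `|x| + `|v|.
  rewrite /cmod /= -[leRHS]ger0_norm ?addr_ge0// -sqrtr_sqr ler_wsqrtr//.
  have nx (u : R) : u ^+ 2 = `|u| ^+ 2 by rewrite -normrX ger0_norm ?sqr_ge0.
  rewrite (nx x) (nx v) sqrrD mulr2n; have := mulr_ge0 (normr_ge0 x) (normr_ge0 v).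
  by move: (_ * _) (_ ^+ 2) (_ ^+ 2) => a b c a0; lra.
have et' : e <= 6 + y := et.
have zb : cmod (Complex (Re z) e) <= (10 + 2 * y) * sp.
  apply: le_trans (cE _ _) _; rewrite (gtr0_norm e0).
  have : `|Re z| <= sp + 3 + y by rewrite ler_norml; apply/andP; split; lra.
  have : (9 + 2 * y) * 1 <= (9 + 2 * y) * sp by rewrite ler_wpM2l//; lra.
  lra.
split => //.
have zg : cmod (Complex (Re z) e - (sp + sp^-1)%:C%C) <= 8 + 2 * y.
  have -> : Complex (Re z) e - (sp + sp^-1)%:C%C = Complex (Re z - (sp + sp^-1)) e.
    by apply/eqP; rewrite eq_complex /= subr0 !eqxx.
  by apply: le_trans (cE _ _) _; rewrite (gtr0_norm e0); lra.
split => //.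
- by apply: le_trans zb _; rewrite ler_wpM2r//; lra.
- have zz : cmod z <= cmod (Complex (Re z) e).
    by rewrite /cmod /= ler_wsqrtr// lerD2l lerXn2r// nnegrE ltW.
  have zw' := le_trans zw zz; have zR : Re z <= cmod (Complex (Re z) e).
    exact: (Re_le_cmod (Complex (Re z) e)).
  move: zw' zR; move: (cmod _) => a aw aR.
  have a0 : 0 < a := lt_le_trans w0 aw.
  (* For large [phi] the real part is at least [sqrt phi / 2]; for bounded [phi] the lower bound
     [omega] on [|z|] suffices. *)
  have [big|small] := leP (2 * (2 + y)) sp.
    rewrite -/sp; apply: (@le_trans _ _ (2 * a)); first by lra.
    apply: ler_wpM2r; first exact: ltW.
    by apply: le_trans k3; rewrite lerDr; apply: mulr_ge0; lra.
  apply: le_trans (ltW small) _; apply: (@le_trans _ _ ((2 * (2 + y) * y) * a)).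
    rewrite -mulrA ler_peMr//; first by apply: mulr_ge0; lra.
    by rewrite mulrC ler_pdivlMr// mul1r.
  apply: ler_wpM2r; first exact: ltW.
  by apply: le_trans k3; rewrite lerDl.
- by apply: le_trans et' _; lra.
- split.
    have -> : mp_b (mp_ratio R N M) (Complex (Re z) e) = (Complex (Re z) e - (sp + sp^-1)%:C%C) + (2 * sp^-1)%:C%C.
      by rewrite /mp_b -/sp !rmorphD /= !rmorphM /= !rmorphD /= rmorph1; ring.
    apply: le_trans (cmodD _ _) _; rewrite cmod_pos ?mulr_ge0 ?(ltW sV0)//; lra.
  have z0' : 0 < Im (Complex (Re z) e) by [].
  have [_ _ mpos _ [_ _ h]] := mp_facts phi1 z0'; apply: le_trans h _.
  apply: ler_wpM2r; first exact: ltW.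
  apply: le_trans k2; rewrite ler_wpM2l// lerXn2r ?nnegrE//.
  - by rewrite addr_ge0 ?cmod_ge0.
  - lra.
  - by move: zg; rewrite -/sp; move: (cmod _) => a; lra.
Qed.

(** Translates [rare] into stochastic domination: the freedom in [q] and [r] is spent on making
    [nu^8] smaller than [N^eps] and on satisfying [okay]. *)
Lemma master (Ev : event R) (eps : R) : 0 < eps ->
  (forall q r, (0 < q)%N -> rare Kdom eta_top (fun p => Cp (2 * p)%N) q r Ev) ->
  forall D : R, 0 < D -> exists N0 : nat, forall N M, (N0 <= N)%N -> (N <= M)%N ->
  forall (d : measure_display) (T : measurableType d) (P : probability T R) (X : T -> 'M[C]_(M, N)),
  model_hyp Cc Cp P X -> forall z, in_S omega N M z -> forall S : set T, measurable S ->
  (forall nu, 1 <= nu -> nu ^+ 8 <= N%:R `^ eps -> 0 < Im z -> (0 < N)%N ->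
     S `<=` Ev d T N M (fun t => adjmx (X t)) z nu) ->
  (P S <= (N%:R `^ (- D))%:E)%E.
Proof.
move=> eps0 rE D D0.
(* The first term ensures [nu^10 <= N^omega <= N * Im z], the second [nu^8 <= N^eps]; the successor
   makes [q] positive. *)
pose q := (Num.bound (10 / omega) + Num.bound (8 / eps)).+1.
have qw : 10 / omega <= q%:R.
  have := archi_boundP (divr_ge0 (ler0n R 10) (ltW w0)) => /ltW/le_trans; apply.
  by rewrite ler_nat (leq_trans (leq_addr _ _) (leqnSn _)).
have qe : 8 / eps <= q%:R.
  have := archi_boundP (divr_ge0 (ler0n R 8) (ltW eps0)) => /ltW/le_trans; apply.
  by rewrite ler_nat (leq_trans (leq_addl _ _) (leqnSn _)).
have q0 : 0 < q%:R :> R by rewrite ltr0n.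
pose r := Num.bound (q%:R * Cc).
have rC : q%:R * Cc <= r%:R by apply/ltW/archi_boundP; rewrite mulr_ge0// ltW.
pose k := Num.bound (q%:R * D).
have kD : q%:R * D <= k%:R by apply/ltW/archi_boundP; rewrite mulr_ge0// ltW.
(* One power of [nu] more than [k] is requested: it absorbs the constant [Cn], since [N] above
   [Cn^q] means that [nu] is at least [Cn]. *)
have [Cn Cn0 hC] := rE q r (ltn0Sn _) k.+1.
exists (Num.bound (Cn ^+ q)).+1 => N M NN NM d T P X mh z zS S mS SE.
have N0 : (0 < N)%N by exact: leq_trans NN.
have NC : 0 < N%:R :> R by rewrite ltr0n.
have N1 : 1 <= N%:R :> R by rewrite ler1n.
have M0 : (0 < M)%N := leq_trans N0 NM.
have [[_ MC] _ _ _ _] := mh; have [kap etal etau zw] := zS.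
have z0 : 0 < Im z by apply: lt_le_trans etal; apply: powR_gt0; rewrite (minn_idPr NM).
pose nu : R := N%:R `^ (q%:R^-1).
have nun (n : nat) : nu ^+ n = N%:R `^ (n%:R / q%:R) by rewrite /nu -powR_mulrn ?powR_ge0// -powRrM mulrC.
have n1 : 1 <= nu.
  by rewrite /nu -[leLHS](powRr0 N%:R) ler_powR// invr_ge0 ltW.
have nq : nu ^+ q = N%:R by rewrite nun divff ?gt_eqF// powRr1// ltW.
have n8 : nu ^+ 8 <= N%:R `^ eps.
  by rewrite nun ler_powR// ler_pdivrMr// mulrC -ler_pdivrMr.
have ok : okay Kdom eta_top (fun p => Cp (2 * p)%N) q r P (fun t => adjmx (X t)) z nu.
  have rm := row_model_hyp N0 NM mh.
  split.
  - split => //; first exact: row_model_adj.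
    by have -> : (fun t => adjmx (adjmx (X t))) = X by apply/funext => t; rewrite adjmxK.
  - split => //.
      apply: le_trans MC _; rewrite nun ler_powR// ler_pdivlMr// mulrC //.
    rewrite nun; apply: (@le_trans _ _ (N%:R * N%:R `^ (-1 + omega))).
      have -> : N%:R * N%:R `^ (-1 + omega) = N%:R `^ omega :> R.
        rewrite -{1}[N%:R]powRr1 ?(ltW NC)// -powRD; last by apply/implyP => _; rewrite gt_eqF.
        by congr (_ `^ _); ring.
      by rewrite ler_powR// ler_pdivrMr// mulrC -ler_pdivrMr.
    by rewrite ler_wpM2l//; move: etal; rewrite (minn_idPr NM).
  - have y1 := y_ge1; have [k1 _ _] := Kdom_parts.
    have ze : Im z <= eta_top by apply: le_trans etau _; rewrite /eta_top; lra.
    split => //; rewrite /eta_top; [lra|lra| |].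
      rewrite cmod_aE// ler_pdivrMr ?sp0//.
      have hz : Im z <= eta_top <= eta_top by rewrite ze lexx.
      have [_ h] := domain N0 NM z0 zS hz; apply: le_trans h _.
      by rewrite ler_wpM2r ?sqrtr_ge0//; lra.
    by move=> e he; have [] := domain N0 NM z0 zS he.
have [B mB [SB PB]] := hC _ _ _ _ _ _ _ _ ok n1.
apply: (@le_trans _ _ (P B)).
  by apply: le_measure; rewrite ?inE//; apply: subset_trans (SE nu n1 n8 z0 N0) SB.
apply: le_trans PB _; rewrite lee_fin.
have nu0 : 0 < nu := lt_le_trans ltr01 n1.
have Cnu : Cn <= nu.
  rewrite leNgt; apply/negP => h.
  have h1 : nu ^+ q < Cn ^+ q by apply: ltrXn2r => //; rewrite ?nnegrE// ltW.
  have h2 : Cn ^+ q < (Num.bound (Cn ^+ q))%:R by apply: archi_boundP; exact: exprn_ge0.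
  have h3 : (Num.bound (Cn ^+ q))%:R <= N%:R :> R by rewrite ler_nat ltnW.
  by move: (lt_le_trans (lt_trans h1 h2) h3); rewrite nq ltxx.
rewrite exprS mulrA; apply: (@le_trans _ _ (1 * nu^-1 ^+ k)).
  apply: ler_wpM2r; first by rewrite exprn_ge0// invr_ge0 ltW.
  by rewrite ler_pdivrMr ?mul1r.
rewrite mul1r exprVn nun -powRN ler_powR// lerN2 ler_pdivlMr// mulrC //.
Qed.
End Interface.

Theorem theorem4p1 (R : realType) (C omega : R) (Cp : nat -> R) :
  0 < C -> 0 < omega -> omega < 1 ->
  (* |R_{mu nu}(z) - delta_{mu nu} m_phi(z)| < Psi(z) *)
  (forall eps D : R, 0 < eps -> 0 < D ->
   exists N0 : nat, forall (N M : nat), (N0 <= N)%N -> (N <= M)%N ->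
   forall (d : measure_display) (T : measurableType d) (P : probability T R)
     (X : T -> 'M[R[i]]_(M, N)),
   model_hyp C Cp P X ->
   forall (z : R[i]) (mu nu : 'I_N), in_S omega N M z ->
   (P [set t | (N%:R `^ eps * Psi N M z <
               cmod (resR (X t) z mu nu - kdelta R mu nu * m_phi (M%:R / N%:R) z))%R]
     <= (N%:R `^ (- D))%:E)%E) /\
  (* |G_{ij}(z) - delta_{ij} m_{phi^{-1}}(z)| < phi^{-1} Psi(z) *)
  (forall eps D : R, 0 < eps -> 0 < D ->
   exists N0 : nat, forall (N M : nat), (N0 <= N)%N -> (N <= M)%N ->
   forall (d : measure_display) (T : measurableType d) (P : probability T R)
     (X : T -> 'M[R[i]]_(M, N)),
   model_hyp C Cp P X ->
   forall (z : R[i]) (i j : 'I_M), in_S omega N M z ->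
   (P [set t | (N%:R `^ eps * ((M%:R / N%:R)^-1 * Psi N M z) <
               cmod (resG (X t) z i j - kdelta R i j * m_phi_inv (M%:R / N%:R) z))%R]
     <= (N%:R `^ (- D))%:E)%E) /\
  (* |N^{-1} tr R(z) - m_phi(z)| < 1/(N eta) *)
  (forall eps D : R, 0 < eps -> 0 < D ->
   exists N0 : nat, forall (N M : nat), (N0 <= N)%N -> (N <= M)%N ->
   forall (d : measure_display) (T : measurableType d) (P : probability T R)
     (X : T -> 'M[R[i]]_(M, N)),
   model_hyp C Cp P X ->
   forall (z : R[i]), in_S omega N M z ->
   (P [set t | (N%:R `^ eps * (N%:R * complex.Im z)^-1 <
               cmod ((N%:R)^-1 * \tr (resR (X t) z) - m_phi (M%:R / N%:R) z))%R]
     <= (N%:R `^ (- D))%:E)%E) /\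
  (* |M^{-1} tr G(z) - m_{phi^{-1}}(z)| < 1/(M eta) *)
  (forall eps D : R, 0 < eps -> 0 < D ->
   exists N0 : nat, forall (N M : nat), (N0 <= N)%N -> (N <= M)%N ->
   forall (d : measure_display) (T : measurableType d) (P : probability T R)
     (X : T -> 'M[R[i]]_(M, N)),
   model_hyp C Cp P X ->
   forall (z : R[i]), in_S omega N M z ->
   (P [set t | (N%:R `^ eps * (M%:R * complex.Im z)^-1 <
               cmod ((M%:R)^-1 * \tr (resG (X t) z) - m_phi_inv (M%:R / N%:R) z))%R]
     <= (N%:R `^ (- D))%:E)%E).
Proof.
move=> C0 w0 w1.
have K1 := Kdom_ge1 w0 w1.
have resX N M (X : 'M[R[i]]_(M, N)) z : resG (adjmx X) z = resR X z by rewrite resG_resR adjmxK.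
have PsiE N M z : Psi N M z = Num.sqrt (complex.Im (m_phi (mp_ratio R N M) z) / (N%:R * complex.Im z)) +
  (N%:R * complex.Im z)^-1 by [].
have Psi0 N M (z : R[i]) : 0 < complex.Im z -> (0 < N)%N -> 0 <= Psi N M z.
  by move=> z0 N0; rewrite PsiE addr_ge0 ?sqrtr_ge0// invr_ge0 mulr_ge0// ltW.
have mXR d (T : measurableType d) N M (X : T -> 'M[R[i]]_(M, N)) z : 0 < complex.Im z -> mxmeas X ->
  mxmeas (fun t => resR (X t) z) by move=> z0 mX; exact: mxmeas_resR.
have mXG d (T : measurableType d) N M (X : T -> 'M[R[i]]_(M, N)) z : 0 < complex.Im z -> mxmeas X ->
  mxmeas (fun t => resG (X t) z).
  move=> z0 mX; under [X in mxmeas X]eq_fun do rewrite resG_resR.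
  by apply: mxmeas_resR => //; exact: mxmeas_adj.
have mcl d (T : measurableType d) (a : R) (b : R[i]) (f : T -> R[i]) : cmeas f ->
  measurable [set t | a < cmod (f t - b)].
  move=> mf; apply: measurable_lt; first exact: rmeas_cst.
  by apply: rmeas_cmod; apply: cmeasB => //; exact: cmeas_cst.
have zpos N M (z : R[i]) : (0 < N)%N -> (N <= M)%N -> in_S omega N M z -> 0 < complex.Im z.
  move=> N0 NM [_ h _ _]; apply: lt_le_trans h; apply: powR_gt0.
  by rewrite (minn_idPr NM) ltr0n.
have hX d (T : measurableType d) (P : probability T R) N M (X : T -> 'M[R[i]]_(M, N)) :
  model_hyp C Cp P X -> mxmeas X by move=> [_ mX _ _ _] i k; have [a b] := mX i k.
(* Shared by both trace estimates. It is stated for measurable subsets of the exceptional set,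
   because the event of the second trace is only shown to be included in that of the first. *)
have avg (eps D : R) : 0 < eps -> 0 < D ->
   exists N0 : nat, forall (N M : nat), (N0 <= N)%N -> (N <= M)%N ->
   forall (d : measure_display) (T : measurableType d) (P : probability T R) (X : T -> 'M[R[i]]_(M, N)),
   model_hyp C Cp P X -> forall (z : R[i]), in_S omega N M z ->
   forall S : set T, measurable S ->
   S `<=` [set t | (N%:R `^ eps * (N%:R * complex.Im z)^-1 <
     cmod ((N%:R)^-1 * \tr (resR (X t) z) - m_phi (M%:R / N%:R) z))%R] ->
   (P S <= (N%:R `^ (- D))%:E)%E.
  move=> eps0 D0.
  have [N0 h] := master (Cc := C) C0 w0 w1 eps0 (fun q r q0 =>
    rare_avg (eta_top omega) (fun p => Cp (2 * p)%N) r K1 q0) D0.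
  exists N0 => N M NN NM d T P X mh z zS S mS SS.
  apply: (h N M NN NM d T P X mh z zS S mS) => nu n1 n8 z0 N1 t /SS /=.
  rewrite ltNge => /negP nle; apply: contra_not nle => hle.
  rewrite -resX; apply: le_trans hle _; apply: ler_wpM2r; first by rewrite invr_ge0 mulr_ge0// ltW.
  by apply: le_trans n8; rewrite ler_weXn2l.
split; [|split; [|split]].
- move=> eps D eps0 D0.
  have [N0 h] := master (Cc := C) C0 w0 w1 eps0 (fun q r q0 =>
    rare_R (eta_top omega) (fun p => Cp (2 * p)%N) r K1 q0) D0.
  (* The successor guarantees [N > 0], hence [Im z > 0], which is needed already for the
     measurability of the event. *)
  exists N0.+1 => N M NN NM d T P X mh z i j zS.
  have z0 := zpos N M z (leq_trans (ltn0Sn _) NN) NM zS.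
  apply: (h N M (ltnW NN) NM d T P X mh z zS) => [|nu n1 n8 _ N1 t /= lt].
    by apply: mcl; exact: (mXR _ _ _ _ _ _ z0 (hX _ _ _ _ _ _ mh)).
  exists i, j; rewrite resX; apply: le_lt_trans lt.
  by rewrite -PsiE ler_wpM2r// Psi0.
- move=> eps D eps0 D0.
  have [N0 h] := master (Cc := C) C0 w0 w1 eps0 (fun q r q0 =>
    rare_G (eta_top omega) (fun p => Cp (2 * p)%N) r K1 q0) D0.
  exists N0.+1 => N M NN NM d T P X mh z i j zS.
  have z0 := zpos N M z (leq_trans (ltn0Sn _) NN) NM zS.
  apply: (h N M (ltnW NN) NM d T P X mh z zS) => [|nu n1 n8 _ N1 t /= lt].
    by apply: mcl; exact: (mXG _ _ _ _ _ _ z0 (hX _ _ _ _ _ _ mh)).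
  exists i, j; rewrite adjmxK; apply: le_lt_trans lt.
  by rewrite -PsiE ler_wpM2r// mulr_ge0 ?Psi0// invr_ge0 divr_ge0.
- move=> eps D eps0 D0; have [N0 h] := avg eps D eps0 D0.
  exists N0.+1 => N M NN NM d T P X mh z zS.
  have z0 := zpos N M z (leq_trans (ltn0Sn _) NN) NM zS.
  apply: (h N M (ltnW NN) NM d T P X mh z zS) => //.
  apply: mcl; apply: cmeasM; first exact: cmeas_cst.
  by apply: cmeas_tr; exact: (mXR _ _ _ _ _ _ z0 (hX _ _ _ _ _ _ mh)).
- move=> eps D eps0 D0; have [N0 h] := avg eps D eps0 D0.
  exists N0.+1 => N M NN NM d T P X mh z zS.
  have N1 : (0 < N)%N by exact: leq_trans (ltn0Sn _) NN.
  have z0 := zpos N M z N1 NM zS.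
  apply: (h N M (ltnW NN) NM d T P X mh z zS) => [|t /=].
    apply: mcl; apply: cmeasM; first exact: cmeas_cst.
    by apply: cmeas_tr; exact: (mXG _ _ _ _ _ _ z0 (hX _ _ _ _ _ _ mh)).
  have NC : 0 < N%:R :> R by rewrite ltr0n.
  have MC : 0 < M%:R :> R by rewrite ltr0n (leq_trans N1).
  have N0' : N%:R != 0 :> R[i] by rewrite pnatr_eq0 -lt0n.
  have M0' : M%:R != 0 :> R[i] by rewrite pnatr_eq0 -lt0n (leq_trans N1).
  have zn : z != 0 by exact: neq0_Im.
  (* [tr (XX^* - z)^-1 = tr (X^*X - z)^-1 + (N - M) / z], so this error is exactly [phi^-1] times the previous one. *)
  have e : (M%:R)^-1 * \tr (resG (X t) z) - m_phi_inv (M%:R / N%:R) z =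
    (N%:R / M%:R : R)%:C%C * ((N%:R)^-1 * \tr (resR (X t) z) - m_phi (M%:R / N%:R) z).
    have tG : \tr (resG (X t) z) = (N%:R + z * \tr (resR (X t) z) - M%:R) / z.
      by rewrite -(tr_resG (X t) z0) mulrC mulKf.
    have e1 : (N%:R / M%:R : R)%:C%C = N%:R / M%:R :> R[i] by rewrite fmorph_div /= -!natC.
    have e2 : toC ((M%:R / N%:R : R)^-1) = N%:R / M%:R :> R[i] by rewrite invf_div -e1.
    have e3 : toC (1 - M%:R / N%:R : R) = 1 - M%:R / N%:R :> R[i].
      have -> : toC (1 - M%:R / N%:R : R) = (1 - M%:R / N%:R : R)%:C%C by [].
      by rewrite rmorphB /= rmorph1 fmorph_div /= -!natC.
    rewrite /m_phi_inv e1 e2 e3 tG; move: (m_phi _ _) (\tr _) => m s; field.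
    by rewrite zn N0' M0'.
  rewrite e cmodM cmod_pos ?divr_ge0// => lt.
  have f0 : 0 < N%:R / M%:R :> R by rewrite divr_gt0.
  rewrite -(ltr_pM2l f0); apply: le_lt_trans lt.
  by rewrite le_eqVlt; apply/orP; left; apply/eqP; field; rewrite !gt_eqF.
Qed.
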